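(* Let $p\geq2$, $n\geq2$, $a>0$ and let $U=\{x\in \mathbb{R}^n: x_n>a|(x_1,\dots,x_{n-1})|^p\}$. Then $U\in \mathcal{S}_R$. As a consequence, for every $T>0$ there exist constants $c_1,c_2>0$ depending only on $n,T,a,p$ such that for all $x,y\in U$, all $0<t<T$ and any half-spaces $H_x,H_y$ with $U\subset H_x$, $U\subset H_y$, $\delta_U(x)=\delta_{H_x}(x)$ and $\delta_U(y)=\delta_{H_y}(y)$, the Dirichlet heat kernel $p_U(t,x,y)$ satisfies $$c_1\,g(t,x,y)\,p(t,x,y)\leq p_U(t,x,y)\leq c_2\,g(t,x,y)\,p(t,x,y),$$ where $$g(t,x,y)=\left(1\wedge \frac{\delta_U(x)\delta_U(y)}{t}\right)+\left(1\wedge \frac{\delta_{H_x}(x)\delta_{H_x}(y)}{t}\right)\left(1\wedge \frac{\delta_{H_y}(y)\delta_{H_y}(x)}{t}\right).$$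
   Context: The number $p$ is an exponent, while $p(t,x,y)=(4\pi t)^{-n/2}e^{-|x-y|^2/(4t)}$ is the global heat kernel of the Laplacian $\Delta$ on $\mathbb{R}^n$. A domain is an open connected subset of $\mathbb{R}^n$. $a\wedge b=\min\{a,b\}$. $p_D(t,x,y)$ is the Dirichlet heat kernel of a domain $D$: the fundamental solution of the heat equation $\partial_t u=\Delta u$ in $D$ with Dirichlet condition on $\partial D$; equivalently, the transition density of Brownian motion (normalized to have transition density $p(t,x,y)$) killed upon leaving $D$. For an open set $E$ and $x\in E$, $\delta_E(x)$ is the distance from $x$ to $\partial E$. Half-spaces are open. A $\mathcal{C}^{1,1}$ set is one whose boundary is locally the graph of a $\mathcal{C}^{1,1}$ function; $\mathcal{C}^{1,1}_r(\mathbb{R}^n)$ denotes the class of $\mathcal{C}^{1,1}$ sets such that for every boundary point $z\in\partial D$ there are two balls of radius at least $r$ tangent to $D$ at $z$, one contained in $D$ and the other in $D^c$. For a convex $\mathcal{C}^{1,1}$ domain $D$ and $w\in\partial D$, $H_w$ is the open half-space containing $D$ whose boundary is the tangent hyperplane to $D$ at $w$. $\overline{wz}$ denotes the line segment joining $w$ and $z$. For a strictly convex $\mathcal{C}^{1,1}$ domain $D$ put $$R_{D}:=\min\left\{\inf_{\substack{w,z\in\partial D,\ w\neq z\\ \delta_D\left(\frac{w+z}2\right)\leq1}}\frac{\delta_D\left(\frac{w+z}{2}\right)}{\delta_{H_{w}}\left(\frac{w+z}2\right)},\ \inf_{\substack{w,z\in\partial D,\ w\neq z\\ \delta_D\left(\frac{w+z}2\right)>1}}\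 \sup_{\substack{m\in\overline{wz}\\ \delta_D(m)>1}}\frac{\delta_D(m)}{\delta_{H_{w}}(m)}\right\}$$ (with $\inf\emptyset=+\infty$). $\mathcal{S}_R$ is the class of strictly convex domains $D$ that belong to $\mathcal{C}^{1,1}_r(\mathbb{R}^n)$ for some $r>0$ and satisfy $R_D>0$. *)

(* Defs.v *)
From HB Require Import structures.
From mathcomp Require Import all_boot all_order all_algebra.
From mathcomp Require Import all_classical all_reals all_analysis.

Set Implicit Arguments.
Unset Strict Implicit.
Unset Printing Implicit Defensive.

Import Order.TTheory GRing.Theory Num.Theory.
Import numFieldNormedType.Exports.

Local Open Scope classical_set_scope.
Local Open Scope ring_scope.

(* R^n is 'rV[R]_n.  The library norm `|x| on it is the sup norm, so the
   Euclidean norm is introduced here; both induce the library topology. *)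

Definition dotv (R : realType) (n : nat) (x y : 'rV[R]_n) : R :=
  \sum_(i < n) x 0 i * y 0 i.

Definition enorm (R : realType) (n : nat) (x : 'rV[R]_n) : R :=
  Num.sqrt (dotv x x).

Definition eball (R : realType) (n : nat) (c : 'rV[R]_n) (r : R) :
  set 'rV[R]_n := [set x | enorm (x - c) < r].

Definition bdry (R : realType) (n : nat) (E : set 'rV[R]_n) : set 'rV[R]_n :=
  closure E `\` E°.

(* Only meaningful when the boundary of E is nonempty (inf set0 = 0). *)
Definition bdist (R : realType) (n : nat) (E : set 'rV[R]_n) (x : 'rV[R]_n) : R :=
  inf [set enorm (x - z) | z in bdry E].

Definition domain (R : realType) (n : nat) (D : set 'rV[R]_n) : Prop :=
  open D /\ connected D.

Definition half_space (R : realType) (n : nat) (H : set 'rV[R]_n) : Prop :=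
  exists (v : 'rV[R]_n) (c : R), v <> 0 /\ H = [set x | c < dotv v x].

Definition strictly_convex (R : realType) (n : nat) (D : set 'rV[R]_n) : Prop :=
  forall (x y : 'rV[R]_n) (s : R), closure D x -> closure D y -> x <> y ->
    0 < s < 1 -> D° ((1 - s) *: x + s *: y).

Definition grad (R : realType) (n : nat) (f : 'rV[R]_n -> R) (x : 'rV[R]_n) :
  'rV[R]_n := \row_(i < n) 'D_(delta_mx 0 i) f x.

Definition C11_fun (R : realType) (n : nat) (f : 'rV[R]_n -> R) : Prop :=
  (forall x, differentiable f x) /\
  exists L : R, forall x y, enorm (grad f x - grad f y) <= L * enorm (x - y).

(* Near each boundary point, the boundary is a graph over the i-th coordinate
   hyperplane of an orthonormal coordinate system y = x *m Q; col' i y is y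
   with its i-th coordinate removed. *)
Definition C11_set (R : realType) (n : nat) (D : set 'rV[R]_n) : Prop :=
  forall z, bdry D z ->
    exists (e : R) (Q : 'M[R]_n) (i : 'I_n) (f : 'rV[R]_n.-1 -> R),
      [/\ 0 < e, Q *m Q^T = 1%:M, C11_fun f &
          forall x, eball z e x ->
            (bdry D x <-> (x *m Q) 0 i = f (col' i (x *m Q)))].

Definition C11_class (R : realType) (n : nat) (r : R) (D : set 'rV[R]_n) : Prop :=
  C11_set D /\
  forall z, bdry D z ->
    exists (c1 c2 : 'rV[R]_n) (r1 r2 : R),
      [/\ r <= r1, enorm (z - c1) = r1 & eball c1 r1 `<=` D] /\
      [/\ r <= r2, enorm (z - c2) = r2 & eball c2 r2 `<=` ~` D].

(* H = H_w: the hyperplane bdry H passes through w and is tangent to bdry D at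
   w, i.e. the distance from z in bdry D to it is o(|z - w|) as z tends to w. *)
Definition tangent_half_space (R : realType) (n : nat) (D : set 'rV[R]_n)
    (w : 'rV[R]_n) (H : set 'rV[R]_n) : Prop :=
  [/\ half_space H, D `<=` H, bdry H w &
      forall e : R, 0 < e -> exists2 r : R, 0 < r &
        forall z, bdry D z -> enorm (z - w) < r ->
          bdist H z <= e * enorm (z - w)].

Definition midpt (R : realType) (n : nat) (w z : 'rV[R]_n) : 'rV[R]_n :=
  2^-1 *: (w + z).

Definition segm (R : realType) (n : nat) (w z : 'rV[R]_n) : set 'rV[R]_n :=
  [set (1 - s) *: w + s *: z | s in [set s : R | 0 <= s <= 1]].

Definition RD (R : realType) (n : nat) (D : set 'rV[R]_n) : \bar R :=
  Order.min
    (ereal_inf [set q : \bar R | exists (w z : 'rV[R]_n) (H : set 'rV[R]_n),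
       [/\ bdry D w, bdry D z, w <> z & tangent_half_space D w H] /\
       bdist D (midpt w z) <= 1 /\
       q = (bdist D (midpt w z) / bdist H (midpt w z))%:E])
    (ereal_inf [set q : \bar R | exists (w z : 'rV[R]_n) (H : set 'rV[R]_n),
       [/\ bdry D w, bdry D z, w <> z & tangent_half_space D w H] /\
       1 < bdist D (midpt w z) /\
       q = ereal_sup [set (bdist D m / bdist H m)%:E
                     | m in [set m | segm w z m /\ 1 < bdist D m]]]).

Definition class_SR (R : realType) (n : nat) (D : set 'rV[R]_n) : Prop :=
  [/\ domain D, strictly_convex D, exists2 r : R, 0 < r & C11_class r D &
      (0 < RD D)%E].

Definition heat_kernel (R : realType) (n : nat) (t : R) (x y : 'rV[R]_n) : R :=
  (4 * pi * t) `^ (- (n%:R / 2)) * expR (- (enorm (x - y) ^+ 2 / (4 * t))).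

(* Integral over R^n as an iterated one-dimensional Lebesgue integral; it is
   only applied to continuous functions with compact support. *)
Fixpoint integral_rV (R : realType) (n : nat) : ('rV[R]_n -> R) -> R :=
  match n with
  | 0 => fun f => f 0
  | m.+1 => fun f =>
      Rintegral (@lebesgue_measure R) setT
        (fun s : R => integral_rV
           (fun x : 'rV[R]_m => f (row_mx (const_mx s : 'rV[R]_1) x)))
  end.

(* u(., ., y) is of class C^{1,2} on (0, +oo) x D and solves the heat equation. *)
Definition solves_heat_equation (R : realType) (n : nat) (D : set 'rV[R]_n)
    (u : R -> 'rV[R]_n -> R) : Prop :=
  forall (t : R) (x : 'rV[R]_n), 0 < t -> D x ->
    [/\ derivable (fun s => u s x) t 1,
        forall i : 'I_n, derivable (u t) x (delta_mx 0 i) &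
        forall i j : 'I_n,
          derivable ('D_(delta_mx 0 i) (u t)) x (delta_mx 0 j)] /\
    [/\ {for (t, x), continuous (fun q : R * 'rV[R]_n => u q.1 q.2)},
        {for (t, x), continuous
           (fun q : R * 'rV[R]_n => 'D_1 (fun s => u s q.2) q.1)},
        forall i : 'I_n, {for (t, x), continuous
           (fun q : R * 'rV[R]_n => 'D_(delta_mx 0 i) (u q.1) q.2)} &
        forall i j : 'I_n, {for (t, x), continuous
           (fun q : R * 'rV[R]_n =>
              'D_(delta_mx 0 j) ('D_(delta_mx 0 i) (u q.1)) q.2)}] /\
    'D_1 (fun s => u s x) t =
      \sum_(i < n) 'D_(delta_mx 0 i) ('D_(delta_mx 0 i) (u t)) x.

(* u(t, ., y) converges to the Dirac mass at y in D as t tends to 0+. *)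
Definition dirac_initial (R : realType) (n : nat) (D : set 'rV[R]_n)
    (u : R -> 'rV[R]_n -> R) (y : 'rV[R]_n) : Prop :=
  forall phi : 'rV[R]_n -> R, continuous phi ->
    (exists K : set 'rV[R]_n,
       [/\ compact K, K `<=` D & forall x, ~ K x -> phi x = 0]) ->
    integral_rV (fun x => u t x * phi x) @[t --> 0^'+] --> phi y.

(* Fundamental solution of the heat equation in D with zero Dirichlet
   condition.  On an unbounded D the heat equation, the boundary values and the
   Dirac initial condition do not determine it; the bounds 0 <= k <= p, which
   the density of the killed Brownian motion satisfies, select it among such
   solutions.  Values of k outside D are irrelevant.  The pointwise boundary
   condition is the appropriate one when all boundary points of D are regular,
   e.g. for C^{1,1} sets. *)
Definition dirichlet_heat_kernel (R : realType) (n : nat) (D : set 'rV[R]_n)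
    (k : R -> 'rV[R]_n -> 'rV[R]_n -> R) : Prop :=
  forall y, D y ->
    [/\ solves_heat_equation D (fun t x => k t x y),
        dirac_initial D (fun t x => k t x y) y,
        forall (t : R) (z : 'rV[R]_n), 0 < t -> bdry D z ->
          k q.1 q.2 y
            @[q --> within [set q : R * 'rV[R]_n | D q.2] (nbhs (t, z))] --> (0 : R) &
        forall (t : R) (x : 'rV[R]_n), 0 < t -> D x ->
          0 <= k t x y <= heat_kernel t x y].

(* {x : x_n > a |(x_1, ..., x_{n-1})|^p}; coordinates are numbered from 0, so
   x_n is the one of index i with i.+1 = n. *)
Definition power_domain (R : realType) (n : nat) (a p : R) : set 'rV[R]_n :=
  [set x | exists2 i : 'I_n, i.+1 = n :> nat &
             a * enorm (col' i x) `^ p < x 0 i].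
Arguments power_domain {R} n a p.

Definition g_factor (R : realType) (n : nat) (U Hx Hy : set 'rV[R]_n)
    (t : R) (x y : 'rV[R]_n) : R :=
  Num.min 1 (bdist U x * bdist U y / t) +
  Num.min 1 (bdist Hx x * bdist Hx y / t) *
  Num.min 1 (bdist Hy y * bdist Hy x / t).

(* Main.v *)
(* Write [d] for the distance to the boundary of the convex set [U], which has
   interior balls of a fixed radius at all boundary points.

   Upper bound.  The maximum principle compares the Dirichlet kernel [k] with the
   kernel of a half-space containing [U], whose image formula gives the factor
   [1 - exp (- d(x) d_H(y) / t)], and with a barrier of product type on a strip
   along the supporting hyperplane at [x]; together they give [g].

   Lower bound.  For a pole [y] and a concave [phi] bounded below by a multiple of
   [d], a convex perturbation [psi] of [phi] makes [p (1 - exp (- b psi / t))] a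
   subsolution; it is enough to test this for the paraboloids over the balls in [U],
   which replace the possibly non-smooth distance.  This gives [1 /\ d(x) d(y) / t].
   Applying the comparison again from an intermediate time, with an intermediate
   point of the segment from [y] to [x] as the pole, is a substitute for the
   semigroup property: along the straight line the Gaussian factors multiply up to a
   constant.  Two such restarts give the second term of [g].

   Geometry.  Starting at a boundary point [w] of [U] towards a point [b] of its closure,
   the height over the graph is controlled by convexity from the height over the
   tangent plane, uniformly in [w] once lengths in the base are measured in units
   of [max (|w'|, 1)].  This bounds [R_D] from below and supplies the deep
   intermediate points for the lower bound. *)

Require Import Defs.
From mathcomp Require Import all_boot all_order all_algebra.
From mathcomp Require Import all_classical all_reals all_analysis.
From mathcomp Require Import ring lra.
From HB Require Import structures.

Set Implicit Arguments.
Unset Strict Implicit.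
Unset Printing Implicit Defensive.

Import Order.TTheory GRing.Theory Num.Theory.
Import numFieldNormedType.Exports.

Local Open Scope classical_set_scope.
Local Open Scope ring_scope.

(* The running time of [lra] and [nra] grows quickly with the size of the
   context; these variants first discard all but equations and inequalities. *)
Ltac only_order :=
  repeat match goal with
  | h : ?P |- _ => lazymatch P with
    | is_true (@Order.le _ _ _ _) => fail
    | is_true (@Order.lt _ _ _ _) => fail
    | @eq (matrix _ _ _) _ _ => clear h
    | @eq _ _ _ => fail
    | _ => clear h
    end
  end;
  repeat match goal with x := _ |- _ => clearbody x end.
Ltac linarith := intros; first [solve [only_order; lra] | lra].
Ltac nlinarith := intros; first [solve [only_order; nra] | nra].

(** * Euclidean space and jets *)

(** The hypotheses on [pU] concern each pole separately: the heat equation, zero boundary values, a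
    limit tested against continuous functions as [t] tends to 0, and the bound by [p]. Symmetry and
    uniqueness would have to be proved first, so each estimate compares a single function [k] with
    an explicit one. Both [k] and the subsolutions lie below [p], whose decay confines extremal
    points to a compact set. Comparison from below needs a pointwise inequality at some positive
    time, while the Dirac condition controls integrals only. The remedy is a finite sum of
    space-time translates of [k], weighted by a truncated Gaussian on a grid: it solves the same
    equation, and its initial values are Riemann sums of those integrals. Its total weight is at
    most [6 ^+ n], which only affects a constant. The horizon [T] enters twice: through the rate in
    [profile], which pays for the curvature of the balls, and through the threshold [eps], below
    which a height measured in units of [sqrt t] is also small against the geometric scale of the
    domain. *)

Section Euclid.
Variable R : realType.
Implicit Types (n : nat) (r s t : R).

Lemma dotvC n (x y : 'rV[R]_n) : dotv x y = dotv y x.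
Proof. by apply: eq_bigr => i _; rewrite mulrC. Qed.

Lemma dotvDl n (x y z : 'rV[R]_n) : dotv (x + y) z = dotv x z + dotv y z.
Proof. by rewrite /dotv -big_split; apply: eq_bigr => i _; rewrite mxE mulrDl. Qed.

Lemma dotvZl n r (x y : 'rV[R]_n) : dotv (r *: x) y = r * dotv x y.
Proof. by rewrite /dotv big_distrr /=; apply: eq_bigr => i _; rewrite mxE mulrA. Qed.

Lemma dotvNl n (x y : 'rV[R]_n) : dotv (- x) y = - dotv x y.
Proof. by rewrite -scaleN1r dotvZl mulN1r. Qed.

Lemma dotvBl n (x y z : 'rV[R]_n) : dotv (x - y) z = dotv x z - dotv y z.
Proof. by rewrite dotvDl dotvNl. Qed.

Lemma dotvDr n (x y z : 'rV[R]_n) : dotv x (y + z) = dotv x y + dotv x z.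
Proof. by rewrite dotvC dotvDl !(dotvC x). Qed.

Lemma dotvZr n r (x y : 'rV[R]_n) : dotv x (r *: y) = r * dotv x y.
Proof. by rewrite dotvC dotvZl dotvC. Qed.

Lemma dotvNr n (x y : 'rV[R]_n) : dotv x (- y) = - dotv x y.
Proof. by rewrite dotvC dotvNl dotvC. Qed.

Lemma dotvBr n (x y z : 'rV[R]_n) : dotv x (y - z) = dotv x y - dotv x z.
Proof. by rewrite dotvDr dotvNr. Qed.

Lemma dotv0l n (x : 'rV[R]_n) : dotv 0 x = 0.
Proof. by rewrite -(scale0r x) dotvZl mul0r. Qed.

Lemma dotv0r n (x : 'rV[R]_n) : dotv x 0 = 0.
Proof. by rewrite dotvC dotv0l. Qed.

Definition dotvE := (dotvDl, dotvDr, dotvNl, dotvNr, dotvZl, dotvZr).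

Lemma dotvv_ge0 n (x : 'rV[R]_n) : 0 <= dotv x x.
Proof. by apply: sumr_ge0 => i _; rewrite -expr2 sqr_ge0. Qed.

Lemma dotvv_eq0 n (x : 'rV[R]_n) : (dotv x x == 0) = (x == 0).
Proof.
apply/idP/eqP => [|->]; last by rewrite dotv0l.
rewrite psumr_eq0 => [|i _]; last by rewrite -expr2 sqr_ge0.
move=> /allP h; apply/rowP => i; rewrite mxE.
by have := h i (mem_index_enum _); rewrite /= mulf_eq0 orbb => /eqP.
Qed.

Lemma enorm_ge0 n (x : 'rV[R]_n) : 0 <= enorm x.
Proof. exact: sqrtr_ge0. Qed.

Lemma enormE n (x : 'rV[R]_n) : enorm x ^+ 2 = dotv x x.
Proof. by rewrite sqr_sqrtr ?dotvv_ge0. Qed.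

Lemma enorm0 n : enorm (0 : 'rV[R]_n) = 0.
Proof. by rewrite /enorm dotv0l sqrtr0. Qed.

Lemma enorm_eq0 n (x : 'rV[R]_n) : (enorm x == 0) = (x == 0).
Proof. by rewrite sqrtr_eq0 -dotvv_eq0 eq_le dotvv_ge0 andbT. Qed.

Lemma enorm_gt0 n (x : 'rV[R]_n) : (0 < enorm x) = (x != 0).
Proof. by rewrite lt_neqAle eq_sym enorm_eq0 enorm_ge0 andbT. Qed.

Lemma enormZ n r (x : 'rV[R]_n) : enorm (r *: x) = `|r| * enorm x.
Proof. by rewrite /enorm dotvZl dotvZr mulrA -expr2 sqrtrM ?sqr_ge0// sqrtr_sqr. Qed.

Lemma enormN n (x : 'rV[R]_n) : enorm (- x) = enorm x.
Proof. by rewrite -scaleN1r enormZ normrN1 mul1r. Qed.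

Lemma enormBC n (x y : 'rV[R]_n) : enorm (x - y) = enorm (y - x).
Proof. by rewrite -opprB enormN. Qed.

Lemma enorm_sqr_le n (x : 'rV[R]_n) r : 0 <= r -> (enorm x <= r) = (dotv x x <= r ^+ 2).
Proof. by move=> r0; rewrite -enormE ler_sqr ?nnegrE ?enorm_ge0. Qed.

Lemma enorm_sqr_lt n (x : 'rV[R]_n) r : 0 <= r -> (enorm x < r) = (dotv x x < r ^+ 2).
Proof. by move=> r0; rewrite -enormE ltr_sqr ?nnegrE ?enorm_ge0. Qed.

Lemma cauchy_schwarz n (x y : 'rV[R]_n) : dotv x y ^+ 2 <= dotv x x * dotv y y.
Proof.
have [->|y0] := eqVneq y 0; first by rewrite !dotv0r mulr0 expr0n.
have py : 0 < dotv y y by rewrite lt_neqAle eq_sym dotvv_eq0 y0 dotvv_ge0.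
have := dotvv_ge0 (dotv y y *: x - dotv x y *: y).
rewrite !dotvE (dotvC y x); set a := dotv x x; set b := dotv x y; set c := dotv y y.
move=> h; have : 0 <= c * (a * c - b ^+ 2) by nra.
by rewrite pmulr_rge0 // subr_ge0.
Qed.

Lemma dotv_le n (x y : 'rV[R]_n) : dotv x y <= enorm x * enorm y.
Proof.
have := cauchy_schwarz x y; rewrite -!enormE -exprMn => h.
apply: le_trans (ler_norm _) _.
by rewrite -(ger0_norm (mulr_ge0 (enorm_ge0 x) (enorm_ge0 y))) -ler_sqr ?nnegrE// !real_normK ?num_real.
Qed.

Lemma enorm_triangle n (x y : 'rV[R]_n) : enorm (x + y) <= enorm x + enorm y.
Proof.
rewrite enorm_sqr_le ?addr_ge0 ?enorm_ge0// !dotvE (dotvC y x) -!enormE.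
have := dotv_le x y; nra.
Qed.

Lemma enorm_triangleB n (z x y : 'rV[R]_n) : enorm (x - y) <= enorm (x - z) + enorm (z - y).
Proof. by apply: le_trans (enorm_triangle _ _); rewrite addrA subrK. Qed.

Lemma enorm_lip n (x y : 'rV[R]_n) : `|enorm x - enorm y| <= enorm (x - y).
Proof.
have h1 := enorm_triangle (x - y) y; have h2 := enorm_triangle (y - x) x.
rewrite !subrK (enormBC y) in h1 h2; rewrite ler_norml; lra.
Qed.

Lemma normr_coord n (x : 'rV[R]_n) i : `|x 0 i| <= `|x|.
Proof.
rewrite [leRHS]/Num.norm /= mx_normrE; apply/bigmax_geP; right => /=.
by exists (0, i).
Qed.

Lemma coord_le_enorm n (x : 'rV[R]_n) i : `|x 0 i| <= enorm x.
Proof.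
rewrite -ler_sqr ?nnegrE ?enorm_ge0// enormE real_normK ?num_real//.
rewrite /dotv (bigD1 i)//= -expr2 lerDl; apply: sumr_ge0 => j _.
by rewrite -expr2 sqr_ge0.
Qed.

Lemma normr_le_enorm n (x : 'rV[R]_n) : `|x| <= enorm x.
Proof.
rewrite [leLHS]/Num.norm /= mx_normrE; apply/bigmax_leP; split; first exact: enorm_ge0.
by move=> [i j] _ /=; rewrite ord1; exact: coord_le_enorm.
Qed.

Lemma enorm_le_normr n (x : 'rV[R]_n) : enorm x <= n%:R * `|x|.
Proof.
rewrite enorm_sqr_le ?mulr_ge0// exprMn.
apply: (@le_trans _ _ (n%:R * `|x| ^+ 2)); last first.
  rewrite ler_wpM2r ?sqr_ge0// -natrX ler_nat.
  by case: (n) => // m; rewrite expnS expn1 leq_pmulr.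
rewrite /dotv mulr_natl -[X in _ *+ X]card_ord -sumr_const.
apply: ler_sum => i _; rewrite -expr2 -(real_normK (num_real (x 0 i))).
by rewrite ler_sqr ?nnegrE// normr_coord.
Qed.

Lemma dotv_delta n (x : 'rV[R]_n) i : dotv x (delta_mx 0 i) = x 0 i.
Proof.
rewrite /dotv (bigD1 i)//= mxE !eqxx mulr1 big1 ?addr0// => j ji.
by rewrite mxE (negbTE ji) andbF mulr0.
Qed.

Lemma cvg_dotv n (T : Type) (F : set_system T) (FF : Filter F) (f g : T -> 'rV[R]_n)
    (a b : 'rV[R]_n) :
  f @ F --> a -> g @ F --> b -> dotv (f z) (g z) @[z --> F] --> dotv a b.
Proof.
move=> cf cg; rewrite /dotv; apply: cvg_big => [|i _]; first exact: add_continuous.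
by apply: cvgM; apply: (cvg_comp _ (fun M : 'rV[R]_n => M 0 i));
  [exact: cf|exact: coord_continuous|exact: cg|exact: coord_continuous].
Qed.

Lemma cvg_enorm n (T : Type) (F : set_system T) (FF : Filter F) (f : T -> 'rV[R]_n)
    (a : 'rV[R]_n) :
  f @ F --> a -> enorm (f z) @[z --> F] --> enorm a.
Proof.
move=> cf; rewrite /enorm.
exact: (@continuous_cvg _ _ _ _ _ _ Num.sqrt _ (@sqrt_continuous R _) (cvg_dotv FF cf cf)).
Qed.

Lemma eball_open n (c : 'rV[R]_n) r : open (eball c r).
Proof.
have cc : continuous (fun x : 'rV[R]_n => enorm (x - c)).
  by move=> x; exact: (cvg_enorm _ (cvgB (@cvg_id _ (nbhs x)) (@cvg_cst _ c _ (nbhs x) _))).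
have -> : eball c r = (fun x => enorm (x - c)) @^-1` [set y | y < r] by [].
by apply: open_comp => [x _|]; [exact: cc|exact: open_lt].
Qed.

Lemma eball_nbhs n (c : 'rV[R]_n) r : 0 < r -> nbhs c (eball c r).
Proof.
by move=> r0; apply: open_nbhs_nbhs; split; [exact: eball_open|rewrite /eball /= subrr enorm0].
Qed.

(** Euclidean balls generate the topology because the sup norm is at most [enorm]. *)
Lemma nbhs_eball n (c : 'rV[R]_n) (A : set 'rV[R]_n) :
  nbhs c A -> exists2 r, 0 < r & eball c r `<=` A.
Proof.
move=> /nbhs_ballP[e /= e0 eA]; exists e => // x xr; apply: eA.
rewrite -ball_normE /ball_ /= -opprB normrN.
exact: le_lt_trans (normr_le_enorm _) xr.
Qed.

Lemma ecompact n (c : 'rV[R]_n) r : compact [set x | enorm (x - c) <= r].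
Proof.
apply: bounded_closed_compact.
  exists (r + `|c|); split; first exact: num_real.
  move=> M hM x /= xr; apply: ltW; apply: le_lt_trans hM.
  rewrite -[x](subrK c); apply: le_trans (ler_normD _ _) _.
  by rewrite lerD2r (le_trans (normr_le_enorm _)).
have cc : continuous (fun x : 'rV[R]_n => enorm (x - c)).
  by move=> x; exact: (cvg_enorm _ (cvgB (@cvg_id _ (nbhs x)) (@cvg_cst _ c _ (nbhs x) _))).
have -> : [set x | enorm (x - c) <= r] = (fun x => enorm (x - c)) @^-1` [set y | y <= r] by [].
by apply: preimage_closed => [x _|]; [exact: cc|exact: closed_le].
Qed.

End Euclid.

(** * First and second derivatives at a point *)

Section Jets.
Variable R : realType.

Lemma is_derive_quotient (f : R -> R) (x l e : R) : is_derive x 1 f l -> 0 < e ->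
  exists2 d, 0 < d & forall h, h != 0 -> `|h| < d ->
    `|h^-1 * (f (x + h) - f x) - l| < e.
Proof.
move=> [df fl] e0.
have hc : h^-1 *: ((f \o shift x) (h *: (1 : R)) - f x) @[h --> 0^'] --> l.
  by rewrite -fl; exact: df.
have /cvgrPdist_lt/(_ _ e0) := hc.
move=> /nbhs_ballP[d /= d0 hd]; exists d => // h h0 hlt.
have := hd h; rewrite /ball /= sub0r normrN => /(_ hlt h0).
have -> : h%:A = h :> R by exact: mulr1.
by rewrite distrC (addrC h x).
Qed.

Lemma is_derive_fun (f g : R -> R) (x df dg : R) :
  is_derive x 1 f df -> f =1 g -> df = dg -> is_derive x 1 g dg.
Proof. by move=> h /funext <- <-. Qed.

Lemma is_derive_const (c x : R) : is_derive x 1 (fun=> c) 0.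
Proof. exact: is_derive_cst. Qed.

Lemma is_derive_var (x : R) : is_derive x 1 (fun z => z) 1.
Proof. exact: is_derive_id. Qed.

Lemma is_derive_add (f g : R -> R) (x df dg : R) : is_derive x 1 f df ->
  is_derive x 1 g dg -> is_derive x 1 (fun z => f z + g z) (df + dg).
Proof. by move=> hf hg; exact: is_deriveD. Qed.

Lemma is_derive_mul (f g : R -> R) (x df dg : R) : is_derive x 1 f df ->
  is_derive x 1 g dg -> is_derive x 1 (fun z => f z * g z) (f x * dg + g x * df).
Proof. by move=> hf hg; exact: is_deriveM. Qed.

Lemma is_derive_scal (c : R) (f : R -> R) (x df : R) : is_derive x 1 f df ->
  is_derive x 1 (fun z => c * f z) (c * df).
Proof. by move=> hf; exact: is_deriveZ. Qed.

Lemma is_derive_opp (f : R -> R) (x df : R) : is_derive x 1 f df ->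
  is_derive x 1 (fun z => - f z) (- df).
Proof. by move=> hf; exact: is_deriveN. Qed.

Lemma is_derive_inv (f : R -> R) (x df : R) : f x != 0 -> is_derive x 1 f df ->
  is_derive x 1 (fun z => (f z)^-1) (- df / f x ^+ 2).
Proof.
move=> f0 hf; apply: (is_derive_fun (is_deriveV f0 hf)) => //.
by rewrite mulNr mulrC -mulNr.
Qed.

Lemma is_derive_exp (f : R -> R) (x df : R) : is_derive x 1 f df ->
  is_derive x 1 (fun z => expR (f z)) (expR (f x) * df).
Proof. by move=> hf; exact: is_derive1_comp. Qed.

(** Only earlier times are compared, because the extremal point of a comparison argument may lie at
    the final time. *)
Lemma left_max_derive (f : R -> R) (x l r : R) : is_derive x 1 f l -> 0 < r ->
  (forall s, x - r < s -> s < x -> f s <= f x) -> 0 <= l.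
Proof.
move=> fl r0 hm; rewrite leNgt; apply/negP => l0.
have l0' : 0 < - l by rewrite oppr_gt0.
have [d d0 hd] := is_derive_quotient fl l0'.
set h := - (Num.min d r / 2).
have m0 : 0 < Num.min d r by rewrite lt_min d0.
have h0 : h < 0 by rewrite /h oppr_lt0 divr_gt0.
have hd' : `|h| < d.
  rewrite ltr0_norm // /h opprK; apply: (@lt_le_trans _ _ (Num.min d r)); last by rewrite ge_min lexx.
  by rewrite ltr_pdivrMr// ltr_pMr// ltrDl.
have := hd h; rewrite lt_eqF // => /(_ isT hd'); rewrite ltr_norml => /andP[_].
have hh : f (x + h) <= f x.
  apply: hm; last by rewrite gtrDl.
  rewrite ltrD2l /h ltrN2; apply: (@lt_le_trans _ _ (Num.min d r)); last by rewrite ge_min lexx orbT.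
  by rewrite ltr_pdivrMr// ltr_pMr// ltrDl.
rewrite ltrBlDr addNr => hlt; have := hlt; apply/negP; rewrite -leNgt.
by rewrite mulr_le0 // ?subr_le0// invr_le0 ltW.
Qed.

(** The derivative [g] exists near 0 but is differentiated at 0 only. This is enough for the
    second-order test at a maximum and is preserved by sums, products and compositions, so gradients
    and Laplacians of the barriers come out of algebra. *)
Definition jet1 (f : R -> R) (f1 f2 : R) : Prop :=
  exists g : R -> R, [/\ \forall s \near (0 : R), is_derive (s : R) (1 : R) f (g s),
    g 0 = f1 & is_derive (0 : R) 1 g f2].

Lemma jet1_max f f1 f2 : jet1 f f1 f2 -> (\forall s \near (0 : R), f s <= f 0) ->
  f1 = 0 /\ f2 <= 0.
Proof.
move=> [g [/nbhs_ballP[d1 /= d10 hd1] g0 dg]] /nbhs_ballP[d2 /= d20 hd2].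
set d := Num.min d1 d2.
have d0 : 0 < d by rewrite lt_min d10.
have D (s : R) : `|s| < d -> is_derive s (1:R) f (g s) /\ f s <= f 0.
  rewrite lt_min => /andP[s1 s2]; split; [apply: hd1|apply: hd2];
  by rewrite /ball /= sub0r normrN.
have f10 : f1 = 0.
  have h : is_derive (0:R) 1 f 0.
    apply: (@derive1_at_max _ f (- d) d); rewrite ?in_itv /= ?oppr_lt0 ?d0//.
    - by rewrite ge0_cp// ltW.
    - by move=> t; rewrite in_itv/= => /andP[t1 t2]; apply: ex_derive; apply: (D t _).1; rewrite ltr_norml t1.
    - by move=> t; rewrite in_itv/= => /andP[t1 t2]; apply: (D t _).2; rewrite ltr_norml t1.
  have h' := (D 0 _).1; rewrite normr0 in h'; have {}h' := h' d0.
  by rewrite -g0 -(@derive_val _ _ _ _ _ _ _ h') (@derive_val _ _ _ _ _ _ _ h).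
split=> //; rewrite leNgt; apply/negP => f20.
(* Were [f2] positive, [g] would be positive just to the right of 0, where it starts from [f1 = 0],
   and the mean value theorem would give [f h > f 0]. *)
have [e e0 he] := is_derive_quotient dg f20.
set h := Num.min d e / 2.
have m0 : 0 < Num.min d e by rewrite lt_min d0.
have h0 : 0 < h by rewrite divr_gt0.
have hm : h < Num.min d e by rewrite ltr_pdivrMr// ltr_pMr// ltrDl.
have hd : h < d by apply: (lt_le_trans hm); rewrite ge_min lexx.
have hE : h < e by apply: (lt_le_trans hm); rewrite ge_min lexx orbT.
have gpos s : 0 < s -> s <= h -> 0 < g s.
  move=> s0 sh; have := he s; rewrite gt_eqF// gtr0_norm// => /(_ isT (le_lt_trans sh hE)).
  rewrite ltr_norml => /andP[+ _]; rewrite ltrBrDr addNr add0r g0 f10 subr0.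
  by rewrite pmulr_rgt0 ?invr_gt0.
have [|| c] := @MVT R f g 0 h h0.
- by move=> x; rewrite in_itv/= => /andP[x1 x2]; apply: (D x _).1; rewrite gtr0_norm// (lt_trans x2).
- apply: derivable_within_continuous => x; rewrite in_itv/= => /andP[x1 x2].
  by apply: ex_derive; apply: (D x _).1; rewrite ger0_norm// (le_lt_trans x2).
rewrite in_itv/= => /andP[c0 ch] hc.
have : f h <= f 0 by apply: (D h _).2; rewrite gtr0_norm.
rewrite -subr_le0 hc subr0; apply/negP; rewrite -ltNge mulr_gt0// gpos// ltW//.
Qed.

Lemma jet1_ext f g f1 f2 : f =1 g -> jet1 f f1 f2 -> jet1 g f1 f2.
Proof. by move=> /funext ->. Qed.

Lemma jet1_eq f f1 f2 g1 g2 : jet1 f f1 f2 -> f1 = g1 -> f2 = g2 -> jet1 f g1 g2.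
Proof. by move=> ? <- <-. Qed.

Lemma jet1_quad (a b c : R) : jet1 (fun s => a + s * b + s ^+ 2 * c) b (2 * c).
Proof.
exists (fun s => b + 2 * s * c); split; last 2 first.
- by rewrite mulr0 mul0r addr0.
- apply: (is_derive_fun (is_derive_add (is_derive_const b 0)
    (is_derive_scal (2 * c) (is_derive_var 0)))) => [s|]; rewrite /= /cst; ring.
apply: (@filterE _ (nbhs (0 : R))) => s.
apply: (is_derive_fun (is_derive_add (is_derive_add (is_derive_const a s)
    (is_derive_scal b (is_derive_var s)))
    (is_derive_scal c (is_derive_mul (is_derive_var s) (is_derive_var s))))) => [u|]; rewrite /= /cst; ring.
Qed.

Lemma jet1_cst c : jet1 (fun=> c) 0 0.
Proof.
apply: (jet1_eq (jet1_ext _ (jet1_quad c 0 0))) => [s|//|]; last by rewrite mulr0.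
by rewrite !mulr0 !addr0.
Qed.

Lemma jet1D f g f1 f2 g1 g2 : jet1 f f1 f2 -> jet1 g g1 g2 ->
  jet1 (fun s => f s + g s) (f1 + g1) (f2 + g2).
Proof.
move=> [h [hf <- dh]] [k [kf <- dk]]; exists (fun s => h s + k s); split=> //.
  by apply: filterS2 hf kf => s df dg; exact: is_deriveD.
exact: is_deriveD.
Qed.

Lemma jet1M f g f1 f2 g1 g2 : jet1 f f1 f2 -> jet1 g g1 g2 ->
  jet1 (fun s => f s * g s) (f 0 * g1 + g 0 * f1) (f 0 * g2 + 2 * (f1 * g1) + g 0 * f2).
Proof.
move=> [h [hf <- dh]] [k [kf <- dk]].
exists (fun s => f s * k s + g s * h s); split=> //.
  by apply: filterS2 hf kf => s df dg; exact: is_deriveM.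
have df := nbhs_singleton hf; have dg := nbhs_singleton kf.
have := is_deriveD (is_deriveM df dk) (is_deriveM dg dh).
by move=> H; apply: (is_derive_eq H); rewrite /GRing.scale/=; ring.
Qed.

Lemma jet1_comp (F : R -> R) (F1 : R -> R) F2 f f1 f2 :
  (\forall s \near f 0, is_derive (s : R) (1 : R) F (F1 s)) -> is_derive (f 0) 1 F1 F2 ->
  jet1 f f1 f2 -> jet1 (fun s => F (f s)) (F1 (f 0) * f1) (F1 (f 0) * f2 + F2 * f1 ^+ 2).
Proof.
move=> hF dF1 [h [hf <- dh]]; exists (fun s => F1 (f s) * h s).
have df0 := nbhs_singleton hf.
have cf : {for 0, continuous f}.
  by apply: differentiable_continuous; apply/derivable1_diffP; exact: ex_derive.
split=> //.
  have hF' : \forall s \near (0:R), is_derive (f s) 1 F (F1 (f s)).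
    exact: (cf (fun u => is_derive u 1 F (F1 u)) hF).
  by apply: filterS2 hf hF' => s df dF; exact: (is_derive1_comp dF df).
have := is_deriveM (is_derive1_comp dF1 df0) dh.
by move=> H; apply: (is_derive_eq H); rewrite /GRing.scale/=; ring.
Qed.

Section nd.
Variable n : nat.
Implicit Types (f g : 'rV[R]_n -> R) (x G : 'rV[R]_n).

(* [f] has gradient [G] and Laplacian [L] at [x], computed along the axes. *)
Definition jet f x G (L : R) : Prop :=
  exists h : 'I_n -> R,
    (forall i, jet1 (fun s => f (x + s *: delta_mx 0 i)) (G 0 i) (h i)) /\
    L = \sum_i h i.

Lemma jet_max f x G L : jet f x G L -> (\forall z \near x, f z <= f x) ->
  G = 0 /\ L <= 0.
Proof.
move=> [h [hj ->]] /nbhs_eball[r r0 hm].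
have H i : G 0 i = 0 /\ h i <= 0.
  apply: (jet1_max (hj i)).
  apply/nbhs_ballP; exists r => //= s; rewrite /ball/= sub0r normrN => sr.
  rewrite scale0r addr0; apply: hm; rewrite /eball/= addrC addKr enormZ.
  have -> : enorm (delta_mx 0 i : 'rV[R]_n) = 1.
    by rewrite /enorm dotv_delta mxE !eqxx sqrtr1.
  by rewrite mulr1.
split; first by apply/rowP => i; rewrite mxE; exact: (H i).1.
by apply: sumr_le0 => i _; exact: (H i).2.
Qed.

Lemma jet_ext f g x G L : f =1 g -> jet f x G L -> jet g x G L.
Proof. by move=> /funext ->. Qed.

Lemma jet_eq f x G L G' L' : jet f x G L -> G = G' -> L = L' -> jet f x G' L'.
Proof. by move=> ? <- <-. Qed.

Lemma jet_cst c x : jet (fun=> c) x 0 0.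
Proof.
exists (fun=> 0); split; last by rewrite big1.
by move=> i; rewrite mxE; exact: jet1_cst.
Qed.

Lemma jetD f g x G L G' L' : jet f x G L -> jet g x G' L' ->
  jet (fun z => f z + g z) x (G + G') (L + L').
Proof.
move=> [h [hj ->]] [k [kj ->]]; exists (fun i => h i + k i); split.
  by move=> i; rewrite mxE; exact: jet1D.
by rewrite big_split.
Qed.

Lemma jetM f g x G L G' L' : jet f x G L -> jet g x G' L' ->
  jet (fun z => f z * g z) x (f x *: G' + g x *: G)
      (f x * L' + 2 * dotv G G' + g x * L).
Proof.
move=> [h [hj ->]] [k [kj ->]].
exists (fun i => f x * k i + 2 * (G 0 i * G' 0 i) + g x * h i); split.
  by move=> i; rewrite !mxE; apply: (jet1_eq (jet1M (hj i) (kj i))); rewrite scale0r addr0.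
by rewrite !big_split/= /dotv !mulr_sumr.
Qed.

Lemma jetZ c f x G L : jet f x G L -> jet (fun z => c * f z) x (c *: G) (c * L).
Proof.
move=> h; apply: (jet_eq (jetM (jet_cst c x) h)); rewrite ?scaler0 ?addr0//.
by rewrite dotv0l !mulr0 !addr0.
Qed.

Lemma jetN f x G L : jet f x G L -> jet (fun z => - f z) x (- G) (- L).
Proof.
move=> h; apply: jet_ext (jet_eq (jetZ (-1) h) _ _) => [z||]; rewrite ?scaleN1r ?mulN1r//.
Qed.

Lemma jetB f g x G L G' L' : jet f x G L -> jet g x G' L' ->
  jet (fun z => f z - g z) x (G - G') (L - L').
Proof. by move=> hf hg; exact: jetD hf (jetN hg). Qed.

Lemma jet_comp (F F1 : R -> R) F2 f x G L :
  (\forall s \near f x, is_derive (s : R) (1 : R) F (F1 s)) -> is_derive (f x) 1 F1 F2 ->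
  jet f x G L -> jet (fun z => F (f z)) x (F1 (f x) *: G) (F1 (f x) * L + F2 * dotv G G).
Proof.
move=> hF dF1 [h [hj ->]].
exists (fun i => F1 (f x) * h i + F2 * (G 0 i * G 0 i)); split.
  move=> i; rewrite mxE -expr2.
  have e0 : f (x + 0 *: delta_mx 0 i) = f x by rewrite scale0r addr0.
  rewrite -e0 in hF dF1 |- *.
  exact: (jet1_comp (f := fun s => f (x + s *: delta_mx 0 i)) hF dF1 (hj i)).
by rewrite big_split/= /dotv !mulr_sumr.
Qed.

Lemma jet_dotv (v : 'rV[R]_n) (c : R) x : jet (fun z => dotv v z + c) x v 0.
Proof.
exists (fun=> 0); split; last by rewrite big1.
move=> i; have := jet1_quad (dotv v x + c) (v 0 i) 0; rewrite mulr0; apply: jet1_ext.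
by move=> s; rewrite dotvDr dotvZr dotv_delta; ring.
Qed.

Lemma jet_sqdist (c : 'rV[R]_n) x :
  jet (fun z => dotv (z - c) (z - c)) x (2 *: (x - c)) (2 * n%:R).
Proof.
exists (fun=> 2); split; last by rewrite sumr_const card_ord mulr_natr.
move=> i; have := jet1_quad (dotv (x - c) (x - c)) ((2 *: (x - c)) 0 i) 1; rewrite mulr1; apply: jet1_ext.
move=> s; rewrite [x + _ - c]addrAC (dotvDl (x - c)) !(dotvDr _ (x - c)) !dotvZl !dotvZr (dotvC (delta_mx _ _) (x - c)) !dotv_delta.
have -> : (2 *: (x - c)) 0 i = 2 * (x - c) 0 i by rewrite mxE.
have -> : (delta_mx 0 i : 'rV[R]_n) 0 i = 1 by rewrite mxE !eqxx.
ring.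
Qed.

End nd.
End Jets.

(** * The heat kernel and the equation for its multiples *)

Section HeatKernel.
Variables (R : realType) (n : nat).
Implicit Types (t s : R) (x y z v G : 'rV[R]_n) (u w : R -> 'rV[R]_n -> R).

Lemma is_derive_cvg (f : R -> R) (x df : R) : is_derive x 1 f df -> f @ x --> f x.
Proof.
move=> h; have d : derivable f x 1 by exact: ex_derive.
exact: (differentiable_continuous ((derivable1_diffP f x).1 d)).
Qed.

Lemma is_derive_line (F : 'rV[R]_n -> R) x v (s : R) : derivable F (x + s *: v) v ->
  is_derive s 1 (fun h => F (x + h *: v)) ('D_v F (x + s *: v)).
Proof.
move=> dF.
have E : (fun h : R => h^-1 *: (((fun h => F (x + h *: v)) \o shift s) (h *: (1 : R)) - F (x + s *: v)))
   = (fun h => h^-1 *: ((F \o shift (x + s *: v)) (h *: v) - F (x + s *: v))).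
  apply/funext => h /=; congr (_ *: (F _ - _)).
  have -> : h%:A = h :> R by exact: mulr1.
  by rewrite scalerDl addrCA.
by split; rewrite /derivable /derive E.
Qed.

Lemma caloric_jet (D : set 'rV[R]_n) u t x : open D -> solves_heat_equation D u ->
  0 < t -> D x -> exists G L, is_derive t 1 (fun s => u s x) L /\ jet (u t) x G L.
Proof.
move=> oD hu t0 Dx; have [[dt d1 d2] [_ heq]] := hu t x t0 Dx.
exists (\row_i 'D_(delta_mx 0 i) (u t) x),
  (\sum_(i < n) 'D_(delta_mx 0 i) ('D_(delta_mx 0 i) (u t)) x); split.
  by split => //; rewrite -heq.
exists (fun i => 'D_(delta_mx 0 i) ('D_(delta_mx 0 i) (u t)) x); split=> // i.
exists (fun s => 'D_(delta_mx 0 i) (u t) (x + s *: delta_mx 0 i)); split.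
- have /nbhs_eball[r r0 hr] : nbhs x D by exact: open_nbhs_nbhs.
  apply/nbhs_ballP; exists r; first exact: r0.
  move=> s; rewrite /ball/= sub0r normrN => sr.
  apply: is_derive_line.
  have [] := hu t (x + s *: delta_mx 0 i) t0.
    apply: hr; rewrite /eball/= addrC addKr enormZ.
    have -> : enorm (delta_mx 0 i : 'rV[R]_n) = 1.
      by rewrite /enorm dotv_delta mxE !eqxx sqrtr1.
    by rewrite mulr1.
  by move=> [_ h _] _; exact: h.
- by rewrite scale0r addr0 mxE.
- have h := @is_derive_line ('D_(delta_mx 0 i) (u t)) x (delta_mx 0 i) 0.
  rewrite scale0r addr0 in h; exact: h (d2 i i).
Qed.

Lemma caloric_continuous (D : set 'rV[R]_n) u t x : solves_heat_equation D u ->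
  0 < t -> D x -> {for (t, x), continuous (fun q : R * 'rV[R]_n => u q.1 q.2)}.
Proof. by move=> hu t0 Dx; have [_ [[]]] := hu t x t0 Dx. Qed.

Lemma heat_kernel_gt0 t x y : 0 < t -> 0 < heat_kernel t x y.
Proof. by move=> t0; rewrite mulr_gt0 ?expR_gt0 ?powR_gt0 // !mulr_gt0 ?pi_gt0. Qed.

Lemma heat_kernel_diag t x : heat_kernel t x x = (4 * pi * t) `^ (- (n%:R / 2)).
Proof. by rewrite /heat_kernel subrr enorm0 expr0n mul0r oppr0 expR0 mulr1. Qed.

Lemma heat_kernelE t x y :
  heat_kernel t x y = heat_kernel t y y * expR (- (dotv (x - y) (x - y) / (4 * t))).
Proof. by rewrite heat_kernel_diag /heat_kernel enormE. Qed.

Lemma heat_kernel_le_diag t x y z : 0 < t -> heat_kernel t x y <= heat_kernel t z z.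
Proof.
move=> t0; rewrite heat_kernel_diag /heat_kernel ler_piMr ?powR_ge0//.
rewrite -expR0 ler_expR oppr_le0 divr_ge0 ?sqr_ge0// mulr_ge0// ltW//.
Qed.

Lemma heat_kernel_time t x y : 0 < t ->
  is_derive t 1 (fun s => heat_kernel s x y)
    (heat_kernel t x y * (dotv (x - y) (x - y) / (4 * t ^+ 2) - n%:R / (2 * t))).
Proof.
move=> t0; have p0 : 0 < 4 * pi * t by rewrite !mulr_gt0 ?pi_gt0.
have h1 : is_derive t 1 (fun s => (4 * pi * s) `^ (- (n%:R / 2)))
    (- (n%:R / 2) * (4 * pi * t) `^ (- (n%:R / 2) - 1) * (4 * pi * 1)).
  exact: (is_derive1_comp (is_derive1_powR (- (n%:R / 2)) p0) (is_derive_scal (4 * pi) (is_derive_var t))).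
have t4 : 4 * t != 0 by rewrite mulf_neq0 // gt_eqF.
have h2 := is_derive_exp (is_derive_opp (is_derive_scal (enorm (x - y) ^+ 2)
   (is_derive_inv t4 (is_derive_scal 4 (is_derive_var t))))).
apply: (is_derive_fun (is_derive_mul h1 h2)) => //.
rewrite /heat_kernel powRB; last by rewrite (gt_eqF p0) implybT.
rewrite powRr1 ?ltW// -enormE.
have t5 : t != 0 by rewrite gt_eqF.
have : (pi : R) != 0 by rewrite gt_eqF ?pi_gt0.
by move: (pi : R) => P P0; field; rewrite ?P0 ?t5.
Qed.

Lemma heat_kernel_jet t x y : 0 < t ->
  jet (fun z => heat_kernel t z y) x (- (heat_kernel t x y / (2 * t)) *: (x - y))
    (heat_kernel t x y * (dotv (x - y) (x - y) / (4 * t ^+ 2) - n%:R / (2 * t))).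
Proof.
move=> t0; have t4 : t != 0 by rewrite gt_eqF.
have h := jetZ (- (4 * t)^-1) (jet_sqdist y x).
have hF : \forall s \near - (4 * t)^-1 * dotv (x - y) (x - y), is_derive (s:R) (1:R) expR (expR s).
  by apply: (@filterE _ (nbhs _)) => s; exact: is_derive_expR.
have := jetZ ((4 * pi * t) `^ (- (n%:R / 2))) (jet_comp hF (is_derive_expR _) h).
move=> H; apply: (jet_eq (jet_ext _ H)) => [z||].
- by rewrite /heat_kernel enormE mulNr (mulrC _^-1 (dotv _ _)).
- rewrite /heat_kernel enormE !scalerA mulNr (mulrC _^-1 (dotv _ _)); congr (_ *: _).
  by field.
- rewrite /heat_kernel enormE !(dotvZl, dotvZr) !mulNr (mulrC _^-1 (dotv _ _)).
  by field.
Qed.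

(* For [u = p w], with [p] the heat kernel with pole [y], one has
   [d_t u - Lap u = p * (d_t w - Lap w + ((x - y) / t) . grad w)]. *)
Lemma heat_kernel_mul t x y w wt G L : 0 < t ->
  is_derive t 1 (fun s => w s x) wt -> jet (w t) x G L ->
  exists dt G' L', [/\ is_derive t 1 (fun s => heat_kernel s x y * w s x) dt,
     jet (fun z => heat_kernel t z y * w t z) x G' L' &
     dt - L' = heat_kernel t x y * (wt - L + dotv (x - y) G / t)].
Proof.
move=> t0 dw jw; have t4 : t != 0 by rewrite gt_eqF.
have h1 := is_derive_mul (heat_kernel_time x y t0) dw.
have h2 := jetM (heat_kernel_jet x y t0) jw.
do 3 eexists; split; [exact: h1|exact: h2|].
by rewrite dotvZl; field.
Qed.

(** The penalty [e * s] makes the conclusion strict: at a maximum of a difference whose heat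
    operator is at most 0 it yields [e <= 0]. *)
Lemma parabolic_max (D : R -> 'rV[R]_n -> R) t x dt G L e r :
  is_derive t 1 (fun s => D s x) dt -> jet (D t) x G L -> 0 < r ->
  (forall s, t - r < s -> s < t -> D s x - e * s <= D t x - e * t) ->
  (\forall z \near x, D t z <= D t x) -> e <= dt - L.
Proof.
move=> hd hj r0 hs hx; have [_ L0] := jet_max hj hx.
have h := left_max_derive (is_derive_add hd (is_derive_opp (is_derive_scal e (is_derive_var t)))) r0 hs.
lra.
Qed.

Lemma cvg_heat_kernel (T : Type) (F : set_system T) (FF : Filter F)
    (f : T -> R) (g : T -> 'rV[R]_n) t x y : 0 < t -> f @ F --> t -> g @ F --> x ->
  heat_kernel (f q) (g q) y @[q --> F] --> heat_kernel t x y.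
Proof.
move=> t0 cf cg; rewrite /heat_kernel.
have p0 : 0 < 4 * pi * t by rewrite !mulr_gt0 ?pi_gt0.
have c4 : (fun z : R => z `^ (- (n%:R / 2))) @ (4 * pi * t) --> (4 * pi * t) `^ (- (n%:R / 2)).
  exact: (is_derive_cvg (is_derive1_powR _ p0)).
have t4 : 4 * t != 0 by rewrite mulf_neq0 // gt_eqF.
apply: cvgM.
  have h0 : 4 * pi * f q @[q --> F] --> 4 * pi * t by apply: cvgM; [exact: cvg_cst|exact: cf].
  exact: (@cvg_comp _ _ _ (fun q => 4 * pi * f q) (fun z : R => z `^ (- (n%:R / 2))) _ _ _ h0 c4).
have h : - (enorm (g q - y) ^+ 2 / (4 * f q)) @[q --> F] --> - (enorm (x - y) ^+ 2 / (4 * t)).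
  have hg : enorm (g q - y) @[q --> F] --> enorm (x - y) by apply: (cvg_enorm FF); apply: cvgB; [exact: cg|exact: cvg_cst].
  apply: cvgN; apply: cvgM; last by apply: cvgV => //; apply: cvgM; [exact: cvg_cst|exact: cf].
  by apply: cvgM.
exact: (cvg_comp _ _ h (@continuous_expR R _)).
Qed.

End HeatKernel.

(** * Upper bounds *)

Section MaxPrinciple.
Variables (R : realType) (n : nat).
Implicit Types (t s : R) (x y z v G : 'rV[R]_n) (u w : R -> 'rV[R]_n -> R).

Lemma heat_kernel_diag_small (b e : R) y : 0 < b -> 0 < e ->
  exists2 d, 0 < d & forall s, 0 < s -> s < d -> heat_kernel s y y * expR (- (b / s)) <= e.
Proof.
move=> b0 e0; set q : R := n%:R / 2; have q0 : 0 <= q by rewrite divr_ge0.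
have p0 : 0 < (pi : R) by exact: pi_gt0.
(* With this [dl], the inequality [ln u <= u] at [u = dl / (4 * pi * s)] costs at most
   [b / (2 * s)]; the other half of [b / s] absorbs the constants collected in [M]. *)
set dl : R := 2 * pi * b / (q + 1).
have dl0 : 0 < dl by rewrite divr_gt0 ?mulr_gt0// ltr_wpDl.
set M := `|q * ln dl| + `|ln e| + 1.
have M0 : 0 < M by rewrite ltr_wpDl// addr_ge0.
exists (b / (2 * M)); first by rewrite divr_gt0// mulr_gt0.
move=> s s0 sM; have s4 : 0 < 4 * pi * s by rewrite !mulr_gt0.
rewrite heat_kernel_diag -/q /powR gt_eqF// -expRD -[leRHS](lnK e0) ler_expR mulNr.
have h1 : - ln (4 * pi * s) <= dl / (4 * pi * s) - ln dl.
  have := ln_sublinear (divr_gt0 dl0 s4); rewrite ln_div ?posrE// => h; lra.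
have h2 : q * (dl / (4 * pi * s)) <= b / (2 * s).
  have -> : q * (dl / (4 * pi * s)) = (q / (q + 1)) * (b / (2 * s)).
    have q1 : q + 1 != 0 by rewrite gt_eqF// ltr_wpDl.
    rewrite /dl; have pn : (pi : R) != 0 by rewrite gt_eqF.
    by move: (pi : R) pn => P pn; field; rewrite pn q1 gt_eqF.
  rewrite ler_piMl ?divr_ge0 ?ltW ?mulr_gt0//.
  by rewrite ltr_pdivrMr ?mul1r ?ltrDl// ltr_wpDl.
have h3 : M <= b / (2 * s).
  rewrite ler_pdivlMr ?mulr_gt0//; move: sM; rewrite ltr_pdivlMr ?mulr_gt0//.
  lra.
have h4 : b / s = 2 * (b / (2 * s)) by field; rewrite gt_eqF.
have h5 := ler_norm (- (q * ln dl)); have h6 := ler_norm (- ln e).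
rewrite !normrN in h5 h6.
have h7 := ler_wpM2l q0 h1.
rewrite /M in h3; rewrite mulrBr in h7; linarith.
Qed.

Lemma heat_kernel_diag_mono s t y : 0 < s -> s <= t -> heat_kernel t y y <= heat_kernel s y y.
Proof.
move=> s0 st; have t0 := lt_le_trans s0 st; have p0 := pi_gt0 R.
rewrite !heat_kernel_diag !powRN lef_pV2 ?posrE ?powR_gt0 ?mulr_gt0//.
have h r : 0 < r -> 0 < 4 * pi * r :> R by move=> r0; apply: mulr_gt0 => //; exact: mulr_gt0.
apply: ge0_ler_powR; rewrite ?nnegrE ?divr_ge0//; [exact/ltW/h|exact/ltW/h|].
by rewrite ler_pM2l // mulr_gt0.
Qed.

Lemma heat_kernel_decay (s1 t2 e : R) y : 0 < s1 -> s1 <= t2 -> 0 < e ->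
  exists2 L, 0 < L & forall s x, s1 <= s -> s <= t2 -> L <= enorm (x - y) ->
    heat_kernel s x y < e.
Proof.
move=> s0 st e0; have t0 := lt_le_trans s0 st.
set P := heat_kernel s1 y y; have P0 : 0 < P by exact: heat_kernel_gt0.
(* From this distance on the Gaussian exponent is at least [P / e], and [exp (P / e) > P / e] gives
   [P * exp (- (P / e)) < e]. *)
exists (Num.sqrt (4 * t2 * (P / e))); first by rewrite sqrtr_gt0 mulr_gt0 ?divr_gt0// mulr_gt0.
move=> s x s1s st2 hL; have s00 := lt_le_trans s0 s1s.
have hd : 4 * t2 * (P / e) <= dotv (x - y) (x - y).
  have h0 : 0 < 4 * t2 * (P / e) by apply: mulr_gt0; [apply: mulr_gt0|apply: divr_gt0].
  by rewrite -enormE -[leLHS](sqr_sqrtr (ltW h0)) ler_sqr ?nnegrE ?sqrtr_ge0 ?enorm_ge0.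
rewrite heat_kernelE; set d := dotv _ _ in hd *.
apply: (@le_lt_trans _ _ (P * expR (- (P / e)))).
  apply: ler_pM; [exact/ltW/heat_kernel_gt0|exact: expR_ge0|exact: heat_kernel_diag_mono|].
  rewrite ler_expR lerN2 ler_pdivlMr ?mulr_gt0//.
  apply: le_trans hd; rewrite mulrC ler_wpM2r//; first by rewrite divr_ge0 // ltW.
  by rewrite ler_pM2l.
rewrite expRN ltr_pdivrMr ?expR_gt0//.
have h := expR_ge1Dx (P / e).
apply: (@lt_le_trans _ _ (e * (1 + P / e))).
  by rewrite mulrDr mulr1 mulrCA divff ?mulr1 ?ltrDr// gt_eqF.
by rewrite ler_wpM2l// ltW.
Qed.

Lemma compact_box_EVT_max (s1 t2 : R) (K : set 'rV[R]_n) (D : R -> 'rV[R]_n -> R) :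
  s1 <= t2 -> compact K -> K !=set0 ->
  (forall s x, s1 <= s -> s <= t2 -> K x ->
     D q.1 q.2 @[q --> (s, x)] --> D s x) ->
  exists s0 x0, [/\ s1 <= s0, s0 <= t2, K x0 &
    forall s x, s1 <= s -> s <= t2 -> K x -> D s x <= D s0 x0].
Proof.
move=> st cK [x1 Kx1] cD.
have cB : compact (`[s1, t2]%classic `*` K) by apply: compact_setX => //; exact: segment_compact.
have [||[s0 x0]] := @compact_EVT_max _ _ (fun q : R * 'rV[R]_n => D q.1 q.2) _ _ cB.
- by exists (s1, x1); split=> //=; rewrite in_itv/= lexx.
- apply: continuous_in_subspaceT => -[s x]; rewrite inE /= in_itv /= => -[/andP[h1 h2] Kx].
  exact: cD.
rewrite inE /= in_itv /= => -[/andP[h1 h2] Kx0] hmax; exists s0, x0; split=> // s x h3 h4 Kx.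
by apply: (hmax (s, x)); rewrite inE /= in_itv /= h3.
Qed.

Section Domain.
Variables (U : set 'rV[R]_n) (k : R -> 'rV[R]_n -> R) (y : 'rV[R]_n).
Hypotheses (oU : open U) (hk : solves_heat_equation U k)
  (kb : forall t z, 0 < t -> bdry U z ->
    k q.1 q.2 @[q --> within [set q : R * 'rV[R]_n | U q.2] (nbhs (t, z))] --> (0 : R))
  (kp : forall t x, 0 < t -> U x -> 0 <= k t x <= heat_kernel t x y).

(** Extension of [k] by zero, so that maxima can be sought on compact sets that leave [U]; the
    Dirichlet condition is what makes it continuous at boundary points. *)
Let kext t x := if `[< U x >] then k t x else 0.

Let kextU t x : U x -> kext t x = k t x.
Proof. by move=> Ux; rewrite /kext; case: asboolP. Qed.

Let kext_cvg t x : 0 < t -> kext q.1 q.2 @[q --> (t, x)] --> kext t x.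
Proof.
move=> t0; have [Ux|nUx] := pselect (U x).
  rewrite kextU//; apply: cvg_trans (caloric_continuous hk t0 Ux).
  apply: near_eq_cvg.
  have : nbhs (t, x) [set q : R * 'rV[R]_n | U q.2].
    exact: (@cvg_snd _ _ (nbhs t) (nbhs x) _ U (open_nbhs_nbhs (conj oU Ux))).
  by apply: filterS => q Uq; rewrite kextU.
have -> : kext t x = 0 by rewrite /kext; case: asboolP.
have [cx|ncx] := pselect (closure U x); last first.
  have nb : nbhs (t, x) [set q : R * 'rV[R]_n | (~` (closure U)) q.2].
    have oC : open (~` closure U) by exact/closed_openC/closed_closure.
    exact: (@cvg_snd _ _ (nbhs t) (nbhs x) _ (~` closure U) (open_nbhs_nbhs (conj oC ncx))).
  apply: cvg_trans (@cvg_cst _ (0:R) _ (nbhs (t, x)) _); apply: near_eq_cvg.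
  apply: filterS nb => q ncq; rewrite /kext; case: asboolP => // Uq.
  by case: ncq; exact: subset_closure.
have bx : bdry U x by split=> //; rewrite ((interior_id U).1 oU).
move=> A /= nA; have := kb t0 bx nA; rewrite /= nbhs_simpl /= => h.
have A0 : A 0 by exact: nbhs_singleton nA.
apply: (@filterS _ (nbhs (t, x)) _ _ _ _ h) => q /= hq; rewrite /kext; case: asboolP => //; exact: hq.
Qed.

(** The barrier has to be a supersolution at points of [U] interior to [Z]; elsewhere on the lateral
    boundary a direct bound on [k] takes its place. The slack [eta] serves starting times at which
    [k] is controlled only through [p]. *)
Lemma upper_max_principle (V : R -> 'rV[R]_n -> R) (Z : set 'rV[R]_n) (s1 t2 eta : R) :
  0 < s1 -> s1 <= t2 -> 0 <= eta -> closed Z ->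
  (forall s x, s1 <= s -> s <= t2 -> Z x -> V q.1 q.2 @[q --> (s, x)] --> V s x) ->
  (forall s x, s1 <= s -> s <= t2 -> Z x -> 0 <= V s x) ->
  (forall x, U x -> Z x -> k s1 x <= V s1 x + eta) ->
  (forall s x, s1 < s -> s <= t2 -> U x -> Z x ->
     k s x <= V s x + eta \/
     (nbhs x Z /\ exists dt G L, [/\ is_derive s 1 (fun r => V r x) dt,
        jet (V s) x G L & 0 <= dt - L])) ->
  forall x, U x -> Z x -> k t2 x <= V t2 x + eta.
Proof.
move=> s0 st eta0 cZ cV V0 hinit hlat x Ux Zx; rewrite leNgt; apply/negP => hlt.
have t0 := lt_le_trans s0 st.
(* A third of the excess pays for the time penalty; the two thirds left at the maximum exceed the
   bound [mu] on [k] at distance [L], so the maximum is not on that sphere. *)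
set mu := (k t2 x - V t2 x - eta) / 3.
have mu0 : 0 < mu by rewrite /mu divr_gt0//; lra.
have [L L0 hL] := heat_kernel_decay y s0 st mu0.
set e := mu / (t2 - s1 + 1).
have ts : 0 < t2 - s1 + 1 by lra.
have e0 : 0 < e by rewrite divr_gt0.
have emu : e * (t2 - s1) <= mu.
  rewrite /e mulrAC ler_pdivrMr// ler_wpM2l ?(ltW mu0)//; lra.
set D := fun s x => kext s x - V s x - e * (s - s1).
set K := Z `&` [set z | enorm (z - y) <= L].
have cK : compact K.
  rewrite /K setIC; apply: compact_closedI => //; exact: ecompact.
have kt2 : mu < k t2 x by have := V0 t2 x st (lexx _) Zx; rewrite /mu; lra.
have Kx : K x.
  split=> //=; rewrite leNgt; apply/negP => /ltW hh.
  have /andP[_ hp] := kp t0 Ux.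
  by have := hL t2 x st (lexx _) hh; lra.
have cD s z : s1 <= s -> s <= t2 -> K z -> D q.1 q.2 @[q --> (s, z)] --> D s z.
  move=> h1 h2 [Zz _]; apply: cvgB; first apply: cvgB.
  - exact: kext_cvg (lt_le_trans s0 h1).
  - exact: cV.
  - apply: cvgM; first exact: cvg_cst.
    by apply: cvgB; [exact: cvg_fst|exact: cvg_cst].
have [|s' [x' [h1 h2 [Zx' Lx'] hmax]]] := compact_box_EVT_max st cK _ cD; first by exists x.
have Dx : eta + 2 * mu <= D t2 x.
  rewrite /D kextU//; have -> : k t2 x = 3 * mu + V t2 x + eta by rewrite /mu; field.
  linarith.
have Dx' := le_trans Dx (hmax t2 x st (lexx _) Kx).
have es' : 0 <= e * (s' - s1) by apply: mulr_ge0; [exact: ltW|rewrite subr_ge0].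
have kx' : eta + 2 * mu <= kext s' x'.
  by have := V0 s' x' h1 h2 Zx'; move: Dx'; rewrite /D; linarith.
have Ux' : U x'.
  move: kx'; rewrite /kext; case: asboolP => // _; linarith.
have s'0 := lt_le_trans s0 h1.
rewrite kextU// in kx'.
have Lx'' : enorm (x' - y) < L.
  rewrite ltNge; apply/negP => hh; have := hL s' x' h1 h2 hh.
  have /andP[_ hp] := kp s'0 Ux'; linarith.
have kV : V s' x' + eta + 2 * mu <= k s' x' by move: Dx'; rewrite /D kextU//; linarith.
have s1s' : s1 < s'.
  rewrite lt_neqAle h1 andbT; apply/negP => /eqP es.
  by have := hinit x' Ux' Zx'; rewrite es; linarith.
have [|[nZ [dt [G [L' [dV jV hV]]]]]] := hlat s' x' s1s' h2 Ux' Zx'; first by linarith.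
have [Gk [Lk [dk jk]]] := caloric_jet oU hk s'0 Ux'.
have hd := is_derive_add dk (is_derive_opp dV).
have hj := jetB jk jV.
have : e <= (Lk - dt) - (Lk - L').
  apply: (parabolic_max (D := fun s z => k s z - V s z) (r := s' - s1) hd hj); first by rewrite subr_gt0.
    move=> s; rewrite subKr => hs1 hs2.
    have := hmax s x' (ltW hs1) (le_trans (ltW hs2) h2) (conj Zx' Lx').
    rewrite /D !kextU//; linarith.
  have nU : nbhs x' U by exact: open_nbhs_nbhs.
  have nL : nbhs x' [set z | enorm (z - y) < L].
    by apply: open_nbhs_nbhs; split => //; exact: eball_open.
  apply: filterS (filterI nU (filterI nL nZ)) => z [Uz [Lz Zz]].
  have := hmax s' z h1 h2 (conj Zz (ltW Lz)).
  rewrite /D !kextU//; linarith.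
linarith.
Qed.

End Domain.
End MaxPrinciple.

Section Affine.
Variables (R : realType) (n : nat).
Implicit Types (v x : 'rV[R]_n) (c : R).

Lemma cvg_affine (T : Type) (F : set_system T) (FF : Filter F) (g : T -> 'rV[R]_n) v c x :
  g @ F --> x -> dotv v (g q) + c @[q --> F] --> dotv v x + c.
Proof.
move=> cg; apply: cvgD; last exact: cvg_cst.
by apply: (cvg_dotv FF); [exact: cvg_cst|].
Qed.

Lemma affine_closed v c : closed [set x | 0 <= dotv v x + c].
Proof.
have -> : [set x | 0 <= dotv v x + c] = (fun x => dotv v x + c) @^-1` [set r | 0 <= r] by [].
apply: preimage_closed => [x _|]; last exact: closed_ge.
exact: (cvg_affine (nbhs_filter x) (@cvg_id _ _)).
Qed.

Lemma affine_open v c (r : R) : open [set x | dotv v x + c < r].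
Proof.
have -> : [set x | dotv v x + c < r] = (fun x => dotv v x + c) @^-1` [set s | s < r] by [].
apply: open_comp => [x _|]; last exact: open_lt.
exact: (cvg_affine (nbhs_filter x) (@cvg_id _ _)).
Qed.

Lemma heat_kernel_continuous (y : 'rV[R]_n) (s : R) x : 0 < s ->
  heat_kernel q.1 q.2 y @[q --> (s, x)] --> heat_kernel s x y.
Proof.
move=> s0; exact: (@cvg_heat_kernel R n _ _ _ _ _ s x y s0 (@cvg_fst _ _ (nbhs s) (nbhs x) _)
  (@cvg_snd _ _ (nbhs s) (nbhs x) _)).
Qed.

Lemma is_derive_expR_near (a : R) : \forall s \near a, is_derive (s : R) (1 : R) (@expR R) (expR s).
Proof. by apply: (@filterE _ (nbhs a)) => s; exact: is_derive_expR. Qed.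

End Affine.

(** * Barriers from half-spaces and strips *)

Section UpperBounds.
Variables (R : realType) (n : nat).
Implicit Types (t s : R).
Variables (U : set 'rV[R]_n) (k : R -> 'rV[R]_n -> R) (y : 'rV[R]_n).
Hypotheses (oU : open U) (Uy : U y) (hk : solves_heat_equation U k)
  (kb : forall t z, 0 < t -> bdry U z ->
    k q.1 q.2 @[q --> within [set q : R * 'rV[R]_n | U q.2] (nbhs (t, z))] --> (0 : R))
  (kp : forall t x, 0 < t -> U x -> 0 <= k t x <= heat_kernel t x y).

(* The right-hand side is the heat kernel of the half-space: the image term at
   the reflected pole is [p exp(- d(x) d(y) / t)]. *)
Lemma half_space_upper (v : 'rV[R]_n) (c : R) : dotv v v = 1 ->
  (forall x, U x -> 0 < dotv v x + c) ->
  forall t x, 0 < t -> U x ->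
    k t x <= heat_kernel t x y * (1 - expR (- ((dotv v x + c) * (dotv v y + c) / t))).
Proof.
move=> vv dU t x t0 Ux; apply/ler_addgt0Pr => eta eta0.
set b := dotv v y + c; have b0 : 0 < b by exact: dU.
have b4 : 0 < b ^+ 2 / 4 by rewrite divr_gt0 ?exprn_gt0.
have [d d0 hd] := heat_kernel_diag_small y b4 eta0.
(* At this time the image term is at most [eta] on the whole half-space, so [k <= p] starts the
   comparison up to [eta]. *)
set s1 := Num.min (d / 2) t.
have s10 : 0 < s1 by rewrite lt_min divr_gt0.
have s1d : s1 < d by rewrite gt_min ltr_pdivrMr// ltr_pMr// ltrDl ltr01.
have s1t : s1 <= t by rewrite ge_min lexx orbT.
set w := fun (s : R) (z : 'rV[R]_n) => 1 - expR (- ((dotv v z + c) * b / s)).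
apply: (upper_max_principle (y := y) oU hk kb kp (V := fun s z => heat_kernel s z y * w s z)
  (Z := [set z | 0 <= dotv v z + c]) s10 s1t (ltW eta0)) => //.
- exact: affine_closed.
- move=> s z h1 _ _; have s0 := lt_le_trans s10 h1.
  apply: cvgM; first exact: heat_kernel_continuous.
  apply: cvgB; first exact: cvg_cst.
  have h : - ((dotv v q.2 + c) * b / q.1) @[q --> (s, z)] --> - ((dotv v z + c) * b / s).
    apply: cvgN; apply: cvgM; last by apply: cvgV; [rewrite gt_eqF|exact: cvg_fst].
    by apply: cvgM; [apply: cvg_affine; exact: cvg_snd|exact: cvg_cst].
  exact: (cvg_comp _ _ h (@continuous_expR R _)).
- move=> s z h1 _ Zz; have s0 := lt_le_trans s10 h1.
  apply: mulr_ge0; first exact/ltW/heat_kernel_gt0.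
  rewrite subr_ge0 -[leRHS]expR0 ler_expR oppr_le0 divr_ge0 ?(ltW s0)//.
  by apply: mulr_ge0 => //; exact: ltW.
- move=> z Uz Zz; have /andP[_ h] := kp s10 Uz.
  apply: (le_trans h); rewrite /w mulrBr mulr1 -lerBlDl opprB addrC subrK.
  apply: le_trans (hd s1 s10 s1d); rewrite (heat_kernelE s1 z) -[leLHS]mulrA -expRD.
  rewrite ler_wpM2l ?(ltW (heat_kernel_gt0 _ _ s10))// ler_expR -opprD lerN2.
  rewrite -(ler_pM2r (mulr_gt0 (ltr0n R 4) s10)).
  have -> : b ^+ 2 / 4 / s1 * (4 * s1) = b ^+ 2 by field; rewrite gt_eqF.
  have -> : (dotv (z - y) (z - y) / (4 * s1) + (dotv v z + c) * b / s1) * (4 * s1) =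
    dotv (z - y) (z - y) + 4 * (dotv v z + c) * b by field; rewrite gt_eqF.
  (* [|z - y|^2 + 4 a b >= (a - b)^2 + 4 a b = (a + b)^2 >= b^2] for the heights [a] of [z] and [b]
     of the pole, so the image term carries a factor [exp (- b^2 / (4 s))] uniformly in [z]. *)
  have hcs := cauchy_schwarz v (z - y); rewrite vv mul1r dotvBr in hcs.
  move: hcs; set q := dotv (z - y) _; rewrite /= in Zz.
  have -> : dotv v z - dotv v y = (dotv v z + c) - b by rewrite /b; ring.
  move: Zz; set a := dotv v z + c => Zz; nra.
- move=> s z h1 _ Uz Zz; right; have s0 := lt_trans s10 h1; split.
    have : nbhs z U by exact: open_nbhs_nbhs.
    by apply: filterS => q /dU /ltW.
  set a := dotv v z + c; have sn : s != 0 by rewrite gt_eqF.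
  have dw : is_derive s 1 (fun r => w r z)
     (- (expR (- (a * b / s)) * - (a * b * (- 1 / s ^+ 2)))).
    apply: (is_derive_fun (is_derive_add (is_derive_const 1 s) (is_derive_opp (is_derive_exp
      (is_derive_opp (is_derive_scal (a * b) (is_derive_inv sn (is_derive_var s)))))))) => //.
    by rewrite add0r.
  have jl := jetZ (- (b / s)) (jet_dotv v c z).
  have jw := jetB (jet_cst 1 z) (jet_comp (is_derive_expR_near _) (is_derive_expR _) jl).
  have {}jw : jet (w s) z (0 - expR (- (b / s) * a) *: (- (b / s) *: v))
      (0 - (expR (- (b / s) * a) * (- (b / s) * 0) + expR (- (b / s) * a) * dotv (- (b / s) *: v) (- (b / s) *: v))).
    by apply: jet_ext jw => q; rewrite /w; congr (1 - expR _); ring.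
  have [dt [G [L [h3 h4 h5]]]] := heat_kernel_mul y s0 dw jw.
  exists dt, G, L; split=> //; rewrite h5.
  have -> : - (a * b / s) = - (b / s) * a by ring.
  move: (expR _) => E; rewrite !sub0r dotvNr !dotvZr !dotvZl vv dotvBl (dotvC z) (dotvC y).
  have -> : dotv v z = a - c by rewrite /a addrK.
  have -> : dotv v y = b - c by rewrite /b addrK.
  (* The half-space kernel is an exact solution, so the bracket vanishes. *)
  set r := (X in 0 <= _ * X); suff -> : r = 0 by rewrite mulr0.
  by rewrite /r; field.
- exact/ltW/dU.
Qed.

(** The supersolution condition for the barrier of [strip_upper] after division by [2 * be / t]. The
    gain [3 * q ^+ 2] is [4 * q ^+ 2] from concavity across the strip minus [q ^+ 2] from the time
    derivative; since [q * sg >= 8], it dominates the drift terms [r1], [r2] and the product [v] of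
    the two gradient directions. *)
Let strip_ineq (X q e r1 v f r2 sg : R) : 0 < sg -> sg <= X -> 8 <= q * sg -> 0 <= e -> e <= 1 ->
  - q <= 4 * r1 -> v <= 1 -> 0 <= f -> f <= 3 -> - 2 <= r2 * sg ->
  0 <= X * (3 * q ^+ 2 + 4 * q * e * r1) - 8 * q * e * v + f * r2.
Proof.
move=> sg0 sX qs e0 e1 hr1 v1 f0 f3 hr2.
have q0 : 0 < q by rewrite -(pmulr_lgt0 _ sg0); exact: lt_le_trans qs.
have h1 : - q <= 4 * e * r1 by nra.
have h2 : 2 * q ^+ 2 <= 3 * q ^+ 2 + 4 * q * e * r1 by nra.
have h3 : 16 * q <= X * (3 * q ^+ 2 + 4 * q * e * r1).
  apply: (@le_trans _ _ (sg * (2 * q ^+ 2))); first by nra.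
  apply: ler_pM => //; [exact: ltW|by rewrite mulr_ge0// sqr_ge0].
have ev : e * v <= 1 by nra.
have h4 : 8 * q * e * v <= 8 * q by nra.
have h5 : - 6 <= f * r2 * sg by nra.
have h6 : - (8 * q) <= f * r2 by rewrite -(ler_pM2r sg0); nra.
lra.
Qed.

(** In a strip of width [q^-1] along the first hyperplane, during the last [q^-2] units of time,
    [f1] is the linear bound coming from the second half-space and [f2] is a concave profile across
    the strip, at least 1 on the initial and inner faces. The comparison multiplies two linear
    gains, of which each half-space bound by itself provides only one. *)
Lemma strip_upper (v1 v2 : 'rV[R]_n) (c1 c2 : R) : dotv v1 v1 = 1 -> dotv v2 v2 = 1 ->
  (forall x, U x -> 0 < dotv v1 x + c1) -> (forall x, U x -> 0 < dotv v2 x + c2) ->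
  forall t x, 0 < t -> U x -> dotv v2 y + c2 <= Num.sqrt t ->
    (dotv v1 x + c1) * (8 * (dotv v1 y + c1 + Num.sqrt t) / t) < 1 ->
    k t x <= 64 * ((dotv v1 x + c1) * (dotv v1 y + c1 + Num.sqrt t) / t) *
     ((dotv v2 y + c2) * (dotv v2 x + c2 + Num.sqrt t) / t) * heat_kernel t x y.
Proof.
move=> vv1 vv2 dU1 dU2 t x t0 Ux bt.
set A := dotv v1 y + c1; set be := dotv v2 y + c2; set sg := Num.sqrt t.
have sg0 : 0 < sg by rewrite sqrtr_gt0.
have sgt : sg ^+ 2 = t by rewrite sqr_sqrtr // ltW.
have A0 : 0 < A by exact: dU1.
have be0 : 0 < be by exact: dU2.
(* [q] is eight times [A / t + 1 / sg], the drift rate plus the diffusive rate: the strip must be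
   thin against both. *)
set q := 8 * (A + sg) / t; have q0 : 0 < q by rewrite divr_gt0// mulr_gt0// addr_gt0.
have qt : q * t = 8 * (A + sg) by rewrite /q divfK// gt_eqF.
have qs : 8 <= q * sg by rewrite -(ler_pM2r sg0) -mulrA -expr2 sgt qt; nra.
have qA : 8 * A / t <= q.
  rewrite ler_pdivrMr// qt; nra.
move=> aq.
set s1 := t - q ^- 2.
have q20 : 0 < q ^- 2 by rewrite invr_gt0 exprn_gt0.
have qtt : q ^- 2 <= t / 2.
  rewrite -(ler_pM2l (exprn_gt0 2 q0)) divff ?expf_neq0 ?gt_eqF//.
  have -> : q ^+ 2 * (t / 2) = (q * sg) ^+ 2 / 2 by rewrite -sgt; ring.
  rewrite ler_pdivlMr//; apply: (@le_trans _ _ (8 ^+ 2)); first by lra.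
  by rewrite ler_sqr ?nnegrE// ltW // mulr_gt0.
have s12 : t / 2 <= s1 by rewrite /s1; lra.
have s10 : 0 < s1 by apply: lt_le_trans s12; rewrite divr_gt0.
have s1t : s1 <= t by rewrite /s1; lra.
set a := fun z : 'rV[R]_n => dotv v1 z + c1; set d2 := fun z : 'rV[R]_n => dotv v2 z + c2.
set f1 := fun z => (2 * be / t) * (dotv v2 z + (c2 + sg)).
set f2 := fun s z => (4 * q) * a z + (- 2 * q ^+ 2) * (a z * a z) + (t - s) * q ^+ 2.
have f1E z : f1 z = (2 * be / t) * (d2 z + sg) by rewrite /f1 /d2 addrA.
have f2le s z : s1 <= s -> s <= t -> 0 <= a z -> a z * q <= 1 -> 0 <= f2 s z <= 3.
  move=> h1 h2 a0 aq1; rewrite /f2.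
  have h3 : (t - s) * q ^+ 2 <= 1.
    have -> : 1 = q ^- 2 * q ^+ 2 by rewrite mulVf// expf_neq0// gt_eqF.
    rewrite ler_pM2r ?exprn_gt0//; move: h1; rewrite /s1; linarith.
  have h4 : 0 <= (t - s) * q ^+ 2 by rewrite mulr_ge0 ?sqr_ge0// subr_ge0.
  have h5 : 0 <= a z * q by rewrite mulr_ge0// ltW.
  move: h3 h4; set r := (t - s) * _ => h3 h4; nlinarith.
set V := fun s z => heat_kernel s z y * (f1 z * f2 s z).
set Z := [set z | 0 <= dotv v2 z + c2] `&` ([set z | 0 <= dotv v1 z + c1] `&`
  [set z | 0 <= dotv (- v1) z + (q^-1 - c1)]).
have ZE z : Z z <-> [/\ 0 <= d2 z, 0 <= a z & a z * q <= 1].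
  rewrite /Z /= dotvNl; split=> [[h1 [h2 h3]]|[h1 h2 h3]]; split => //.
    rewrite -(ler_pM2r (_ : 0 < q^-1)) ?invr_gt0// mulfK ?gt_eqF// mul1r /a; linarith.
  split=> //; move: h3; rewrite -ler_pdivlMr// mul1r /a; linarith.
have kZ s z : s1 <= s -> U z -> k s z <= heat_kernel s z y * f1 z.
  move=> h1 Uz; have s0 := lt_le_trans s10 h1.
  apply: le_trans (half_space_upper vv2 dU2 s0 Uz) _.
  rewrite ler_pM2l ?heat_kernel_gt0// -/(d2 z) -/be f1E.
  have h2 := expR_ge1Dx (- (d2 z * be / s)).
  apply: (@le_trans _ _ (d2 z * be / s)); first by linarith.
  have d0 : 0 < d2 z by exact: dU2.
  apply: (@le_trans _ _ (d2 z * be * (2 / t))).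
    rewrite ler_pM2l ?mulr_gt0// -[leRHS]invrK invf_div lef_pV2 ?posrE ?divr_gt0//.
    exact: le_trans h1.
  have -> : d2 z * be * (2 / t) = 2 * be / t * d2 z by ring.
  by rewrite ler_pM2l ?divr_gt0 ?mulr_gt0// lerDl ltW.
have -> : 64 * (a x * (A + sg) / t) * (be * (d2 x + sg) / t) * heat_kernel t x y =
   heat_kernel t x y * (f1 x * (4 * q * a x)).
  by rewrite f1E /q; field; rewrite gt_eqF.
have Vx : V t x <= heat_kernel t x y * (f1 x * (4 * q * a x)).
  rewrite /V ler_pM2l ?heat_kernel_gt0// ler_pM2l; last first.
    by rewrite f1E !mulr_gt0 ?invr_gt0// addr_gt0// dU2.
  rewrite /f2 subrr mul0r addr0 gerDl mulNr mulNr oppr_le0.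
  by rewrite -expr2 mulr_ge0 ?sqr_ge0// mulr_ge0 ?sqr_ge0.
apply: le_trans Vx; rewrite -[leRHS]addr0.
apply: (upper_max_principle (y := y) oU hk kb kp (V := V) (Z := Z) s10 s1t (lexx 0)) => //.
- by apply: closedI; [|apply: closedI]; exact: affine_closed.
- move=> s z h1 h2 _; have s0 := lt_le_trans s10 h1.
  apply: cvgM; first exact: heat_kernel_continuous.
  have ca : a q.2 @[q --> (s, z)] --> a z by apply: cvg_affine; exact: cvg_snd.
  apply: cvgM.
    by apply: cvgM; [exact: cvg_cst|apply: cvg_affine; exact: cvg_snd].
  apply: cvgD; first apply: cvgD.
  + by apply: cvgM => //; exact: cvg_cst.
  + by apply: cvgM; [exact: cvg_cst|apply: cvgM].
  + apply: cvgM; last exact: cvg_cst.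
    by apply: cvgB; [exact: cvg_cst|exact: cvg_fst].
- move=> s z h1 h2 /ZE[z1 z2 z3]; have s0 := lt_le_trans s10 h1.
  have /andP[f20 _] := f2le s z h1 h2 z2 z3.
  apply: mulr_ge0; first exact/ltW/heat_kernel_gt0.
  apply: mulr_ge0 => //; rewrite f1E; apply: mulr_ge0.
    by rewrite divr_ge0 ?mulr_ge0 ?(ltW be0) ?(ltW t0).
  by rewrite addr_ge0// ltW.
- move=> z Uz /ZE[z1 z2 z3]; rewrite addr0; apply: le_trans (kZ s1 z (lexx _) Uz) _.
  rewrite /V ler_pM2l ?heat_kernel_gt0// -[leLHS]mulr1 ler_pM2l; last first.
    by rewrite f1E !mulr_gt0 ?invr_gt0// addr_gt0// dU2.
  rewrite /f2 /s1 opprB addrCA subrr addr0 mulVf ?expf_neq0 ?gt_eqF// lerDr.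
  have h5 : 0 <= a z * q by rewrite mulr_ge0// ltW.
  nlinarith.
- move=> s z h1 h2 Uz /ZE[z1 z2 z3]; have s0 := lt_trans s10 h1.
  (* On the inner face [a z * q = 1] the profile [f2] is at least 2, and the half-space bound [kZ]
     suffices. *)
  have [zq|zq] := ltP (a z * q) 1; last first.
    left; rewrite addr0; apply: le_trans (kZ s z (ltW h1) Uz) _.
    have aq1 : a z * q = 1 by apply/eqP; rewrite eq_le z3.
    rewrite /V ler_pM2l ?heat_kernel_gt0// -[leLHS]mulr1 ler_pM2l; last first.
      by rewrite f1E !mulr_gt0 ?invr_gt0// addr_gt0// dU2.
    have h4 : 0 <= (t - s) * q ^+ 2 by rewrite mulr_ge0 ?sqr_ge0// subr_ge0.
    rewrite /f2; have -> : 4 * q * a z + - 2 * q ^+ 2 * (a z * a z) = 2 * (a z * q) * (2 - a z * q) by ring.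
    by rewrite aq1; linarith.
  right; split.
    have nU : nbhs z U by exact: open_nbhs_nbhs.
    have na : nbhs z [set z' | dotv v1 z' + c1 < q^-1].
      apply: open_nbhs_nbhs; split; first exact: affine_open.
      by rewrite /= -/(a z) -[q^-1]mul1r ltr_pdivlMr.
    apply: filterS (filterI nU na) => z' [Uz' az']; apply/ZE; split; try exact/ltW/dU1; try exact/ltW/dU2.
    by rewrite ltW // -ltr_pdivlMr// mul1r.
  have dw : is_derive s 1 (fun r => f1 z * f2 r z) (f1 z * (- q ^+ 2)).
    apply: is_derive_scal.
    apply: (is_derive_fun (is_derive_add (is_derive_const _ s)
       (is_derive_mul (is_derive_add (is_derive_const t s) (is_derive_opp (is_derive_var s))) (is_derive_const (q ^+ 2) s)))) => //.
    by rewrite mulr0 !add0r mulrN1.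
  have j1 := jetZ (2 * be / t) (jet_dotv v2 (c2 + sg) z).
  have ja := jet_dotv v1 c1 z.
  have j2 := jetD (jetD (jetZ (4 * q) ja) (jetZ (- 2 * q ^+ 2) (jetM ja ja))) (jet_cst ((t - s) * q ^+ 2) z).
  have j3 : jet ((fun r z' => f1 z' * f2 r z') s) z _ _ := jetM j1 j2.
  have [dt [G [L [h3 h4 h5]]]] := heat_kernel_mul (w := fun r z' => f1 z' * f2 r z') y s0 dw j3.
  exists dt, G, L; split=> //; rewrite h5; apply: mulr_ge0; first exact/ltW/heat_kernel_gt0.
  have /andP[f20 f23] := f2le s z (ltW h1) h2 z2 z3.
  rewrite -/(a z) -/(f1 z) -/(f2 s z).
  have := @strip_ineq (d2 z + sg) q (1 - a z * q) ((a z - A) / s) (dotv v1 v2) (f2 s z) ((d2 z - be) / s) sg.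
  pose e := (d2 z + sg) * (3 * q ^+ 2 + 4 * q * (1 - a z * q) * ((a z - A) / s)) -
    8 * q * (1 - a z * q) * dotv v1 v2 + f2 s z * ((d2 z - be) / s).
  rewrite -/e => hh.
  have eE : (2 * be / t) * e = f1 z * - q ^+ 2 - (f1 z * ((4 * q) * 0 + (- 2 * q ^+ 2) * (a z * 0 + 2 * dotv v1 v1 + a z * 0) + 0) +
    2 * dotv ((2 * be / t) *: v2) ((4 * q) *: v1 + (- 2 * q ^+ 2) *: (a z *: v1 + a z *: v1) + 0) + f2 s z * (2 * be / t * 0)) +
    dotv (z - y) (f1 z *: ((4 * q) *: v1 + (- 2 * q ^+ 2) *: (a z *: v1 + a z *: v1) + 0) + f2 s z *: ((2 * be / t) *: v2)) / s.
    rewrite addr0 -scalerDl !scalerA -scalerDl !(dotvE, dotvBl) vv1 (dotvC v2 v1) (dotvC z) (dotvC y) (dotvC z v2) (dotvC y v2).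
    have -> : dotv v1 z = a z - c1 by rewrite /a addrK.
    have -> : dotv v2 z = d2 z - c2 by rewrite /d2 addrK.
    have -> : dotv v1 y = A - c1 by rewrite /A addrK.
    have -> : dotv v2 y = be - c2 by rewrite /be addrK.
    rewrite !dotv0r f1E /e; move: (f2 s z) (dotv v1 v2) (a z) (d2 z) => F D a' d'.
    by field; rewrite !gt_eqF.
  rewrite -eE; apply: mulr_ge0; first by rewrite divr_ge0 ?mulr_ge0 ?(ltW be0) ?(ltW t0).
  apply: hh => //.
  + by rewrite lerDr.
  + by rewrite subr_ge0.
  + have h5' : 0 <= a z * q by rewrite mulr_ge0// ltW.
    linarith.
  + have : - (A / (t / 2)) <= (a z - A) / s.
      rewrite -mulNr; apply: (@le_trans _ _ (- A / s)).
        rewrite !mulNr lerN2 ler_pM2l// lef_pV2 ?posrE ?divr_gt0//.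
        exact: le_trans s12 (ltW h1).
      by rewrite ler_pM2r ?invr_gt0// lerDr.
    have -> : A / (t / 2) = (8 * A / t) / 4 by field; rewrite gt_eqF.
    linarith.
  + have := cauchy_schwarz v1 v2; rewrite vv1 vv2 mulr1 => hcs.
    by apply: (le_trans (ler_norm _)); rewrite -(ler_sqr (normr_ge0 _)) ?nnegrE ?ler01// real_normK ?num_real// expr1n.
  + have : - (be / (t / 2)) <= (d2 z - be) / s.
      rewrite -mulNr; apply: (@le_trans _ _ (- be / s)).
        rewrite !mulNr lerN2 ler_pM2l// lef_pV2 ?posrE ?divr_gt0//.
        exact: le_trans s12 (ltW h1).
      by rewrite ler_pM2r ?invr_gt0// lerDr.
    move=> h6; have := ler_wpM2r (ltW sg0) h6; apply: le_trans.
    rewrite mulNr lerN2 -sgt.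
    have -> : be / (sg ^+ 2 / 2) * sg = 2 * (be / sg) by field; rewrite gt_eqF.
    have : be / sg <= 1 by rewrite ler_pdivrMr// mul1r.
    linarith.
- by apply/ZE; split; [exact/ltW/dU2|exact/ltW/dU1|exact: ltW].
Qed.

End UpperBounds.

(** * Lower comparison functions *)

Section Profile.
Variable R : realType.
Implicit Types (m kap t phi sg : R).

(* Convex in [phi], quadratic up to the diffusive scale [sqrt t] and linear
   beyond; the factor [exp (- m sqrt t)] makes [1 - exp (- b profile / t)] a
   subsolution uniformly in [b]. *)
Definition profile m kap t phi : R :=
  let sg := Num.sqrt t in
  expR (- (m * sg)) * (phi + kap * (Num.min phi sg * (2 * phi - Num.min phi sg))).

Lemma profile_low m kap t phi : 0 <= phi -> 0 <= kap ->
  expR (- (m * Num.sqrt t)) * phi <= profile m kap t phi.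
Proof.
move=> p0 k0; rewrite /profile ler_pM2l ?expR_gt0// lerDl mulr_ge0//.
have := sqrtr_ge0 t; case: (leP phi (Num.sqrt t)) => h s0; nra.
Qed.

(** [2 * kap <= m] lets [exp (- m sg)] absorb the slope factor [1 + 2 kap sg]. *)
Lemma profile_le m kap t phi : 0 <= phi -> 0 <= kap -> 2 * kap <= m -> profile m kap t phi <= phi.
Proof.
move=> p0 k0 mk; have s0 := sqrtr_ge0 t; set sg := Num.sqrt t in s0 *.
apply: (@le_trans _ _ (expR (- (m * sg)) * ((1 + m * sg) * phi))).
  rewrite /profile -/sg ler_pM2l ?expR_gt0//.
  apply: (@le_trans _ _ (phi + kap * (2 * sg * phi))).
    by rewrite lerD2l ler_wpM2l//; case: (leP phi sg) => h; nra.
  have : kap * (2 * sg * phi) <= m * sg * phi.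
    have : 2 * kap * (sg * phi) <= m * (sg * phi) by rewrite ler_wpM2r// mulr_ge0.
    lra.
  lra.
rewrite mulrA ler_piMl// expRN ler_pdivrMl ?expR_gt0// mulr1; exact: expR_ge1Dx.
Qed.

(** Used to see that a ball which maximizes the profile at a point also maximizes the paraboloid
    there. *)
Lemma profile_mono m kap t phi phi' : 0 <= phi -> 0 <= kap ->
  profile m kap t phi' <= profile m kap t phi -> phi' <= phi.
Proof.
move=> p0 k0; rewrite /profile ler_pM2l ?expR_gt0// => h; rewrite leNgt; apply/negP => lt.
have := sqrtr_ge0 t; set sg := Num.sqrt t in h * => s0.
suff : kap * (Num.min phi sg * (2 * phi - Num.min phi sg)) <= kap * (Num.min phi' sg * (2 * phi' - Num.min phi' sg)) by lra.
rewrite ler_wpM2l//; case: (leP phi sg) => h1; case: (leP phi' sg) => h2; nra.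
Qed.

Lemma cvg_profile (T : Type) (F : set_system T) (FF : Filter F) (f g : T -> R) m kap t phi :
  f @ F --> t -> g @ F --> phi -> profile m kap (f q) (g q) @[q --> F] --> profile m kap t phi.
Proof.
move=> cf cg; rewrite /profile.
have cs : Num.sqrt (f q) @[q --> F] --> Num.sqrt t.
  exact: (@continuous_cvg _ _ _ _ _ f Num.sqrt t (@sqrt_continuous R t) cf).
have cm : Num.min (g q) (Num.sqrt (f q)) @[q --> F] --> Num.min phi (Num.sqrt t).
  rewrite minr_absE; under eq_fun do rewrite minr_absE.
  apply: cvgM; last exact: cvg_cst.
  by apply: cvgB; [apply: cvgD|apply: cvg_norm; apply: cvgB].
apply: cvgM.
  have h : - (m * Num.sqrt (f q)) @[q --> F] --> - (m * Num.sqrt t).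
    by apply: cvgN; apply: cvgM => //; exact: cvg_cst.
  exact: (cvg_comp _ _ h (@continuous_expR R _)).
apply: cvgD => //; apply: cvgM; first exact: cvg_cst.
apply: cvgM => //; apply: cvgB => //; apply: cvgM => //; exact: cvg_cst.
Qed.

(* The differential inequality for the quadratic piece of the profile. *)
Lemma profile_ineq_quad (C kap m sg T1 r0 phi g b L : R) :
  0 < C -> C <= kap -> 0 < sg -> sg <= T1 -> 0 < r0 ->
  2 * (kap + C + 2 * kap * C * T1 + 4 * C * T1 / r0) <= m ->
  0 < phi -> phi <= sg -> 0 <= g -> g <= 1 -> (phi <= r0 / 4 -> 1 / 2 <= g) ->
  L <= (phi - b) / sg ^+ 2 + C -> 0 < b ->
  forall D, D = expR (- (m * sg)) ->
  - (m / (2 * sg)) * (D * (phi + kap * phi ^+ 2)) - D * (phi + kap * phi ^+ 2) / sg ^+ 2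
    + D * (1 + 2 * kap * phi) * L - D * (2 * kap) * g
    + b / sg ^+ 2 * (D * (1 + 2 * kap * phi)) ^+ 2 * g <= 0.
Proof.
move=> C0 Ck s0 sT r00 hm p0 ps g0 g1 hg hL b0 D DE.
have k0 : 0 < kap by exact: lt_le_trans Ck.
have D0 : 0 < D by rewrite DE expR_gt0.
set a := 1 + 2 * kap * phi; have a0 : 0 < a by rewrite /a addr_gt0// !mulr_gt0.
have T0 : 0 < T1 by exact: lt_le_trans sT.
have Da : D * a <= 1.
  rewrite DE expRN ler_pdivrMl ?expR_gt0// mulr1.
  apply: le_trans (expR_ge1Dx _); rewrite /a lerD2l.
  apply: (@le_trans _ _ (2 * kap * sg)); first by rewrite ler_pM2l ?mulr_gt0.
  rewrite ler_pM2r//; apply: le_trans hm.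
  have : 0 <= C + 2 * kap * C * T1 + 4 * C * T1 / r0.
    by rewrite ltW // !addr_gt0// ?divr_gt0// !mulr_gt0.
  lra.
(* The term quadratic in the gradient is at most what [- b] in [hL] contributes, because
   [D * a <= 1] and [g <= 1]. After this [b] has disappeared, whence the uniformity in [b]. *)
have h1 : b / sg ^+ 2 * (D * a) ^+ 2 * g <= D * a * (b / sg ^+ 2).
  have bs : 0 < b / sg ^+ 2 by rewrite divr_gt0// exprn_gt0.
  have Da0 : 0 < D * a by exact: mulr_gt0.
  have : (D * a) ^+ 2 * g <= D * a.
    by apply: le_trans (ler_piMr (sqr_ge0 _) g1) _; rewrite expr2 ler_piMl// ltW.
  move: bs; move: (b / sg ^+ 2) (D * a) => X Y X0 hY; nlinarith.
have h2 : D * a * L <= D * a * ((phi - b) / sg ^+ 2 + C) by rewrite ler_pM2l// mulr_gt0.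
suff : - (m / (2 * sg)) * (phi + kap * phi ^+ 2) - (phi + kap * phi ^+ 2) / sg ^+ 2
    + a * (phi / sg ^+ 2 + C) - 2 * kap * g <= 0.
  move=> h3; have := ler_wpM2l (ltW D0) h3; rewrite mulr0.
  move: h1 h2; rewrite mulrBl; set X := b / _; set Y := phi / _.
  have -> : D * (phi + kap * phi ^+ 2) / sg ^+ 2 = D * ((phi + kap * phi ^+ 2) / sg ^+ 2) by rewrite mulrA.
  set Z := (_ / sg ^+ 2); set W := m / _; nlinarith.
set u := phi / sg; have u0 : 0 < u by rewrite divr_gt0.
have u1 : u <= 1 by rewrite ler_pdivrMr// mul1r.
have hphi : phi = u * sg by rewrite /u divfK// gt_eqF.
have e1 : (phi + kap * phi ^+ 2) / sg ^+ 2 = u / sg + kap * u ^+ 2.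
  by rewrite hphi; field; rewrite gt_eqF.
have e2 : phi / sg ^+ 2 = u / sg by rewrite hphi; field; rewrite gt_eqF.
have e3 : m / (2 * sg) * (phi + kap * phi ^+ 2) = m / 2 * (u + kap * u * phi).
  by rewrite hphi; field; rewrite gt_eqF.
have e4 : 2 * kap * phi * (u / sg) = 2 * kap * u ^+ 2 by rewrite hphi; field; rewrite gt_eqF.
rewrite mulNr e1 e2 e3 /a.
have -> : (1 + 2 * kap * phi) * (u / sg + C) = u / sg + C + 2 * kap * phi * (u / sg) + 2 * kap * C * phi by ring.
rewrite e4.
have h5 : (kap + C + 2 * kap * C * T1 + 4 * C * T1 / r0) * u <= m / 2 * u.
  rewrite ler_pM2r//; linarith.
have h6 : 0 <= m / 2 * (kap * u * phi).
  have : 0 <= C + 2 * kap * C * T1 + 4 * C * T1 / r0.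
    by rewrite ltW // !addr_gt0// ?divr_gt0// !mulr_gt0.
  move=> h; have m0 : 0 <= m by linarith.
  have kup : 0 < kap * u * phi by apply: mulr_gt0 => //; exact: mulr_gt0.
  by rewrite mulr_ge0 ?divr_ge0 ?(ltW kup).
have h7 : kap * u ^+ 2 <= kap * u by rewrite ler_pM2l// expr2 ler_piMl// ltW.
have h8 : 2 * kap * C * phi <= 2 * kap * C * T1 * u.
  have : kap * C * u * sg <= kap * C * u * T1.
    by rewrite ler_pM2l//; apply: mulr_gt0 => //; exact: mulr_gt0.
  rewrite hphi; linarith.
(* The Laplacian constant [C] is paid by the convexity term [2 * kap * g] near the sphere, where the
   gradient is not small, and by the decay rate [m] further inside. *)
have h9 : C <= 2 * kap * g + 4 * C * T1 / r0 * u.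
  have [pr|pr] := leP phi (r0 / 4).
    have hg' := hg pr.
    have : 0 <= 4 * C * T1 / r0 * u by apply: mulr_ge0; [rewrite divr_ge0 ?mulr_ge0 ?(ltW C0) ?(ltW T0) ?(ltW r00)|exact: ltW].
    nlinarith.
  have : C <= 4 * C * T1 / r0 * u.
    have -> : 4 * C * T1 / r0 * u = C * (4 * T1 * u / r0) by ring.
    rewrite ler_peMr ?(ltW C0)// ler_pdivlMr// mul1r.
    have : phi <= T1 * u by rewrite hphi mulrC ler_pM2r.
    linarith.
  have : 0 <= 2 * kap * g by rewrite mulr_ge0// mulr_ge0// ltW.
  linarith.
have h10 : 0 <= C * u by apply: mulr_ge0; exact: ltW.
linarith.
Qed.

(** The linear piece has no convexity term. Beyond the diffusive scale the decay of [exp (- m sg)]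
    contributes at least [m * phi / (2 * sg) >= m / 2], which pays for the Laplacian and for the
    growth of the slope in time. *)
Lemma profile_ineq_lin (C kap m sg T1 phi g b L : R) :
  0 < C -> C <= kap -> 0 < sg -> sg <= T1 ->
  2 * (kap + C + 2 * kap * C * T1) <= m ->
  sg <= phi -> 0 <= g -> g <= 1 ->
  L <= (phi - b) / sg ^+ 2 + C -> 0 < b ->
  forall D th, D = expR (- (m * sg)) -> th = (1 + 2 * kap * sg) * phi - kap * sg ^+ 2 ->
  - (m / (2 * sg)) * (D * th) + D * (kap * phi / sg - kap) - D * th / sg ^+ 2
    + D * (1 + 2 * kap * sg) * L
    + b / sg ^+ 2 * (D * (1 + 2 * kap * sg)) ^+ 2 * g <= 0.
Proof.
move=> C0 Ck s0 sT hm ps g0 g1 hL b0 D th DE thE.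
have k0 : 0 < kap by exact: lt_le_trans Ck.
have D0 : 0 < D by rewrite DE expR_gt0.
have p0 : 0 < phi by exact: lt_le_trans ps.
set a := 1 + 2 * kap * sg; have a0 : 0 < a by rewrite /a addr_gt0// !mulr_gt0.
have T0 : 0 < T1 by exact: lt_le_trans sT.
have mk : 2 * kap <= m.
  apply: le_trans hm; have : 0 <= C + 2 * kap * C * T1 by rewrite ltW // !addr_gt0// !mulr_gt0.
  lra.
have Da : D * a <= 1.
  rewrite DE expRN ler_pdivrMl ?expR_gt0// mulr1.
  by apply: le_trans (expR_ge1Dx _); rewrite /a lerD2l ler_pM2r.
have h1 : b / sg ^+ 2 * (D * a) ^+ 2 * g <= D * a * (b / sg ^+ 2).
  have bs : 0 < b / sg ^+ 2 by rewrite divr_gt0// exprn_gt0.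
  have Da0 : 0 < D * a by exact: mulr_gt0.
  have : (D * a) ^+ 2 * g <= D * a.
    by apply: le_trans (ler_piMr (sqr_ge0 _) g1) _; rewrite expr2 ler_piMl// ltW.
  move: bs; move: (b / sg ^+ 2) (D * a) => X Y X0 hY; nra.
have h2 : D * a * L <= D * a * ((phi - b) / sg ^+ 2 + C) by rewrite ler_pM2l// mulr_gt0.
suff : - (m / (2 * sg)) * th + (kap * phi / sg - kap) - th / sg ^+ 2
    + a * (phi / sg ^+ 2 + C) <= 0.
  move=> h3; have := ler_wpM2l (ltW D0) h3; rewrite mulr0.
  move: h1 h2; rewrite mulrBl; set X := b / _; set Y := phi / _.
  have -> : D * th / sg ^+ 2 = D * (th / sg ^+ 2) by rewrite mulrA.
  set Z := (th / sg ^+ 2); set W := m / _; set V := kap * phi / sg; nlinarith.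
set u := phi / sg; have u1 : 1 <= u by rewrite ler_pdivlMr// mul1r.
have hphi : phi = u * sg by rewrite /u divfK// gt_eqF.
have e1 : th / sg ^+ 2 = a * (phi / sg ^+ 2) - kap.
  by rewrite thE -/a; field; rewrite gt_eqF.
have e2 : m / (2 * sg) * th = m / 2 * (u + kap * sg * (2 * u - 1)).
  by rewrite thE hphi; field; rewrite gt_eqF.
have e3 : kap * phi / sg = kap * u by rewrite hphi; field; rewrite gt_eqF.
rewrite mulNr e1 e2 e3.
have h5 : (kap + C + 2 * kap * C * T1) * u <= m / 2 * u.
  rewrite ler_pM2r ?(lt_le_trans _ u1)//; lra.
have h6 : 0 <= m / 2 * (kap * sg * (2 * u - 1)).
  by rewrite !mulr_ge0 ?ltW//; linarith.
have h7 : a * C <= (C + 2 * kap * C * T1) * u.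
  have : a * C <= C + 2 * kap * C * T1.
    have : kap * C * sg <= kap * C * T1 by rewrite ler_pM2l// mulr_gt0.
    rewrite /a; linarith.
  have : 0 < C + 2 * kap * C * T1 by rewrite addr_gt0// !mulr_gt0.
  nlinarith.
linarith.
Qed.

End Profile.

(** * Paraboloids over balls *)

Section Paraboloid.
Variables (R : realType) (n : nat).
Implicit Types (x y c : 'rV[R]_n) (r t s b : R).

(* Over balls [eball c r] inside a convex set these are jointly concave in
   [(x, c, r)], so their supremum is a concave substitute for the distance to
   the boundary that is touched from below by paraboloids. *)
Definition paraboloid x c r : R := r / 2 - dotv (x - c) (x - c) / (2 * r).

Lemma paraboloid_le x c r : 0 < r -> enorm (x - c) < r -> paraboloid x c r <= r - enorm (x - c).
Proof.
move=> r0; rewrite /paraboloid -enormE; have := enorm_ge0 (x - c).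
move: (enorm _) => d d0 dr; rewrite -subr_ge0.
have -> : r - d - (r / 2 - d ^+ 2 / (2 * r)) = (r - d) ^+ 2 / (2 * r) by field; rewrite gt_eqF.
by rewrite divr_ge0 ?sqr_ge0// mulr_ge0// ltW.
Qed.

Lemma paraboloid_gt0 x c r : 0 < r -> (0 < paraboloid x c r) = (enorm (x - c) < r).
Proof.
move=> r0; rewrite /paraboloid enorm_sqr_lt ?(ltW r0)// -(pmulr_lgt0 _ (mulr_gt0 (ltr0n R 2) r0)).
have -> : (r / 2 - dotv (x - c) (x - c) / (2 * r)) * (2 * r) = r ^+ 2 - dotv (x - c) (x - c).
  by field; rewrite gt_eqF.
by rewrite subr_gt0.
Qed.

Lemma paraboloid_jet x c r :
  r != 0 -> jet (fun z => paraboloid z c r) x (- r^-1 *: (x - c)) (- (n%:R / r)).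
Proof.
move=> r0; have h := jetB (jet_cst (r / 2) x) (jetZ (2 * r)^-1 (jet_sqdist c x)).
apply: (jet_eq (jet_ext _ h)) => [z||].
- by rewrite /paraboloid [_^-1 * _]mulrC.
- by rewrite sub0r scalerA -scaleNr; congr (_ *: _); field.
- by field.
Qed.

Lemma cvg_paraboloid (T : Type) (F : set_system T) (FF : Filter F) (f g : T -> 'rV[R]_n) (h : T -> R)
    x c r : r != 0 -> f @ F --> x -> g @ F --> c -> h @ F --> r ->
  paraboloid (f q) (g q) (h q) @[q --> F] --> paraboloid x c r.
Proof.
move=> r0 cf cg ch; rewrite /paraboloid; apply: cvgB.
  by apply: cvgM => //; exact: cvg_cst.
have cd : dotv (f q - g q) (f q - g q) @[q --> F] --> dotv (x - c) (x - c).
  by apply: (cvg_dotv FF); apply: cvgB.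
apply: cvgM => //; apply: cvgV; first by rewrite mulf_neq0.
by apply: cvgM => //; exact: cvg_cst.
Qed.

(* First-order optimality of [(c, r)] for a fixed [x], combined with joint
   concavity, compares the directional derivative at [x] with the value at [y]. *)
Lemma paraboloid_support x y c c' r r' : 0 < r -> 0 < r' ->
  (forall s, 0 < s -> s <= 1 ->
     paraboloid x (c + s *: (c' - c)) (r + s * (r' - r)) <= paraboloid x c r) ->
  dotv (x - y) (- r^-1 *: (x - c)) <= paraboloid x c r - paraboloid y c' r'.
Proof.
move=> r0 r'0 hopt.
set X := dotv (x - c) (x - c); set E := dotv (x - c) (c' - c); set F := dotv (c' - c) (c' - c).
set f := r' - r.
have h1 s : 0 < s -> s <= 1 ->
    (r * f + 2 * E + f * X / r) + s * (f ^+ 2 - F) <= 0.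
  move=> s0 s1; have rs : 0 < r + s * f by rewrite /f; nra.
  have := hopt s s0 s1; rewrite -/f /paraboloid.
  have -> : x - (c + s *: (c' - c)) = (x - c) - s *: (c' - c) by rewrite opprD addrA.
  have -> : dotv ((x - c) - s *: (c' - c)) ((x - c) - s *: (c' - c)) = X - 2 * s * E + s ^+ 2 * F.
    by rewrite (dotvBl (x - c)) !(dotvBr _ (x - c)) !dotvZl !dotvZr (dotvC (c' - c) (x - c)) -/X -/E -/F; ring.
  rewrite -(ler_pM2r (mulr_gt0 (ltr0n R 2) rs)) mulrBl.
  have -> : (r + s * f) / 2 * (2 * (r + s * f)) = (r + s * f) ^+ 2 by field.
  rewrite divfK ?gt_eqF ?mulr_gt0// => h2.
  have h3 : s * ((r * f + 2 * E + f * X / r) + s * (f ^+ 2 - F)) <= 0.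
    move: h2; rewrite -subr_le0; apply: le_trans; rewrite le_eqVlt; apply/orP; left; apply/eqP.
    by rewrite -/X; field; rewrite gt_eqF.
  by rewrite -(pmulr_rle0 _ s0).
(* The first-order optimality condition at [s = 0], extracted from a suitable finite [s] instead of
   a limit. *)
have h2 : r * f + 2 * E + f * X / r <= 0.
  rewrite leNgt; apply/negP => pos; set G := r * f + _ + _ in pos h1 *.
  have [FF|FF] := leP 0 (f ^+ 2 - F); first by have := h1 1 ltr01 (lexx _); lra.
  have [GF|GF] := leP G (- (f ^+ 2 - F)).
    have s0 : 0 < G / (2 * - (f ^+ 2 - F)) by rewrite divr_gt0// mulr_gt0// oppr_gt0.
    have := h1 _ s0; rewrite ler_pdivrMr ?mulr_gt0 ?oppr_gt0// mul1r.
    have -> : G / (2 * - (f ^+ 2 - F)) * (f ^+ 2 - F) = - (G / 2) by field; rewrite lt_eqF.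
    move=> h; have : G + - (G / 2) <= 0 by apply: h; lra.
    lra.
  have := h1 1 ltr01 (lexx _); lra.
(* Nonnegativity of this square expresses the convexity of [|z|^2 / r] jointly in [(z, r)]. *)
have h3 := dotvv_ge0 (r *: (y - c') - r' *: (x - c)).
have h4 : dotv (x - y) (- r^-1 *: (x - c)) = - r^-1 * (X - dotv (y - c') (x - c) - E).
  rewrite dotvZr; congr (_ * _).
  have -> : x - y = (x - c) - (y - c') - (c' - c) by apply/rowP => i; rewrite !mxE; ring.
  by rewrite !(dotvBl _ (c' - c)) (dotvBl (x - c)) -/X [dotv (c' - c) _]dotvC.
rewrite h4 /paraboloid -/X.
move: h3; rewrite (dotvBl (r *: _)) !(dotvBr _ (r *: _)) !dotvZl !dotvZr -/X (dotvC (x - c) (y - c')).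
set P := dotv (y - c') (x - c); set Y := dotv (y - c') (y - c').
move=> h5; rewrite -subr_ge0.
have -> : r / 2 - X / (2 * r) - (r' / 2 - Y / (2 * r')) - - r^-1 * (X - P - E) =
   (r * (r * Y - r' * P) - r' * (r * P - r' * X)) / (2 * r' * r ^+ 2)
   - (r * f + 2 * E + f * X / r) / (2 * r).
  by rewrite /f; field; rewrite !gt_eqF.
rewrite addr_ge0 ?oppr_ge0//; last by rewrite mulr_le0_ge0// invr_ge0 mulr_ge0// ltW.
apply: divr_ge0; last by rewrite ltW// !mulr_gt0// exprn_gt0.
lra.
Qed.

(** Both pieces of [profile] are quadratic in the paraboloid with coefficients depending on time, so
    one computation covers them. Here [- r^-1 (x - c)] is the gradient of the paraboloid, [- n / r]
    its Laplacian and [g] its squared gradient. *)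
Lemma paraboloid_subsolution (a0 a1 a2 : R -> R) (a0' a1' a2' : R) t x y c r b :
  0 < t -> 0 < r -> 0 < b ->
  is_derive t 1 a0 a0' -> is_derive t 1 a1 a1' -> is_derive t 1 a2 a2' ->
  let phi := paraboloid x c r in
  let th := a0 t + a1 t * phi + a2 t * phi ^+ 2 in
  let d1 := a1 t + 2 * a2 t * phi in
  let g := dotv (x - c) (x - c) / r ^+ 2 in
  (a0' + a1' * phi + a2' * phi ^+ 2) - th / t
   + d1 * (dotv (x - y) (- r^-1 *: (x - c)) / t + n%:R / r)
   - 2 * a2 t * g + b / t * d1 ^+ 2 * g <= 0 ->
  exists dt G L, [/\
    is_derive t 1 (fun s => heat_kernel s x y *
       (1 - expR (- (b / s) * (a0 s + a1 s * paraboloid x c r + a2 s * paraboloid x c r ^+ 2)))) dt,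
    jet (fun z => heat_kernel t z y *
       (1 - expR (- (b / t) * (a0 t + a1 t * paraboloid z c r + a2 t * paraboloid z c r ^+ 2)))) x G L &
    dt - L <= 0].
Proof.
move=> t0 r0 b0 da0 da1 da2 phi th d1 g hE; have tn : t != 0 by rewrite gt_eqF.
pose w := fun s z => 1 - expR (- (b / s) * (a0 s + a1 s * paraboloid z c r + a2 s * paraboloid z c r ^+ 2)).
have dth := is_derive_add (is_derive_add da0 (is_derive_mul da1 (is_derive_const phi t)))
   (is_derive_mul da2 (is_derive_const (phi ^+ 2) t)).
have db := is_derive_opp (is_derive_scal b (is_derive_inv tn (is_derive_var t))).
have dw := is_derive_add (is_derive_const 1 t) (is_derive_opp (is_derive_exp (is_derive_mul db dth))).
have jp := paraboloid_jet x c (lt0r_neq0 r0).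
have jth := jetD (jetD (jet_cst (a0 t) x) (jetZ (a1 t) jp)) (jetZ (a2 t) (jetM jp jp)).
have jw := jetB (jet_cst 1 x) (jet_comp (is_derive_expR_near _) (is_derive_expR _) (jetZ (- (b / t)) jth)).
pose E := expR (- (b / t) * th).
have {}jw : jet (w t) x ((E * (b / t) * d1) *: (- r^-1 *: (x - c)))
    (E * (b / t) * (2 * a2 t * g - d1 * (n%:R / r)) - E * (b / t) ^+ 2 * d1 ^+ 2 * g).
  have e1 : 0 + a1 t *: (- r^-1 *: (x - c)) +
       a2 t *: (phi *: (- r^-1 *: (x - c)) + phi *: (- r^-1 *: (x - c))) = d1 *: (- r^-1 *: (x - c)).
    by rewrite add0r -scalerDl !scalerA -scalerDl; congr (_ *: _); rewrite /d1; ring.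
  apply: (jet_eq jw); rewrite -/phi e1 -/th -/E.
  - by rewrite sub0r !scalerA -scaleNr; congr (_ *: _); ring.
  - by rewrite !dotvZl !dotvZr /g /d1; field; rewrite tn gt_eqF.
have dw' : is_derive t 1 (fun s => w s x) _ := dw.
have [dt [G [L [h1 h2 h3]]]] := heat_kernel_mul y t0 dw' jw.
exists dt, G, L; split=> //; rewrite h3 pmulr_rle0 ?heat_kernel_gt0//.
have E0 : 0 < E by exact: expR_gt0.
have := ler_wpM2l (ltW (mulr_gt0 E0 (divr_gt0 b0 t0))) hE; rewrite mulr0; apply: le_trans.
rewrite -/th -/E dotvZr le_eqVlt; apply/orP; left; apply/eqP.
by field; rewrite tn gt_eqF.
Qed.

End Paraboloid.

(** * Comparison from below with an optimal ball *)

Section LowerComparison.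
Variables (R : realType) (n : nat).
Implicit Types (x y z c : 'rV[R]_n) (s t b eta : R).

Definition sub_kernel (m kap b t : R) x y c (r : R) : R :=
  heat_kernel t x y * (1 - expR (- (b / t) * profile m kap t (paraboloid x c r))).

Lemma sub_kernel_le (m kap b t : R) x y c r : 0 < t -> 0 <= b -> 0 <= kap -> 2 * kap <= m ->
  0 <= paraboloid x c r ->
  sub_kernel m kap b t x y c r <= heat_kernel t x y * (b / t * paraboloid x c r).
Proof.
move=> t0 b0 k0 mk p0; rewrite /sub_kernel ler_pM2l ?heat_kernel_gt0//.
have h := expR_ge1Dx (- (b / t) * profile m kap t (paraboloid x c r)).
apply: (@le_trans _ _ (b / t * profile m kap t (paraboloid x c r))); first by lra.
by rewrite ler_wpM2l ?divr_ge0 ?(ltW t0)//; exact: profile_le.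
Qed.

Lemma sub_kernel_le_heat (m kap b t : R) x y c r : 0 < t ->
  sub_kernel m kap b t x y c r <= heat_kernel t x y.
Proof.
by move=> t0; rewrite /sub_kernel ler_piMr ?(ltW (heat_kernel_gt0 _ _ t0))// gerBl expR_ge0.
Qed.

Variables (adm : 'rV[R]_n -> R -> Prop) (r0 Rm : R).
Hypotheses (n0 : (0 < n)%N) (r00 : 0 < r0)
  (adm_bd : forall c r, adm c r -> r0 <= r /\ r <= Rm)
  (adm_cvx : forall c c' r r' s, adm c r -> adm c' r' -> 0 <= s -> s <= 1 ->
     adm (c + s *: (c' - c)) (r + s * (r' - r)))
  (adm_closed : closed [set q : 'rV[R]_n * R | adm q.1 q.2]).

(** The rate required by [profile_ineq_quad] for [C = kap = n / r0], where [n / r0] bounds the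
    absolute value of the Laplacian of every admissible paraboloid. *)
Definition profile_rate (T1 : R) : R :=
  2 * (n%:R / r0 + n%:R / r0 + 2 * (n%:R / r0) * (n%:R / r0) * T1 + 4 * (n%:R / r0) * T1 / r0).

Lemma profile_rate_ge T1 : 0 <= T1 -> 2 * (n%:R / r0) <= profile_rate T1.
Proof.
move=> T0; rewrite /profile_rate.
have C0 : 0 <= n%:R / r0 by rewrite divr_ge0// ltW.
have h1 : 0 <= 2 * (n%:R / r0) * (n%:R / r0) * T1 by apply: mulr_ge0 => //; apply: mulr_ge0 => //; exact: mulr_ge0.
have h2 : 0 <= 4 * (n%:R / r0) * T1 / r0.
  by apply: divr_ge0; [apply: mulr_ge0 => //; exact: mulr_ge0|exact: ltW].
lra.
Qed.

(* At a maximum point the profile may be replaced by one of its two smooth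
   pieces, which touches it from below there. *)
Lemma sub_kernel_touch (T1 t b : R) x y c r : 0 < t -> Num.sqrt t <= T1 -> 0 < b ->
  r0 <= r -> enorm (x - c) < r ->
  dotv (x - y) (- r^-1 *: (x - c)) <= paraboloid x c r - b ->
  exists (q : R -> 'rV[R]_n -> R) dt G L e, [/\ 0 < e,
    forall s z, t - e < s -> s <= t -> enorm (z - x) < e ->
      q s z <= sub_kernel (profile_rate T1) (n%:R / r0) b s z y c r,
    q t x = sub_kernel (profile_rate T1) (n%:R / r0) b t x y c r,
    is_derive t 1 (fun s => q s x) dt /\ jet (q t) x G L & dt - L <= 0].
Proof.
move=> t0 tT b0 r0r xc hop.
have rp : 0 < r by exact: lt_le_trans r0r.
set phi := paraboloid x c r; have p0 : 0 < phi by rewrite paraboloid_gt0.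
set C := n%:R / r0; have C0 : 0 < C by rewrite divr_gt0// ltr0n.
set m := profile_rate T1; set sg := Num.sqrt t.
have sg0 : 0 < sg by rewrite sqrtr_gt0.
have sgt : sg ^+ 2 = t by rewrite sqr_sqrtr// ltW.
have T0 : 0 < T1 by exact: lt_le_trans tT.
set g := dotv (x - c) (x - c) / r ^+ 2.
have g0 : 0 <= g by rewrite divr_ge0 ?dotvv_ge0 ?sqr_ge0.
have gE : g = 1 - 2 * phi / r by rewrite /g /phi /paraboloid; field; rewrite gt_eqF.
have g1 : g <= 1 by rewrite gE gerBl divr_ge0 ?mulr_ge0// ltW.
have hg : phi <= r0 / 4 -> 1 / 2 <= g.
  move=> hp; rewrite gE; have : 2 * phi / r <= 1 / 2 by rewrite ler_pdivrMr//; lra.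
  lra.
have hL : dotv (x - y) (- r^-1 *: (x - c)) / t + n%:R / r <= (phi - b) / sg ^+ 2 + C.
  rewrite sgt; apply: lerD; first by rewrite ler_pM2r ?invr_gt0.
  by rewrite /C ler_wpM2l// lef_pV2 ?posrE.
have dD : is_derive t 1 (fun s => expR (- (m * Num.sqrt s))) (expR (- (m * sg)) * - (m * (2 * sg)^-1)).
  exact: (is_derive_exp (is_derive_opp (is_derive_scal m (is_derive1_sqrt t0)))).
set D := expR (- (m * sg)) in dD.
have pos s z : 0 < s -> 0 < heat_kernel s z y by move=> s0; exact: heat_kernel_gt0.
have mono s z u v : 0 < s -> u <= v -> heat_kernel s z y * (1 - expR (- (b / s) * u)) <=
    heat_kernel s z y * (1 - expR (- (b / s) * v)).
  move=> s0 uv; rewrite ler_pM2l ?pos// lerD2l lerN2 ler_expR !mulNr lerN2.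
  by rewrite ler_pM2l// divr_gt0.
have [ps|ps] := ltP phi sg.
- have dk := is_derive_scal C dD.
  have hE := @profile_ineq_quad R C C m sg T1 r0 phi g b _ C0 (lexx _) sg0 tT r00 (lexx _) p0 (ltW ps) g0 g1 hg hL b0 D erefl.
  have [|dt [G [L [h1 h2 h3]]]] := @paraboloid_subsolution R n (fun=> 0) (fun s => expR (- (m * Num.sqrt s)))
     (fun s => C * expR (- (m * Num.sqrt s))) _ _ _ t x y c r b t0 rp b0 (is_derive_const 0 t) dD dk.
    rewrite -/phi -/g -/D -/sg; apply: le_trans hE; rewrite sgt le_eqVlt; apply/orP; left; apply/eqP.
    by field; rewrite !gt_eqF.
  have : \forall q \near ((t, x) : R * 'rV[R]_n), paraboloid q.2 c r < Num.sqrt q.1.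
    have c1 : paraboloid q.2 c r @[q --> ((t, x) : R * 'rV[R]_n)] --> phi.
      by apply: cvg_paraboloid; [rewrite gt_eqF|exact: cvg_snd|exact: cvg_cst|exact: cvg_cst].
    have c2 : Num.sqrt q.1 @[q --> ((t, x) : R * 'rV[R]_n)] --> sg.
      exact: (cvg_comp _ _ (@cvg_fst _ _ (nbhs t) (nbhs x) _) (@sqrt_continuous R t)).
    have h : Num.sqrt q.1 - paraboloid q.2 c r @[q --> ((t, x) : R * 'rV[R]_n)] --> sg - phi by apply: cvgB.
    have sp : 0 < sg - phi by rewrite subr_gt0.
    have /cvgrPdist_lt /(_ _ sp) := h; apply: filterS => q /=; rewrite ltr_norml => /andP[_]; linarith.
  move=> [[A B] /= [/nbhs_ballP[e1 /= e10 hA] /nbhs_eball[e2 e20 hB]] hAB].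
  have e3 : 0 < Num.min e1 (Num.min e2 t) by rewrite !lt_min e10 e20 t0.
  exists (fun s z => heat_kernel s z y * (1 - expR (- (b / s) * (0 + expR (- (m * Num.sqrt s)) * paraboloid z c r
     + C * expR (- (m * Num.sqrt s)) * paraboloid z c r ^+ 2)))), dt, G, L, (Num.min e1 (Num.min e2 t)); split=> //.
    move=> s z hs st hz.
    have st0 : 0 < s.
      have : Num.min e1 (Num.min e2 t) <= t by rewrite !ge_min lexx !orbT.
      linarith.
    have se1 : `|t - s| < e1.
      have : Num.min e1 (Num.min e2 t) <= e1 by rewrite ge_min lexx.
      by move=> h; rewrite ger0_norm ?subr_ge0//; linarith.
    have ze2 : enorm (z - x) < e2 by apply: (lt_le_trans hz); rewrite !ge_min lexx !orbT.
    have hlt : paraboloid z c r < Num.sqrt s by apply: (hAB (s, z)); split; [exact: hA|exact: hB].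
    apply: mono => //; rewrite /profile (min_idPl (ltW hlt)) -/m -/C le_eqVlt.
    by apply/orP; left; apply/eqP; ring.
  rewrite /sub_kernel /profile -/phi -/sg (min_idPl (ltW ps)) -/m -/C -/D.
  by congr (_ * (1 - expR (_ * _))); ring.
(* For [sg <= phi], equality included, the linear piece is used: it is the tangent line at [sg] of
   the convex profile, hence below it everywhere. *)
- have dS : is_derive t 1 Num.sqrt (2 * sg)^-1 by exact: is_derive1_sqrt.
  have d1 := is_derive_mul dD (is_derive_add (is_derive_const 1 t) (is_derive_scal (2 * C) dS)).
  have d0 := is_derive_opp (is_derive_scal C (is_derive_mul dD (is_derive_var t))).
  have hm : 2 * (C + C + 2 * C * C * T1) <= m.
    rewrite /m /profile_rate -/C; have : 0 <= 4 * C * T1 / r0.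
      by apply: divr_ge0; [apply: mulr_ge0; [apply: mulr_ge0 => //|]; exact: ltW|exact: ltW].
    linarith.
  have hE := @profile_ineq_lin R C C m sg T1 phi g b _ C0 (lexx _) sg0 tT hm ps g0 g1 hL b0 D _ erefl erefl.
  have [|dt [G [L [h1 h2 h3]]]] := @paraboloid_subsolution R n _ _ (fun=> 0) _ _ _ t x y c r b t0 rp b0 d0 d1 (is_derive_const 0 t).
    rewrite -/phi -/g -/D -/sg; apply: le_trans hE; rewrite le_eqVlt; apply/orP; left; apply/eqP.
    by rewrite -sgt; field; rewrite !gt_eqF.
  exists (fun s z => heat_kernel s z y * (1 - expR (- (b / s) * (- (C * (expR (- (m * Num.sqrt s)) * s)) +
     expR (- (m * Num.sqrt s)) * (1 + 2 * C * Num.sqrt s) * paraboloid z c r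
     + 0 * paraboloid z c r ^+ 2)))), dt, G, L, t; split=> //.
    move=> s z; rewrite subrr => s0 st hz; apply: mono => //.
    rewrite /profile -/m -/C; move: (paraboloid z c r) => f.
    move: (expR_gt0 (- (m * Num.sqrt s))); move: (expR _) => u u0.
    have := sqr_sqrtr (ltW s0); have := sqrtr_ge0 s; move: (Num.sqrt s) => v v0 <-.
    have -> : - (C * (u * v ^+ 2)) + u * (1 + 2 * C * v) * f + 0 * f ^+ 2 = u * (f + C * (2 * v * f - v ^+ 2)) by ring.
    rewrite ler_pM2l// lerD2l ler_pM2l//.
    by case: (leP f v) => h; nlinarith.
  rewrite /sub_kernel /profile -/phi -/sg (min_idPr ps) -/m -/C -/D.
  have -> : - (C * (D * t)) = - (C * (D * sg ^+ 2)) by rewrite sgt.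
  by congr (_ * (1 - expR (_ * _))); ring.
Qed.

(** The maximum of [Q - K] is taken over time, point and admissible ball at once. At a maximum the
    ball is optimal for its point, so [paraboloid_support], with the ball [(c', r')] at the pole,
    controls the drift term; freezing the optimal ball leaves an explicit function to differentiate.
    Only points inside admissible balls occur, so [K] is controlled there alone. *)
Theorem lower_comparison (K : R -> 'rV[R]_n -> R) (T1 t1 t2 eta b : R) y c' r' :
  0 < t1 -> t1 <= t2 -> Num.sqrt t2 <= T1 -> 0 <= eta -> 0 < b ->
  adm c' r' -> b <= paraboloid y c' r' ->
  let reach x := exists c r, adm c r /\ enorm (x - c) < r in
  let Q t x c r := sub_kernel (profile_rate T1) (n%:R / r0) b t x y c r in
  (forall s x, t1 <= s -> s <= t2 -> reach x -> 0 <= K s x) ->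
  (forall s x, t1 <= s -> s <= t2 -> reach x -> K q.1 q.2 @[q --> (s, x)] --> K s x) ->
  (forall s x, t1 < s -> s <= t2 -> reach x ->
     exists G L, is_derive s 1 (fun r => K r x) L /\ jet (K s) x G L) ->
  (forall x c r, adm c r -> enorm (x - c) < r -> Q t1 x c r - eta <= K t1 x) ->
  forall x c r, adm c r -> enorm (x - c) < r -> Q t2 x c r - eta <= K t2 x.
Proof.
move=> t10 t12 tT eta0 b0 ac' bc' reach Q K0 Kc Ke Kinit x c r acr xcr.
rewrite leNgt; apply/negP => hlt.
have t20 := lt_le_trans t10 t12.
have C0 : 0 < n%:R / r0 by rewrite divr_gt0// ltr0n.
have T0 : 0 <= T1 by apply: le_trans tT; exact: sqrtr_ge0.
have mk := profile_rate_ge T0.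
have Qle s z u v : 0 < s -> adm u v -> 0 <= paraboloid z u v ->
    Q s z u v <= heat_kernel s z y * (b / s * paraboloid z u v).
  by move=> s0 auv hp; apply: sub_kernel_le => //; exact: ltW.
set mu := (Q t2 x c r - eta - K t2 x) / 3.
have mu0 : 0 < mu by rewrite divr_gt0// subr_gt0.
have [L L0 hL] := heat_kernel_decay y t10 t12 mu0.
set e := mu / (t2 - t1 + 1).
have ts : 0 < t2 - t1 + 1 by lra.
have e0 : 0 < e by rewrite divr_gt0.
have emu : e * (t2 - t1) <= mu.
  rewrite /e mulrAC ler_pdivrMr// ler_wpM2l ?(ltW mu0)//; lra.
set P := heat_kernel t1 y y; have P0 : 0 < P by exact: heat_kernel_gt0.
(* Where the paraboloid is at most [sig], [Q] is at most [mu]: the constraint [sig <= paraboloid]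
   loses no maximum and keeps the constraint set away from the spheres. *)
set sig := mu * t1 / (P * b).
have sig0 : 0 < sig by apply: divr_gt0; exact: mulr_gt0.
have Qsmall s z u v : t1 <= s -> s <= t2 -> adm u v -> enorm (z - u) < v ->
    (L <= enorm (z - y)) || (paraboloid z u v <= sig) -> Q s z u v <= mu.
  move=> h1 h2 auv zuv; have s0 := lt_le_trans t10 h1.
  have [v1 _] := adm_bd auv; have v0 : 0 < v by exact: lt_le_trans v1.
  move=> /orP[hz|hp].
    by apply: le_trans (sub_kernel_le_heat _ _ _ _ _ _ _ s0) _; exact/ltW/hL.
  have pp : 0 < paraboloid z u v by rewrite paraboloid_gt0.
  apply: (le_trans (Qle s z u v s0 auv (ltW pp))).
  apply: (@le_trans _ _ (P * (b / t1 * sig))); last first.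
    rewrite le_eqVlt; apply/orP; left; apply/eqP.
    by rewrite /sig; field; rewrite !gt_eqF.
  apply: ler_pM; [exact/ltW/heat_kernel_gt0|by apply: mulr_ge0; [rewrite divr_ge0// ltW|exact: ltW]| |].
    exact: le_trans (heat_kernel_le_diag _ _ y s0) (heat_kernel_diag_mono _ t10 h1).
  apply: ler_pM => //; [by rewrite divr_ge0// ltW|exact: ltW|].
  by rewrite ler_pM2l// lef_pV2.
pose D (q : R * ('rV[R]_n * ('rV[R]_n * R))) :=
  Q q.1 q.2.1 q.2.2.1 q.2.2.2 - K q.1 q.2.1 - e * (q.1 - t1).
pose S := (`[t1, t2]%classic `*` ([set z | enorm (z - y) <= L] `*`
   ([set u | enorm (u - y) <= L + Rm] `*` `[r0, Rm]%classic))) `&`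
  ((fun q : R * ('rV[R]_n * ('rV[R]_n * R)) => q.2.2) @^-1` [set q | adm q.1 q.2] `&`
   (fun q : R * ('rV[R]_n * ('rV[R]_n * R)) => q.2.2.2 ^+ 2 - dotv (q.2.1 - q.2.2.1) (q.2.1 - q.2.2.1) - 2 * sig * q.2.2.2)
     @^-1` [set d | 0 <= d]).
have c22 : continuous (fun q : R * ('rV[R]_n * ('rV[R]_n * R)) => q.2.2).
  by move=> q; apply: (@cvg_comp _ _ _ snd snd); exact: cvg_snd.
have c221 : continuous (fun q : R * ('rV[R]_n * ('rV[R]_n * R)) => q.2.2.1).
  by move=> q; apply: (@cvg_comp _ _ _ (fun q => q.2.2) fst _ _ _ (c22 q)); exact: cvg_fst.
have c222 : continuous (fun q : R * ('rV[R]_n * ('rV[R]_n * R)) => q.2.2.2).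
  by move=> q; apply: (@cvg_comp _ _ _ (fun q => q.2.2) snd _ _ _ (c22 q)); exact: cvg_snd.
have c21 : continuous (fun q : R * ('rV[R]_n * ('rV[R]_n * R)) => q.2.1).
  by move=> q; apply: (@cvg_comp _ _ _ snd fst); [exact: cvg_snd|exact: cvg_fst].
have SE s z u v : S (s, (z, (u, v))) <-> [/\ t1 <= s /\ s <= t2, enorm (z - y) <= L, adm u v & sig <= paraboloid z u v].
  have E : adm u v -> (0 <= v ^+ 2 - dotv (z - u) (z - u) - 2 * sig * v) = (sig <= paraboloid z u v).
    move=> auv; have [v1 _] := adm_bd auv; have v0 : 0 < v by exact: lt_le_trans v1.
    rewrite -[RHS](ler_pM2r (mulr_gt0 (ltr0n R 2) v0)).
    have -> : paraboloid z u v * (2 * v) = v ^+ 2 - dotv (z - u) (z - u).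
      by rewrite /paraboloid; field; rewrite gt_eqF.
    by rewrite -[RHS]subr_ge0; congr (0 <= _); ring.
  split.
    move=> [[/= + [h3 _]] [/= h4]]; rewrite in_itv/= => /andP[h1 h2].
    by rewrite E// => h5; split.
  move=> [[h1 h2] h3 auv h4]; have [v1 v2] := adm_bd auv; have v0 : 0 < v by exact: lt_le_trans v1.
  split; last by split=> //=; rewrite E.
  split=> /=; first by rewrite in_itv/= h1.
  split=> //; split; last by rewrite /= in_itv/= v1.
  have zu : enorm (z - u) < v by rewrite -paraboloid_gt0//; exact: lt_le_trans h4.
  rewrite /= enormBC; apply: le_trans (enorm_triangleB z _ _) _; rewrite (enormBC y).
  by apply: lerD => //; apply: (le_trans (ltW zu)).
have cS : compact S.
  rewrite /S; apply: compact_closedI; last first.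
    apply: closedI; first by apply: preimage_closed => [q _|]; [exact: c22|exact: adm_closed].
    apply: preimage_closed => [q _|]; last exact: closed_ge.
    apply: cvgB; first apply: cvgB.
    - by apply: cvgM; exact: c222.
    - by apply: (cvg_dotv (nbhs_filter q)); apply: cvgB; [exact: c21|exact: c221|exact: c21|exact: c221].
    - by apply: cvgM; [exact: cvg_cst|exact: c222].
  apply: compact_setX; first exact: segment_compact.
  apply: compact_setX; first exact: ecompact.
  by apply: compact_setX; [exact: ecompact|exact: segment_compact].
have Qt2 : eta + 3 * mu <= Q t2 x c r.
  have -> : Q t2 x c r = 3 * mu + eta + K t2 x by rewrite /mu; field.
  have : 0 <= K t2 x by apply: K0 => //; exists c, r.
  linarith.
have Sx : S (t2, (x, (c, r))).
  apply/SE; split=> //; rewrite leNgt; apply/negP => hh.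
    by have := Qsmall t2 x c r t12 (lexx _) acr xcr; rewrite (ltW hh) => /(_ isT); linarith.
  by have := Qsmall t2 x c r t12 (lexx _) acr xcr; rewrite (ltW hh) orbT => /(_ isT); linarith.
have reachS s z u v : adm u v -> sig <= paraboloid z u v -> enorm (z - u) < v /\ 0 < v.
  move=> auv h; have [v1 _] := adm_bd auv; have v0 : 0 < v by exact: lt_le_trans v1.
  by rewrite -paraboloid_gt0// (lt_le_trans sig0 h).
have [||q0] := @compact_EVT_max _ _ D S _ cS.
- by exists (t2, (x, (c, r))).
- apply: continuous_in_subspaceT => -[s [z [u v]]]; rewrite inE => /SE[[h1 h2] _ auv hs].
  have [zu v0] := reachS s z u v auv hs; have s0 := lt_le_trans t10 h1.
  apply: cvgB; first apply: cvgB.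
  + apply: cvgM; first by apply: (cvg_heat_kernel _ s0); [exact: cvg_fst|exact: c21].
    apply: cvgB; first exact: cvg_cst.
    have h : - (b / q.1) * profile (profile_rate T1) (n%:R / r0) q.1 (paraboloid q.2.1 q.2.2.1 q.2.2.2)
        @[q --> (s, (z, (u, v)))] --> - (b / s) * profile (profile_rate T1) (n%:R / r0) s (paraboloid z u v).
      apply: cvgM.
        apply: cvgN; apply: cvgM; first exact: cvg_cst.
        by apply: cvgV; [rewrite gt_eqF|exact: cvg_fst].
      apply: cvg_profile; first exact: cvg_fst.
      exact: (cvg_paraboloid (nbhs_filter _) (lt0r_neq0 v0) (c21 (s, (z, (u, v)))) (c221 (s, (z, (u, v)))) (c222 (s, (z, (u, v))))).
    exact: (cvg_comp _ _ h (@continuous_expR R _)).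
  + have hp : (q.1, q.2.1) @[q --> (s, (z, (u, v)))] --> (s, z).
      exact: (cvg_pair (@cvg_fst _ _ (nbhs s) (nbhs (z, (u, v))) _) (c21 (s, (z, (u, v))))).
    have hK : K q.1 q.2 @[q --> (s, z)] --> K s z by apply: Kc => //; exists u, v.
    exact: (cvg_comp _ _ hp hK).
  + apply: cvgM; first exact: cvg_cst.
    by apply: cvgB; [exact: cvg_fst|exact: cvg_cst].
case: q0 => s0 [x0 [u0 v0]]; rewrite inE => S0 hmax.
have [[s01 s02] _ a0 sig0'] := (SE _ _ _ _).1 S0.
have [xu0 v00] := reachS s0 x0 u0 v0 a0 sig0'.
have D0 : eta + 2 * mu <= D (s0, (x0, (u0, v0))).
  apply: le_trans (hmax (t2, (x, (c, r))) _); last by rewrite inE.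
  rewrite /D /=; have -> : Q t2 x c r = 3 * mu + eta + K t2 x by rewrite /mu; field.
  linarith.
(* Outside [S] the function is at most [mu], so the maximum over [S] is one over all admissible
   balls; the competitors used below may leave [S]. *)
have glob s z u v : t1 <= s -> s <= t2 -> adm u v -> enorm (z - u) < v ->
    Q s z u v - K s z - e * (s - t1) <= D (s0, (x0, (u0, v0))).
  move=> h1 h2 auv zuv.
  have [Szuv|nS] := pselect (S (s, (z, (u, v)))); first by apply: (hmax (s, (z, (u, v)))); rewrite inE.
  have hq : Q s z u v <= mu.
    apply: Qsmall => //; apply/orP; have [h3|h3] := leP L (enorm (z - y)); first by left.
    right; rewrite leNgt; apply/negP => h4; apply: nS; apply/SE; split=> //; exact: ltW.
  have k0 : 0 <= K s z by apply: K0 => //; exists u, v.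
  have : 0 <= e * (s - t1) by apply: mulr_ge0; [exact: ltW|rewrite subr_ge0].
  linarith.
have st1 : t1 < s0.
  rewrite lt_neqAle s01 andbT; apply/negP => /eqP es.
  have := Kinit x0 u0 v0 a0 xu0; move: D0; rewrite /D /= -es subrr mulr0; linarith.
have s00 := lt_trans t10 st1.
have hopt s : 0 < s -> s <= 1 ->
    paraboloid x0 (u0 + s *: (c' - u0)) (v0 + s * (r' - v0)) <= paraboloid x0 u0 v0.
  move=> h1 h2; have auv := adm_cvx a0 ac' (ltW h1) h2.
  move: auv; move: (u0 + _) (v0 + _) => u v auv.
  have [v1 _] := adm_bd auv; have vp : 0 < v by exact: lt_le_trans v1.
  have [h3|h3] := leP (paraboloid x0 u v) 0.
    by apply: (le_trans h3); apply: ltW; exact: lt_le_trans sig0'.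
  have zuv : enorm (x0 - u) < v by rewrite -paraboloid_gt0.
  have := glob s0 x0 u v s01 s02 auv zuv; rewrite /D /= !lerD2r /Q /sub_kernel.
  rewrite ler_pM2l ?heat_kernel_gt0// lerD2l lerN2 ler_expR !mulNr lerN2.
  rewrite ler_pM2l ?divr_gt0//; apply: profile_mono; last exact: ltW.
  by apply: ltW; exact: lt_le_trans sig0'.
have [v01 _] := adm_bd a0; have [r'1 _] := adm_bd ac'.
have hsup := paraboloid_support y v00 (lt_le_trans r00 r'1) hopt.
have sT : Num.sqrt s0 <= T1 by apply: le_trans tT; rewrite ler_sqrt// (le_trans _ s02)// ltW.
have [|q [dt [G [L' [d [d0 hq1 hq2 [hq3 hq4] hq5]]]]]] := @sub_kernel_touch T1 s0 b x0 y u0 v0 s00 sT b0 v01 xu0.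
  by apply: (le_trans hsup); linarith.
have reach0 : reach x0 by exists u0, v0.
have [Gk [Lk [hk1 hk2]]] := Ke s0 x0 st1 s02 reach0.
have hd := is_derive_add hq3 (is_derive_opp hk1).
have hj := jetB hq4 hk2.
have m0 : 0 < Num.min d (s0 - t1) by rewrite lt_min d0 subr_gt0.
have : e <= (dt - Lk) - (L' - Lk).
  apply: (parabolic_max (D := fun s z => q s z - K s z) hd hj m0).
    move=> s h1 h2.
    have sd : s0 - d < s by apply: le_lt_trans h1; rewrite lerD2l lerN2 ge_min lexx.
    have s1s : t1 <= s.
      have : Num.min d (s0 - t1) <= s0 - t1 by rewrite ge_min lexx orbT.
      linarith.
    have hx : enorm (x0 - x0) < d by rewrite subrr enorm0.
    have := hq1 s x0 sd (ltW h2) hx.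
    have := glob s x0 u0 v0 s1s (le_trans (ltW h2) s02) a0 xu0.
    rewrite hq2 /D /= -/(Q _ _ _ _) -/(Q _ _ _ _); linarith.
  have n1 : nbhs x0 (eball x0 d) by exact: eball_nbhs.
  have n2 : nbhs x0 (eball u0 v0) by apply: open_nbhs_nbhs; split; [exact: eball_open|].
  apply: filterS (filterI n1 n2) => z [z1 z2].
  have sd : s0 - d < s0 by rewrite gtrBl.
  have := hq1 s0 z sd (lexx _) z1.
  have := glob s0 z u0 v0 s01 s02 a0 z2.
  rewrite hq2 /D /= -/(Q _ _ _ _) -/(Q _ _ _ _); linarith.
linarith.
Qed.

End LowerComparison.

(** * Dirac initial data *)

Section RiemannSums.
Variable R : realType.
Local Notation mu := (@lebesgue_measure R).

(** Dividing by [q + 1] avoids a case distinction at [q = 0]. *)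
Lemma mulr_frac_le (q e : R) : 0 <= q -> 0 < e -> q * (e / (q + 1)) <= e.
Proof.
move=> q0 e0; have q1 : 0 < q + 1 by lra.
by rewrite mulrA ler_pdivrMr// mulrDr mulr1 [e * q]mulrC lerDl ltW.
Qed.

(** With a global antiderivative, integrals become differences and the later one-dimensional
    estimates follow from the mean value theorem. *)
Lemma antiderivative_compact_support (g : R -> R) (a b : R) : a <= b -> continuous g ->
  (forall s, s <= a -> g s = 0) -> (forall s, b <= s -> g s = 0) ->
  exists G : R -> R, (forall x : R, is_derive x (1 : R) G (g x)) /\
    Rintegral mu setT g = G b - G a.
Proof.
move=> ab cg ga gb.
have gi : mu.-integrable setT (EFin \o g).
  have gE : EFin \o g = (EFin \o g) \_ `[a, b].
    apply/funext => s; rewrite patchE; case: ifPn => //; rewrite notin_setE/= in_itv/= => h.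
    have [sa|sa] := leP s a; first by rewrite ga.
    have [sb|sb] := leP b s; first by rewrite gb.
    by case: h; rewrite (ltW sa) (ltW sb).
  rewrite gE; apply: (integrable_mkcond _ _).1 => //.
  apply: continuous_compact_integrable; first exact: segment_compact.
  exact: continuous_subspaceT.
pose G x := Rintegral mu `]-oo, x] g.
exists G; split.
  move=> x; have xu : x < x + 1 by rewrite ltrDl.
  have gu : mu.-integrable `]-oo, x + 1] (EFin \o g).
    exact: integrableS gi.
  have [||dG GE] := @continuous_FTC1 R g (BInfty _ true) x (x + 1) xu gu; [exact: ltNyr|by move=> *; exact: cg|].
  by apply: DeriveDef; [exact: dG|rewrite -derive1E; exact: GE].
have -> : G a = 0.
  rewrite /G (@eq_Rintegral _ _ _ _ _ (fun=> 0)).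
    by rewrite Rintegral_cst ?mul0r//.
  by move=> s; rewrite inE/= in_itv/= => /ga.
rewrite subr0 /G [RHS]Rintegral_mkcond; apply: eq_Rintegral => s _.
rewrite patchE; case: ifPn => //; rewrite notin_setE/= in_itv/= => /negP; rewrite -ltNge => h.
by rewrite gb// ltW.
Qed.

Lemma is_derive_lipschitz (G g : R -> R) (a b c w : R) :
  (forall x : R, is_derive x (1 : R) G (g x)) -> a <= b ->
  (forall x, a <= x -> x <= b -> `|g x - c| <= w) -> `|G b - G a - c * (b - a)| <= w * (b - a).
Proof.
move=> dG ab hg.
have [|x] := @MVT_segment R G g a b ab (fun x _ => dG x).
- by apply: derivable_within_continuous => x _; exact: ex_derive.
rewrite in_itv/= => /andP[ax xb] ->; rewrite -mulrBl normrM (ger0_norm (_ : 0 <= b - a)) ?subr_ge0//.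
by rewrite ler_wpM2r ?subr_ge0// hg.
Qed.

Lemma integral_dist1 (f g : R -> R) (a b w : R) : a <= b -> continuous f -> continuous g ->
  (forall s, s <= a -> f s = 0) -> (forall s, b <= s -> f s = 0) ->
  (forall s, s <= a -> g s = 0) -> (forall s, b <= s -> g s = 0) ->
  (forall s, `|f s - g s| <= w) -> `|Rintegral mu setT f - Rintegral mu setT g| <= (b - a) * w.
Proof.
move=> ab cf cg fa fb ga gb hw.
have [F [dF ->]] := antiderivative_compact_support ab cf fa fb.
have [G [dG ->]] := antiderivative_compact_support ab cg ga gb.
have dFG (x : R) : is_derive x (1 : R) (fun z => F z - G z) (f x - g x).
  exact: (is_derive_add (dF x) (is_derive_opp (dG x))).
have := is_derive_lipschitz (c := 0) (w := w) dFG ab.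
rewrite mul0r subr0 mulrC => h.
have -> : F b - F a - (G b - G a) = F b - G b - (F a - G a) by ring.
by apply: h => x _ _; rewrite subr0.
Qed.

Lemma riemann_sum1 (f : R -> R) (o h w : R) N : 0 < h -> continuous f ->
  (forall s, N%:R * h <= `|s - o| -> f s = 0) ->
  (forall s s', `|s - s'| <= h -> `|f s - f s'| <= w) ->
  `|Rintegral mu setT f - h * \sum_(0 <= j < N + N) f (o + (j%:R - N%:R) * h)|
    <= 2 * (N%:R * h) * w.
Proof.
move=> h0 cf sf hw; have M0 : 0 <= N%:R * h by rewrite mulr_ge0// ltW.
move: sf M0; have -> : 2 * (N%:R * h) * w = \sum_(0 <= j < N + N) (w * h).
  rewrite sumr_const_nat subn0 -[RHS]mulr_natr natrD; ring.
move ME : (N%:R * h) => M sf M0.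
have [|||F [dF ->]] := @antiderivative_compact_support f (o - M) (o + M) _ cf.
- lra.
- by move=> s hs; apply: sf; rewrite ler0_norm; lra.
- by move=> s hs; apply: sf; rewrite ger0_norm; lra.
pose p j := o + (j%:R - N%:R) * h.
have -> : o + M = p (N + N)%N by rewrite /p natrD -ME; ring.
have -> : o - M = p 0%N by rewrite /p -ME; ring.
rewrite -(telescope_sumr (fun j => F (p j)) (leq0n _)) mulr_sumr -sumrB.
apply: le_trans (ler_norm_sum _ _ _) _.
apply: ler_sum => j _.
have pj : p j.+1 - p j = h by rewrite /p -addn1 natrD; ring.
have pp : p j <= p j.+1 by lra.
rewrite [h * _]mulrC.
have := is_derive_lipschitz (c := f (p j)) (w := w) dF pp; rewrite pj; apply=> x x1 x2.
by apply: hw; rewrite ger0_norm; lra.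
Qed.

End RiemannSums.

(** * Iterated integrals and grid sums in several variables *)

Section RiemannSumsRn.
Variable R : realType.
Local Notation mu := (@lebesgue_measure R).

Lemma normr_lt n (x : 'rV[R]_n) e : 0 < e -> (forall i, `|x 0 i| < e) -> `|x| < e.
Proof.
move=> e0 h; rewrite [ltLHS]/Num.norm /= mx_normrE; apply/bigmax_ltP; split=> //.
by move=> [i j] _ /=; rewrite ord1.
Qed.

Definition unif_cont n (f : 'rV[R]_n -> R) : Prop := forall e, 0 < e ->
  exists2 d, 0 < d & forall x z, `|x - z| < d -> `|f x - f z| <= e.

Definition supported n (f : 'rV[R]_n -> R) (o : 'rV[R]_n) (M : R) : Prop :=
  forall x, M <= `|x - o| -> f x = 0.

Definition slice n (f : 'rV[R]_n.+1 -> R) (s : R) : 'rV[R]_n -> R :=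
  fun x => f (row_mx (const_mx s : 'rV[R]_1) x).

Let hdv n (o : 'rV[R]_n.+1) : R := (o : 'rV[R]_(1 + n)) 0 (lshift n 0).
Let tlv n (o : 'rV[R]_n.+1) : 'rV[R]_n := rsubmx (o : 'rV[R]_(1 + n)).

Lemma row_hd_tl n (o : 'rV[R]_n.+1) : o = row_mx (const_mx (hdv o) : 'rV[R]_1) (tlv o).
Proof.
apply: etrans (esym (@hsubmxK R 1 1 n o)) _; congr (row_mx _ _); apply/rowP => i.
by rewrite !mxE ord1.
Qed.

Lemma row_mx_sub n (s s' : R) (x x' : 'rV[R]_n) :
  row_mx (const_mx s : 'rV[R]_1) x - row_mx (const_mx s') x' = row_mx (const_mx (s - s')) (x - x').
Proof.
rewrite opp_row_mx add_row_mx; congr row_mx.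
by apply/rowP => i; rewrite !mxE.
Qed.

Lemma norm_row_lt n (s : R) (x : 'rV[R]_n) e : `|s| < e -> `|x| < e ->
  `|row_mx (const_mx s : 'rV[R]_1) x| < e.
Proof.
move=> se xe; apply: normr_lt => [|i]; first exact: le_lt_trans se.
case: (@split_ordP 1 n i) => j ->; first by rewrite row_mxEl mxE.
by rewrite row_mxEr; apply: le_lt_trans (normr_coord x j) xe.
Qed.

Lemma norm_row_ge n (s : R) (x : 'rV[R]_n) :
  `|s| <= `|row_mx (const_mx s : 'rV[R]_1) x| /\ `|x| <= `|row_mx (const_mx s : 'rV[R]_1) x|.
Proof.
split.
  by have := normr_coord (row_mx (const_mx s : 'rV[R]_1) x) (lshift n 0); rewrite row_mxEl mxE.
rewrite [leLHS]/Num.norm /= mx_normrE; apply/bigmax_leP; split=> [//|[i j] _ /=].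
rewrite ord1; have := normr_coord (row_mx (const_mx s : 'rV[R]_1) x) (rshift 1 j).
by rewrite row_mxEr.
Qed.

Lemma slice_uc n (f : 'rV[R]_n.+1 -> R) s : unif_cont f -> unif_cont (slice f s).
Proof.
move=> uf e e0; have [d d0 hd] := uf e e0; exists d => // x z xz; apply: hd.
by rewrite row_mx_sub subrr; apply: norm_row_lt => //; rewrite normr0.
Qed.

Lemma slice_supp n (f : 'rV[R]_n.+1 -> R) o M s : supported f o M -> supported (slice f s) (tlv o) M.
Proof.
move=> sf x hx; apply: sf; rewrite [in leRHS](row_hd_tl o) row_mx_sub.
exact: le_trans hx (norm_row_ge _ _).2.
Qed.

Lemma slice_supp0 n (f : 'rV[R]_n.+1 -> R) o M s : supported f o M -> M <= `|s - hdv o| ->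
  slice f s = fun=> 0.
Proof.
move=> sf hs; apply/funext => x; apply: sf; rewrite [in leRHS](row_hd_tl o) row_mx_sub.
exact: le_trans hs (norm_row_ge _ _).1.
Qed.

Lemma integral_rV0 n : integral_rV (fun _ : 'rV[R]_n => 0) = 0 :> R.
Proof.
elim: n => [//|n IH] /=.
under eq_Rintegral do rewrite IH.
by rewrite Rintegral_cst ?mul0r.
Qed.

Lemma integral_slice0 n (f : 'rV[R]_n.+1 -> R) o M s : supported f o M -> M <= `|s - hdv o| ->
  integral_rV (slice f s) = 0.
Proof. by move=> sf hs; rewrite (slice_supp0 sf hs) integral_rV0. Qed.

Lemma integral_rV_dist n (f g : 'rV[R]_n -> R) o M w : 0 <= M -> unif_cont f -> unif_cont g ->
  supported f o M -> supported g o M -> (forall x, `|f x - g x| <= w) ->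
  `|integral_rV f - integral_rV g| <= (2 * M) ^+ n * w.
Proof.
move=> M0; elim: n f g o w => [|n IH] f g o w uf ug sf sg hw; first by rewrite expr0 mul1r; exact: hw.
have cont (h : 'rV[R]_n.+1 -> R) : unif_cont h -> supported h o M ->
    continuous (fun s => integral_rV (slice h s)).
  move=> uh sh s; apply/cvgrPdist_le => /= e e0.
  have e'0 : 0 < e / ((2 * M) ^+ n + 1).
    by rewrite divr_gt0// ltr_wpDl// exprn_ge0// mulr_ge0.
  have [d d0 hd] := uh _ e'0.
  near=> s'.
  apply: (@le_trans _ _ ((2 * M) ^+ n * (e / ((2 * M) ^+ n + 1)))).
    apply: (IH _ _ (tlv o)); [exact: slice_uc|exact: slice_uc|exact: slice_supp|exact: slice_supp|].
    move=> x; apply: hd; rewrite row_mx_sub subrr; apply: norm_row_lt; last by rewrite normr0.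
    by near: s'; exact: (cvgr_dist_lt _ _ (@cvg_id _ (nbhs s)) _ d0).
  have q0 : 0 <= (2 * M) ^+ n by rewrite exprn_ge0// mulr_ge0.
  exact: mulr_frac_le.
rewrite exprS -mulrA /=.
have hM : 2 * M = (hdv o + M) - (hdv o - M) by ring.
rewrite [X in X * _]hM; apply: integral_dist1; [lra|exact: cont|exact: cont| | | | |].
- by move=> s hs; apply: (integral_slice0 sf); rewrite ler0_norm; lra.
- by move=> s hs; apply: (integral_slice0 sf); rewrite ger0_norm; lra.
- by move=> s hs; apply: (integral_slice0 sg); rewrite ler0_norm; lra.
- by move=> s hs; apply: (integral_slice0 sg); rewrite ger0_norm; lra.
move=> s; apply: (IH _ _ (tlv o)); [exact: slice_uc|exact: slice_uc|exact: slice_supp|exact: slice_supp|].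
by move=> x; exact: hw.
Unshelve. all: end_near.
Qed.

(** The lower corners of the cells of the cube of half-side [N * h], listed so that a sum over them
    splits off the first coordinate as [integral_rV] does. *)
Fixpoint grid (N : nat) (h : R) (n : nat) : seq 'rV[R]_n :=
  match n with
  | 0 => [:: 0]
  | m.+1 => [seq (row_mx (const_mx ((j%:R - N%:R) * h) : 'rV[R]_1) xi : 'rV[R]_m.+1)
               | j <- index_iota 0 (N + N), xi <- grid N h m]
  end.

Definition rsum n (N : nat) (h : R) (f : 'rV[R]_n -> R) (o : 'rV[R]_n) : R :=
  h ^+ n * \sum_(xi <- grid N h n) f (o + xi).

Lemma rsumS n N h (f : 'rV[R]_n.+1 -> R) o :
  rsum N h f o = h * \sum_(0 <= j < N + N) rsum N h (slice f (hdv o + (j%:R - N%:R) * h)) (tlv o).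
Proof.
rewrite /rsum /= exprS -mulrA -mulr_sumr; congr (_ * (_ * _)).
rewrite big_allpairs_dep; apply: eq_bigr => j _; apply: eq_bigr => xi _.
rewrite /slice; congr f; apply/rowP => i; rewrite mxE.
case: (@split_ordP 1 n i) => k ->; first by rewrite !(@row_mxEl _ 1 1 n) !mxE ord1.
by rewrite !(@row_mxEr _ 1 1 n) !mxE.
Qed.

Lemma rsum_approx n (f : 'rV[R]_n -> R) o h w N : 0 < h -> unif_cont f ->
  supported f o (N%:R * h) ->
  (forall x z, `|x - z| <= h -> `|f x - f z| <= w) ->
  `|integral_rV f - rsum N h f o| <= n%:R * (2 * (N%:R * h)) ^+ n * w.
Proof.
move=> h0; elim: n f o w => [|n IH] f o w uf sf hw.
  rewrite /rsum/= expr0 mul1r big_seq1 addr0 mul0r mul0r.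
  by rewrite (_ : o = 0) ?subrr ?normr0//; apply/rowP => -[].
have M0 : 0 <= N%:R * h by rewrite mulr_ge0// ltW.
have dist s s' e : (forall x, `|slice f s x - slice f s' x| <= e) ->
    `|integral_rV (slice f s) - integral_rV (slice f s')| <= (2 * (N%:R * h)) ^+ n * e.
  move=> he; apply: (@integral_rV_dist _ _ _ (tlv o)) => //.
  - exact: slice_uc.
  - exact: slice_uc.
  - exact: slice_supp.
  - exact: slice_supp.
have cont : continuous (fun s => integral_rV (slice f s)).
  move=> s; apply/cvgrPdist_le => /= e e0.
  have q0 : 0 <= (2 * (N%:R * h)) ^+ n by rewrite exprn_ge0// mulr_ge0.
  have e'0 : 0 < e / ((2 * (N%:R * h)) ^+ n + 1) by rewrite divr_gt0// ltr_wpDl.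
  have [d d0 hd] := uf _ e'0.
  near=> s'.
  apply: (@le_trans _ _ ((2 * (N%:R * h)) ^+ n * (e / ((2 * (N%:R * h)) ^+ n + 1)))).
    apply: dist => x; apply: hd; rewrite row_mx_sub subrr; apply: norm_row_lt; last by rewrite normr0.
    by near: s'; exact: (cvgr_dist_lt _ _ (@cvg_id _ (nbhs s)) _ d0).
  exact: mulr_frac_le.
pose F s := integral_rV (slice f s); pose S s := rsum N h (slice f s) (tlv o).
pose q j := hdv o + (j%:R - N%:R) * h.
have step1 : `|integral_rV f - h * \sum_(0 <= j < N + N) F (q j)|
    <= 2 * (N%:R * h) * ((2 * (N%:R * h)) ^+ n * w).
  apply: (riemann_sum1 (f := F)) => //.
  - by move=> s hs; exact: (integral_slice0 sf).
  - move=> s s' ss'; apply: dist => x; apply: hw; rewrite row_mx_sub subrr.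
    apply: le_trans _ ss'; apply/ler_addgt0Pr => e e0; apply/ltW/norm_row_lt; first by rewrite ltrDl.
    by rewrite normr0 ltr_wpDl.
have step2 j : `|F (q j) - S (q j)| <= n%:R * (2 * (N%:R * h)) ^+ n * w.
  apply: IH; [exact: slice_uc|exact: slice_supp|move=> x z xz].
  apply: hw; rewrite row_mx_sub subrr.
  apply: le_trans _ xz; apply/ler_addgt0Pr => e e0; apply/ltW/norm_row_lt; last by rewrite ltrDl.
  by rewrite normr0 ltr_wpDl.
rewrite rsumS.
have step3 : `|h * \sum_(0 <= j < N + N) F (q j) - h * \sum_(0 <= j < N + N) S (q j)|
    <= 2 * (N%:R * h) * (n%:R * (2 * (N%:R * h)) ^+ n * w).
  rewrite -mulrBr -sumrB normrM (gtr0_norm h0).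
  have -> : 2 * (N%:R * h) * (n%:R * (2 * (N%:R * h)) ^+ n * w) =
      h * \sum_(0 <= j < N + N) (n%:R * (2 * (N%:R * h)) ^+ n * w).
    by rewrite sumr_const_nat subn0 -[_ *+ (N + N)]mulr_natr natrD; ring.
  rewrite ler_wpM2l//; first exact/ltW.
  by apply: le_trans (ler_norm_sum _ _ _) _; apply: ler_sum => j _.
have -> : integral_rV f - h * \sum_(0 <= j < N + N) S (q j) =
  (integral_rV f - h * \sum_(0 <= j < N + N) F (q j)) +
  (h * \sum_(0 <= j < N + N) F (q j) - h * \sum_(0 <= j < N + N) S (q j)) by ring.
apply: le_trans (ler_normD _ _) _; apply: le_trans (lerD step1 step3) _.
by rewrite -(addn1 n) natrD addn1 exprS le_eqVlt; apply/orP; left; apply/eqP; ring.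
Unshelve. all: end_near.
Qed.

Lemma rsum_cvg n (f : 'rV[R]_n -> R) o M e : 0 < M -> 0 < e -> unif_cont f -> supported f o M ->
  exists N0, forall N, (N0 <= N)%N -> (0 < N)%N ->
    `|integral_rV f - rsum N (M / N%:R) f o| <= e.
Proof.
move=> M0 e0 uf sf.
have K0 : 0 <= n%:R * (2 * M) ^+ n by rewrite mulr_ge0// exprn_ge0// mulr_ge0// ltW.
have e'0 : 0 < e / (n%:R * (2 * M) ^+ n + 1) by rewrite divr_gt0// ltr_wpDl.
have [d d0 hd] := uf _ e'0.
exists (Num.bound (M / d)) => N leN N0'.
have NR : 0 < N%:R :> R by rewrite ltr0n.
have NM : N%:R * (M / N%:R) = M by field; rewrite gt_eqF.
apply: le_trans (rsum_approx (w := e / (n%:R * (2 * M) ^+ n + 1)) _ uf _ _) _.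
- by rewrite divr_gt0.
- by rewrite NM.
- move=> x z xz; apply: hd; apply: le_lt_trans xz _.
  rewrite ltr_pdivrMr// mulrC -ltr_pdivrMr//.
  have := archi_boundP (ltW (divr_gt0 M0 d0)) => /lt_le_trans; apply.
  by rewrite ler_nat.
- by rewrite NM; exact: mulr_frac_le.
Qed.

(** Monotonicity is inherited from Riemann sums of the three functions on a common grid. *)
Lemma integral_rV_ge n (f g chi : 'rV[R]_n -> R) o M eta : 0 < M ->
  unif_cont f -> unif_cont g -> unif_cont chi ->
  supported f o M -> supported g o M -> supported chi o M ->
  (forall x, g x - eta * chi x <= f x) ->
  integral_rV g - eta * integral_rV chi <= integral_rV f.
Proof.
move=> M0 uf ug uc sf sg sc hle; apply/ler_addgt0Pr => e e0.
have d0 : 0 < e / (2 + `|eta|) by rewrite divr_gt0// ltr_pwDl.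
have [N1 h1] := rsum_cvg M0 d0 uf sf.
have [N2 h2] := rsum_cvg M0 d0 ug sg.
have [N3 h3] := rsum_cvg M0 d0 uc sc.
pose N := (maxn N1 (maxn N2 N3)).+1.
have /h1 := leq_trans (leq_maxl N1 (maxn N2 N3)) (leqnSn _) => /(_ isT).
have /h2 := leq_trans (leq_trans (leq_maxl N2 N3) (leq_maxr N1 _)) (leqnSn _) => /(_ isT).
have /h3 := leq_trans (leq_trans (leq_maxr N2 N3) (leq_maxr N1 _)) (leqnSn _) => /(_ isT).
rewrite -/N; set h := M / N%:R; set d := e / _ in d0 *.
have hr : rsum N h g o - eta * rsum N h chi o <= rsum N h f o.
  rewrite /rsum [eta * _]mulrCA -mulrBr mulr_sumr -sumrB; apply: ler_wpM2l.
    by apply: exprn_ge0; apply: divr_ge0 => //; exact: ltW.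
  by apply: ler_sum => xi _; exact: hle.
have ed : e = 2 * d + `|eta| * d by rewrite /d; field; rewrite gt_eqF// ltr_pwDl.
move=> a3; rewrite !ler_distl => /andP[a1 a2] /andP[b1 b2].
have : `|eta * (integral_rV chi - rsum N h chi o)| <= `|eta| * d by rewrite normrM ler_wpM2l.
rewrite ler_norml => /andP[c1 c2].
rewrite ed; lra.
Qed.

End RiemannSumsRn.

(** * Gaussian sums on a grid *)

Section GaussMass.
Variable R : realType.

(** [exp (- u^2) <= 2 / (1 + u)^2], and the sum of the latter over the grid is dominated by a
    telescoping sum of [2 / (1 + u)]. *)
Lemma gauss_sum (a : R) K : 0 < a -> a <= 1 ->
  \sum_(0 <= k < K) a * expR (- (k%:R * a) ^+ 2) <= 3.
Proof.
move=> a0 a1.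
have bd (k : nat) : a * expR (- (k%:R * a) ^+ 2) <= 2 * a / (1 + k%:R * a) ^+ 2.
  have u0 : 0 <= k%:R * a by rewrite mulr_ge0// ltW.
  set u := k%:R * a in u0 *.
  rewrite ler_pdivlMr ?exprn_gt0//; last lra.
  have := expR_ge1Dx (u ^+ 2); rewrite expRN => h.
  have e0 := expR_gt0 (u ^+ 2).
  have h2 : (1 + u) ^+ 2 <= 2 * expR (u ^+ 2).
    by have := sqr_ge0 (1 - u); move: h; rewrite !expr2; lra.
  by rewrite mulrAC ler_pdivrMr//; have := ler_wpM2l (ltW a0) h2; lra.
have h : forall m, \sum_(0 <= k < m.+1) a * expR (- (k%:R * a) ^+ 2) <= a + 2 - 2 / (1 + m%:R * a).
  elim=> [|m IH].
    by rewrite big_nat1 mul0r expr0n/= oppr0 expR0 mulr1 addr0 divr1; lra.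
  rewrite big_nat_recr//=; apply: le_trans (lerD IH (bd _)) _.
  have u0 : 0 <= m%:R * a by rewrite mulr_ge0// ltW.
  rewrite -(natr1 m) ![(m%:R + 1) * a]mulrDl mul1r ![1 + (_ + a)]addrA; set u := 1 + m%:R * a.
  have u1 : 1 <= u by rewrite /u lerDl.
  have -> : a + 2 - 2 / (u + a) = a + 2 - 2 / u + 2 * a / ((u + a) * u).
    by field; rewrite !gt_eqF//; lra.
  rewrite lerD2l ler_pdivrMr; last by apply: exprn_gt0; lra.
  rewrite mulrAC ler_pdivlMr; last by apply: mulr_gt0; lra.
  rewrite expr2; nra.
case: K => [|m]; first by rewrite big_geq.
apply: le_trans (h m) _.
have : 0 <= 2 / (1 + m%:R * a) by rewrite divr_ge0// addr_ge0// mulr_ge0// ltW.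
lra.
Qed.

Lemma gauss_sum2 (a : R) N : 0 < a -> a <= 1 ->
  \sum_(0 <= j < N + N) a * expR (- ((j%:R - N%:R) * a) ^+ 2) <= 6.
Proof.
move=> a0 a1; rewrite (@big_cat_nat _ _ _ N)//= ?leq_addr//.
have -> : (6 : R) = 3 + 3 by ring.
apply: lerD; last first.
  rewrite -{1}[N]add0n big_addn addnK; apply: le_trans _ (gauss_sum N a0 a1).
  by apply: ler_sum => j _; rewrite natrD addrK.
(* Reversed, the negative half has arguments [- (j + 1) * a], one step further out than in
   [gauss_sum]. *)
rewrite big_nat_rev /=; apply: le_trans _ (gauss_sum N a0 a1).
rewrite big_nat_cond [leRHS]big_nat_cond; apply: ler_sum => j /andP[/andP[_ jN] _].
rewrite ler_pM2l// ler_expR lerN2 add0n natrB// -[j.+1]addn1 natrD.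
have j0 : 0 <= j%:R * a by rewrite mulr_ge0// ltW.
have -> : (N%:R - (j%:R + 1) - N%:R) * a = - (j%:R * a + a) by ring.
rewrite sqrrN ler_sqr ?nnegrE; lra.
Qed.

Lemma heat_kernel_row n (e s : R) (x : 'rV[R]_n) : 0 < e ->
  heat_kernel e (row_mx (const_mx s : 'rV[R]_1) x : 'rV[R]_n.+1) 0 =
  (Num.sqrt (4 * pi * e))^-1 * expR (- (s ^+ 2 / (4 * e))) * heat_kernel e x 0.
Proof.
move=> e0; have p0 := @pi_gt0 R.
have c0 : 0 < 4 * pi * e by rewrite !mulr_gt0.
rewrite /heat_kernel !subr0 !enormE.
have -> : dotv (row_mx (const_mx s : 'rV[R]_1) x : 'rV[R]_n.+1) (row_mx (const_mx s : 'rV[R]_1) x)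
    = s ^+ 2 + dotv x x.
  rewrite /dotv (@big_split_ord _ _ _ 1 n) /= big_ord1 (@row_mxEl _ 1 1 n) mxE; congr (_ + _).
  by apply: eq_bigr => i _; rewrite (@row_mxEr _ 1 1 n).
rewrite [(s ^+ 2 + _) / _]mulrDl [- (s ^+ 2 / _ + _)]opprD expRD -(natr1 n) [(n%:R + _) / 2]mulrDl [- (n%:R / 2 + _)]opprD powRD; last by rewrite (gt_eqF c0) implybT.
rewrite [_ `^ (- (1 / 2))]powRN mul1r -powR12_sqrt; last exact/ltW.
by ring.
Qed.

(** The kernel is a product over the coordinates, each contributing a one-dimensional sum bounded by
    6 once the mesh is at most the width [2 * sqrt e]. The bound is independent of [N] and [e]. *)
Lemma heat_kernel_mass n N (h e : R) : 0 < e -> 0 < h -> h <= 2 * Num.sqrt e ->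
  rsum N h (fun x : 'rV[R]_n => heat_kernel e x 0) 0 <= 6 ^+ n.
Proof.
move=> e0 h0 he; have p0 := @pi_gt0 R; have se : 0 < Num.sqrt e by rewrite sqrtr_gt0.
elim: n => [|n IH].
  rewrite /rsum/= !expr0 mul1r big_seq1 /heat_kernel addr0 subrr enorm0.
  by rewrite expr0n/= !mul0r oppr0 expR0 powRr0 mulr1.
rewrite /rsum /= exprS -mulrA big_allpairs_dep.
have -> : \sum_(0 <= j < N + N) \sum_(xi <- grid N h n)
    heat_kernel e (0 + row_mx (const_mx ((j%:R - N%:R) * h) : 'rV[R]_1) xi : 'rV[R]_n.+1) 0 =
  \sum_(0 <= j < N + N) (Num.sqrt (4 * pi * e))^-1 * expR (- (((j%:R - N%:R) * h) ^+ 2 / (4 * e))) *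
    \sum_(xi <- grid N h n) heat_kernel e (0 + xi) 0.
  apply: eq_bigr => j _; rewrite mulr_sumr; apply: eq_bigr => xi _.
  by rewrite !add0r heat_kernel_row.
rewrite -mulr_suml.
set A := \sum_(0 <= j < _) _; set B := \sum_(xi <- _) _.
have -> : h * (h ^+ n * (A * B)) = (h * A) * (h ^+ n * B) by ring.
rewrite exprS; apply: ler_pM => //; rewrite /A /B {A B}.
- by apply: mulr_ge0; [exact/ltW|apply: sumr_ge0 => j _; rewrite mulr_ge0 ?invr_ge0 ?sqrtr_ge0 ?expR_ge0].
- apply: mulr_ge0; first by rewrite exprn_ge0// ltW.
  by apply: sumr_ge0 => xi _; exact/ltW/heat_kernel_gt0.
have a0 : 0 < h / (2 * Num.sqrt e) by rewrite divr_gt0// mulr_gt0.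
have a1 : h / (2 * Num.sqrt e) <= 1 by rewrite ler_pdivrMr ?mul1r ?mulr_gt0.
apply: le_trans _ (gauss_sum2 N a0 a1).
rewrite mulr_sumr; apply: ler_sum => j _; rewrite mulrA.
have -> : ((j%:R - N%:R) * h) ^+ 2 / (4 * e) = ((j%:R - N%:R) * (h / (2 * Num.sqrt e))) ^+ 2.
  rewrite -[in LHS](sqr_sqrtr (ltW e0)); field; lra.
rewrite ler_wpM2r ?expR_ge0// ler_pM2l// lef_pV2 ?posrE ?sqrtr_gt0 ?mulr_gt0//.
have -> : 2 * Num.sqrt e = Num.sqrt (4 * e).
  by rewrite sqrtrM// (_ : 4 = 2 ^+ 2) ?sqrtr_sqr ?ger0_norm//; ring.
rewrite ler_sqrt; last by apply: mulr_ge0; [apply: mulr_ge0; [|exact/ltW]|exact/ltW].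
by have := @pi_ge2 R; nra.
Qed.

End GaussMass.

Section CompactTools.
Variable R : realType.

Lemma cvg_max0 (T : Type) (F : set_system T) (FF : Filter F) (f : T -> R) (a : R) :
  f @ F --> a -> Num.max 0 (f q) @[q --> F] --> Num.max 0 a.
Proof.
move=> cf; rewrite maxr_absE; under eq_fun do rewrite maxr_absE.
apply: cvgM; last exact: cvg_cst.
apply: cvgD; first by apply: cvgD => //; exact: cvg_cst.
by apply: cvg_norm; apply: cvgB => //; exact: cvg_cst.
Qed.

Lemma unif_cont_compact n (f : 'rV[R]_n -> R) (K : set 'rV[R]_n) : compact K -> continuous f ->
  (forall x, ~ K x -> f x = 0) -> unif_cont f.
Proof.
move=> cK cf f0 e e0.
have e2 : 0 < e / 2 by rewrite divr_gt0.
have : \forall d \near (0 : R)^'+, K `<=` [set x | forall z, `|x - z| < d -> `|f x - f z| <= e].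
  apply: (iffLR (compact_near_coveringP K)) => // x Kx.
  have /cvgrPdist_lt/(_ _ e2)/nbhs_ballP[r /= r0 hr] := cf x.
  have r2 : 0 < r / 2 by rewrite divr_gt0.
  exists (ball x (r / 2), [set d | d < r / 2]).
    by split; [exact: nbhsx_ballx|exact: nbhs_right_lt].
  case=> x' d /= [xx' dr] z x'z.
  have h1 : `|f x - f x'| < e / 2.
    by apply: hr; apply: le_ball xx'; rewrite ler_pdivrMr// ler_pMr// ler1n.
  have h2 : `|f x - f z| < e / 2.
    apply: hr; rewrite -ball_normE /ball_ /=.
    move: xx'; rewrite -ball_normE /ball_ /= => xx'.
    have -> : x - z = (x - x') + (x' - z) by rewrite addrA subrK.
    by apply: le_lt_trans (ler_normD _ _) _; lra.
  have -> : f x' - f z = (f x - f z) - (f x - f x') by ring.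
  by apply: le_trans (ler_normB _ _) _; lra.
move=> h; have [d [d0 hd]] := filter_ex (filterI (nbhs_right_gt (0 : R)) h).
exists d => // x z xz.
have [Kx|nKx] := pselect (K x); first exact: (hd x Kx).
have [Kz|nKz] := pselect (K z); first by rewrite distrC; apply: (hd z Kz); rewrite distrC.
by rewrite !f0// subrr normr0 ltW.
Qed.

End CompactTools.

(** * Translates and sums of solutions, and a cut-off *)

Section Caloric.
Variables (R : realType) (n : nat).
Implicit Types (u : R -> 'rV[R]_n -> R) (s t : R) (x y z xi : 'rV[R]_n).

(** The pointwise data consumed by the comparison principles, in a form that passes to translates
    and finite sums. *)
Definition caloric_at u t x : Prop :=
  u q.1 q.2 @[q --> (t, x)] --> u t x /\
  exists G L, is_derive t 1 (fun s => u s x) L /\ jet (u t) x G L.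

Lemma caloric_at_shift u t x c (xi : 'rV[R]_n) :
  caloric_at u (t + c) (x + xi) -> caloric_at (fun s z => u (s + c) (z + xi)) t x.
Proof.
move=> [cu [G [L [dL [h [hj hL]]]]]]; split.
  have c1 : (q.1 + c, q.2 + xi) @[q --> (t, x)] --> (t + c, x + xi).
    apply: (@cvg_pair _ _ _ _ (nbhs (t + c)) (nbhs (x + xi))).
      by apply: cvgD; [exact: (@cvg_fst _ _ (nbhs t) (nbhs x) _)|exact: cvg_cst].
    by apply: cvgD; [exact: (@cvg_snd _ _ (nbhs t) (nbhs x) _)|exact: cvg_cst].
  exact: (cvg_comp _ _ c1 cu).
exists G, L; split.
  have d1 : is_derive t 1 (fun s => s + c) 1.
    by apply: (is_derive_fun (is_derive_add (is_derive_var t) (is_derive_const c t))) => //; rewrite addr0.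
  have := @is_derive1_comp R (fun s => u s (x + xi)) (fun s => s + c) t L 1 dL d1.
  by move=> H; apply: (is_derive_fun H) => //; exact: mulr1.
exists h; split=> // i; have := hj i; apply: jet1_ext => s /=.
by rewrite addrAC.
Qed.

Lemma caloric_at0 t x : caloric_at (fun _ _ => 0) t x.
Proof.
split; first exact: cvg_cst.
by exists 0, 0; split; [exact: is_derive_const|exact: jet_cst].
Qed.

Lemma caloric_atZ w u t x : caloric_at u t x -> caloric_at (fun s z => w * u s z) t x.
Proof.
move=> [cu [G [L [dL jL]]]]; split; first by apply: cvgM => //; exact: cvg_cst.
by exists (w *: G), (w * L); split; [exact: is_derive_scal|exact: jetZ].
Qed.

Lemma caloric_atD u v t x : caloric_at u t x -> caloric_at v t x ->
  caloric_at (fun s z => u s z + v s z) t x.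
Proof.
move=> [cu [G [L [dL jL]]]] [cv [G' [L' [dL' jL']]]]; split; first exact: cvgD.
by exists (G + G'), (L + L'); split; [exact: is_derive_add|exact: jetD].
Qed.

Lemma caloric_at_sum (I : eqType) (r : seq I) (u : I -> R -> 'rV[R]_n -> R) t x :
  (forall i, caloric_at (u i) t x) ->
  caloric_at (fun s z => \sum_(i <- r) u i s z) t x.
Proof.
move=> hu; elim: r => [|i r IH].
  rewrite (_ : (fun _ _ => _) = fun _ _ => 0); first exact: caloric_at0.
  by apply/funext => s; apply/funext => z; rewrite big_nil.
rewrite (_ : (fun _ _ => _) = fun s z => u i s z + \sum_(j <- r) u j s z); first exact: caloric_atD.
by apply/funext => s; apply/funext => z; rewrite big_cons.
Qed.

Lemma solves_caloric_at (D : set 'rV[R]_n) u t x : open D -> solves_heat_equation D u ->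
  0 < t -> D x -> caloric_at u t x.
Proof.
move=> oD hu t0 Dx; split; first exact: (caloric_continuous hu t0 Dx).
exact: (caloric_jet oD hu t0 Dx).
Qed.

Lemma continuous_translate (phi : 'rV[R]_n -> R) z : continuous phi ->
  continuous (fun x => phi (x - z)).
Proof.
move=> cphi x; have h : (fun w : 'rV[R]_n => w - z) @ x --> x - z.
  exact: (cvgB (@cvg_id _ (nbhs x)) (cvg_cst z)).
exact: (cvg_comp (fun w : 'rV[R]_n => w - z) phi h (cphi _)).
Qed.

(** This is [min 1 (max 0 (3 - |x - y| / e))]: equal to 1 up to distance [2 e] and to 0 from [3 e]
    on. Multiplied by it, [k] becomes continuous on the whole space. *)
Definition bump (y : 'rV[R]_n) (e : R) (x : 'rV[R]_n) : R :=
  1 - Num.max 0 (1 - Num.max 0 (3 - enorm (x - y) / e)).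

Lemma cvg_bump y e (T : Type) (F : set_system T) (FF : Filter F) (f : T -> 'rV[R]_n) x :
  f @ F --> x -> bump y e (f q) @[q --> F] --> bump y e x.
Proof.
move=> cf; apply: cvgB; first exact: cvg_cst.
apply: cvg_max0; apply: cvgB; first exact: cvg_cst.
apply: cvg_max0; apply: cvgB; first exact: cvg_cst.
apply: cvgM; last exact: cvg_cst.
by apply: (cvg_enorm FF); apply: cvgB => //; exact: cvg_cst.
Qed.

Lemma bump_continuous y e : continuous (bump y e).
Proof. by move=> x; exact: (@cvg_bump y e _ _ (nbhs_filter x) id x (@cvg_id _ (nbhs x))). Qed.

Lemma cvg_at_time (T : Type) (F : set_system T) (FF : Filter F) (f : T -> 'rV[R]_n) u t x :
  {for (t, x), continuous (fun q : R * 'rV[R]_n => u q.1 q.2)} -> f @ F --> x ->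
  u t (f q) @[q --> F] --> u t x.
Proof.
move=> cu cf; have c1 : (t, f q) @[q --> F] --> (t, x).
  by apply: (@cvg_pair _ _ _ _ (nbhs t) (nbhs x)) => //; exact: cvg_cst.
exact: (cvg_comp _ _ c1 cu).
Qed.

Lemma bump_ge0 y e x : 0 <= bump y e x.
Proof. by rewrite /bump /Num.max; case: ifP => _; [case: ifP => h|]; lra. Qed.

Lemma bump_le1 y e x : bump y e x <= 1.
Proof. by rewrite /bump gerBl le_max lexx. Qed.

Lemma bump1 y e x : 0 < e -> enorm (x - y) <= 2 * e -> bump y e x = 1.
Proof.
move=> e0 h; have h1 : enorm (x - y) / e <= 2 by rewrite ler_pdivrMr.
rewrite /bump (_ : Num.max 0 (3 - _) = 3 - enorm (x - y) / e); last by apply/max_idPr; lra.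
by rewrite (_ : Num.max 0 _ = 0) ?subr0//; apply/max_idPl; lra.
Qed.

Lemma bump0 y e x : 0 < e -> 3 * e <= enorm (x - y) -> bump y e x = 0.
Proof.
move=> e0 h; have h1 : 3 <= enorm (x - y) / e by rewrite ler_pdivlMr.
rewrite /bump (_ : Num.max 0 (3 - _) = 0); last by apply/max_idPl; lra.
by rewrite subr0 (max_idPr _) ?subrr.
Qed.

End Caloric.

(** * From the weak initial condition to uniform bounds *)

Section DiracStage.
Variables (R : realType) (n : nat).
Implicit Types (t s eta : R) (x z w xi : 'rV[R]_n).
Variables (U : set 'rV[R]_n) (k : R -> 'rV[R]_n -> R) (y : 'rV[R]_n).
Hypotheses (oU : open U) (hk : solves_heat_equation U k) (hd : dirac_initial U k y)
  (kp : forall t x, 0 < t -> U x -> 0 <= k t x <= heat_kernel t x y).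

Variables (e : R) (phi : 'rV[R]_n -> R).
Hypotheses (e0 : 0 < e) (He : forall x, enorm (x - y) <= 3 * e -> U x)
  (cphi : continuous phi) (phi0 : forall xi, e <= enorm xi -> phi xi = 0)
  (phi_ge0 : forall xi, 0 <= phi xi).

Let phiz z x := phi (x - z).

Lemma phiz_cont z : continuous (phiz z).
Proof.
exact: continuous_translate.
Qed.

Let kchi t x := k t x * bump y e x.

Lemma kchi_cont t : 0 < t -> continuous (kchi t).
Proof.
move=> t0 x; have [Ux|nUx] := pselect (U x).
  have h := caloric_continuous hk t0 Ux.
  exact: (cvgM (@cvg_at_time _ _ _ _ (nbhs_filter x) id k t x h (@cvg_id _ (nbhs x))) (@bump_continuous R n y e x)).
have far : 3 * e < enorm (x - y) by rewrite ltNge; apply/negP => /He.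
have z0 : kchi t x = 0 by rewrite /kchi bump0 ?mulr0// ltW.
rewrite /continuous_at z0; apply: (@cvg_near_cst _ _ _ _ _ (nbhs_filter x)).
have r0 : 0 < enorm (x - y) - 3 * e by rewrite subr_gt0.
apply: filterS (eball_nbhs x r0) => z; rewrite /eball /= => hz.
rewrite /kchi bump0 ?mulr0//.
have := enorm_triangleB z x y; rewrite (enormBC x z); lra.
Qed.

Lemma cball r : compact [set x : 'rV[R]_n | enorm (x - y) <= r].
Proof. exact: ecompact. Qed.

Lemma supp_phiz z x : enorm (z - y) <= e -> phiz z x != 0 -> bump y e x = 1.
Proof.
move=> hz h; apply: bump1 => //.
have : enorm (x - z) < e by rewrite ltNge; apply/negP => /phi0 h0; rewrite /phiz h0 eqxx in h.
have := enorm_triangleB z x y; lra.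
Qed.

Lemma k_phiz t z x : enorm (z - y) <= e -> k t x * phiz z x = kchi t x * phiz z x.
Proof.
move=> hz; have [->|h] := eqVneq (phiz z x) 0; first by rewrite !mulr0.
by rewrite /kchi (supp_phiz hz h) mulr1.
Qed.

Lemma kphi_uc t z : 0 < t -> enorm (z - y) <= e -> unif_cont (fun x => k t x * phiz z x).
Proof.
move=> t0 hz; apply: (unif_cont_compact (@cball (2 * e))).
  rewrite (_ : (fun x => _) = fun x => kchi t x * phiz z x).
    by move=> x; apply: (@cvgM _ _ _ (nbhs_filter x)); [exact: kchi_cont|exact: phiz_cont].
  by apply/funext => x; exact: k_phiz.
move=> x /= nx; rewrite (_ : phiz z x = 0) ?mulr0//; apply: phi0; rewrite leNgt; apply/negP => h.
apply: nx; have := enorm_triangleB z x y; lra.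
Qed.

Lemma kchi_uc t : 0 < t -> unif_cont (kchi t).
Proof.
move=> t0; apply: (unif_cont_compact (@cball (3 * e))); first exact: kchi_cont.
move=> x /= nx; rewrite /kchi bump0 ?mulr0//; rewrite leNgt; apply/negP => h.
by apply: nx; exact: ltW.
Qed.

Lemma phi_uc : unif_cont phi.
Proof.
apply: (unif_cont_compact (@ecompact R n 0 e)) => // x /= nx; apply: phi0.
by rewrite leNgt; apply/negP => h; apply: nx; rewrite subr0 ltW.
Qed.

Lemma kchi_ge0 t x : 0 < t -> 0 <= kchi t x.
Proof.
move=> t0; have [Ux|nUx] := pselect (U x).
  by apply: mulr_ge0; [have /andP[] := kp t0 Ux|exact: bump_ge0].
rewrite /kchi bump0 ?mulr0// leNgt; apply/negP => h; apply: nUx; apply: He; exact: ltW.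
Qed.

(** The weak limit is given one test function at a time. Compactness of the set of centres [z] makes
    it uniform: nearby translates of [phi] differ little in sup norm, and the mass of [k] near [y],
    tested with [bump], stays below 2. *)
Lemma dirac_uniform eta : 0 < eta ->
  \forall t \near (0 : R)^'+, [set z | enorm (z - y) <= e] `<=`
     [set z | phi (y - z) - eta <= integral_rV (fun x => k t x * phi (x - z))].
Proof.
move=> eta0; have e8 : 0 < eta / 8 by rewrite divr_gt0.
have [d d0 hdd] := phi_uc e8.
have hchi : integral_rV (kchi t) @[t --> 0^'+] --> (1 : R).
  have := hd (@bump_continuous R n y e); rewrite bump1//; last by rewrite subrr enorm0 mulr_ge0// ltW.
  apply; exists [set x | enorm (x - y) <= 3 * e]; split; [exact: cball|exact: He|].
  move=> x /= nx; rewrite bump0// leNgt; apply/negP => h; apply: nx; exact: ltW.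
have echi : \forall t \near (0 : R)^'+, integral_rV (kchi t) <= 2.
  have /cvgrPdist_lt/(_ _ ltr01) := hchi; apply: filterS => t; rewrite ltr_norml => /andP[]; lra.
have /compact_near_coveringP/near_covering_withinP nc := @cball e.
apply: nc => z0' /= hz0'; move: (z0' : 'rV[R]_n) hz0' => {z0'} z0 hz0.
have : integral_rV (fun x => k t x * phiz z0 x) @[t --> 0^'+] --> phiz z0 y.
  apply: hd; first exact: phiz_cont.
  exists [set x | enorm (x - y) <= 3 * e]; split; [exact: cball|exact: He|].
  move=> x /= nx; apply: phi0; rewrite leNgt; apply/negP => h.
  have tr : enorm (x - y) <= enorm (x - z0) + enorm (z0 - y) := enorm_triangleB z0 x y.
  apply: nx; apply: le_trans tr _; have := e0; lra.
have e4 : 0 < eta / 4 by rewrite divr_gt0.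
move=> /cvgrPdist_lt/(_ _ e4) ez0.
exists (ball z0 d `&` [set z | True], [set t | 0 < t /\ integral_rV (kchi t) <= 2 /\
    `|phiz z0 y - integral_rV (fun x => k t x * phiz z0 x)| < eta / 4]).
  split; first by apply: filterI; [exact: nbhsx_ballx|exact: filterT].
  apply: filterI; first exact: nbhs_right_gt.
  exact: filterI.
case=> z t /= [[zz0 _] [t0 [ht]]]; rewrite ltr_norml => /andP[h1 h2] .
have hdist x : `|phiz z0 x - phiz z x| <= eta / 8.
  apply: hdd; rewrite opprB addrC addrA subrK.
  by move: zz0; rewrite -ball_normE /ball_ /= distrC.
move: (z : 'rV[R]_n) zz0 h1 h2 hdist => {}z _ h1 h2 hdist hz.
have hg : integral_rV (fun x => k t x * phiz z0 x) - (eta / 8) * integral_rV (kchi t)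
    <= integral_rV (fun x => k t x * phiz z x).
  have sup w : enorm (w - y) <= e -> supported (fun x => k t x * phiz w x) y (3 * e).
    move=> hw x hx; rewrite (_ : phiz w x = 0) ?mulr0//; apply: phi0; rewrite leNgt; apply/negP => h.
    have := e0; have := enorm_triangleB w x y; have := normr_le_enorm (x - y); linarith.
  apply: (@integral_rV_ge R n _ _ _ y (3 * e)); [exact: mulr_gt0|exact: kphi_uc|exact: kphi_uc|exact: kchi_uc| | | |].
  - exact: sup.
  - exact: sup.
  - by move=> x hx; rewrite /kchi bump0 ?mulr0//; apply: le_trans hx (normr_le_enorm _).
  move=> x; rewrite !k_phiz//.
  have := hdist x; have := kchi_ge0 x t0; rewrite ler_norml => c0 /andP[a1 a2].
  have [hp|hp] := eqVneq (phiz z0 x) 0.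
    have [hp'|hp'] := eqVneq (phiz z x) 0.
      rewrite hp hp' !mulr0 sub0r oppr_le0; apply: mulr_ge0 => //; exact: ltW.
    by rewrite {1}/kchi hp mulr0 sub0r; nlinarith.
  nlinarith.
have hy := hdist y.
move: h1 h2 hy; rewrite ler_norml /phiz => h1 h2 /andP[h3 h4].
rewrite /phiz in hg; have : eta / 8 * integral_rV (kchi t) <= eta / 4.
  by apply: (@le_trans _ _ (eta / 8 * 2)); [rewrite ler_wpM2l// ltW|linarith].
linarith.
Qed.

(** At a fixed positive time [k] is bounded and uniformly continuous near [y], so one mesh serves
    all translates. *)
Lemma rsum_uniform t eta B P : 0 < t -> 0 < eta -> 0 <= B -> 0 <= P ->
  (forall x, U x -> k t x <= B) -> (forall xi, phi xi <= P) ->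
  exists N0, forall N, (N0 <= N)%N -> (0 < N)%N -> forall z, enorm (z - y) <= e ->
    integral_rV (fun x => k t x * phi (x - z)) - eta <=
    rsum N (e / N%:R) (fun x => k t x * phi (x - z)) z.
Proof.
move=> t0 eta0 B0 P0 kB phiP.
have kcB x : `|kchi t x| <= B.
  rewrite ger0_norm ?kchi_ge0//; have [Ux|nUx] := pselect (U x).
    apply: (@le_trans _ _ (k t x)); last exact: kB.
    by rewrite /kchi ler_piMr ?bump_le1//; have /andP[] := kp t0 Ux.
  rewrite /kchi bump0 ?mulr0// leNgt; apply/negP => h; apply: nUx; apply: He; exact: ltW.
set q := n%:R * (2 * e) ^+ n * (B + P).
have q0 : 0 <= q.
  by apply: mulr_ge0; [apply: mulr_ge0 => //; apply: exprn_ge0; apply: mulr_ge0 => //; exact: ltW|exact: addr_ge0].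
have w0 : 0 < eta / (q + 1) by apply: divr_gt0 => //; exact: ltr_wpDl.
have [d1 d10 hd1] := kchi_uc t0 w0.
have [d2 d20 hd2] := phi_uc w0.
have dd : 0 < Num.min d1 d2 by rewrite lt_min d10.
exists (Num.bound (e / Num.min d1 d2)) => N leN N0 z hz.
have NR : 0 < N%:R :> R by rewrite ltr0n.
have NM : N%:R * (e / N%:R) = e by field; rewrite gt_eqF.
have small : e / N%:R < Num.min d1 d2.
  rewrite ltr_pdivrMr// mulrC -ltr_pdivrMr//.
  have := archi_boundP (ltW (divr_gt0 e0 dd)) => /lt_le_trans; apply.
  by rewrite ler_nat.
have := @rsum_approx R n (fun x => k t x * phi (x - z)) z (e / N%:R) ((B + P) * (eta / (q + 1))) N.
rewrite NM => h.
have : `|integral_rV (fun x => k t x * phi (x - z)) - rsum N (e / N%:R) (fun x => k t x * phi (x - z)) z| <= eta.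
  apply: le_trans (h _ _ _ _) _.
  - exact: divr_gt0.
  - exact: (kphi_uc t0 hz).
  - by move=> x hx; rewrite phi0 ?mulr0//; apply: le_trans hx (normr_le_enorm _).
  - move=> x x' xx'; have -> : k t x * phi (x - z) = kchi t x * phiz z x by exact: k_phiz.
    have -> : k t x' * phi (x' - z) = kchi t x' * phiz z x' by exact: k_phiz.
    have -> : kchi t x * phiz z x - kchi t x' * phiz z x' =
      kchi t x * (phiz z x - phiz z x') + phiz z x' * (kchi t x - kchi t x') by ring.
    apply: le_trans (ler_normD _ _) _; rewrite mulrDl; apply: lerD; rewrite normrM.
      apply: ler_pM => //; apply: hd2.
      rewrite opprB addrA subrK; apply: le_lt_trans xx' (lt_le_trans small _).
      by rewrite ge_min lexx orbT.
    apply: ler_pM => //; first by rewrite ger0_norm; [exact: phiP|exact: phi_ge0].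
    by apply: hd1; apply: le_lt_trans xx' (lt_le_trans small _); rewrite ge_min lexx.
  rewrite mulrA -/q; exact: mulr_frac_le.
rewrite ler_distl => /andP[]; linarith.
Qed.

End DiracStage.

(** * Families of balls in a convex set *)

Section BallAdmissible.
Variables (R : realType) (n : nat).
Implicit Types (c x y z : 'rV[R]_n) (r s e : R).
Variables (U : set 'rV[R]_n).

(** The margin [e] leaves room for translating points of the ball by vectors shorter than [e]
    without leaving [U]. *)
Definition ball_adm (r0 Rm e : R) c r : Prop :=
  [/\ r0 <= r, r <= Rm & eball c (r + e) `<=` U].

Lemma ball_adm_convex r0 Rm e c c' r r' s :
  (forall x y t, U x -> U y -> 0 <= t -> t <= 1 -> U (x + t *: (y - x))) ->
  0 < r0 -> 0 <= e -> ball_adm r0 Rm e c r -> ball_adm r0 Rm e c' r' -> 0 <= s -> s <= 1 ->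
  ball_adm r0 Rm e (c + s *: (c' - c)) (r + s * (r' - r)).
Proof.
move=> cU r00 e0 [h1 h2 h3] [h1' h2' h3'] s0 s1; split; [nra|nra|].
move=> z; rewrite /eball /=; set w := z - _ => hw.
set q := r + s * (r' - r) + e in hw; have q0 : 0 < q by apply: le_lt_trans (enorm_ge0 _) hw.
have inU d p : 0 < p -> eball d p `<=` U -> U (d + (p / q) *: w).
  move=> p0; apply; rewrite /eball /= addrC addKr enormZ ger0_norm; last by apply: divr_ge0; exact: ltW.
  by rewrite mulrAC ltr_pdivrMr// ltr_pM2l.
(* A point of the interpolated ball is the same convex combination of corresponding points of the
   two balls, obtained by rescaling the radius vector [w]. *)
have zE : z = c + ((r + e) / q) *: w + s *: (c' + ((r' + e) / q) *: w - (c + ((r + e) / q) *: w)).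
  have -> : z = (c + s *: (c' - c)) + w by rewrite /w addrC subrK.
  have -> : c' + ((r' + e) / q) *: w - (c + ((r + e) / q) *: w) = (c' - c) + ((r' - r) / q) *: w.
    rewrite opprD addrACA -scalerBl -mulrBl; congr (_ + (_ / _) *: _); ring.
  have E v : s *: (c' - c + v) = s *: (c' - c) + s *: v by rewrite scalerDr.
  rewrite E [RHS]addrACA scalerA -scalerDl; congr (_ + _).
  rewrite -[LHS]scale1r; congr (_ *: _).
  by rewrite mulrA -mulrDl -(divff (lt0r_neq0 q0)); congr (_ / _); rewrite /q; ring.
rewrite zE; apply: cU => //; apply: inU => //; lra.
Qed.

Lemma ball_adm_closed r0 Rm e : closed [set q : 'rV[R]_n * R | ball_adm r0 Rm e q.1 q.2].
Proof.
have cl (f : 'rV[R]_n * R -> R) : continuous f -> closed [set q | 0 <= f q].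
  move=> cf; apply: (@preimage_closed _ _ f [set r | 0 <= r]) => [q _|]; [exact: cf|exact: closed_ge].
have -> : [set q : 'rV[R]_n * R | ball_adm r0 Rm e q.1 q.2] =
  [set q | 0 <= q.2 - r0] `&` ([set q | 0 <= Rm - q.2] `&`
    \bigcap_(x in ~` U) [set q | 0 <= enorm (x - q.1) - (q.2 + e)]).
  apply/seteqP; split=> -[c r] /=.
    move=> [h1 h2 h3]; split; first by rewrite subr_ge0.
    split; first by rewrite subr_ge0.
    by move=> x /= nUx; rewrite subr_ge0 leNgt; apply/negP => h; apply: nUx; exact: h3.
  rewrite !subr_ge0 => -[h1 [h2 h3]]; split=> // x hx; apply: contrapT => nUx.
  by have := h3 x nUx; rewrite /= subr_ge0 leNgt => /negP; apply.
have c2 (q : 'rV[R]_n * R) : p.2 @[p --> q] --> q.2.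
  by case: q => a b; apply: (@cvg_snd _ _ (nbhs a) (nbhs b)).
have c1 (q : 'rV[R]_n * R) : p.1 @[p --> q] --> q.1.
  by case: q => a b; apply: (@cvg_fst _ _ (nbhs a) (nbhs b)).
apply: closedI; first by apply: cl => q; apply: cvgB; [exact: c2|exact: cvg_cst].
apply: closedI; first by apply: cl => q; apply: cvgB; [exact: cvg_cst|exact: c2].
apply: closed_bigI => x _; apply: cl => q; apply: cvgB.
  apply: (cvg_enorm (nbhs_filter q)).
  exact: (cvgB (cvg_cst x) (c1 q)).
by apply: cvgD; [exact: c2|exact: cvg_cst].
Qed.

End BallAdmissible.

Section ErrorTerms.
Variable R : realType.
Implicit Types (a b u v w h k e : R).

Lemma approx_chain a h u v w e : a <= h -> h - e <= u -> u - e <= v -> v - e <= w -> a - 3 * e <= w.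
Proof. by move=> *; lra. Qed.

Lemma approx_far a h w e : 0 <= w -> a <= h -> h <= e -> 0 < e -> a - 3 * e <= w.
Proof. by move=> *; lra. Qed.

Lemma approx_sum a b k e : a - 3 * e <= b -> 0 < e -> forall c, b <= c * (k + e) -> a <= c * k + (6 + c) * e.
Proof. by move=> h e0 c hb; lra. Qed.

Lemma time_shift e a t h : 0 < a -> a < e -> e <= h / 2 -> `|t - (t + (a - e))| < h.
Proof.
move=> a0 ae eh; have -> : t - (t + (a - e)) = e - a by ring.
by rewrite gtr0_norm ?subr_gt0//; lra.
Qed.

Lemma scales_le (e1 e rho ep t : R) : 0 < e -> 0 < rho -> 0 < t -> e1 <= e / 4 -> e1 <= rho / 2 -> ep <= t / 2 ->
  [/\ e1 <= e, e1 <= rho, ep <= t & 3 * e1 < e].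
Proof. by move=> *; split; lra. Qed.

End ErrorTerms.

(** * Lower bound from the Dirac condition *)

Section DiracLower.
Variables (R : realType) (n : nat).
Implicit Types (t s eta : R) (c x z w xi : 'rV[R]_n).
Variables (U : set 'rV[R]_n) (k : R -> 'rV[R]_n -> R) (y : 'rV[R]_n).
Hypotheses (n0 : (0 < n)%N) (oU : open U)
  (cU : forall x y t, U x -> U y -> 0 <= t -> t <= 1 -> U (x + t *: (y - x)))
  (hk : solves_heat_equation U k) (hd : dirac_initial U k y)
  (kp : forall t x, 0 < t -> U x -> 0 <= k t x <= heat_kernel t x y).

(** [K] averages [k] over a grid with weights [phi], the Gaussian of time [ep] cut off at radius
    [e1]. At the starting time [ep] of the comparison it is read off from [k] at the much smaller
    time [tau], where the Dirac condition gives about [phi (y - z)], hence about the heat kernel at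
    time [ep]. At time [t], continuity of [k] and the Gaussian mass lead back from [K] to [6 ^+ n]
    times [k]. *)
Theorem dirac_lower (r0 Rm e T1 t b : R) x c r c' r' : 0 < r0 -> 0 < e -> 0 < t ->
  Num.sqrt t <= T1 -> 0 < b ->
  ball_adm U r0 Rm e c' r' -> b <= paraboloid y c' r' ->
  ball_adm U r0 Rm e c r -> enorm (x - c) < r ->
  sub_kernel (profile_rate n r0 T1) (n%:R / r0) b t x y c r <= 6 ^+ n * k t x.
Proof.
move=> r00 e0 t0 tT b0 adm' hb adm xc.
have C0 : 0 <= n%:R / r0 by apply: divr_ge0 => //; exact: ltW.
have T10 : 0 <= T1 by apply: le_trans tT; exact: sqrtr_ge0.
have [r0r' _ U'] := adm'; have r'0 : 0 < r' := lt_le_trans r00 r0r'.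
have yc' : enorm (y - c') < r' by rewrite -(paraboloid_gt0 _ _ r'0); exact: lt_le_trans hb.
have Uy w : enorm (w - y) < e -> U w.
  by move=> hw; apply: U'; rewrite /eball /=; have := enorm_triangleB y w c'; lra.
have [r0r _ Uc] := adm; have rr0 : 0 < r := lt_le_trans r00 r0r.
have Ux : U x by apply: Uc; rewrite /eball /=; lra.
have p6 : 0 < 6 ^+ n :> R by rewrite exprn_gt0.
apply/ler_addgt0Pr => dl dl0.
set eta := dl / (6 + 6 ^+ n).
have eta0 : 0 < eta by apply: divr_gt0 => //; rewrite addr_gt0.
have etaE : dl = (6 + 6 ^+ n) * eta by rewrite /eta; field; apply: lt0r_neq0; rewrite addr_gt0.
have [rho rho0 hrho] : exists2 rho, 0 < rho & forall s w, `|t - s| < rho -> enorm (w - x) < rho ->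
    k s w <= k t x + eta.
  have /cvgrPdist_lt/(_ _ eta0) := caloric_continuous hk t0 Ux.
  move=> [[A B] /= [/nbhs_ballP[e1 /= e10 hA] /nbhs_eball[e2 e20 hB]] hAB].
  exists (Num.min e1 e2); first by rewrite lt_min e10.
  move=> s w; rewrite !lt_min => /andP[s1 _] /andP[_ w2].
  have := hAB (s, w) (conj (hA s s1) (hB w w2)); rewrite /= ltr_norml => /andP[]; lra.
set e1 := Num.min (e / 4) (rho / 2).
have e10 : 0 < e1 by rewrite lt_min !divr_gt0.
have e1e : e1 <= e / 4 by rewrite ge_min lexx.
have e1r : e1 <= rho / 2 by rewrite ge_min lexx orbT.
have b4 : 0 < e1 ^+ 2 / 4 by rewrite divr_gt0// exprn_gt0.
have [d d0 hdd] := heat_kernel_diag_small (0 : 'rV[R]_n) b4 eta0.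
set ep := Num.min (Num.min (d / 2) (t / 2)) (rho / 2).
have ep0 : 0 < ep by rewrite !lt_min !divr_gt0.
have epd : ep <= d / 2 by rewrite !ge_min lexx.
have ept : ep <= t / 2 by rewrite !ge_min lexx orbT.
have epr : ep <= rho / 2 by rewrite !ge_min lexx orbT.
(* The value of the Gaussian on the sphere of radius [e1]; subtracting it and taking the positive
   part gives a continuous weight supported in the ball. *)
pose Gm := heat_kernel ep (0 : 'rV[R]_n) 0 * expR (- (e1 ^+ 2 / 4 / ep)).
have Gm0 : 0 <= Gm by apply: mulr_ge0; [exact/ltW/heat_kernel_gt0|exact: expR_ge0].
have [e1e' e1rho ept' e13] := scales_le e0 rho0 t0 e1e e1r ept.
have Gme : Gm <= eta.
  by apply: hdd => //; apply: le_lt_trans epd _; rewrite ltr_pdivrMr// ltr_pMr// ltr1n.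
have hfar xi : e1 <= enorm xi -> heat_kernel ep xi 0 <= Gm.
  move=> hxi; rewrite heat_kernelE /Gm ler_pM2l ?heat_kernel_gt0// ler_expR lerN2 subr0 -enormE.
  rewrite -mulrA -invfM ler_pM2r ?invr_gt0 ?mulr_gt0//.
  by rewrite ler_sqr ?nnegrE ?enorm_ge0// ltW.
pose phi xi := Num.max 0 (heat_kernel ep xi 0 - Gm).
have cphi : continuous phi.
  move=> xi; apply: (@cvg_max0 R _ _ (nbhs_filter xi)); apply: (@cvgB _ _ _ _ (nbhs_filter xi)); last exact: cvg_cst.
  exact: (@cvg_heat_kernel R n _ _ (nbhs_filter xi) (fun=> ep) id ep xi 0 ep0 (cvg_cst ep) (@cvg_id _ (nbhs xi))).
have phi_ge0 xi : 0 <= phi xi by rewrite /phi le_max lexx.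
have phi0 xi : e1 <= enorm xi -> phi xi = 0.
  by move=> /hfar h; apply/max_idPl; rewrite subr_le0.
have phi_le xi : phi xi <= heat_kernel ep xi 0.
  by rewrite /phi ge_max (ltW (heat_kernel_gt0 _ _ ep0)) lerBlDr lerDl.
have phi_ge xi : heat_kernel ep xi 0 - eta <= phi xi.
  by rewrite le_max; apply/orP; right; rewrite lerD2l lerN2.
have He w : enorm (w - y) <= 3 * e1 -> U w by move=> hw; apply: Uy; exact: le_lt_trans e13.
have [tau [tau0 [tau_ep htau]]] : exists tau, 0 < tau /\ (tau < ep /\ forall z, enorm (z - y) <= e1 ->
    phi (y - z) - eta <= integral_rV (fun w => k tau w * phi (w - z))).
  have h := @dirac_uniform _ _ U k y hk hd kp e1 phi e10 He cphi phi0 eta eta0.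
  exact: (filter_ex (filterI (nbhs_right_gt (0 : R)) (filterI (nbhs_right_lt ep0) h))).
have [||||N1 hN1] := @rsum_uniform _ _ U k y hk kp e1 phi e10 He cphi phi0 phi_ge0 tau eta
   (heat_kernel tau y y) (heat_kernel ep (0 : 'rV[R]_n) 0) tau0 eta0.
- exact/ltW/heat_kernel_gt0.
- exact/ltW/heat_kernel_gt0.
- by move=> w Uw; have /andP[_ hw] := kp tau0 Uw; apply: le_trans hw (heat_kernel_le_diag _ _ _ tau0).
- by move=> xi; apply: le_trans (phi_le xi) (heat_kernel_le_diag _ _ _ ep0).
have sep : 0 < 2 * Num.sqrt ep by rewrite mulr_gt0// sqrtr_gt0.
pose N := (maxn N1 (Num.bound (e1 / (2 * Num.sqrt ep)))).+1.
have NR : 0 < N%:R :> R by rewrite ltr0n.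
pose h := e1 / N%:R; have h0 : 0 < h by rewrite divr_gt0.
have hsep : h <= 2 * Num.sqrt ep.
  rewrite /h ler_pdivrMr// mulrC -ler_pdivrMr//.
  apply: le_trans (ltW (archi_boundP _)) _; first by apply: divr_ge0; exact: ltW.
  by rewrite ler_nat; apply: leq_trans (leq_maxr N1 _) (leqnSn _).
have {}hN1 := hN1 N (leq_trans (leq_maxl N1 _) (leqnSn _)) isT.
(* The shift makes the comparison clock read [ep] when [k] is at time [tau]: there the averaged
   kernel resembles the heat kernel of time [ep]. *)
pose K s z := \sum_(xi <- grid N h n) (h ^+ n * phi xi) * k (s + (tau - ep)) (z + xi).
have hn0 : 0 <= h ^+ n by rewrite exprn_ge0// ltW.
have reachU z xi : (exists c r, ball_adm U r0 Rm e c r /\ enorm (z - c) < r) -> phi xi != 0 -> U (z + xi).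
  move=> [d' [q [[_ _ hU] hz]]] hphi; apply: hU; rewrite /eball /=.
  have : enorm xi < e1 by rewrite ltNge; apply/negP => /phi0 hp; rewrite hp eqxx in hphi.
  have -> : z + xi - d' = (z - d') + xi by rewrite addrAC.
  move=> hxi; apply: le_lt_trans (enorm_triangle _ _) _; exact: ltrD hz (lt_le_trans hxi e1e').
have later s : ep <= s -> 0 < s + (tau - ep).
  by move=> h1; rewrite addrCA ltr_wpDr ?subr_ge0.
have Kcal s z : ep <= s -> (exists c r, ball_adm U r0 Rm e c r /\ enorm (z - c) < r) -> caloric_at K s z.
  move=> hs hz; apply: caloric_at_sum => xi; have [hp|hp] := eqVneq (phi xi) 0.
    rewrite (_ : (fun _ _ => _) = fun _ _ => 0); first exact: caloric_at0.
    by apply/funext => s'; apply/funext => z'; rewrite hp mulr0 mul0r.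
  apply: caloric_atZ; apply: caloric_at_shift; apply: (solves_caloric_at oU hk); first exact: later.
  exact: reachU.
have K0 s z : ep <= s -> (exists c r, ball_adm U r0 Rm e c r /\ enorm (z - c) < r) -> 0 <= K s z.
  move=> hs hz; apply: sumr_ge0 => xi _; have [->|hp] := eqVneq (phi xi) 0; first by rewrite mulr0 mul0r.
  apply: mulr_ge0; first exact: mulr_ge0.
  by have /andP[] := kp (later s hs) (reachU _ _ hz hp).
have hQ : sub_kernel (profile_rate n r0 T1) (n%:R / r0) b t x y c r - 3 * eta <= K t x.
  apply: (@lower_comparison R n (ball_adm U r0 Rm e) r0 Rm n0 r00 _ _ _ K T1 ep t (3 * eta) b y c' r') => //.
  - by move=> ? ? [].
  - by move=> *; apply: ball_adm_convex => //; exact: ltW.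
  - exact: ball_adm_closed.
  - by apply: mulr_ge0 => //; exact: ltW.
  - by move=> s z s1 _ hz; exact: K0.
  - by move=> s z s1 _ hz; exact: (Kcal s z s1 hz).1.
  - by move=> s z s1 _ hz; exact: (Kcal s z (ltW s1) hz).2.
  move=> z d' q hadm hz.
  have hz' : exists c r, ball_adm U r0 Rm e c r /\ enorm (z - c) < r by exists d', q.
  have Q1 := @sub_kernel_le_heat R n (profile_rate n r0 T1) (n%:R / r0) b ep z y d' q ep0.
  have heq : heat_kernel ep z y = heat_kernel ep (y - z) 0.
    by rewrite /heat_kernel subr0 enormBC.
  (* Away from the pole the Gaussian itself is at most [eta], and [K >= 0] is enough. *)
  have [zy|zy] := leP (enorm (z - y)) e1; last first.
    have : heat_kernel ep (y - z) 0 <= Gm by apply: hfar; rewrite enormBC ltW.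
    rewrite -heq => far; exact: approx_far (K0 ep z (lexx _) hz') Q1 (le_trans far Gme) eta0.
  have KE : K ep z = rsum N h (fun w => k tau w * phi (w - z)) z.
    rewrite /K /rsum mulr_sumr; apply: eq_bigr => xi _.
    rewrite (_ : ep + (tau - ep) = tau); last by ring.
    by rewrite [z + xi - z]addrC addrA addNr add0r; ring.
  have := hN1 z zy; have := htau z zy; have := phi_ge (y - z); rewrite KE -/h -heq.
  exact: approx_chain Q1.
have hK : K t x <= 6 ^+ n * (k t x + eta).
  have kt0 : 0 <= k t x + eta by have /andP[k0 _] := kp t0 Ux; exact: addr_ge0 (ltW eta0).
  apply: (@le_trans _ _ (\sum_(xi <- grid N h n) (h ^+ n * phi xi) * (k t x + eta))).
    apply: ler_sum => xi _; have [->|hp] := eqVneq (phi xi) 0; first by rewrite mulr0 !mul0r.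
    apply: ler_wpM2l; first exact: mulr_ge0.
    have hxi : enorm xi < e1 by rewrite ltNge; apply/negP => /phi0 hp'; rewrite hp' eqxx in hp.
    apply: hrho; last by rewrite addrC addKr; exact: lt_le_trans e1rho.
    exact: time_shift tau_ep epr.
  rewrite -mulr_suml; apply: ler_wpM2r => //.
  apply: le_trans (heat_kernel_mass n N ep0 h0 hsep).
  rewrite /rsum -mulr_sumr; apply: ler_wpM2l => //.
  by apply: ler_sum => xi _; rewrite add0r.
by rewrite etaE; exact: approx_sum hQ eta0 _ hK.
Qed.

End DiracLower.

(** * Restarting at intermediate points *)

Section Restart.
Variables (R : realType) (n : nat).
Implicit Types (t s v : R) (c x z w y : 'rV[R]_n).

(** By [exp v >= 1 + v], the right-hand side is at least [v / (1 + v)]. *)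
Lemma one_minus_expR_ge v : 0 <= v -> Num.min 1 v / 2 <= 1 - expR (- v).
Proof.
move=> v0; have h := expR_ge1Dx v.
have e0 := expR_gt0 v.
have : expR (- v) <= (1 + v)^-1 by rewrite expRN lef_pV2 ?posrE//; lra.
have h2 : (1 + v)^-1 * (1 + v) = 1 by apply: mulVf; apply: lt0r_neq0; lra.
move: (_^-1) h2 => i h2 hi; have i0 : 0 <= i by nra.
have [h3|h3] := leP 1 v; nra.
Qed.

Lemma one_minus_expR_le v : 0 <= v -> 1 - expR (- v) <= Num.min 1 v.
Proof.
move=> v0; have h := expR_ge1Dx (- v); have e0 := expR_gt0 (- v).
by rewrite le_min; apply/andP; split; lra.
Qed.

Lemma minr_scale (q v : R) : 0 <= q -> q <= 1 -> 0 <= v -> q * Num.min 1 v <= Num.min 1 (q * v).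
Proof.
move=> q0 q1 v0; have m1 : Num.min 1 v <= 1 by rewrite ge_min lexx.
have m2 : Num.min 1 v <= v by rewrite ge_min lexx orbT.
have m0 : 0 <= Num.min 1 v by rewrite le_min v0 ler01.
by rewrite le_min; apply/andP; split; nra.
Qed.

Lemma sub_kernel_ge (m kap b t T1 : R) x y c r : 0 < t -> 0 <= b -> 0 <= kap -> 0 <= m ->
  Num.sqrt t <= T1 -> 0 <= paraboloid x c r ->
  expR (- (m * T1)) / 2 * (heat_kernel t x y * Num.min 1 (b * paraboloid x c r / t)) <=
  sub_kernel m kap b t x y c r.
Proof.
move=> t0 b0 k0 m0 tT p0; rewrite /sub_kernel mulrCA ler_pM2l ?heat_kernel_gt0//.
set D := expR (- (m * T1)); set ph := paraboloid x c r in p0 *.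
have D0 : 0 < D by exact: expR_gt0.
have T0 : 0 <= T1 by apply: le_trans tT; exact: sqrtr_ge0.
have D1 : D <= 1 by rewrite /D -expR0 ler_expR oppr_le0 mulr_ge0.
have bt : 0 <= b / t by apply: divr_ge0 => //; exact: ltW.
have v0 : 0 <= b * ph / t by rewrite mulrAC mulr_ge0.
have hp : D * ph <= profile m kap t ph.
  apply: le_trans (profile_low m t p0 k0); rewrite ler_wpM2r// ler_expR lerN2.
  by rewrite ler_wpM2l.
apply: (@le_trans _ _ (1 - expR (- (D * (b * ph / t))))).
  apply: le_trans (one_minus_expR_ge _); last by rewrite mulr_ge0// ltW.
  rewrite mulrAC ler_pM2r ?invr_gt0//; exact: minr_scale (ltW D0) D1 v0.
rewrite lerD2l lerN2 ler_expR mulNr lerN2.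
have -> : D * (b * ph / t) = b / t * (D * ph) by ring.
exact: ler_wpM2l.
Qed.

Lemma paraboloid_lip z w c r : 0 < r -> enorm (w - c) <= r -> enorm (z - w) <= r ->
  paraboloid w c r - 2 * enorm (z - w) <= paraboloid z c r.
Proof.
move=> r0 wc zw; rewrite /paraboloid.
have -> : z - c = (z - w) + (w - c) by rewrite addrA subrK.
move: (z - w) zw => u zw; move: (w - c) wc => q wc.
rewrite !dotvE [dotv u q]dotvC.
have h := dotv_le q u; have h0 := enorm_ge0 u; have h1 := enorm_ge0 q.
rewrite -!enormE.
move: (enorm u) (enorm q) (dotv q u) zw wc h h0 h1 => a b d zw wc h h0 h1.
have -> : a ^+ 2 + d + (d + b ^+ 2) = b ^+ 2 + (2 * d + a ^+ 2) by ring.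
rewrite [(b ^+ 2 + _) / _]mulrDl [- (b ^+ 2 / _ + _)]opprD addrA lerD2l lerN2.
by rewrite ler_pdivrMr ?mulr_gt0//; nra.
Qed.

Lemma paraboloid_half z w c r h : 0 < r -> enorm (w - c) < r -> 0 < h -> h <= paraboloid w c r ->
  enorm (z - w) <= h / 4 -> h / 2 <= paraboloid z c r.
Proof.
move=> r0 wc h0 hw zw; have hr : h <= r.
  by apply: le_trans hw _; apply: le_trans (paraboloid_le r0 wc) _; rewrite gerBl enorm_ge0.
by have := paraboloid_lip r0 (ltW wc) (ltac:(lra) : enorm (z - w) <= r); lra.
Qed.

Lemma half_le_minr (u v w : R) : 0 < u -> u <= 1 -> u <= v -> v / 2 <= w -> u / 2 <= Num.min 1 w.
Proof. by move=> u0 u1 uv vw; rewrite le_min; apply/andP; split; lra. Qed.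

(* With [z = m + w], the exponents along the straight line of velocity [v] differ
   exactly by [|w|^2/4B - |w|^2/4A]. *)
Lemma heat_kernel_refocus (A B : R) (Y m0 m z v : 'rV[R]_n) : 0 < B -> 2 * B <= A ->
  m = Y + A *: v -> m = m0 + B *: v ->
  heat_kernel A m Y / heat_kernel B m m0 * heat_kernel B z m0 * expR (enorm (z - m) ^+ 2 / (8 * B)) <=
  heat_kernel A z Y.
Proof.
move=> B0 BA mA mB; have A0 : 0 < A by lra.
have mA' : m - Y = A *: v by rewrite mA addrC addKr.
have mB' : m - m0 = B *: v by rewrite mB addrC addKr.
have zA : z - Y = (z - m) + A *: v by rewrite -mA' addrA subrK.
have zB : z - m0 = (z - m) + B *: v by rewrite -mB' addrA subrK.
rewrite /heat_kernel zA zB mA' mB' !enormE; move: (z - m) => w; rewrite !dotvE.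
have pp s : 0 < s -> 0 < (4 * pi * s) `^ (- (n%:R / 2)).
  by move=> s0; rewrite powR_gt0// !mulr_gt0// pi_gt0.
move: (pp A A0) (pp B B0); move: (_ `^ _) => PA; move: ((4 * pi * B) `^ _) => PB PA0 PB0.
rewrite [dotv v w]dotvC.
move: (dotv w w) (dotv w v) (dotv v v) (dotvv_ge0 w) => ww wv vv ww0.
set eA := expR (- ((A * (A * vv)) / (4 * A))); set eB := expR (- ((B * (B * vv)) / (4 * B))).
have eB0 : 0 < eB by exact: expR_gt0.
set e1 := expR _; set e2 := expR _; set e3 := expR _.
have -> : PA * eA / (PB * eB) * (PB * e1) * e2 = PA * (eA * e1 * e2 / eB).
  by field; rewrite !gt_eqF.
rewrite ler_pM2l// ler_pdivrMr// /eA /e1 /e2 /e3 /eB -!expRD ler_expR.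
have i1 : A^-1 * 2 <= B^-1 by rewrite mulrC ler_pdivrMr// mulrC ler_pdivlMr.
have hw : ww / (4 * A) <= ww / (8 * B).
  rewrite ler_wpM2l// lef_pV2 ?posrE ?mulr_gt0//; lra.
have -> : - ((ww + B * wv + (B * wv + B * (B * vv))) / (4 * B)) =
    - (ww / (4 * B)) - wv / 2 - B * vv / 4 by field; rewrite gt_eqF.
have -> : - ((ww + A * wv + (A * wv + A * (A * vv))) / (4 * A)) =
    - (ww / (4 * A)) - wv / 2 - A * vv / 4 by field; rewrite gt_eqF.
have -> : A * (A * vv) / (4 * A) = A * vv / 4 by field; rewrite gt_eqF.
have -> : B * (B * vv) / (4 * B) = B * vv / 4 by field; rewrite gt_eqF.
have -> : ww / (4 * B) = 2 * (ww / (8 * B)) by field; rewrite gt_eqF.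
lra.
Qed.

Variables (U : set 'rV[R]_n) (r0 Rm : R).
Hypotheses (n0 : (0 < n)%N) (oU : open U)
  (cU : forall x y t, U x -> U y -> 0 <= t -> t <= 1 -> U (x + t *: (y - x)))
  (r00 : 0 < r0).
Local Notation adm := (ball_adm U r0 Rm 0).

(** [256 = 2 * 128]: the 2 comes from [sub_kernel_ge], and [128 = 4^2 * 8] from inserting
    [|z - m| >= dm / 4] into the exponent [|z - m|^2 / (8 * B)]. *)
Definition restart_const (T1 : R) : R := expR (- (profile_rate n r0 T1 * T1)) / 256.

Lemma restart_const_gt0 T1 : 0 < restart_const T1.
Proof. by rewrite divr_gt0 ?expR_gt0 ?ltr0n. Qed.

(* The lower bound [H] for the pole [(sa, Y)] is converted into one for the pole
   [(s0, m0)].  Near [m] use the ball [(cm, Rc)]; far from [m] the gain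
   [exp (|z-m|^2/8B)] of [heat_kernel_refocus] compensates for the lost factor. *)
Lemma restart (K : R -> 'rV[R]_n -> R) T1 (sa s0 s1 s2 C bY dm b0 : R)
    (Y m0 m vel cm c0 : 'rV[R]_n) (rm rc : R) :
  0 <= sa -> sa < s0 -> s0 < s1 -> s1 <= s2 -> Num.sqrt (s2 - s0) <= T1 ->
  2 * (s1 - s0) <= s1 - sa -> m = Y + (s1 - sa) *: vel -> m = m0 + (s1 - s0) *: vel ->
  adm cm rm -> enorm (m - cm) < rm -> 0 < dm -> dm <= paraboloid m cm rm -> 0 < b0 -> b0 <= dm ->
  adm c0 rc -> b0 <= paraboloid m0 c0 rc -> 0 < C -> 0 < bY ->
  (forall s x, 0 < s -> U x -> 0 <= K s x) -> (forall s x, 0 < s -> U x -> caloric_at K s x) ->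
  (forall z c r, adm c r -> enorm (z - c) < r ->
     C * (heat_kernel (s1 - sa) z Y * Num.min 1 (bY * paraboloid z c r / (s1 - sa))) <= K s1 z) ->
  forall x c r, adm c r -> enorm (x - c) < r ->
    restart_const T1 * C * (heat_kernel (s1 - sa) m Y / heat_kernel (s1 - s0) m m0) *
      Num.min 1 (bY * dm / (s1 - sa)) *
      (heat_kernel (s2 - s0) x m0 * Num.min 1 (b0 * paraboloid x c r / (s2 - s0))) <= K s2 x.
Proof.
move=> sa0 sas0 s01 s12 hT hB mA mB admm mcm dm0 hdm b00 b0d adm0 hb0 C0 bY0 K0 Kcal H x c r admx xc.
have C' : 0 <= n%:R / r0 by apply: divr_ge0 => //; exact: ltW.
have T10 : 0 <= T1 by apply: le_trans hT; exact: sqrtr_ge0.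
set A := s1 - sa in hB mA H *; set B := s1 - s0 in hB mB *.
have A0 : 0 < A by rewrite subr_gt0; exact: lt_trans s01.
have B0 : 0 < B by rewrite subr_gt0.
set G := heat_kernel A m Y / heat_kernel B m m0.
have G0 : 0 < G by rewrite divr_gt0 ?heat_kernel_gt0.
set mu := Num.min 1 (bY * dm / A).
have mu0 : 0 < mu by rewrite lt_min ltr01 divr_gt0// mulr_gt0.
have mu1 : mu <= 1 by rewrite ge_min lexx.
have mu2 : mu <= bY * dm / A by rewrite ge_min lexx orbT.
set M := profile_rate n r0 T1; have M0 : 0 <= M by apply: le_trans (profile_rate_ge n r00 T10); rewrite mulr_ge0.
set C1 := C * G * mu / 128; have C10 : 0 < C1 by apply: divr_gt0 => //; do 2!apply: mulr_gt0 => //.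
have inU z : (exists c r, adm c r /\ enorm (z - c) < r) -> U z.
  by move=> [d [q [[_ _ h] hz]]]; apply: h; rewrite /eball /= addr0.
have shift s : B <= s -> 0 < s + s0.
  by move=> Bs; apply: addr_gt0; [exact: lt_le_trans Bs|exact: le_lt_trans sas0].
(* The clock of this comparison starts at [s0], where the new pole sits, but the comparison begins
   at clock time [B], that is at [s1], where [H] applies. *)
have hQ : sub_kernel M (n%:R / r0) b0 (s2 - s0) x m0 c r - 0 <= C1^-1 * K (s2 - s0 + s0) x.
  apply: (@lower_comparison R n adm r0 Rm n0 r00 _ _ _ (fun s z => C1^-1 * K (s + s0) z) T1 B (s2 - s0) 0 b0 m0 c0 rc) => //.
  - by move=> ? ? [].
  - by move=> *; apply: ball_adm_convex.
  - exact: ball_adm_closed.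
  - by rewrite /B lerD2r.
  - move=> s z h1 _ hz; apply: mulr_ge0; first by rewrite invr_ge0 ltW.
    by apply: K0 (inU _ hz); exact: shift s h1.
  - move=> s z h1 _ hz; have sp := shift s h1.
    have := caloric_atZ C1^-1 (@caloric_at_shift R n K s z s0 0 _); rewrite addr0 => /(_ (Kcal _ _ sp (inU _ hz)))[+ _].
    rewrite addr0; apply: cvg_trans; rewrite (_ : (fun q => _) = (fun q : R * 'rV[R]_n => C1^-1 * K (q.1 + s0) (q.2 + 0)))//.
    by apply/funext => q; rewrite addr0.
  - move=> s z h1 _ hz; have sp := shift s (ltW h1).
    have := caloric_atZ C1^-1 (@caloric_at_shift R n K s z s0 0 _); rewrite addr0 => /(_ (Kcal _ _ sp (inU _ hz)))[_ [G' [L [h3 h4]]]].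
    exists G', L; split.
      by move: h3; rewrite addr0.
    by apply: jet_ext h4 => z'; rewrite addr0.
  move=> z d q admz zd; rewrite subr0 -/M (_ : B + s0 = s1); last by rewrite /B subrK.
  rewrite [C1^-1 * _]mulrC ler_pdivlMr//.
  have rq : 0 < q by have [h _ _] := admz; exact: lt_le_trans h.
  have rmp : 0 < rm by have [h _ _] := admm; exact: lt_le_trans h.
  have ph0 : 0 < paraboloid z d q by rewrite paraboloid_gt0.
  set ph := paraboloid z d q in ph0 *.
  have hk0 : 0 < heat_kernel B z m0 by exact: heat_kernel_gt0.
  set th := Num.min 1 (b0 * ph / B).
  have th1 : th <= 1 by rewrite ge_min lexx.
  have th2 : th <= b0 * ph / B by rewrite ge_min lexx orbT.
  have th0 : 0 <= th by rewrite le_min ler01 divr_ge0// ?mulr_ge0// ltW.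
  have Qle : sub_kernel M (n%:R / r0) b0 B z m0 d q <= heat_kernel B z m0 * th.
    rewrite /sub_kernel ler_pM2l//.
    have hpr : 0 <= profile M (n%:R / r0) B ph.
      by apply: le_trans (profile_low M B (ltW ph0) C'); rewrite mulr_ge0 ?expR_ge0// ltW.
    rewrite mulNr; apply: le_trans (one_minus_expR_le _) _; first by rewrite mulr_ge0// divr_ge0// ltW.
    have hle : b0 / B * profile M (n%:R / r0) B ph <= b0 * ph / B.
      rewrite [b0 * ph / B]mulrAC; apply: ler_wpM2l; first by apply: divr_ge0; exact: ltW.
      by apply: profile_le => //; [exact: ltW|exact: profile_rate_ge].
    rewrite /th -/ph le_min; apply/andP; split; first by rewrite ge_min lexx.
    by apply: le_trans hle; rewrite ge_min lexx orbT.
  apply: le_trans (ler_wpM2r (ltW C10) Qle) _.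
  have ref := heat_kernel_refocus z B0 hB mA mB; rewrite -/G in ref.
  set E := expR _ in ref.
  have E1 : 1 + enorm (z - m) ^+ 2 / (8 * B) <= E by exact: expR_ge1Dx.
  set W := enorm (z - m) in E1 *; have W0 : 0 <= W by exact: enorm_ge0.
  have WB : 0 <= W ^+ 2 / (8 * B) by rewrite divr_ge0 ?exprn_ge0// mulr_ge0// ltW.
  have [near|far] := leP W (dm / 4).
    have hph := paraboloid_half rmp mcm dm0 hdm near.
    have zcm : enorm (z - cm) < rm.
      by rewrite -paraboloid_gt0//; apply: lt_le_trans hph; rewrite divr_gt0.
    apply: le_trans (H z cm rm admm zcm).
    have hmin : mu / 2 <= Num.min 1 (bY * paraboloid z cm rm / A).
      apply: half_le_minr mu0 mu1 mu2 _.
      have h1 : bY * dm / A / 2 <= bY * paraboloid z cm rm / A.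
        by rewrite mulrAC ler_pM2r ?invr_gt0// -mulrA ler_pM2l.
      exact: h1.
    have h2 : G * heat_kernel B z m0 <= heat_kernel A z Y.
      apply: le_trans ref; apply: ler_peMr; first by apply: mulr_ge0; exact: ltW.
      by apply: le_trans E1; rewrite lerDl.
    have h3 : G * heat_kernel B z m0 * (mu / 2) <= heat_kernel A z Y * Num.min 1 (bY * paraboloid z cm rm / A).
      apply: ler_pM => //; first by rewrite mulr_ge0// ltW.
      by rewrite divr_ge0// ltW.
    have GH : 0 < G * heat_kernel B z m0 * C by do 2!apply: mulr_gt0 => //.
    apply: le_trans (ler_wpM2l (ltW C0) h3).
    have -> : heat_kernel B z m0 * th * C1 = (G * heat_kernel B z m0 * C) * (mu * th / 128) by rewrite /C1; ring.
    have -> : C * (G * heat_kernel B z m0 * (mu / 2)) = (G * heat_kernel B z m0 * C) * (mu / 2) by ring.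
    by rewrite ler_pM2l//; clear - mu0 mu1 th0 th1; nra.
  apply: le_trans (H z d q admz zd); rewrite -/ph.
  apply: (@le_trans _ _ (C * ((G * heat_kernel B z m0 * E) * Num.min 1 (bY * ph / A)))); last first.
    rewrite ler_pM2l// ler_wpM2r// le_min ler01 divr_ge0// ?mulr_ge0// ltW//.
  have GH : 0 < G * heat_kernel B z m0 * C by do 2!apply: mulr_gt0 => //.
  have -> : heat_kernel B z m0 * th * C1 = (G * heat_kernel B z m0 * C) * (mu * th / 128) by rewrite /C1; ring.
  have -> : C * (G * heat_kernel B z m0 * E * Num.min 1 (bY * ph / A)) =
    (G * heat_kernel B z m0 * C) * (E * Num.min 1 (bY * ph / A)) by ring.
  rewrite ler_pM2l//; have [h1|h1] := leP 1 (bY * ph / A).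
    by rewrite mulr1; clear - mu0 mu1 th0 th1 E1 WB; nra.
  have bp : 0 < bY * ph / A by rewrite divr_gt0// mulr_gt0.
  (* Far from [m] the exponential gain is used through its linear term [W^2 / (8 * B)]. Both minima
     are replaced by their second arguments, and [b0 <= dm] makes the powers of [dm] match. *)
  apply: (@le_trans _ _ (W ^+ 2 / (8 * B) * (bY * ph / A))); last first.
    by rewrite ler_pM2r//; apply: le_trans E1; rewrite lerDr.
  apply: (@le_trans _ _ ((bY * dm / A) * (dm * ph / B) / 128)).
    rewrite ler_pM2r ?invr_gt0//; apply: ler_pM => //; first exact: ltW.
    apply: le_trans th2 _; rewrite ler_pM2r ?invr_gt0// ler_pM2r//.
  have -> : bY * dm / A * (dm * ph / B) / 128 = (dm / 4) ^+ 2 / (8 * B) * (bY * ph / A).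
    by field; rewrite !gt_eqF.
  rewrite ler_pM2r// ler_pM2r ?invr_gt0 ?mulr_gt0// ler_sqr ?nnegrE//; first exact: ltW.
  by apply: divr_ge0 => //; exact: ltW.
move: hQ; rewrite subr0 subrK => hQ.
have s20 : 0 < s2 - s0 by rewrite subr_gt0; exact: lt_le_trans s12.
have rr : 0 < r by have [h _ _] := admx; exact: lt_le_trans h.
have phx : 0 <= paraboloid x c r by apply: ltW; rewrite paraboloid_gt0.
have := @sub_kernel_ge M (n%:R / r0) b0 (s2 - s0) T1 x m0 c r s20 (ltW b00) C' M0 hT phx.
move=> /le_trans/(_ hQ); rewrite [C1^-1 * _]mulrC ler_pdivlMr//; apply: le_trans.
rewrite le_eqVlt; apply/orP; left; apply/eqP; rewrite /restart_const -/M /C1; by field.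
Qed.

End Restart.

(** * Two restarts along a segment *)

Section LowerBounds.
Variables (R : realType) (n : nat).
Implicit Types (t s a b : R) (c x z w y : 'rV[R]_n).

Lemma minr_mono (u v : R) : u <= v -> Num.min 1 u <= Num.min 1 v.
Proof. by move=> uv; rewrite le_min !ge_min lexx uv !orbT. Qed.

Lemma minr_ge (q u v : R) : 0 <= q -> q <= 1 -> 0 <= v -> q * v <= u ->
  q * Num.min 1 v <= Num.min 1 u.
Proof. by move=> q0 q1 v0 /minr_mono; apply: le_trans; exact: minr_scale. Qed.

Lemma chain_times t a b : 0 < t -> 0 < a -> a <= 1 / 4 -> 0 < b -> b <= 1 / 4 ->
  [/\ [/\ a * t < 3 / 2 * a * t, 3 / 2 * a * t <= (1 - b / 2) * t, (1 - b / 2) * t - a * t <= t,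
          2 * (3 / 2 * a * t - a * t) <= 3 / 2 * a * t - 0 & 3 / 2 * a * t <= t],
      [/\ a * t < (1 - b) * t, (1 - b) * t < (1 - b / 2) * t, (1 - b / 2) * t <= t,
          t - (1 - b) * t <= t &
          2 * ((1 - b / 2) * t - (1 - b) * t) <= (1 - b / 2) * t - a * t],
      0 < (1 - b / 2 - a) * t & (1 - b / 2 - a) * t <= t].
Proof.
move=> t0 a0 a4 b0 b4; have bt : 0 < b * t by exact: mulr_gt0.
have att : 0 < a * t by exact: mulr_gt0.
have : a * t <= 1 / 4 * t by rewrite ler_pM2r.
have : b * t <= 1 / 4 * t by rewrite ler_pM2r.
by move=> h1 h2; split; [split|split| |]; lra.
Qed.

Lemma chain_params a b : 0 < a -> a <= 1 / 4 -> 0 < b -> b <= 1 / 4 ->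
  [/\ 0 <= a /\ a <= 1, 0 <= 3 / 2 * a /\ 3 / 2 * a <= 1, 0 <= 1 - b /\ 1 - b <= 1 &
      0 <= 1 - b / 2 /\ 1 - b / 2 <= 1].
Proof. by move=> a0 a4 b0 b4; do !split; lra. Qed.

(** The three factors lose 6, 4 and 4, owing to the halved depths and the changed times; [96] is the
    product. *)
Lemma chain_mins t a b u v u' v' dA dB : 0 < t -> 0 < a -> 0 < b ->
  0 < (1 - b / 2 - a) * t -> (1 - b / 2 - a) * t <= t ->
  0 < u -> 0 < v -> 0 < dA -> 0 < dB -> u / 2 <= u' -> v / 2 <= v' ->
  0 <= Num.min 1 (u * dA / (a * t)) * Num.min 1 (dA * dB / t) * Num.min 1 (dB * v / (b * t)) /\
  96^-1 * (Num.min 1 (u * dA / (a * t)) * Num.min 1 (dA * dB / t) * Num.min 1 (dB * v / (b * t))) <=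
  Num.min 1 (u' * (dA / 2) / (3 / 2 * a * t)) * Num.min 1 (dA / 2 * (dB / 2) / ((1 - b / 2 - a) * t)) *
  Num.min 1 (dB / 2 * v' / (b * t)).
Proof.
move=> t0 a0 b0 m0 mt u0 v0 A0 B0 uu vv.
have att : 0 < a * t by exact: mulr_gt0.
have bt : 0 < b * t by exact: mulr_gt0.
have w1 : 0 <= u * dA / (a * t) by rewrite divr_ge0 ?mulr_ge0// ltW.
have w2 : 0 <= dA * dB / t by rewrite divr_ge0 ?mulr_ge0// ltW.
have w3 : 0 <= dB * v / (b * t) by rewrite divr_ge0 ?mulr_ge0// ltW.
have pos (w : R) : 0 <= w -> 0 <= Num.min 1 w by move=> w0; rewrite le_min ler01.
have [[p1 p2] p3] := (pos _ w1, pos _ w2, pos _ w3).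
have q6 : 0 <= (6^-1 : R) <= 1 by rewrite invr_ge0 invf_le1// ler1n ler0n.
have q4 : 0 <= (4^-1 : R) <= 1 by rewrite invr_ge0 invf_le1// ler1n ler0n.
case/andP: q6 => q60 q61; case/andP: q4 => q40 q41.
have h1 : 6^-1 * Num.min 1 (u * dA / (a * t)) <= Num.min 1 (u' * (dA / 2) / (3 / 2 * a * t)).
  apply: minr_ge q60 q61 w1 _.
  have -> : 6^-1 * (u * dA / (a * t)) = u / 2 * (dA / 2) / (3 / 2 * a * t).
    by field; rewrite !gt_eqF.
  rewrite ler_pM2r ?invr_gt0; last by rewrite -mulrA mulr_gt0// divr_gt0.
  by rewrite ler_pM2r// divr_gt0.
have h2 : 4^-1 * Num.min 1 (dA * dB / t) <= Num.min 1 (dA / 2 * (dB / 2) / ((1 - b / 2 - a) * t)).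
  apply: minr_ge q40 q41 w2 _.
  have -> : 4^-1 * (dA * dB / t) = dA / 2 * (dB / 2) / t by field; rewrite !gt_eqF.
  by rewrite ler_pM2l ?lef_pV2 ?posrE// mulr_gt0// divr_gt0.
have h3 : 4^-1 * Num.min 1 (dB * v / (b * t)) <= Num.min 1 (dB / 2 * v' / (b * t)).
  apply: minr_ge q40 q41 w3 _.
  have -> : 4^-1 * (dB * v / (b * t)) = dB / 2 * (v / 2) / (b * t) by field; rewrite !gt_eqF.
  by rewrite ler_pM2r ?invr_gt0// ler_pM2l// divr_gt0.
move: p1 p2 p3 h1 h2 h3; set u1 := Num.min 1 _; set u2 := Num.min 1 _; set u3 := Num.min 1 _.
move=> p1 p2 p3 h1 h2 h3; split; first by apply: mulr_ge0 => //; exact: mulr_ge0.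
have -> : 96^-1 * (u1 * u2 * u3) = (6^-1 * u1) * (4^-1 * u2) * (4^-1 * u3) by field.
have r1 := mulr_ge0 q60 p1; have r2 := mulr_ge0 q40 p2; have r3 := mulr_ge0 q40 p3.
by apply: ler_pM (mulr_ge0 r1 r2) r3 _ h3; exact: ler_pM.
Qed.

Lemma chain_combine (c e H f G1 G2 G3 m1 m2 m3 u : R) : 0 <= e -> 0 <= H -> 0 <= u ->
  H <= G1 * G2 * G3 -> 96^-1 * u <= m1 * m2 * m3 ->
  f = c ^+ 2 * e * H / 96 ->
  f * u <= c * (c * e * G1 * m1) * G2 * m2 * (G3 * m3).
Proof.
move=> e0 H0 u0 hG hm ->.
have -> : c ^+ 2 * e * H / 96 * u = c ^+ 2 * e * (H * (96^-1 * u)) by field.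
have -> : c * (c * e * G1 * m1) * G2 * m2 * (G3 * m3) =
  c ^+ 2 * e * ((G1 * G2 * G3) * (m1 * m2 * m3)) by ring.
apply: ler_wpM2l; first by apply: mulr_ge0 => //; exact: sqr_ge0.
by apply: ler_pM => //; rewrite mulr_ge0// invr_ge0 ler0n.
Qed.

Lemma heat_kernel_line s (v p q : 'rV[R]_n) : 0 < s -> p - q = s *: v ->
  heat_kernel s p q = (4 * pi * s) `^ (- (n%:R / 2)) * expR (- (s * dotv v v / 4)).
Proof.
move=> s0 pq; rewrite /heat_kernel pq enormE !dotvE; congr (_ * expR (- _)).
by field; rewrite gt_eqF.
Qed.

Lemma heat_prefactorM (l s : R) : 0 < l -> 0 < s ->
  (4 * pi * (l * s)) `^ (- (n%:R / 2)) = l `^ (- (n%:R / 2)) * (4 * pi * s) `^ (- (n%:R / 2)).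
Proof.
move=> l0 s0; rewrite -powRM; [|exact: ltW|].
  by congr (_ `^ _); ring.
by apply: mulr_ge0; [apply: mulr_ge0 => //; exact: pi_ge0|exact: ltW].
Qed.

Definition refocus_const : R := 3 `^ (- (n%:R / 2)) * 2 `^ (- (n%:R / 2)).

Lemma refocus_const_gt0 : 0 < refocus_const.
Proof. by rewrite mulr_gt0// powR_gt0. Qed.

Let L y x s : 'rV[R]_n := y + s *: (x - y).

(** All the points lie on the line run with velocity [(x - y) / t], along which the exponents are
    linear in the elapsed time and add up exactly. Only the prefactors remain: the time ratios 3 and
    2 give [refocus_const], and the middle duration, being at most [t], only helps. *)
Lemma heat_kernel_chain t a b x y : 0 < t -> 0 < a -> a <= 1 / 4 -> 0 < b -> b <= 1 / 4 ->
  refocus_const * heat_kernel t x y <=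
  heat_kernel (3 / 2 * a * t) (L y x (3 / 2 * a)) y /
    heat_kernel (1 / 2 * a * t) (L y x (3 / 2 * a)) (L y x a) *
  (heat_kernel ((1 - b / 2 - a) * t) (L y x (1 - b / 2)) (L y x a) /
    heat_kernel (b / 2 * t) (L y x (1 - b / 2)) (L y x (1 - b))) *
  heat_kernel (b * t) x (L y x (1 - b)).
Proof.
move=> t0 a0 a4 b0 b4.
have ab : 0 < 1 - b / 2 - a by lra.
set v := t^-1 *: (x - y).
have vE s : (s * t) *: v = s *: (x - y) by rewrite /v scalerA mulfK ?gt_eqF.
have LL s s' : L y x s - L y x s' = ((s - s') * t) *: v.
  by rewrite vE /L opprD addrACA subrr add0r -scalerBl.
have Ly s : L y x s - y = (s * t) *: v by rewrite vE /L addrC addKr.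
have xL s : x - L y x s = ((1 - s) * t) *: v.
  by rewrite vE /L scalerBl scale1r opprD addrA.
have xy : x - y = t *: v by rewrite -[t]mul1r vE scale1r.
rewrite (heat_kernel_line t0 xy).
rewrite (@heat_kernel_line (3 / 2 * a * t) v); [|by rewrite !mulr_gt0|exact: Ly].
rewrite (@heat_kernel_line (1 / 2 * a * t) v); [|by rewrite !mulr_gt0|rewrite LL; congr (_ *: _); by field].
rewrite (@heat_kernel_line ((1 - b / 2 - a) * t) v); [|by rewrite mulr_gt0|exact: LL].
rewrite (@heat_kernel_line (b / 2 * t) v); [|by rewrite !mulr_gt0|rewrite LL; congr (_ *: _); by field].
rewrite (@heat_kernel_line (b * t) v); [|by rewrite mulr_gt0|rewrite xL; congr (_ *: _); by field].
set P := fun s => (4 * pi * s) `^ (- (n%:R / 2)).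
have P0 s : 0 < s -> 0 < P s.
  by move=> s0; rewrite powR_gt0// mulr_gt0// mulr_gt0// pi_gt0.
have e1 : P (3 / 2 * a * t) = 3 `^ (- (n%:R / 2)) * P (1 / 2 * a * t).
  rewrite /P -heat_prefactorM ?mulr_gt0//.
  by congr (_ `^ _); field.
have e2 : P (b * t) = 2 `^ (- (n%:R / 2)) * P (b / 2 * t).
  rewrite /P -heat_prefactorM ?mulr_gt0// ?invr_gt0//.
  by congr (_ `^ _); field.
have e3 : P t <= P ((1 - b / 2 - a) * t).
  have := @heat_kernel_diag_mono R n ((1 - b / 2 - a) * t) t y; rewrite !heat_kernel_diag; apply.
    by rewrite mulr_gt0.
  by rewrite ler_piMl ?(ltW t0)//; lra.
rewrite -![(4 * pi * _) `^ _]/(P _) e1 e2.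
move: (P0 (1 / 2 * a * t)) (P0 (b / 2 * t)); rewrite !mulr_gt0// => /(_ isT) Q1 /(_ isT) Q2.
move: (P _) Q1 (P (b / 2 * t)) Q2 (P ((1 - b / 2 - a) * t)) (P t) e3 {P0 e1 e2} => p1 Q1 p2 Q2 p3 p4 e3.
set V := dotv v v.
set E1 := expR (- (3 / 2 * a * t * V / 4)); set E2 := expR (- (1 / 2 * a * t * V / 4)).
set E3 := expR (- ((1 - b / 2 - a) * t * V / 4)); set E4 := expR (- (b / 2 * t * V / 4)).
set E5 := expR (- (b * t * V / 4)).
have EE : E1 * E3 * E5 = E2 * E4 * expR (- (t * V / 4)).
  by rewrite /E1 /E2 /E3 /E4 /E5 -!expRD; congr expR; field.
have [E20 E40] : 0 < E2 /\ 0 < E4 by split; exact: expR_gt0.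
have -> : 3 `^ (- (n%:R / 2)) * p1 * E1 / (p1 * E2) * (p3 * E3 / (p2 * E4)) * (2 `^ (- (n%:R / 2)) * p2 * E5)
   = refocus_const * p3 * (E1 * E3 * E5 / (E2 * E4)).
  by rewrite /refocus_const; field; rewrite !gt_eqF.
rewrite EE [E2 * E4 * _]mulrC mulfK ?gt_eqF ?mulr_gt0// mulrA.
by rewrite ler_pM2r ?expR_gt0// ler_pM2l// refocus_const_gt0.
Qed.

Variables (U : set 'rV[R]_n) (r0 : R) (k : R -> 'rV[R]_n -> R) (y : 'rV[R]_n).
Hypotheses (n0 : (0 < n)%N) (oU : open U)
  (cU : forall x y t, U x -> U y -> 0 <= t -> t <= 1 -> U (x + t *: (y - x)))
  (r00 : 0 < r0) (hk : solves_heat_equation U k) (hd : dirac_initial U k y)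
  (kp : forall t x, 0 < t -> U x -> 0 <= k t x <= heat_kernel t x y).

(** The divisors come from [sub_kernel_ge], from halving both paraboloids when the balls are shrunk,
    and from the Gaussian mass; [r0 / 2] bounds the shrunk radii from below. *)
Definition dirac_const (T1 : R) : R :=
  expR (- (profile_rate n (r0 / 2) T1 * T1)) / 2 / 4 / 6 ^+ n.

Lemma dirac_const_gt0 T1 : 0 < dirac_const T1.
Proof. by rewrite !divr_gt0 ?expR_gt0// exprn_gt0. Qed.

Lemma shrink z c r : 0 < r -> enorm (z - c) < r ->
  \forall e \near (0 : R)^'+, enorm (z - c) < r - e /\ paraboloid z c r / 2 <= paraboloid z c (r - e).
Proof.
move=> rr0 zc; apply: filterI.
  have h : 0 < r - enorm (z - c) by rewrite subr_gt0.
  by apply: filterS (nbhs_right_lt h) => e; lra.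
have p0 : 0 < paraboloid z c r by rewrite paraboloid_gt0.
have h : paraboloid z c (r - e) @[e --> (0 : R)^'+] --> paraboloid z c r.
  apply: (@cvg_paraboloid R n _ _ _ (fun=> z) (fun=> c)); [by rewrite gt_eqF|exact: cvg_cst|exact: cvg_cst|].
  rewrite -[X in _ --> X]subr0; apply: cvgB; first exact: cvg_cst.
  exact: cvg_at_right_filter.
have p2 : 0 < paraboloid z c r / 2 by rewrite divr_gt0.
have /cvgrPdist_lt/(_ _ p2) := h; apply: filterS => e; rewrite ltr_norml => /andP[]; lra.
Qed.

Lemma dirac_bound Rm T1 t x c r c' r' : 0 < t -> Num.sqrt t <= T1 ->
  ball_adm U r0 Rm 0 c r -> enorm (x - c) < r -> ball_adm U r0 Rm 0 c' r' -> enorm (y - c') < r' ->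
  dirac_const T1 * (heat_kernel t x y * Num.min 1 (paraboloid y c' r' * paraboloid x c r / t)) <= k t x.
Proof.
move=> t0 tT [h1 h2 h3] xc [h1' h2' h3'] yc'.
have rr0 : 0 < r by exact: lt_le_trans h1.
have rr0' : 0 < r' by exact: lt_le_trans h1'.
have r02 : 0 < r0 / 2 by rewrite divr_gt0.
have C0 : 0 <= n%:R / (r0 / 2) by apply: divr_ge0 => //; exact: ltW.
have T10 : 0 <= T1 by apply: le_trans tT; exact: sqrtr_ge0.
have [e [e0 [[[xe pe] [ye pe']] er]]] := filter_ex (filterI (nbhs_right_gt (0 : R))
  (filterI (filterI (shrink rr0 xc) (shrink rr0' yc')) (nbhs_right_lt r02))).
have p0 : 0 < paraboloid x c r by rewrite paraboloid_gt0.
have p0' : 0 < paraboloid y c' r' by rewrite paraboloid_gt0.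
set b := paraboloid y c' (r' - e); have b0 : 0 < b by rewrite /b; lra.
set ph := paraboloid x c (r - e) in pe; have ph0 : 0 < ph by lra.
rewrite !addr0 in h3 h3'.
have adm1 : ball_adm U (r0 / 2) Rm e c (r - e) by split; [linarith|linarith|rewrite subrK].
have adm2 : ball_adm U (r0 / 2) Rm e c' (r' - e) by split; [linarith|linarith|rewrite subrK].
have := dirac_lower n0 oU cU hk hd kp r02 e0 t0 tT b0 adm2 (lexx _) adm1 xe.
have M0 : 0 <= profile_rate n (r0 / 2) T1.
  by apply: le_trans (profile_rate_ge n r02 T10); rewrite mulr_ge0.
have := @sub_kernel_ge R n (profile_rate n (r0 / 2) T1) (n%:R / (r0 / 2)) b t T1 x y c (r - e) t0 (ltW b0) C0 M0 tT (ltW ph0).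
move=> /le_trans h /h {}h; rewrite -/ph in h.
set v := paraboloid y c' r' * paraboloid x c r / t.
have v0 : 0 <= v by rewrite divr_ge0 ?mulr_ge0// ltW.
have hv : Num.min 1 v / 4 <= Num.min 1 (b * ph / t).
  apply: (@le_trans _ _ (Num.min 1 (4^-1 * v))).
    by rewrite mulrC; apply: minr_scale => //; rewrite ?invr_ge0//; linarith.
  apply: minr_mono; rewrite /v mulrA ler_pM2r ?invr_gt0//.
  by rewrite /b in b0 *; nlinarith.
rewrite /dirac_const; set D := expR _ in h *.
have D0 : 0 < D by exact: expR_gt0.
have p6 : 0 < 6 ^+ n :> R by rewrite exprn_gt0.
rewrite -(ler_pM2l p6); apply: le_trans h.
have hk0 : 0 < heat_kernel t x y by exact: heat_kernel_gt0.
have -> : 6 ^+ n * (D / 2 / 4 / 6 ^+ n * (heat_kernel t x y * Num.min 1 v)) =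
  (D / 2 * heat_kernel t x y) * (Num.min 1 v / 4) by field; rewrite gt_eqF.
by rewrite mulrA ler_pM2l// mulr_gt0// divr_gt0.
Qed.

Variable d : 'rV[R]_n -> R.
Hypotheses (d0 : forall z, U z -> 0 < d z)
  (hball : forall z, U z -> exists c r, [/\ r0 <= r, eball c r `<=` U, enorm (z - c) < r &
     d z / 2 <= paraboloid z c r]).

Lemma Unear T1 t x : U x -> U y -> 0 < t -> Num.sqrt t <= T1 ->
  dirac_const T1 / 4 * (heat_kernel t x y * Num.min 1 (d x * d y / t)) <= k t x.
Proof.
move=> Ux Uy t0 tT.
have [c [r [h1 h2 h3 h4]]] := hball Ux; have [c' [r' [h1' h2' h3' h4']]] := hball Uy.
have adm q p : r0 <= p -> p <= Num.max r r' -> eball q p `<=` U -> ball_adm U r0 (Num.max r r') 0 q p.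
  by move=> ? ? ?; split=> //; rewrite addr0.
have := dirac_bound t0 tT (adm c r h1 _ h2) h3 (adm c' r' h1' _ h2') h3'.
rewrite !le_max !lexx orbT => /(_ isT isT); apply: le_trans.
rewrite -mulrA ler_pM2l ?dirac_const_gt0// [_^-1 * _]mulrCA ler_pM2l ?heat_kernel_gt0//.
have [dx dy] := (d0 Ux, d0 Uy).
apply: le_trans (minr_scale _ _ _) _; [by rewrite invr_ge0|lra|by rewrite divr_ge0 ?mulr_ge0// ltW|].
by apply: minr_mono; rewrite mulrA ler_pM2r ?invr_gt0//; nra.
Qed.

Lemma lower_near T1 t x : U x -> U y -> 0 < t -> Num.sqrt t <= T1 ->
  dirac_const T1 / 4 * Num.min 1 (d x * d y / t) * heat_kernel t x y <= k t x.
Proof. by move=> *; rewrite -mulrA [Num.min _ _ * _]mulrC; exact: Unear. Qed.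

Definition chain_const (T1 : R) : R :=
  restart_const n r0 T1 ^+ 2 * dirac_const T1 * refocus_const / 96.

Lemma chain_const_gt0 T1 : 0 < chain_const T1.
Proof.
apply: divr_gt0 => //; apply: mulr_gt0; last exact: refocus_const_gt0.
by apply: mulr_gt0; [apply: exprn_gt0; exact: restart_const_gt0|exact: dirac_const_gt0].
Qed.

(** The poles are [y] at time 0, [L a] at time [a t] and [L (1 - b)] at time [(1 - b) t]. Each
    restart uses the preceding bound slightly after its own pole, at times [3/2 a t] and
    [(1 - b/2) t], when the new kernel is no longer singular. *)
Lemma lower_chain T1 t x a b dA dB : U x -> U y -> 0 < t -> Num.sqrt t <= T1 ->
  0 < a -> a <= 1 / 4 -> 0 < b -> b <= 1 / 4 ->
  0 < dA -> dA <= d (L y x a) -> dA <= d (L y x (3 / 2 * a)) ->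
  0 < dB -> dB <= d (L y x (1 - b)) -> dB <= d (L y x (1 - b / 2)) ->
  chain_const T1 * (Num.min 1 (d y * dA / (a * t)) * Num.min 1 (dA * dB / t) *
    Num.min 1 (dB * d x / (b * t))) * heat_kernel t x y <= k t x.
Proof.
move=> Ux Uy t0 tT a0 a4 b0 b4 dA0 hA1 hA2 dB0 hB1 hB2.
have UL s : 0 <= s -> s <= 1 -> U (L y x s) by move=> *; exact: cU.
have [c1 [r1 [p1 q1 w1 z1]]] := hball Uy.
have [[j2 j2'] [j3 j3'] [j4 j4'] [j5 j5']] := chain_params a0 a4 b0 b4.
have [c2 [r2 [p2 q2 w2 z2]]] := hball (UL a j2 j2').
have [c3 [r3 [p3 q3 w3 z3]]] := hball (UL (3 / 2 * a) j3 j3').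
have [c4 [r4 [p4 q4 w4 z4]]] := hball (UL (1 - b) j4 j4').
have [c5 [r5 [p5 q5 w5 z5]]] := hball (UL (1 - b / 2) j5 j5').
clear j2 j2' j3 j3' j4 j4' j5 j5'.
have [c6 [r6 [p6 q6 w6 z6]]] := hball Ux.
(* The comparison needs radii bounded above for compactness; a bound covering the six balls used
   here is enough. *)
pose Rm := \big[Num.max/r0]_(i <- [:: r1; r2; r3; r4; r5; r6]) i.
have adm q p : p \in [:: r1; r2; r3; r4; r5; r6] -> r0 <= p -> eball q p `<=` U -> ball_adm U r0 Rm 0 q p.
  move=> hp h1 h2; split; [exact: h1| |by rewrite addr0].
  exact: (le_bigmax_seq r0 p xpredT id hp).
have A1 : ball_adm U r0 Rm 0 c1 r1 by apply: adm; rewrite ?inE ?eqxx ?orbT.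
have A2 : ball_adm U r0 Rm 0 c2 r2 by apply: adm; rewrite ?inE ?eqxx ?orbT.
have A3 : ball_adm U r0 Rm 0 c3 r3 by apply: adm; rewrite ?inE ?eqxx ?orbT.
have A4 : ball_adm U r0 Rm 0 c4 r4 by apply: adm; rewrite ?inE ?eqxx ?orbT.
have A5 : ball_adm U r0 Rm 0 c5 r5 by apply: adm; rewrite ?inE ?eqxx ?orbT.
have A6 : ball_adm U r0 Rm 0 c6 r6 by apply: adm; rewrite ?inE ?eqxx ?orbT.
clear adm UL p1 q1 p2 q2 p3 q3 p4 q4 p5 q5 p6 q6.
have sT s : s <= t -> Num.sqrt s <= T1 by move=> st; apply: le_trans tT; exact: ler_wsqrtr.
pose vel := t^-1 *: (x - y).
have velE s : (s * t) *: vel = s *: (x - y) by rewrite /vel scalerA mulfK ?gt_eqF.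
have LL s s' : L y x s = L y x s' + ((s - s') * t) *: vel.
  by rewrite velE /L -addrA -scalerDl; congr (_ + _ *: _); ring.
have L0 s : L y x s = y + (s * t) *: vel by rewrite velE.
have k0 s z : 0 < s -> U z -> 0 <= k s z by move=> s0 Uz; have /andP[] := kp s0 Uz.
have kcal s z : 0 < s -> U z -> caloric_at k s z by exact: solves_caloric_at.
have bt : 0 < b * t by rewrite mulr_gt0.
have att : 0 < a * t by rewrite mulr_gt0.
have [[i1 i2 i3 i4 i5] [l1 l2 l3 l4 l5] mt mt'] := chain_times t0 a0 a4 b0 b4.
have ph1 : 0 < paraboloid y c1 r1 by apply: lt_le_trans z1; rewrite divr_gt0 ?d0.
have half (u v w : R) : u <= v -> v / 2 <= w -> u / 2 <= w by move=> uv; apply: le_trans; rewrite ler_pM2r.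
have hz2 := half _ _ _ hA1 z2; have hz3 := half _ _ _ hA2 z3.
have hz4 := half _ _ _ hB1 z4; have hz5 := half _ _ _ hB2 z5.
have E1 : 3 / 2 * a * t - 0 = 3 / 2 * a * t by rewrite subr0.
have E2 : 3 / 2 * a * t - a * t = 1 / 2 * a * t by field.
have E3 : (1 - b / 2) * t - a * t = (1 - b / 2 - a) * t by ring.
have E4 : (1 - b / 2) * t - (1 - b) * t = b / 2 * t by field.
have E5 : t - (1 - b) * t = b * t by ring.
have dA2 : 0 < dA / 2 by rewrite divr_gt0.
have dB2 : 0 < dB / 2 by rewrite divr_gt0.
have step1 : forall z c r, ball_adm U r0 Rm 0 c r -> enorm (z - c) < r ->
    restart_const n r0 T1 * dirac_const T1 *
    (heat_kernel (3 / 2 * a * t) (L y x (3 / 2 * a)) y /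
      heat_kernel (1 / 2 * a * t) (L y x (3 / 2 * a)) (L y x a)) *
    Num.min 1 (paraboloid y c1 r1 * (dA / 2) / (3 / 2 * a * t)) *
    (heat_kernel ((1 - b / 2) * t - a * t) z (L y x a) *
      Num.min 1 (dA / 2 * paraboloid z c r / ((1 - b / 2) * t - a * t))) <= k ((1 - b / 2) * t) z.
  rewrite -[X in heat_kernel X _ y]E1 -E2 -[X in _ * (dA / 2) / X]E1.
  apply: (@restart R n U r0 Rm n0 cU r00 k T1 0 (a * t) (3 / 2 * a * t) ((1 - b / 2) * t)
    (dirac_const T1) (paraboloid y c1 r1) (dA / 2) (dA / 2) y (L y x a) (L y x (3 / 2 * a)) vel c3 c2 r3 r2) => //.
  - exact: sT.
  - by rewrite E1; exact: L0.
  - by rewrite (LL (3 / 2 * a) a); congr (_ + _ *: _); field.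
  - exact: dirac_const_gt0.
  move=> z c r admz zc; rewrite E1; apply: (dirac_bound _ _ admz zc A1 w1).
    by rewrite -mulrA mulr_gt0// divr_gt0.
  exact: sT.
set C2 := restart_const n r0 T1 * dirac_const T1 * _ * _ in step1.
have C20 : 0 < C2.
  have h0 s p q : 0 < s -> 0 < heat_kernel s p q by exact: heat_kernel_gt0.
  have h1 : 0 < 3 / 2 * a * t by rewrite -mulrA mulr_gt0// divr_gt0.
  have h2 : 0 < 1 / 2 * a * t by rewrite -mulrA mulr_gt0// divr_gt0.
  apply: mulr_gt0; last by rewrite lt_min ltr01 divr_gt0// mulr_gt0.
  by apply: mulr_gt0; [apply: mulr_gt0; [exact: restart_const_gt0|exact: dirac_const_gt0]|apply: divr_gt0; exact: h0].
have step2 : restart_const n r0 T1 * C2 *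
    (heat_kernel ((1 - b / 2) * t - a * t) (L y x (1 - b / 2)) (L y x a) /
      heat_kernel ((1 - b / 2) * t - (1 - b) * t) (L y x (1 - b / 2)) (L y x (1 - b))) *
    Num.min 1 (dA / 2 * (dB / 2) / ((1 - b / 2) * t - a * t)) *
    (heat_kernel (t - (1 - b) * t) x (L y x (1 - b)) *
      Num.min 1 (dB / 2 * paraboloid x c6 r6 / (t - (1 - b) * t))) <= k t x.
  apply: (@restart R n U r0 Rm n0 cU r00 k T1 (a * t) ((1 - b) * t) ((1 - b / 2) * t) t
    C2 (dA / 2) (dB / 2) (dB / 2) (L y x a) (L y x (1 - b)) (L y x (1 - b / 2)) vel c5 c4 r5 r4) => //.
  - exact: ltW.
  - exact: sT.
  - by rewrite (LL (1 - b / 2) a) E3.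
  - by rewrite (LL (1 - b / 2) (1 - b)); congr (_ + _ *: _); field.
rewrite E3 E4 E5 in step2.
have chain := @heat_kernel_chain t a b x y t0 a0 a4 b0 b4.
move: chain step2; rewrite /C2.
move=> chain step2; apply: le_trans step2.
have [g0 hm] := chain_mins t0 a0 b0 mt mt' (d0 Uy) (d0 Ux) dA0 dB0 z1 z6.
have dc0 := ltW (dirac_const_gt0 T1).
have hk0 : 0 <= refocus_const * heat_kernel t x y.
  by apply: mulr_ge0; apply: ltW; [exact: refocus_const_gt0|exact: heat_kernel_gt0].
rewrite mulrAC; apply: (chain_combine dc0 hk0 g0 chain hm).
by rewrite /chain_const; field.
Qed.

End LowerBounds.

(** * Combining the bounds in units of the diffusive length *)

Section Regimes.
Variable R : realType.
Implicit Types (al be A B ka eps C c : R).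

Lemma minr_le_scale (q u v : R) : 1 <= q -> u <= q * v -> Num.min 1 u <= q * Num.min 1 v.
Proof.
move=> q1 uv; have [h|h] := leP 1 v; first by rewrite mulr1; apply: le_trans q1; rewrite ge_min lexx.
by apply: le_trans uv; rewrite ge_min lexx orbT.
Qed.

Lemma le_minr_scale (q u v : R) : 1 <= q -> u <= 1 -> u <= q * v -> u <= q * Num.min 1 v.
Proof.
move=> q1 u1 uv; apply: le_trans (minr_le_scale q1 uv).
by rewrite le_min u1 lexx.
Qed.

Lemma absorb_factor eps (m m' ka : R) : 0 < eps -> eps <= m -> 0 <= m' -> ka <= m' ->
  ka <= eps^-1 * (m' * m).
Proof.
move=> e0 em m0 km; apply: le_trans km _; rewrite mulrCA ler_peMr//.
by rewrite mulrC ler_pdivlMr// mul1r.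
Qed.

Lemma ler_prod_scale (q x u v : R) : 0 <= x -> u <= q * v -> x * u <= q * (x * v).
Proof. by move=> x0 uv; rewrite mulrCA; exact: ler_wpM2l. Qed.

(* Lengths are measured in units of [sqrt t]. *)
Lemma upper_regimes al be A B ka eps C : 0 < eps -> eps <= 1 -> 1 <= C ->
  0 < al -> 0 < be -> al <= B -> be <= A ->
  (A < eps -> B <= C * (al + 1)) -> (B < eps -> A <= C * (be + 1)) ->
  ka <= 1 -> ka <= al * A -> ka <= be * B ->
  (be <= 1 -> al * (8 * (A + 1)) < 1 -> ka <= 64 * (al * (A + 1)) * (be * (B + 1))) ->
  ka <= (384 * C + 256 / eps ^+ 2) *
    (Num.min 1 (al * be) + Num.min 1 (al * A) * Num.min 1 (be * B)).
Proof.
move=> e0 e1 C1 al0 be0 alB beA hA hB k1 kA kB hs.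
have A0 : 0 < A by exact: lt_le_trans beA.
have B0 : 0 < B by exact: lt_le_trans alB.
have ab0 : 0 < al * be by exact: mulr_gt0.
have aA0 : 0 < al * A by exact: mulr_gt0.
have bB0 : 0 < be * B by exact: mulr_gt0.
have E0 : 0 <= 256 / eps ^+ 2 by rewrite divr_ge0 ?ler0n ?exprn_ge0 ?ltW.
have ei : 1 <= eps^-1 by rewrite invf_ge1.
have ee : eps^-1 * eps = 1 by rewrite mulVf// gt_eqF.
have E1 : 256 * eps^-1 <= 256 / eps ^+ 2.
  by rewrite -exprVn ler_pM2l ?ltr0n// expr2; apply: ler_peMl => //; exact: le_trans ei.
set g1 := Num.min 1 (al * be); set m1 := Num.min 1 (al * A); set m2 := Num.min 1 (be * B).
have g10 : 0 <= g1 by rewrite le_min ler01 ltW.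
have m10 : 0 <= m1 by rewrite le_min ler01 ltW.
have m20 : 0 <= m2 by rewrite le_min ler01 ltW.
have m12 : 0 <= m1 * m2 by exact: mulr_ge0.
have C384 : 0 <= 384 * C by clear - C1; lra.
have fin1 q : q <= 384 * C -> ka <= q * g1 -> ka <= (384 * C + 256 / eps ^+ 2) * (g1 + m1 * m2).
  move=> qC h; apply: le_trans h _; apply: (@le_trans _ _ (384 * C * g1)); first exact: ler_wpM2r.
  apply: ler_pM => //; [by rewrite lerDl|by rewrite lerDl].
have fin2 q : q <= 256 / eps ^+ 2 -> ka <= q * (m1 * m2) -> ka <= (384 * C + 256 / eps ^+ 2) * (g1 + m1 * m2).
  move=> qC h; apply: le_trans h _; apply: (@le_trans _ _ (256 / eps ^+ 2 * (m1 * m2))); first exact: ler_wpM2r.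
  apply: ler_pM => //; [by rewrite lerDr|by rewrite lerDr].
have km1 : ka <= m1 by rewrite le_min k1 kA.
have km2 : ka <= m2 by rewrite le_min k1 kB.
have strip K1 K2 : be <= 1 -> al * (8 * (A + 1)) < 1 -> A + 1 <= K1 -> B + 1 <= K2 ->
    ka <= 64 * K1 * K2 * (al * be).
  move=> h1 h2 h3 h4; apply: le_trans (hs h1 h2) _.
  have -> : 64 * K1 * K2 * (al * be) = 64 * (al * K1) * (be * K2) by ring.
  have A1 : 0 <= A + 1 by exact/ltW/addr_gt0.
  have B1 : 0 <= B + 1 by exact/ltW/addr_gt0.
  apply: ler_pM; [by apply: mulr_ge0 => //; apply: mulr_ge0 => //; exact: ltW|by apply: mulr_ge0 => //; exact: ltW| |by rewrite ler_pM2l].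
  by rewrite ler_pM2l// ler_pM2l.
(* If [A] or [B] is below [eps], the cross bounds [hA], [hB] reduce everything to the first term of
   [g]. Otherwise [A + 1] and [B + 1] are comparable with [A] and [B], and the second term is
   reached. *)
have [Ae|Ae] := ltP A eps.
  have {}hB := hA Ae; have be1 : be <= 1 by exact: le_trans beA (le_trans (ltW Ae) e1).
  have [h|h] := ltP (al * (8 * (A + 1))) 1.
    have a8 : al <= 1 / 8 by clear - h A0 al0; nra.
    apply: (fin1 (384 * C)) => //; apply: le_minr_scale => //; first by clear - C1; lra.
    have -> : 384 * C * (al * be) = 64 * 2 * (3 * C) * (al * be) by ring.
    by apply: strip => //; [clear - Ae e1; lra|clear - hB a8 C1; nra].
  have a16 : 1 <= 16 * al by clear - h A0 al0 Ae e1; nra.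
  apply: (fin1 (17 * C)); first by clear - C1; lra.
  apply: le_minr_scale => //; [by clear - C1; lra|apply: le_trans kB _].
  by rewrite [al * be]mulrC; apply: ler_prod_scale; [exact: ltW|clear - hB a16 C1; nra].
have [Be|Be] := ltP B eps.
  have {}hA := hB Be; have al1 : al <= 1 by exact: le_trans alB (le_trans (ltW Be) e1).
  have [b1|b1] := ltP 1 be.
    apply: (fin1 (2 * C)); first by clear - C1; lra.
    apply: le_minr_scale => //; [by clear - C1; lra|apply: le_trans kA _].
    by apply: ler_prod_scale; [exact: ltW|clear - hA b1 C1; nra].
  have A2 : A <= 2 * C by clear - hA b1 C1; nra.
  have [h|h] := ltP (al * (8 * (A + 1))) 1.
    apply: (fin1 (384 * C)) => //; apply: le_minr_scale => //; first by clear - C1; lra.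
    have -> : 384 * C * (al * be) = 64 * (3 * C) * 2 * (al * be) by ring.
    by apply: strip => //; [clear - A2 C1; lra|clear - Be e1; lra].
  have a24 : 1 <= 24 * C * al.
    have : al * (8 * (A + 1)) <= al * (24 * C) by rewrite ler_pM2l//; clear - A2 C1; lra.
    by clear - h; lra.
  apply: (fin1 (24 * C)); first by clear - C1; lra.
  apply: le_minr_scale => //; [by clear - C1; lra|apply: le_trans kB _].
  by rewrite [al * be]mulrC; apply: ler_prod_scale; [exact: ltW|clear - a24 Be e1; lra].
have [b1|b1] := ltP 1 be.
  apply: (fin2 eps^-1); first by clear - E1 ei; lra.
  apply: absorb_factor => //; rewrite le_min e1/=.
  by apply: le_trans Be _; rewrite ler_peMl// ltW.
have A1i : A + 1 <= 2 * eps^-1 * A.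
  have -> : 2 * eps^-1 * A = 2 * (A / eps) by ring.
  have h1 : 1 <= A / eps by rewrite ler_pdivlMr// mul1r.
  have h2 : A <= A / eps by rewrite ler_peMr// ltW.
  by clear - h1 h2; lra.
have B1i : B + 1 <= 2 * eps^-1 * B.
  have -> : 2 * eps^-1 * B = 2 * (B / eps) by ring.
  have h1 : 1 <= B / eps by rewrite ler_pdivlMr// mul1r.
  have h2 : B <= B / eps by rewrite ler_peMr// ltW.
  by clear - h1 h2; lra.
have [h|h] := ltP (al * (8 * (A + 1))) 1; last first.
  apply: (fin2 (eps / 16)^-1).
    rewrite invf_div; clear - E1 ei; lra.
  rewrite [m1 * m2]mulrC; apply: absorb_factor => //; first by rewrite divr_gt0.
  rewrite le_min; apply/andP; split; first by clear - e1; lra.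
  have hh : 1 <= al * (8 * (2 * eps^-1 * A)) by apply: le_trans h _; rewrite ler_pM2l// ler_pM2l.
  have -> : al * A = eps * (al * (8 * (2 * eps^-1 * A))) / 16 by field; rewrite gt_eqF.
  by rewrite ler_pM2r ?invr_gt0// ler_peMr// ltW.
have a1 : al * A <= 1.
  have : al * A <= al * (8 * (A + 1)) by rewrite ler_pM2l//; clear - A0; lra.
  by clear - h; lra.
apply: (fin2 (256 / eps ^+ 2)) => //.
rewrite /m1 (min_idPr a1); have [hb|hb] := leP 1 (be * B).
  rewrite /m2 (min_idPl hb) mulr1; apply: le_trans kA _; rewrite ler_peMl//; first exact: ltW.
  by clear - E1 ei; lra.
rewrite /m2 (min_idPr (ltW hb)); apply: le_trans (strip _ _ b1 h A1i B1i) _.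
by rewrite le_eqVlt; apply/orP; left; apply/eqP; field; rewrite gt_eqF.
Qed.

(** When [A] or [B] is below [eps], the cross bounds make the second term of [g] at most [2 * C]
    times the first, so the near bound suffices; otherwise both lower bounds are available. *)
Lemma lower_regimes al be A B ka eps C c1 c2 : 0 < eps -> eps <= 1 -> 1 <= C ->
  0 < al -> 0 < be -> al <= B -> be <= A -> 0 < c1 -> 0 < c2 ->
  (A < eps -> B <= C * (al + 1)) -> (B < eps -> A <= C * (be + 1)) ->
  c1 * Num.min 1 (al * be) <= ka ->
  (eps <= A -> eps <= B -> c2 * (Num.min 1 (al * A) * Num.min 1 (be * B)) <= ka) ->
  Num.min (c1 / (3 * C)) (Num.min c1 c2 / 2) *
    (Num.min 1 (al * be) + Num.min 1 (al * A) * Num.min 1 (be * B)) <= ka.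
Proof.
move=> e0 e1 C1 al0 be0 alB beA c10 c20 hA hB h1 h2.
have A0 : 0 < A by exact: lt_le_trans beA.
have B0 : 0 < B by exact: lt_le_trans alB.
have ab0 : 0 < al * be by exact: mulr_gt0.
set g1 := Num.min 1 (al * be) in h1 *; set m1 := Num.min 1 (al * A) in h2 *; set m2 := Num.min 1 (be * B) in h2 *.
have g10 : 0 <= g1 by rewrite le_min ler01 ltW.
have m10 : 0 <= m1 by rewrite le_min ler01 ltW// mulr_gt0.
have m20 : 0 <= m2 by rewrite le_min ler01 ltW// mulr_gt0.
have m11 : m1 <= 1 by rewrite ge_min lexx.
have m21 : m2 <= 1 by rewrite ge_min lexx.
have m1A : m1 <= al * A by rewrite ge_min lexx orbT.
have m2B : m2 <= be * B by rewrite ge_min lexx orbT.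
set c := Num.min _ _.
have cc1 : c <= c1 / (3 * C) by rewrite ge_min lexx.
have cc2 : c <= Num.min c1 c2 / 2 by rewrite ge_min lexx orbT.
have mc1 : Num.min c1 c2 <= c1 by rewrite ge_min lexx.
have mc2 : Num.min c1 c2 <= c2 by rewrite ge_min lexx orbT.
have fin : m1 * m2 <= 2 * C * g1 -> c * (g1 + m1 * m2) <= ka.
  move=> h; apply: le_trans h1; apply: (@le_trans _ _ (c1 / (3 * C) * (3 * C * g1))).
    apply: ler_pM => //; last by move: (m1 * m2) h => m h; clear - h C1 g10; nra.
      by rewrite le_min !divr_ge0// ?le_min ?(ltW c10) ?(ltW c20)//; clear - C1; lra.
    by rewrite addr_ge0// mulr_ge0.
  by rewrite le_eqVlt; apply/orP; left; apply/eqP; field; apply: lt0r_neq0; clear - C1; lra.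
have m12 : m1 * m2 <= 1 by rewrite -[X in _ <= X]mulr1; exact: ler_pM.
have C2 : 1 <= 2 * C by clear - C1; lra.
have [Ae|Ae] := ltP A eps.
  have hB' := hA Ae; apply: fin; apply: le_minr_scale => //.
  have [a1|a1] := leP 1 al.
    apply: (@le_trans _ _ (be * B)); first by apply: le_trans m2B; rewrite ler_piMl.
    by rewrite [al * be]mulrC; apply: ler_prod_scale; [exact: ltW|clear - hB' a1 C1; nra].
  have -> : 2 * C * (al * be) = (al * 1) * (be * (2 * C)) by ring.
  apply: ler_pM => //.
    by apply: le_trans m1A _; rewrite ler_pM2l//; exact: le_trans (ltW Ae) e1.
  by apply: le_trans m2B _; rewrite ler_pM2l//; clear - hB' a1 C1; nra.
have [Be|Be] := ltP B eps.
  have hA' := hB Be; apply: fin; apply: le_minr_scale => //.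
  have [b1|b1] := leP 1 be.
    apply: (@le_trans _ _ (al * A)); first by apply: le_trans m1A; rewrite ler_piMr.
    by apply: ler_prod_scale; [exact: ltW|clear - hA' b1 C1; nra].
  have -> : 2 * C * (al * be) = (al * (2 * C)) * (be * 1) by ring.
  apply: ler_pM => //.
    by apply: le_trans m1A _; rewrite ler_pM2l//; clear - hA' b1 C1; nra.
  by apply: le_trans m2B _; rewrite ler_pM2l//; exact: le_trans (ltW Be) e1.
have {}h2 := h2 Ae Be; have m0 : 0 <= m1 * m2 by exact: mulr_ge0.
move: (m1 * m2) m0 h2 => m m0 h2; clear - h1 h2 cc2 mc1 mc2 m0 g10; nra.
Qed.

(** The middle minimum is bounded below by a constant because both intermediate depths are at least
    [cg / 2 * (e * sg)]. Each outer one keeps a factor of [g] because a depth divided by its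
    fraction of the segment is at least [cg] times the corresponding height. *)
Lemma far_mins (cg e sg t s s' A B dA dB u v : R) :
  0 < cg -> cg <= 1 -> 0 < e -> e <= 1 -> 0 < sg -> sg ^+ 2 = t -> e * sg <= cg / 2 ->
  0 < s -> s <= 1 / 2 -> 0 < s' -> s' <= 1 / 2 ->
  0 < u -> 0 < v -> 0 < A -> 0 < B -> 0 < dA -> 0 < dB ->
  e * sg <= A -> e * sg <= B -> cg * s * B <= dA -> cg * s' * A <= dB ->
  s = 1 / 2 \/ cg <= dA -> s' = 1 / 2 \/ cg <= dB ->
  cg * (cg ^+ 2 * e ^+ 2 / 32) * (cg / 2) * (Num.min 1 (u * A / t) * Num.min 1 (v * B / t)) <=
  Num.min 1 (v * (dA / 2) / (s / 2 * t)) * Num.min 1 (dA / 2 * (dB / 4) / t) *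
  Num.min 1 (dB / 4 * u / (s' / 2 * t)).
Proof.
move=> c0 c1 e0 e1 sg0 sgt es s0 s2 s'0 s'2 u0 v0 A0 B0 dA0 dB0 eA eB hA hB cA cB.
have t0 : 0 < t by rewrite -sgt exprn_gt0.
have w1 : 0 <= u * A / t by rewrite divr_ge0 ?mulr_ge0// ltW.
have w2 : 0 <= v * B / t by rewrite divr_ge0 ?mulr_ge0// ltW.
have pos (w : R) : 0 <= w -> 0 <= Num.min 1 w by move=> w0; rewrite le_min ler01.
have es0 : 0 < e * sg by exact: mulr_gt0.
have c20 : 0 < cg / 2 by rewrite divr_gt0.
have m1 : cg * Num.min 1 (v * B / t) <= Num.min 1 (v * (dA / 2) / (s / 2 * t)).
  apply: minr_ge (ltW c0) c1 w2 _.
  have -> : v * (dA / 2) / (s / 2 * t) = v * (dA / s) / t by field; rewrite !gt_eqF.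
  by rewrite mulrA ler_pM2r ?invr_gt0// mulrCA ler_pM2l// ler_pdivlMr// mulrAC.
have m3 : cg / 2 * Num.min 1 (u * A / t) <= Num.min 1 (dB / 4 * u / (s' / 2 * t)).
  have c2 : cg / 2 <= 1 by rewrite ler_pdivrMr// mul1r (le_trans c1)// ler1n.
  apply: minr_ge (ltW c20) c2 w1 _.
  have -> : dB / 4 * u / (s' / 2 * t) = u * (dB / s' / 2) / t by field; rewrite !gt_eqF.
  rewrite mulrA ler_pM2r ?invr_gt0// mulrCA ler_pM2l// mulrAC ler_pM2r ?invr_gt0//.
  by rewrite ler_pdivlMr// mulrAC.
have bound (r D X : R) : e * sg <= X -> cg * r * X <= D -> r = 1 / 2 \/ cg <= D -> cg / 2 * (e * sg) <= D.
  move=> hX hD [er|h].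
    by apply: le_trans hD; rewrite er mul1r ler_pM2l.
  apply: le_trans h; apply: (@le_trans _ _ (cg / 2 * 1)); last by lra.
    by rewrite ler_pM2l//; lra.
have kA := bound _ _ _ eB hA cA; have kB := bound _ _ _ eA hB cB.
have m2 : cg ^+ 2 * e ^+ 2 / 32 <= Num.min 1 (dA / 2 * (dB / 4) / t).
  rewrite le_min; apply/andP; split.
    have : cg ^+ 2 * e ^+ 2 <= 1 * 1.
      by apply: ler_pM; rewrite ?sqr_ge0// exprn_ile1// ltW.
    lra.
  rewrite ler_pdivlMr// -sgt.
  have -> : cg ^+ 2 * e ^+ 2 / 32 * sg ^+ 2 = (cg / 2 * (e * sg) / 2) * (cg / 2 * (e * sg) / 4) by field.
  have h0 : 0 < cg / 2 * (e * sg) by exact: mulr_gt0.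
  by apply: ler_pM; rewrite ?ler_pM2r// divr_ge0// ltW.
have -> : cg * (cg ^+ 2 * e ^+ 2 / 32) * (cg / 2) * (Num.min 1 (u * A / t) * Num.min 1 (v * B / t)) =
  (cg * Num.min 1 (v * B / t)) * (cg ^+ 2 * e ^+ 2 / 32) * (cg / 2 * Num.min 1 (u * A / t)) by ring.
have p1 := mulr_ge0 (ltW c0) (pos _ w2); have p3 := mulr_ge0 (ltW c20) (pos _ w1).
have p2 : 0 <= cg ^+ 2 * e ^+ 2 / 32 by rewrite divr_ge0// mulr_ge0// sqr_ge0.
by apply: ler_pM (mulr_ge0 p1 p2) p3 _ m3; exact: ler_pM.
Qed.

Lemma half_param (s : R) : 0 < s -> s <= 1 / 2 -> [/\ 0 <= s, s <= 1, 0 < s / 2 & s / 2 <= 1 / 4].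
Proof. by move=> s0 s2; split; lra. Qed.

Lemma unit_fractions : [/\ 0 <= (1 / 2 : R) /\ (1 / 2 : R) <= 1, 0 <= (3 / 4 : R) /\ (3 / 4 : R) <= 1,
  0 <= (1 / 4 : R) /\ (1 / 4 : R) <= 1 & (2^-1 : R) <= 3 / 4].
Proof. by split; [split|split|split|]; lra. Qed.

End Regimes.

(** * Two-sided estimate for an abstract convex set *)

Section TwoSided.
Variables (R : realType) (n : nat) (U : set 'rV[R]_n) (r0 : R) (d : 'rV[R]_n -> R) (cg : R).
Implicit Types (t s c : R) (v x y z w : 'rV[R]_n).
Hypotheses (n0 : (0 < n)%N) (oU : open U)
  (cU : forall x y t, U x -> U y -> 0 <= t -> t <= 1 -> U (x + t *: (y - x)))
  (r00 : 0 < r0) (d0 : forall z, U z -> 0 < d z)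
  (hball : forall z, U z -> exists (c : 'rV[R]_n) (r : R), [/\ r0 <= r, eball c r `<=` U, enorm (z - c) < r &
     d z / 2 <= paraboloid z c r])
  (dconc : forall x y s, U x -> U y -> 0 <= s -> s <= 1 ->
     (1 - s) * d x + s * d y <= d (x + s *: (y - x))).

(** The half-spaces [Hx] of the theorem, with a unit normal. *)
Definition supporting v c x : Prop :=
  [/\ dotv v v = 1, forall z, U z -> 0 < dotv v z + c & dotv v x + c = d x].

Hypotheses (dle : forall v c x z, supporting v c x -> U z -> d z <= dotv v z + c)
  (cg0 : 0 < cg) (cg1 : cg <= 1)
  (geo : forall x y v c, U x -> U y -> supporting v c x ->
     exists s, [/\ 0 < s, s <= 1 / 2, cg * s * (dotv v y + c) <= d (x + s *: (y - x)) &
       s = 1 / 2 \/ cg <= d (x + s *: (y - x))]).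

Lemma dseg l s x y : U x -> U y -> 0 <= l -> l <= 1 -> 0 <= s -> s <= 1 ->
  l * d (x + s *: (y - x)) <= d (x + (l * s) *: (y - x)).
Proof.
move=> Ux Uy l0 l1 s0 s1; have := dconc Ux (cU Ux Uy s0 s1) l0 l1.
rewrite [x + _ - x]addrC addKr scalerA; apply: le_trans; rewrite lerDr.
by apply: mulr_ge0; [rewrite subr_ge0|exact/ltW/d0].
Qed.

(** With [A] and [B] the heights of [y] over the hyperplane at [x] and of [x] over that at [y], the
    point supplied by [geo] has depth at least [cg * s * B] and at most [(1 - s) A + s d(x)]. If its
    depth is at least [cg], smallness of [A] forces [A <= s d(x)], and [s] cancels. *)
Lemma cross x y v1 c1 v2 c2 : U x -> U y -> supporting v1 c1 x -> supporting v2 c2 y ->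
  dotv v1 y + c1 <= cg / 2 ->
  dotv v2 x + c2 <= 2 / cg * (d x + (dotv v1 y + c1)).
Proof.
move=> Ux Uy S1 S2 sgc; have cg0' := cg0.
have [s [s0 s1 h1 h2]] := geo Uy Ux S2.
have Uys : U (y + s *: (x - y)) by apply: cU => //; lra.
have h3 := dle S1 Uys.
have [_ pos1 e1] := S1; have A0 := pos1 y Uy.
have e3 : dotv v1 (y + s *: (x - y)) + c1 = (1 - s) * (dotv v1 y + c1) + s * d x.
  by rewrite -e1 !dotvE; ring.
rewrite e3 in h3; have dx := d0 Ux.
rewrite mulrAC ler_pdivlMr//.
have k1 := le_trans h1 h3.
move: (dotv v1 y + c1) (dotv v2 x + c2) (d x) (d (y + s *: (x - y))) sgc A0 dx h2 h3 k1 {h1 e1 e3} => A B al dy sgc A0 dx h2 h3 k1.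
case: h2 => h2; first by rewrite h2 in k1; lra.
have sA : 0 <= s * A by apply: mulr_ge0; exact: ltW.
have k2 : A <= s * al by lra.
have k3 : s * (B * cg) <= s * (2 * al) by lra.
by move: k3; rewrite ler_pM2l//; lra.
Qed.

Variables (T : R).
Hypothesis (T0 : 0 < T).
Let T1 := Num.sqrt T.
(** Chosen so that [eps * sqrt t <= cg / 2] for [t < T], the smallness that [cross] requires. *)
Let eps := Num.min 1 (cg / (2 * T1)).
Let C := 2 / cg.

Let T10 : 0 < T1. Proof. by rewrite sqrtr_gt0. Qed.

Let eps0 : 0 < eps.
Proof. by rewrite lt_min ltr01 divr_gt0// mulr_gt0. Qed.

Let eps1 : eps <= 1. Proof. by rewrite ge_min lexx. Qed.

Let C1 : 1 <= C.
Proof. by rewrite ler_pdivlMr// mul1r; apply: le_trans cg1 _; rewrite ler1n. Qed.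

Lemma sqrt_le t : 0 < t -> t < T -> Num.sqrt t <= T1.
Proof. by move=> t0 tT; rewrite ler_sqrt ltW. Qed.

Lemma eps_sqrt t : 0 < t -> t < T -> eps * Num.sqrt t <= cg / 2.
Proof.
move=> t0 tT; apply: (@le_trans _ _ (cg / (2 * T1) * T1)).
  apply: ler_pM; [exact/ltW/eps0|exact: sqrtr_ge0|by rewrite ge_min lexx orbT|exact: sqrt_le].
by rewrite invfM mulrA mulfVK// gt_eqF.
Qed.

Lemma cross_scaled t x y v1 c1 v2 c2 : 0 < t -> t < T -> U x -> U y ->
  supporting v1 c1 x -> supporting v2 c2 y ->
  (dotv v1 y + c1) / Num.sqrt t < eps ->
  (dotv v2 x + c2) / Num.sqrt t <= C * (d x / Num.sqrt t + 1).
Proof.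
move=> t0 tT Ux Uy S1 S2; have sg0 : 0 < Num.sqrt t by rewrite sqrtr_gt0.
rewrite ltr_pdivrMr// => h.
have h1 := cross Ux Uy S1 S2 (le_trans (ltW h) (eps_sqrt t0 tT)).
rewrite ler_pdivrMr// -mulrA mulrDl mul1r mulfVK ?gt_eqF//.
apply: le_trans h1 _; rewrite ler_pM2l ?(lt_le_trans ltr01 C1)// lerD2l.
by apply: le_trans (ltW h) _; rewrite ler_piMl// ltW.
Qed.

Let q0 : R := cg ^+ 2 * eps ^+ 2 / 32.

Let q0_gt0 : 0 < q0.
Proof. by rewrite /q0 divr_gt0// mulr_gt0// exprn_gt0. Qed.

Let mid_const : R := cg * q0 * (cg / 2).

(** [geo] is used from both ends: [s] is a fraction of the segment counted from [y], and [s'] one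
    counted from [x]. The chain runs with [a = s / 2] and [b = s' / 2], and concavity of [d] passes
    the two depths on to its four intermediate points. *)
Lemma lower_far k t x y v1 c1 v2 c2 : 0 < t -> t < T -> U x -> U y ->
  supporting v1 c1 x -> supporting v2 c2 y ->
  solves_heat_equation U k -> dirac_initial U k y ->
  (forall t x, 0 < t -> U x -> 0 <= k t x <= heat_kernel t x y) ->
  eps * Num.sqrt t <= dotv v1 y + c1 -> eps * Num.sqrt t <= dotv v2 x + c2 ->
  chain_const n r0 T1 * mid_const *
    (Num.min 1 (d x * (dotv v1 y + c1) / t) * Num.min 1 (d y * (dotv v2 x + c2) / t)) *
    heat_kernel t x y <= k t x.
Proof.
move=> t0 tT Ux Uy S1 S2 hk hd kp.
have [s [s0 s1 h1 h2]] := geo Uy Ux S2.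
have [s' [s'0 s'1 h1' h2']] := geo Ux Uy S1.
have A0 : 0 < dotv v1 y + c1 by have [_ + _] := S1; apply.
have B0 : 0 < dotv v2 x + c2 by have [_ + _] := S2; apply.
move: (dotv v1 y + c1) (dotv v2 x + c2) h1 h1' A0 B0 => A B h1 h1' A0 B0 eA eB.
have dx := d0 Ux; have dy := d0 Uy.
have [[f1 f1'] [f2 f2'] [f3 f3'] f4] := unit_fractions R.
have [s_ge0 s_le1 q1 q2] := half_param s0 s1.
have [s'_ge0 s'_le1 q3 q4] := half_param s'0 s'1.
set L := fun s : R => y + s *: (x - y).
have Lx l : L (1 - l) = x + l *: (y - x).
  rewrite /L scalerBl scale1r addrA [y + (x - y)]addrC subrK.
  by rewrite -scalerN opprB.
set DA := d (L s) in h1 h2; set DB := d (x + s' *: (y - x)) in h1' h2'.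
have Ux' : U (x + s' *: (y - x)) by exact: cU.
have ULs : U (L s) by exact: cU.
have DA0 : 0 < DA by exact: d0.
have DB0 : 0 < DB by exact: d0.
have a1 : DA / 2 <= d (L (s / 2)).
  have := @dseg (1 / 2) s y x Uy Ux f1 f1' s_ge0 s_le1.
  by rewrite -/DA /L mul1r [_^-1 * DA]mulrC [_^-1 * s]mulrC.
have a2 : DA / 2 <= d (L (3 / 2 * (s / 2))).
  have := @dseg (3 / 4) s y x Uy Ux f2 f2' s_ge0 s_le1.
  rewrite -/DA /L (_ : 3 / 4 * s = 3 / 2 * (s / 2)); last by field.
  by apply: le_trans; rewrite mulrC ler_pM2r.
have b1 : DB / 4 <= d (L (1 - s' / 2)).
  have := @dseg (1 / 2) s' x y Ux Uy f1 f1' s'_ge0 s'_le1.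
  rewrite Lx -/DB mul1r [_^-1 * s']mulrC; apply: le_trans.
  by rewrite mulrC ler_pM2r// lef_pV2 ?posrE// ler_nat.
have b2 : DB / 4 <= d (L (1 - s' / 2 / 2)).
  have := @dseg (1 / 4) s' x y Ux Uy f3 f3' s'_ge0 s'_le1.
  rewrite Lx -/DB (_ : 1 / 4 * s' = s' / 2 / 2); last by field.
  by rewrite mul1r mulrC.
have q5 : 0 < DA / 2 by exact: divr_gt0.
have q6 : 0 < DB / 4 by exact: divr_gt0.
have := @lower_chain R n U r0 k y n0 oU cU r00 hk hd kp d d0 hball T1 t x (s / 2) (s' / 2) (DA / 2) (DB / 4)
  Ux Uy t0 (sqrt_le t0 tT) q1 q2 q3 q4 q5 a1 a2 q6 b1 b2.
apply: le_trans; rewrite ler_pM2r ?heat_kernel_gt0// -mulrA ler_pM2l ?chain_const_gt0//.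
have sgt : Num.sqrt t ^+ 2 = t by rewrite sqr_sqrtr// ltW.
have sg0 : 0 < Num.sqrt t by rewrite sqrtr_gt0.
exact: (far_mins cg0 cg1 eps0 eps1 sg0 sgt (eps_sqrt t0 tT) s0 s1 s'0 s'1 dx dy A0 B0 DA0 DB0 eA eB h1 h1' h2 h2').
Qed.

Theorem two_sided_estimate : exists K1 K2 : R, [/\ 0 < K1, 0 < K2 &
  forall k y, U y -> solves_heat_equation U k -> dirac_initial U k y ->
  (forall t z, 0 < t -> bdry U z ->
     k q.1 q.2 @[q --> within [set q : R * 'rV[R]_n | U q.2] (nbhs (t, z))] --> (0 : R)) ->
  (forall t x, 0 < t -> U x -> 0 <= k t x <= heat_kernel t x y) ->
  forall t x v1 c1 v2 c2, 0 < t -> t < T -> U x -> supporting v1 c1 x -> supporting v2 c2 y ->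
  let g := Num.min 1 (d x * d y / t) +
    Num.min 1 (d x * (dotv v1 y + c1) / t) * Num.min 1 (d y * (dotv v2 x + c2) / t) in
  K1 * g * heat_kernel t x y <= k t x /\ k t x <= K2 * g * heat_kernel t x y].
Proof.
pose l1 := dirac_const n r0 T1 / 4; pose l2 := chain_const n r0 T1 * mid_const.
have l10 : 0 < l1 by rewrite divr_gt0// dirac_const_gt0.
have l20 : 0 < l2.
  have := cg0 => cg0'; apply: mulr_gt0; first exact: chain_const_gt0.
  by rewrite /mid_const mulr_gt0// ?mulr_gt0// divr_gt0.
have C0 : 0 < C by exact: lt_le_trans C1.
exists (Num.min (l1 / (3 * C)) (Num.min l1 l2 / 2)), (384 * C + 256 / eps ^+ 2); split.
- rewrite lt_min; apply/andP; split; first by apply: divr_gt0 => //; exact: mulr_gt0.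
  by apply: divr_gt0 => //; rewrite lt_min l10 l20.
- apply: addr_gt0; first by apply: mulr_gt0; [rewrite ltr0n|exact: C0].
  by apply: divr_gt0; [rewrite ltr0n|apply: exprn_gt0; exact: eps0].
move=> k y Uy hk hd kb kp t x v1 c1 v2 c2 t0 tT Ux S1 S2 /=.
have sg0 : 0 < Num.sqrt t by rewrite sqrtr_gt0.
have dx := d0 Ux; have dy := d0 Uy.
have [u1 pos1 e1] := S1; have [u2 pos2 e2] := S2.
have A0 := pos1 y Uy; have B0 := pos2 x Ux.
have hp0 := heat_kernel_gt0 x y t0.
have dA := dle S1 Uy; have dB := dle S2 Ux.
have crA := cross_scaled t0 tT Ux Uy S1 S2.
have crB := cross_scaled t0 tT Uy Ux S2 S1.
have sgt : Num.sqrt t ^+ 2 = t by rewrite sqr_sqrtr// ltW.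
have sE (u w : R) : u * w / t = (u / Num.sqrt t) * (w / Num.sqrt t).
  by rewrite -[in LHS]sgt; field; rewrite gt_eqF.
have near := lower_near n0 oU cU r00 hk hd kp d0 hball Ux Uy t0 (sqrt_le t0 tT).
have far := lower_far t0 tT Ux Uy S1 S2 hk hd kp.
have /andP[k0 k1] := kp t x t0 Ux.
have kA : k t x / heat_kernel t x y <= d x * (dotv v1 y + c1) / t.
  rewrite ler_pdivrMr// mulrC; apply: le_trans (half_space_upper oU Uy hk kb kp u1 pos1 t0 Ux) _.
  rewrite e1 ler_pM2l//.
  have v0 : 0 <= d x * (dotv v1 y + c1) / t by rewrite divr_ge0 ?mulr_ge0// ltW.
  by apply: le_trans (one_minus_expR_le v0) _; rewrite ge_min lexx orbT.
have kB : k t x / heat_kernel t x y <= d y * (dotv v2 x + c2) / t.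
  rewrite ler_pdivrMr// mulrC; apply: le_trans (half_space_upper oU Uy hk kb kp u2 pos2 t0 Ux) _.
  rewrite e2 [_ * d y]mulrC ler_pM2l//.
  have v0 : 0 <= d y * (dotv v2 x + c2) / t by rewrite divr_ge0 ?mulr_ge0// ltW.
  by apply: le_trans (one_minus_expR_le v0) _; rewrite ge_min lexx orbT.
have strip := strip_upper oU Uy hk kb kp u1 u2 pos1 pos2 t0 Ux.
rewrite e1 e2 in strip.
have al0 : 0 < d x / Num.sqrt t by rewrite divr_gt0.
have be0 : 0 < d y / Num.sqrt t by rewrite divr_gt0.
have alB : d x / Num.sqrt t <= (dotv v2 x + c2) / Num.sqrt t by rewrite ler_pM2r ?invr_gt0.
have beA : d y / Num.sqrt t <= (dotv v1 y + c1) / Num.sqrt t by rewrite ler_pM2r ?invr_gt0.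
split.
  rewrite -ler_pdivlMr// !sE.
  apply: (lower_regimes (eps := eps)) => //.
    by rewrite ler_pdivlMr// -sE.
  rewrite !ler_pdivlMr// => h1 h2; rewrite -!sE; exact: far.
rewrite -ler_pdivrMr// !sE.
apply: (upper_regimes (eps := eps)) => //.
- by rewrite ler_pdivrMr// mul1r.
- by rewrite -sE.
- by rewrite -sE.
rewrite ler_pdivrMr// mul1r => h1 h2; rewrite ler_pdivrMr//.
have sE1 (u w : R) : u * (w + Num.sqrt t) / t = (u / Num.sqrt t) * (w / Num.sqrt t + 1).
  by rewrite sE [(w + _) / _]mulrDl divff// gt_eqF.
rewrite -!sE1; apply: strip => //.
have -> : d x * (8 * (dotv v1 y + c1 + Num.sqrt t) / t) = 8 * (d x * (dotv v1 y + c1 + Num.sqrt t) / t) by ring.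
by rewrite sE1 mulrCA.
Qed.

End TwoSided.

(** * The epigraph of a power *)

Section PowerFunction.
Variable R : realType.
Implicit Types (q r x y K S e : R).

(** Young's inequality with exponents [q] and [q / (q - 1)], applied to [y] and [x^(q - 1)]; no
    derivative of the power is taken, so 0 is not a special point. *)
Lemma pow_tangent q x y : 1 <= q -> 0 <= x -> 0 <= y ->
  x `^ q + q * x `^ (q - 1) * (y - x) <= y `^ q.
Proof.
move=> q1 x0 y0; have qp : 0 < q by exact: lt_le_trans q1.
have [->|qn1] := eqVneq q 1; first by rewrite subrr powRr0 !powRr1// !mul1r subrKC.
have q1' : 0 < q - 1 by rewrite subr_gt0 lt_neqAle eq_sym qn1.
have hx : x * x `^ (q - 1) = x `^ q by exact: mulr_powRB1.
have := @conjugate_powR R y (x `^ (q - 1)) q (q / (q - 1)) y0 (powR_ge0 _ _) qp (divr_gt0 qp q1').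
have -> : q^-1 + (q / (q - 1))^-1 = 1 by field; rewrite !gt_eqF.
have -> : (x `^ (q - 1)) `^ (q / (q - 1)) = x `^ q.
  by rewrite -powRrM mulrCA divff ?mulr1// gt_eqF.
move=> /(_ erefl) h.
have h2 : q * (y * x `^ (q - 1)) <= y `^ q + (q - 1) * x `^ q.
  have -> : y `^ q + (q - 1) * x `^ q = q * (y `^ q / q + x `^ q / (q / (q - 1))).
    by field; rewrite !gt_eqF.
  by rewrite ler_pM2l.
have -> : x `^ q + q * x `^ (q - 1) * (y - x) = x `^ q + q * (y * x `^ (q - 1)) - q * (x * x `^ (q - 1)) by ring.
rewrite hx; lra.
Qed.

(** [S^q = S^(q - 1) (S - e) + S^(q - 1) e]; the second part is the gain behind the quantitative
    midpoint convexity. *)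
Lemma pow_split q S e : 1 <= q -> 0 <= e -> e <= S -> (S - e) `^ q + S `^ (q - 1) * e <= S `^ q.
Proof.
move=> q1 e0 eS; have qp : 0 < q by exact: lt_le_trans q1.
have S0 : 0 <= S by exact: le_trans eS.
have Se : 0 <= S - e by rewrite subr_ge0.
rewrite -(mulr_powRB1 S0 qp) -(mulr_powRB1 Se qp).
have : (S - e) `^ (q - 1) <= S `^ (q - 1).
  by apply: ge0_ler_powR; rewrite ?nnegrE// ?subr_ge0// gerBl.
by have := powR_ge0 S (q - 1); nra.
Qed.

Lemma pow_diff q x y : 1 <= q -> 0 <= y -> y <= x ->
  x * (x `^ (q - 1) - y `^ (q - 1)) <= q * x `^ (q - 1) * (x - y).
Proof.
move=> q1 y0 yx; have qp : 0 < q by exact: lt_le_trans q1.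
have x0 : 0 <= x by exact: le_trans yx.
have h := pow_tangent q1 x0 y0; rewrite -(mulr_powRB1 x0 qp) -(mulr_powRB1 y0 qp) in h.
have : 0 <= (x - y) * y `^ (q - 1) by apply: mulr_ge0; [rewrite subr_ge0|exact: powR_ge0].
lra.
Qed.

End PowerFunction.

(** * The function below the epigraph and its truncations *)

Section BaseFunction.
Variables (R : realType) (m : nat) (a q : R).
Hypotheses (a0 : 0 < a) (q1 : 1 <= q).
Implicit Types (u v w z : 'rV[R]_m) (K s : R).

Local Notation sq u := (dotv u u).

(** This is [a |u|^p] for [q = p / 2]. As a power of [|u|^2] its exponent is at least 1, so the
    gradient formula has no singularity at the origin. *)
Definition base u : R := a * sq u `^ q.

(* [base] continued beyond [|u|^2 = K] by the tangent line of [t |-> t^q] in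
   [t = |u|^2], which makes the gradient globally Lipschitz. *)
Definition base_trunc K u : R :=
  a * (Num.min (sq u) K `^ q + q * Num.min (sq u) K `^ (q - 1) * (sq u - Num.min (sq u) K)).

Definition base_grad K u : 'rV[R]_m := (2 * a * q * Num.min (sq u) K `^ (q - 1)) *: u.

Let qp : 0 < q. Proof. exact: lt_le_trans q1. Qed.
Let r0 : 0 <= q - 1. Proof. by rewrite subr_ge0. Qed.

Lemma base_truncE K u : sq u <= K -> base_trunc K u = base u.
Proof. by move=> h; rewrite /base_trunc (min_idPl h) subrr mulr0 addr0. Qed.

Lemma sq_expand u v : sq v = sq u + 2 * dotv u (v - u) + sq (v - u).
Proof. by rewrite !dotvE [dotv v u]dotvC; ring. Qed.

Lemma base_trunc_tangent K u v : 0 <= K ->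
  base_trunc K u + dotv (base_grad K u) (v - u) <= base_trunc K v.
Proof.
move=> K0; rewrite /base_trunc /base_grad dotvZl.
have su := dotvv_ge0 u; have sv := dotvv_ge0 v; have sd := dotvv_ge0 (v - u).
have e := sq_expand u v; move: (dotv u (v - u)) (sq (v - u)) (sq u) (sq v) su sv sd e.
move=> p d x y x0 y0 d0 e.
have mx0 : 0 <= Num.min x K by rewrite le_min x0.
have mxK : Num.min x K <= K by rewrite ge_min lexx orbT.
have mxx : Num.min x K <= x by rewrite ge_min lexx.
set s := Num.min x K in mx0 mxK mxx *.
have P0 := powR_ge0 s (q - 1); set P := s `^ (q - 1) in P0 *.
have qP : 0 <= q * P by apply: mulr_ge0 => //; exact: ltW.
have line : s `^ q + q * P * (y - s) <= Num.min y K `^ q + q * Num.min y K `^ (q - 1) * (y - Num.min y K).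
  have [yK|yK] := leP y K.
    by rewrite subrr mulr0 addr0; exact: pow_tangent.
  have h := pow_tangent q1 mx0 K0.
  have hP : P <= K `^ (q - 1) by apply: ge0_ler_powR; rewrite ?nnegrE.
  have : q * P * (y - K) <= q * K `^ (q - 1) * (y - K).
    by rewrite ler_pM2r ?subr_gt0// ler_pM2l.
  rewrite -/P in h; lra.
have -> : a * (s `^ q + q * P * (x - s)) + 2 * a * q * P * p = a * (s `^ q + q * P * (x + 2 * p - s)) by ring.
rewrite ler_pM2l//; apply: le_trans line; rewrite lerD2l ler_wpM2l//; lra.
Qed.

Let sqK K u : 0 <= K -> Num.min (sq u) (K ^+ 2) = Num.min (enorm u) K ^+ 2.
Proof.
move=> K0; rewrite -enormE; have e0 := enorm_ge0 u; have [h|h] := leP (enorm u) K.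
  by apply/min_idPl; rewrite ler_sqr.
by apply/min_idPr; rewrite ler_sqr ?nnegrE// ltW.
Qed.

Let pow2 x : 0 <= x -> (x ^+ 2) `^ (q - 1) = x `^ (2 * q - 1 - 1).
Proof. by move=> x0; rewrite -powR_mulrn// -powRrM; congr (_ `^ _); ring. Qed.

Lemma base_grad_lipschitz K u v : 0 <= K ->
  enorm (base_grad (K ^+ 2) u - base_grad (K ^+ 2) v) <=
  2 * a * q * (2 * q) * (K ^+ 2) `^ (q - 1) * enorm (u - v).
Proof.
move=> K0; wlog uv : u v / enorm u <= enorm v => [hw|].
  have [h|h] := leP (enorm u) (enorm v); first exact: hw.
  by rewrite enormBC (enormBC u); apply: hw; exact: ltW.
have [eu ev] := (enorm_ge0 u, enorm_ge0 v).
rewrite /base_grad !sqK// !pow2 ?le_min ?eu ?ev ?K0//.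
set r := 2 * q - 1 - 1; have r2 : 0 <= r by rewrite /r; have := q1; lra.
set s := Num.min (enorm u) K; set s' := Num.min (enorm v) K.
have s0 : 0 <= s by rewrite le_min eu.
have ss' : s <= s' by rewrite le_min !ge_min lexx uv !orbT.
have s'0 : 0 <= s' by exact: le_trans ss'.
have sK : s' <= K by rewrite ge_min lexx orbT.
have c0 : 0 < 2 * a * q by rewrite !mulr_gt0.
(* One part is a difference of points with a bounded coefficient; the other, a difference of
   coefficients times the shorter vector, is controlled by [pow_diff]. *)
have -> : (2 * a * q * s `^ r) *: u - (2 * a * q * s' `^ r) *: v =
   (2 * a * q) *: (s' `^ r *: (u - v) - (s' `^ r - s `^ r) *: u).
  by apply/rowP => i; rewrite !mxE; ring.
rewrite enormZ (gtr0_norm c0) -!mulrA !(ler_pM2l _) //.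
have hK : s' `^ r <= K `^ r by apply: ge0_ler_powR; rewrite ?nnegrE.
have hss : s `^ r <= s' `^ r by apply: ge0_ler_powR; rewrite ?nnegrE.
have P0 := powR_ge0 s' r.
have d0 := enorm_ge0 (u - v).
have h1 : (s' `^ r - s `^ r) * enorm u <= (2 * q - 1) * s' `^ r * enorm (u - v).
  have [Ku|uK] := leP K (enorm u).
    have -> : s = s'.
      by rewrite /s /s' (min_idPr Ku) (min_idPr (le_trans Ku uv)).
    rewrite subrr mul0r; apply: mulr_ge0 => //; apply: mulr_ge0 => //; have := q1; linarith.
  have su : s = enorm u by apply/min_idPl; exact: ltW.
  have q2 : 1 <= 2 * q - 1 by have := q1; linarith.
  have h := pow_diff q2 s0 ss'; rewrite -/r in h.
  rewrite -su mulrC; apply: (@le_trans _ _ (s' * (s' `^ r - s `^ r))).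
    by rewrite ler_wpM2r// subr_ge0.
  apply: le_trans h _; rewrite ler_wpM2l//; first by apply: mulr_ge0 => //; linarith.
  have := enorm_lip v u; rewrite (enormBC v) ler_norml => /andP[_].
  have : s' <= enorm v by rewrite ge_min lexx.
  by rewrite su; linarith.
have := enorm_triangle (s' `^ r *: (u - v)) (- ((s' `^ r - s `^ r) *: u)).
rewrite enormN !enormZ (ger0_norm P0) (ger0_norm (_ : 0 <= s' `^ r - s `^ r)) ?subr_ge0//.
move=> /le_trans; apply.
have : s' `^ r * enorm (u - v) <= K `^ r * enorm (u - v) by exact: ler_wpM2r.
have := q1 => q1'; move: h1; rewrite -mulrA.
by move: (s' `^ r * enorm (u - v)) (K `^ r * enorm (u - v)) => X Y; nlinarith.
Qed.

Definition base_lip K : R := 2 * a * q * (2 * q) * K `^ (q - 1).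

Lemma base_lip_ge0 K : 0 <= base_lip K.
Proof.
rewrite /base_lip; apply: mulr_ge0; last exact: powR_ge0.
by apply: ltW; rewrite !mulr_gt0.
Qed.

Lemma base_trunc_upper K u v : 0 <= K ->
  base_trunc (K ^+ 2) v <= base_trunc (K ^+ 2) u + dotv (base_grad (K ^+ 2) u) (v - u)
    + base_lip (K ^+ 2) * sq (v - u).
Proof.
move=> K0; have h := base_trunc_tangent v u (sqr_ge0 K).
have h2 := dotv_le (base_grad (K ^+ 2) v - base_grad (K ^+ 2) u) (v - u).
have h3 := base_grad_lipschitz v u K0.
have h4 := ler_wpM2r (enorm_ge0 (v - u)) h3.
have -> : base_lip (K ^+ 2) * sq (v - u) = base_lip (K ^+ 2) * enorm (v - u) * enorm (v - u).
  by rewrite -enormE; ring.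
rewrite dotvBl in h2; rewrite -/(base_lip _) in h4.
rewrite -[u - v]opprB dotvNr in h; lra.
Qed.

End BaseFunction.

Section QuadraticBound.
Variables (R : realType) (m : nat).
Implicit Types (u v x h : 'rV[R]_m).

(** A two-sided quadratic bound identifies the differential, which spares differentiating real
    powers of the norm. *)
Lemma quadratic_differentiable (f : 'rV[R]_m -> R) (g : 'rV[R]_m) (L : R) x : 0 <= L ->
  (forall v, `|f v - f x - dotv g (v - x)| <= L * dotv (v - x) (v - x)) ->
  differentiable f x /\ forall v, 'D_v f x = dotv g v.
Proof.
move=> L0 hf.
pose df := fun v => dotv g v.
have ldf : linear (df : 'rV[R]_m -> R).
  by move=> c u v; rewrite /df dotvDr dotvZr.
pose dfl : {linear 'rV[R]_m -> R} := HB.pack df (GRing.isLinear.Build R 'rV[R]_m R _ df ldf).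
have cdf : continuous dfl.
  move=> v; apply: (@cvg_dotv R m _ _ (nbhs_filter v) (fun=> g) id); [exact: cvg_cst|exact: cvg_id].
have ho : f \o shift x = cst (f x) + dfl +o_ (0 : 'rV[R]_m) id.
  apply/eqaddoP => _/posnumP[e].
  have c0 : 0 < e%:num / (L * m%:R ^+ 2 + 1) by rewrite divr_gt0// ltr_wpDl// mulr_ge0// exprn_ge0.
  have hb : \forall h \near (0 : 'rV[R]_m), `|h| < e%:num / (L * m%:R ^+ 2 + 1).
    by apply/nbhs_ballP; exists (e%:num / (L * m%:R ^+ 2 + 1)) => //= h; rewrite -ball_normE /ball_ /= sub0r normrN.
  apply: (@filterS _ (nbhs (0 : 'rV[R]_m)) _ _ _ _ hb) => h hn.
  rewrite /= /cst /=.
  have := hf (h + x); rewrite addrK => /le_trans; rewrite opprD addrA; apply.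
  rewrite -enormE; have hle := enorm_le_normr h.
  have := enorm_ge0 h; have h0 := normr_ge0 h.
  move: (enorm h) hle => E hle E0.
  have hE : E ^+ 2 <= (m%:R * `|h|) ^+ 2 by rewrite ler_sqr ?nnegrE ?mulr_ge0.
  apply: (@le_trans _ _ ((L * m%:R ^+ 2 + 1) * `|h| * `|h|)).
    apply: (le_trans (ler_wpM2l L0 hE)).
    by rewrite exprMn; have := sqr_ge0 `|h|; rewrite !expr2; nra.
  rewrite ler_wpM2r// mulrC -ler_pdivlMr ?(ltW hn)//.
  by rewrite ltr_wpDl// mulr_ge0// exprn_ge0.
have dE := diff_unique cdf ho.
have dfx : differentiable f x by apply/diff_locallyP; rewrite dE.
by split=> // v; rewrite deriveE// dE.
Qed.

Lemma quadratic_C11 (f : 'rV[R]_m -> R) (g : 'rV[R]_m -> 'rV[R]_m) (L L' : R) : 0 <= L ->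
  (forall x v, `|f v - f x - dotv (g x) (v - x)| <= L * dotv (v - x) (v - x)) ->
  (forall x v, enorm (g x - g v) <= L' * enorm (x - v)) -> C11_fun f.
Proof.
move=> L0 hf hg; split=> [x|]; first exact: (quadratic_differentiable L0 (hf x)).1.
exists L' => x v.
have gE z : grad f z = g z.
  by apply/rowP => i; rewrite mxE (quadratic_differentiable L0 (hf z)).2 dotv_delta.
by rewrite !gE.
Qed.

End QuadraticBound.

(** * Quantitative convexity of the base function *)

Section BaseEstimates.
Variables (R : realType) (m : nat) (a q : R).
Hypotheses (a0 : 0 < a) (q1 : 1 <= q).
Implicit Types (u v w z : 'rV[R]_m) (K s : R).

Local Notation sq u := (dotv u u).
Local Notation base := (base a q).

Definition bgrad u : 'rV[R]_m := (2 * a * q * sq u `^ (q - 1)) *: u.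

(** Bregman divergence of [base]: the height of the graph at [v] over the tangent plane at [u]. *)
Definition breg u v : R := base v - base u - dotv (bgrad u) (v - u).

Definition base_slope K : R := 2 * a * q * (K ^+ 2) `^ (q - 1) * K.

Let qp : 0 < q. Proof. exact: lt_le_trans q1. Qed.
Let r0 : 0 <= q - 1. Proof. by rewrite subr_ge0. Qed.

Let sq_le K u : 0 <= K -> enorm u <= K -> sq u <= K ^+ 2.
Proof. by move=> K0; rewrite enorm_sqr_le. Qed.

Let bgradE K u : sq u <= K -> base_grad a q K u = bgrad u.
Proof. by move=> h; rewrite /base_grad (min_idPl h). Qed.

Lemma breg_ge0 u v : 0 <= breg u v.
Proof.
have [eu ev] := (enorm_ge0 u, enorm_ge0 v).
have K0 : 0 <= enorm u + enorm v by exact: addr_ge0.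
have hu : sq u <= (enorm u + enorm v) ^+ 2 by apply: sq_le => //; rewrite lerDl.
have hv : sq v <= (enorm u + enorm v) ^+ 2 by apply: sq_le => //; rewrite lerDr.
have := base_trunc_tangent a0 q1 u v (sqr_ge0 (enorm u + enorm v)).
by rewrite !base_truncE// bgradE// /breg -addrA -opprD subr_ge0.
Qed.

Lemma breg_le K u v : enorm u <= K -> enorm v <= K -> breg u v <= base_lip a q (K ^+ 2) * sq (v - u).
Proof.
move=> uK vK; have K0 : 0 <= K by exact: le_trans (enorm_ge0 _) uK.
have hu := sq_le K0 uK; have hv := sq_le K0 vK.
have := base_trunc_upper a0 q1 u v K0; rewrite !base_truncE// bgradE// /breg; lra.
Qed.

Lemma bgrad_le K u : enorm u <= K -> enorm (bgrad u) <= base_slope K.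
Proof.
move=> uK; have K0 : 0 <= K by exact: le_trans (enorm_ge0 _) uK.
have c0 : 0 < 2 * a * q by rewrite !mulr_gt0.
rewrite /bgrad enormZ ger0_norm; last by apply: mulr_ge0; [exact: ltW|exact: powR_ge0].
rewrite /base_slope; apply: ler_pM => //; last 1 first.
- by rewrite ler_pM2l//; apply: ge0_ler_powR; rewrite ?nnegrE ?dotvv_ge0 ?sqr_ge0//; exact: sq_le.
- by apply: mulr_ge0; [exact: ltW|exact: powR_ge0].
- exact: enorm_ge0.
Qed.

Lemma base_slope_ge0 K : 0 <= K -> 0 <= base_slope K.
Proof.
move=> K0; apply: mulr_ge0 => //; apply: mulr_ge0; last exact: powR_ge0.
by apply: ltW; rewrite !mulr_gt0.
Qed.

Lemma base_lipschitz K u v : enorm u <= K -> enorm v <= K ->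
  base v <= base u + base_slope K * enorm (v - u).
Proof.
move=> uK vK; have := breg_ge0 v u; rewrite /breg -[u - v]opprB dotvNr.
have h := dotv_le (bgrad v) (v - u).
have := ler_wpM2r (enorm_ge0 (v - u)) (bgrad_le vK); lra.
Qed.

(** With [S] the mean of [|u|^2] and [|v|^2], the midpoint has squared norm [S - |v - u|^2 / 4].
    [pow_split] yields the gain, and in the sum of the two tangent inequalities at [S] the slope
    terms cancel. *)
Lemma base_mid_convex u v :
  a * ((sq u + sq v) / 2) `^ (q - 1) * sq (v - u) / 2 <=
  base u + base v - 2 * base (2^-1 *: (u + v)).
Proof.
set S := (sq u + sq v) / 2.
have [x0 y0] := (dotvv_ge0 u, dotvv_ge0 v).
have S0 : 0 <= S by rewrite divr_ge0// addr_ge0.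
have e0 : 0 <= sq (v - u) / 4 by rewrite divr_ge0// dotvv_ge0.
have hm : sq (2^-1 *: (u + v)) = S - sq (v - u) / 4.
  by rewrite /S !dotvE [dotv v u]dotvC; field.
have eS : sq (v - u) / 4 <= S by rewrite -subr_ge0 -hm dotvv_ge0.
have h1 := pow_split q1 e0 eS.
have hx := pow_tangent q1 S0 x0; have hy := pow_tangent q1 S0 y0.
have hxy : S `^ q * 2 <= sq u `^ q + sq v `^ q.
  have : q * S `^ (q - 1) * (sq u - S) + q * S `^ (q - 1) * (sq v - S) = 0.
    by rewrite -mulrDr (_ : sq u - S + (sq v - S) = 0) ?mulr0// /S; field.
  lra.
rewrite /base hm.
have -> : a * S `^ (q - 1) * sq (v - u) / 2 = a * (2 * (S `^ (q - 1) * (sq (v - u) / 4))) by field.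
have -> : a * sq u `^ q + a * sq v `^ q - 2 * (a * (S - sq (v - u) / 4) `^ q) =
  a * (sq u `^ q + sq v `^ q - 2 * (S - sq (v - u) / 4) `^ q) by ring.
by rewrite ler_pM2l//; linarith.
Qed.

Lemma base_convex u v s : 0 <= s -> s <= 1 ->
  base (u + s *: (v - u)) <= (1 - s) * base u + s * base v.
Proof.
move=> s0 s1; set w := u + _.
have h1 := breg_ge0 w u; have h2 := breg_ge0 w v; rewrite /breg in h1 h2.
have e : (1 - s) * dotv (bgrad w) (u - w) + s * dotv (bgrad w) (v - w) = 0.
  by rewrite -!dotvZr -dotvDr (_ : _ + _ = 0) ?dotv0r//; apply/rowP => i; rewrite !mxE; ring.
have s1' : 0 <= 1 - s by rewrite subr_ge0.
have k1 := mulr_ge0 s1' h1; have k2 := mulr_ge0 s0 h2; linarith.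
Qed.

(** For [s <= 1 / 2] the point lies between [u] and the midpoint, where convexity applies with
    parameter [2 * s]. *)
Lemma base_chord u v s : 0 <= s -> s <= 1 / 2 ->
  s * (base u + base v - 2 * base (2^-1 *: (u + v))) <=
  (1 - s) * base u + s * base v - base (u + s *: (v - u)).
Proof.
move=> s0 s1; have h1 : 0 <= 2 * s by lra.
have h2 : 2 * s <= 1 by lra.
have := @base_convex u (2^-1 *: (u + v)) (2 * s) h1 h2.
have -> : u + (2 * s) *: (2^-1 *: (u + v) - u) = u + s *: (v - u).
  by apply/rowP => i; rewrite !mxE; field.
linarith.
Qed.

Definition breg_const : R := (8 * q ^+ 2 * 2 `^ (q - 1))^-1.

Lemma breg_const_gt0 : 0 < breg_const.
Proof. by rewrite invr_gt0 mulr_gt0 ?powR_gt0// mulr_gt0// exprn_gt0. Qed.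

Lemma breg_const_le1 : breg_const <= 1.
Proof.
rewrite invf_le1; last by rewrite mulr_gt0 ?powR_gt0// mulr_gt0// exprn_gt0.
have h2 : (1 : R) <= 2 `^ (q - 1) by rewrite -[X in X <= _](powRr0 2); apply: ler_powR => //; rewrite ler1n.
have hq : 1 <= q ^+ 2 by rewrite exprn_ege1.
nra.
Qed.

(** The upper bound [breg_le] and the lower bound [base_mid_convex] carry the same power [S^(q - 1)]
    of the mean square, which cancels and leaves a constant depending on [q] only. This scale
    invariance is the source of uniformity in the boundary point. *)
Lemma breg_mid u v : breg_const * breg u v <= base u + base v - 2 * base (2^-1 *: (u + v)).
Proof.
apply: le_trans (base_mid_convex u v).
set S := (sq u + sq v) / 2.
have [x0 y0] := (dotvv_ge0 u, dotvv_ge0 v).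
have S0 : 0 <= S by rewrite divr_ge0// addr_ge0.
have S2 : Num.sqrt (2 * S) ^+ 2 = 2 * S by rewrite sqr_sqrtr// mulr_ge0.
have hle z : sq z <= 2 * S -> enorm z <= Num.sqrt (2 * S).
  by move=> hz; rewrite enorm_sqr_le ?sqrtr_ge0// S2.
have hu : enorm u <= Num.sqrt (2 * S) by apply: hle; rewrite /S mulrC divfK// lerDl.
have hv : enorm v <= Num.sqrt (2 * S) by apply: hle; rewrite /S mulrC divfK// lerDr.
have := breg_le hu hv; rewrite S2 /base_lip powRM// => h.
have c0 := breg_const_gt0.
apply: (le_trans (ler_wpM2l (ltW c0) h)); rewrite le_eqVlt; apply/orP; left; apply/eqP.
have p2 : 0 < (2 : R) `^ (q - 1) by exact: powR_gt0.
by rewrite /breg_const; field; rewrite !gt_eqF.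
Qed.

Lemma breg_ge u v : a * ((sq u + sq v) / 2) `^ (q - 1) * sq (v - u) / 2 <= breg u v.
Proof.
apply: le_trans (base_mid_convex u v) _.
have := breg_ge0 u (2^-1 *: (u + v)); rewrite /breg.
have -> : 2^-1 *: (u + v) - u = 2^-1 *: (v - u) by apply/rowP => i; rewrite !mxE; field.
rewrite dotvZr; lra.
Qed.

Lemma base_strict_convex u v s : u != v -> 0 < s -> s < 1 ->
  base (u + s *: (v - u)) < (1 - s) * base u + s * base v.
Proof.
move=> uv s0 s1.
have pos (x y : 'rV[R]_m) : x != y -> 0 < base x + base y - 2 * base (2^-1 *: (x + y)).
  move=> xy; apply: lt_le_trans (base_mid_convex x y).
  have d0 : 0 < sq (y - x) by rewrite lt_neqAle dotvv_ge0 andbT eq_sym dotvv_eq0 subr_eq0 eq_sym.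
  rewrite divr_gt0// mulr_gt0// mulr_gt0// powR_gt0// divr_gt0//.
  have : sq (y - x) <= 2 * (sq x + sq y).
    have := dotvv_ge0 (x + y); rewrite !dotvE; lra.
  lra.
have [s2|s2] := leP s (1 / 2).
  have := base_chord u v (ltW s0) s2; have := mulr_gt0 s0 (pos u v uv); linarith.
have s3 : 0 < 1 - s by rewrite subr_gt0.
have s4 : 1 - s <= 1 / 2 by lra.
have := base_chord v u (ltW s3) s4; have := mulr_gt0 s3 (pos v u ltac:(by rewrite eq_sym)).
have -> : v + (1 - s) *: (u - v) = u + s *: (v - u) by apply/rowP => i; rewrite !mxE; ring.
rewrite opprB addrCA subrr addr0; linarith.
Qed.

End BaseEstimates.

(** * The epigraph as a convex set *)

Section Epigraph.
Variables (R : realType) (m : nat) (a q : R).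
Hypotheses (a0 : 0 < a) (q1 : 1 <= q).
Implicit Types (x y z w : 'rV[R]_m.+1) (u v : 'rV[R]_m) (s h : R).

Definition pr x : 'rV[R]_m := col' ord_max x.
Definition ht x : R := x 0 ord_max.
Definition pack u h : 'rV[R]_m.+1 :=
  \row_i (if unlift ord_max i is Some j then u 0 j else h).
Definition gap x : R := ht x - base a q (pr x).

Lemma pr_pack u h : pr (pack u h) = u.
Proof. by apply/rowP => j; rewrite !mxE liftK. Qed.

Lemma ht_pack u h : ht (pack u h) = h.
Proof. by rewrite /ht mxE unlift_none. Qed.

Lemma prD x y : pr (x + y) = pr x + pr y. Proof. by apply/rowP => j; rewrite !mxE. Qed.
Lemma prB x y : pr (x - y) = pr x - pr y. Proof. by apply/rowP => j; rewrite !mxE. Qed.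
Lemma prZ s x : pr (s *: x) = s *: pr x. Proof. by apply/rowP => j; rewrite !mxE. Qed.
Lemma htD x y : ht (x + y) = ht x + ht y. Proof. by rewrite /ht mxE. Qed.
Lemma htB x y : ht (x - y) = ht x - ht y. Proof. by rewrite /ht !mxE. Qed.
Lemma htZ s x : ht (s *: x) = s * ht x. Proof. by rewrite /ht mxE. Qed.

Lemma dotv_prht x y : dotv x y = dotv (pr x) (pr y) + ht x * ht y.
Proof.
rewrite /dotv big_ord_recr /=; congr (_ + _); apply: eq_bigr => i _.
by rewrite !mxE (_ : lift ord_max i = widen_ord (leqnSn m) i)//; apply: ord_inj; rewrite lift_max.
Qed.

Lemma enorm_pr x : enorm (pr x) <= enorm x.
Proof.
rewrite enorm_sqr_le ?enorm_ge0// enormE dotv_prht lerDl -expr2; exact: sqr_ge0.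
Qed.

Lemma norm_ht x : `|ht x| <= enorm x.
Proof.
rewrite -(ler_sqr (normr_ge0 _) (enorm_ge0 _)) enormE dotv_prht real_normK ?num_real//.
by rewrite expr2 lerDr dotvv_ge0.
Qed.

Lemma power_domainE (p : R) : 2 * q = p -> power_domain m.+1 a p = [set x | 0 < gap x].
Proof.
move=> qp; have e u : a * enorm u `^ p = base a q u.
  by rewrite /base -enormE -powR_mulrn ?enorm_ge0// -powRrM qp.
apply/seteqP; split=> x /=.
  case=> i im; have -> : i = ord_max by apply: val_inj => /=; apply: succn_inj.
  by rewrite e /gap subr_gt0.
by rewrite /gap subr_gt0 => h; exists ord_max => //; rewrite e.
Qed.

Lemma gap_concave x y s : 0 <= s -> s <= 1 -> (1 - s) * gap x + s * gap y <= gap (x + s *: (y - x)).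
Proof.
move=> s0 s1; rewrite /gap htD htZ htB prD prZ prB.
have := base_convex a0 q1 (pr x) (pr y) s0 s1; linarith.
Qed.

Lemma gap_lipschitz K x y : enorm (pr x) <= K -> enorm (pr y) <= K ->
  gap x - gap y <= (1 + base_slope a q K) * enorm (x - y).
Proof.
move=> xK yK; have K0 : 0 <= K by exact: le_trans (enorm_ge0 _) xK.
have h1 := base_lipschitz a0 q1 xK yK.
have h2 := norm_ht (x - y); rewrite htB ler_norml in h2; case/andP: h2 => _ h2.
have := enorm_pr (y - x); rewrite prB (enormBC y) => h3.
have := ler_wpM2l (base_slope_ge0 a0 q1 K0) h3; rewrite /gap; linarith.
Qed.

Lemma gap_continuous : continuous gap.
Proof.
move=> x; apply/(@cvgrPdist_le _ _ _ _ (nbhs_filter x)) => /= e e0.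
have K0 : 0 <= enorm (pr x) + 1 by rewrite addr_ge0// enorm_ge0.
have L0 : 0 < 1 + base_slope a q (enorm (pr x) + 1).
  by rewrite ltr_wpDr// base_slope_ge0.
have r0 : 0 < Num.min 1 (e / (1 + base_slope a q (enorm (pr x) + 1))) by rewrite lt_min ltr01 divr_gt0.
apply: (@filterS _ (nbhs x) _ _ _ _ (eball_nbhs x r0)) => z; rewrite /eball /= lt_min => /andP[z1 z2].
have hz : enorm (pr z) <= enorm (pr x) + 1.
  have := enorm_triangleB 0 (pr z) 0; rewrite !subr0 => _.
  have := enorm_triangle (pr x) (pr (z - x)); rewrite prB [_ + (_ - _)]addrC subrK.
  have := enorm_pr (z - x); rewrite prB; lra.
have hx : enorm (pr x) <= enorm (pr x) + 1 by rewrite lerDl.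
have h1 := gap_lipschitz hx hz; have h2 := gap_lipschitz hz hx.
rewrite (enormBC x) in h1.
have h3 : (1 + base_slope a q (enorm (pr x) + 1)) * enorm (z - x) <= e.
  by rewrite mulrC -ler_pdivlMr// ltW.
by rewrite ler_norml; apply/andP; split; linarith.
Qed.

Local Notation U := [set x | 0 < gap x].

Lemma epi_open : open U.
Proof.
have -> : U = gap @^-1` [set r | 0 < r] by [].
by apply: open_comp => [x _|]; [exact: gap_continuous|exact: open_gt].
Qed.

Lemma epi_convex x y s : U x -> U y -> 0 <= s -> s <= 1 -> U (x + s *: (y - x)).
Proof.
move=> /= x0 y0 s0 s1; apply: lt_le_trans (gap_concave x y s0 s1).
have [->|sn] := eqVneq s 0; first by rewrite subr0 mul1r mul0r addr0.
have sp : 0 < s by rewrite lt_neqAle eq_sym sn.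
apply: ltr_wpDl; last exact: mulr_gt0.
by apply: mulr_ge0; [rewrite subr_ge0|exact: ltW].
Qed.

Lemma gap_up x s : gap (x + pack 0 s) = gap x + s.
Proof. by rewrite /gap htD prD pr_pack ht_pack addr0; ring. Qed.

Lemma enorm_pack0 s : enorm (pack 0 s) = `|s|.
Proof. by rewrite /enorm dotv_prht pr_pack ht_pack dotv0l add0r -expr2 sqrtr_sqr. Qed.

Lemma epi_closure : closure U = [set x | 0 <= gap x].
Proof.
apply/seteqP; split=> x /=.
  have cl : closed [set x | 0 <= gap x].
    have -> : [set x | 0 <= gap x] = gap @^-1` [set r | 0 <= r] by [].
    by apply: preimage_closed => [z _|]; [exact: gap_continuous|exact: closed_ge].
  move=> cx; apply: (cl x) => B nB; have [z [Uz Bz]] := cx B nB.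
  by exists z; split=> //; exact: ltW.
move=> g0 B /nbhs_eball[r r0 hB].
exists (x + pack 0 (r / 2)); split; first by rewrite /= gap_up ltr_wpDl// divr_gt0.
by apply: hB; rewrite /eball /= addrC addKr enorm_pack0 gtr0_norm ?divr_gt0//; lra.
Qed.

Lemma epi_bdry : bdry U = [set x | gap x = 0].
Proof.
rewrite /bdry epi_closure; have /interior_id -> := epi_open; apply/seteqP; split=> x /=.
  by move=> [h1 /negP]; rewrite -leNgt => h2; apply/eqP; rewrite eq_le h1 h2.
by move=> ->; rewrite ltxx.
Qed.

Lemma epi_connected : connected U.
Proof.
have zU : U (pack 0 1).
  rewrite /= /gap ht_pack pr_pack /base dotv0l powR0 ?mulr0 ?subr0//.
  by rewrite gt_eqF// (lt_le_trans ltr01 q1).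
have -> : U = \bigcup_(x in U) (fun s : R => pack 0 1 + s *: (x - pack 0 1)) @` `[0, 1].
  apply/seteqP; split=> x.
    by move=> Ux; exists x => //; exists 1; [rewrite /= in_itv/= lexx ler01|rewrite scale1r addrC subrK].
  move=> [y Uy [s /=]]; rewrite in_itv/= => /andP[s0 s1] <-; exact: epi_convex.
apply: bigcup_connected.
  exists (pack 0 1) => x Ux; exists 0; first by rewrite /= in_itv/= lexx ler01.
  by rewrite scale0r addr0.
move=> x Ux; apply: connected_continuous_connected; first exact: segment_connected.
apply: continuous_subspaceT => s; apply: (@cvgD _ _ _ _ (nbhs_filter s)); first exact: cvg_cst.
by apply: (@cvgZr_tmp _ _ _ _ (nbhs_filter s)); exact: cvg_id.
Qed.

(** Strict convexity of [base] sees only the projections; of two distinct points on one vertical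
    line, at least one has positive gap. *)
Lemma epi_strictly_convex : strictly_convex U.
Proof.
move=> x y s; rewrite epi_closure /= => x0 y0 xy /andP[s0 s1].
have /interior_id -> /= := epi_open.
have -> : (1 - s) *: x + s *: y = x + s *: (y - x).
  by apply/rowP => i; rewrite !mxE; ring.
have [e|ne] := eqVneq (pr x) (pr y); last first.
  have := base_strict_convex a0 q1 ne s0 s1.
  rewrite /gap in x0 y0 *; rewrite htD htZ htB prD prZ prB.
  by have := mulr_ge0 (ltW (ltac:(linarith) : 0 < 1 - s)) x0; have := mulr_ge0 (ltW s0) y0; linarith.
have hne : ht x != ht y.
  apply/eqP => hxy; apply: xy; apply/rowP => i.
  have [j ->|->] := unliftP ord_max i; last exact: hxy.
  by have /rowP/(_ j) := e; rewrite !mxE.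
apply: lt_le_trans (gap_concave x y (ltW s0) (ltW s1)).
have gxy : gap x != gap y by rewrite /gap e; apply: contra hne => /eqP/addIr/eqP.
have [g|g] := eqVneq (gap x) 0.
  have gy : 0 < gap y by rewrite lt_neqAle y0 andbT -g.
  by rewrite g mulr0 add0r mulr_gt0.
have gx : 0 < gap x by rewrite lt_neqAle x0 andbT eq_sym.
by apply: ltr_pwDl; [rewrite mulr_gt0// subr_gt0|rewrite mulr_ge0// ltW].
Qed.

End Epigraph.

(** * Distance to the boundary; half-spaces *)

Section BoundaryDistance.
Variables (R : realType) (n : nat).
Implicit Types (x z w v : 'rV[R]_n) (c r : R) (E : set 'rV[R]_n).

Lemma bdist_le E x z : bdry E z -> bdist E x <= enorm (x - z).
Proof.
move=> Ez; apply: ge_inf; last by exists z.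
by exists 0 => _ [w _ <-]; exact: enorm_ge0.
Qed.

Lemma bdist_ge E x r : bdry E !=set0 -> (forall z, bdry E z -> r <= enorm (x - z)) -> r <= bdist E x.
Proof.
move=> [w Ew] h; apply: lb_le_inf; first by exists (enorm (x - w)), w.
by move=> _ [z Ez <-]; exact: h.
Qed.

Lemma half_space_bdry v c : v != 0 -> bdry [set x | c < dotv v x] = [set x | dotv v x = c].
Proof.
move=> v0; have vv : 0 < dotv v v by rewrite lt_neqAle dotvv_ge0 andbT eq_sym dotvv_eq0.
have oH : open [set x | c < dotv v x].
  rewrite (_ : [set x | c < dotv v x] = [set x | dotv (- v) x + c < 0]); first exact: affine_open.
  by apply/seteqP; split=> x /=; rewrite dotvNl; lra.
have cH : closed [set x | c <= dotv v x].
  rewrite (_ : [set x | c <= dotv v x] = [set x | 0 <= dotv v x + - c]); first exact: affine_closed.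
  by apply/seteqP; split=> x /=; lra.
rewrite /bdry; have /interior_id -> := oH; apply/seteqP; split=> x /=.
  move=> [h1 /negP]; rewrite -leNgt => h2; apply/eqP; rewrite eq_le h2 /=.
  by apply: cH => B nB; have [z [Hz Bz]] := h1 B nB; exists z; split=> //; exact: ltW.
move=> e; split; last by rewrite e ltxx.
move=> B /nbhs_eball[r r0 hB].
have ev : 0 < enorm v by rewrite enorm_gt0.
exists (x + (r / 2 / enorm v) *: v); split.
  by rewrite /= dotvDr dotvZr e ltrDl mulr_gt0// !divr_gt0.
apply: hB; rewrite /eball /= addrC addKr enormZ gtr0_norm ?divr_gt0// ?divr_gt0//.
by rewrite divfK ?gt_eqF//; lra.
Qed.

Lemma bdist_half_space v c x : v != 0 -> c < dotv v x ->
  bdist [set x | c < dotv v x] x = (dotv v x - c) / enorm v.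
Proof.
move=> v0 cx; have ev : 0 < enorm v by rewrite enorm_gt0.
have hb := half_space_bdry c v0.
set z := x - ((dotv v x - c) / enorm v ^+ 2) *: v.
have Ez : dotv v z = c by rewrite /z dotvBr dotvZr -enormE divfK ?sqrf_eq0 ?gt_eqF// opprB addrC subrK.
apply/eqP; rewrite eq_le; apply/andP; split.
  have := @bdist_le [set x | c < dotv v x] x z; rewrite hb => /(_ Ez); move=> /le_trans; apply.
  rewrite /z opprB addrC subrK enormZ ger0_norm; last by rewrite divr_ge0 ?subr_ge0 ?sqr_ge0// ltW.
  by rewrite le_eqVlt; apply/orP; left; apply/eqP; field; rewrite gt_eqF.
apply: bdist_ge; rewrite hb; first by exists z.
move=> w /= ew; rewrite ler_pdivrMr// -ew -dotvBr mulrC; exact: dotv_le.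
Qed.

Lemma tangent_ball v x r : dotv v v = 1 -> 0 <= r ->
  (enorm (x - r *: v) < r) = (dotv x x < 2 * r * dotv v x).
Proof.
move=> vv r0; rewrite enorm_sqr_lt// !dotvE vv [dotv x v]dotvC; apply/idP/idP; lra.
Qed.

Lemma dotv_max_eq v x r : dotv v v = 1 -> enorm x = r -> r <= dotv v x -> x = r *: v.
Proof.
move=> vv ex h; have r0 : 0 <= r by rewrite -ex enorm_ge0.
apply/eqP; rewrite -subr_eq0 -dotvv_eq0; apply/eqP/le_anti; rewrite dotvv_ge0 andbT.
by rewrite !dotvE vv -enormE ex [dotv x v]dotvC mulr1 expr2; nra.
Qed.

End BoundaryDistance.

(** * Tangent balls and nearest boundary points *)

Section EpigraphBalls.
Variables (R : realType) (m : nat) (a q : R).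
Hypotheses (a0 : 0 < a) (q1 : 1 <= q).
Implicit Types (x y z w b : 'rV[R]_m.+1) (u v : 'rV[R]_m) (s r : R).

Local Notation U := [set x : 'rV[R]_m.+1 | 0 < gap a q x].
Local Notation sq u := (dotv u u).

Definition slope u : R := Num.sqrt (1 + sq (bgrad a q u)).
Definition normal u : 'rV[R]_m.+1 := (slope u)^-1 *: pack (- bgrad a q u) 1.

Let slope_sq u : slope u ^+ 2 = 1 + sq (bgrad a q u).
Proof. by rewrite sqr_sqrtr// addr_ge0// dotvv_ge0. Qed.

Lemma slope_ge1 u : 1 <= slope u.
Proof. by rewrite -[X in X <= _]sqrtr1 ler_sqrt ?lerDl ?dotvv_ge0// addr_ge0// dotvv_ge0. Qed.

Lemma slope_gt0 u : 0 < slope u.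
Proof. exact: lt_le_trans ltr01 (slope_ge1 u). Qed.

Lemma bgrad_le_slope u : enorm (bgrad a q u) <= slope u.
Proof.
rewrite /enorm ler_sqrt ?lerDr//; first by rewrite addr_ge0// dotvv_ge0.
Qed.

Lemma slope_le u : slope u <= 1 + enorm (bgrad a q u).
Proof.
rewrite -(ger0_norm (addr_ge0 ler01 (enorm_ge0 (bgrad a q u)))) -sqrtr_sqr ler_sqrt ?sqr_ge0//.
by rewrite sqrrD expr1n -enormE; have := enorm_ge0 (bgrad a q u); lra.
Qed.

Let slope_pos := slope_gt0.

Lemma normal_unit u : dotv (normal u) (normal u) = 1.
Proof.
rewrite /normal dotvZl dotvZr dotv_prht pr_pack ht_pack dotvNl dotvNr opprK mulr1.
rewrite [sq _ + 1]addrC -slope_sq; field; rewrite gt_eqF//.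
Qed.

(** The vertical height over the tangent plane is the height over the graph plus that of the graph
    over the plane; the slope converts vertical into normal distance. *)
Lemma gap_normal w z : gap a q w = 0 ->
  slope (pr w) * dotv (normal (pr w)) (z - w) = gap a q z + breg a q (pr w) (pr z).
Proof.
move=> gw; rewrite /normal dotvZl mulrA mulfV ?gt_eqF// mul1r dotv_prht pr_pack ht_pack.
by move: gw; rewrite /gap /breg htB prB dotvNl; lra.
Qed.

Definition scale u : R := Num.max (enorm u) 1.

Lemma scale_ge1 u : 1 <= scale u. Proof. by rewrite le_max lexx orbT. Qed.
Lemma scale_ge u : enorm u <= scale u. Proof. by rewrite le_max lexx. Qed.
Let qp : 0 < q. Proof. exact: lt_le_trans q1. Qed.
Let aq0 : 0 < 2 * a * q. Proof. by rewrite !mulr_gt0. Qed.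

Definition growth : R := 1 + (2 * a * q)^-1.

(** Together with [slope_upper]: [slope u] is comparable with [scale u ^ (2 q - 1)], also near the
    origin, where the gradient vanishes but both are of order 1. *)
Lemma slope_lower u : (scale u ^+ 2) `^ (q - 1) * scale u <= growth * slope u.
Proof.
have s1 := slope_ge1 u; have i0 : 0 < (2 * a * q)^-1 by rewrite invr_gt0.
have h := bgrad_le_slope u; rewrite /scale; have [h1|h1] := leP (enorm u) 1.
  rewrite expr1n powR1 mul1r /growth; nra.
rewrite /bgrad enormZ ger0_norm ?(mulr_ge0 (ltW aq0) (powR_ge0 _ _))// in h.
rewrite enormE; apply: (@le_trans _ _ ((2 * a * q)^-1 * slope u)); last by rewrite /growth; nra.
by rewrite ler_pdivlMl// mulrA.
Qed.

Lemma slope_upper u : slope u <= (1 + 2 * a * q) * ((scale u ^+ 2) `^ (q - 1) * scale u).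
Proof.
apply: le_trans (slope_le u) _.
have h := bgrad_le a0 q1 (scale_ge u); rewrite /base_slope in h.
have h1 : 1 <= (scale u ^+ 2) `^ (q - 1) * scale u.
  have hs := scale_ge1 u; have : 1 <= (scale u ^+ 2) `^ (q - 1).
    rewrite -[X in X <= _](powRr0 (scale u ^+ 2)); apply: ler_powR; first exact: exprn_ege1.
    by rewrite subr_ge0.
  by move: (_ `^ _) => P P1; nra.
lra.
Qed.

(** [2 a q * 2 q * 9^(q - 1)] is the coefficient in [base_lip] for [|v| <= 3 * scale u], a range
    that contains the projection of a tangent ball of radius at most 1; [growth] relates it to the
    slope. *)
Definition ball_radius : R :=
  Num.min 1 (2 * (2 * a * q * (2 * q) * 9 `^ (q - 1) * growth))^-1.

Lemma growth_gt0 : 0 < growth. Proof. by rewrite addr_gt0// invr_gt0. Qed.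

Let growth_pos := growth_gt0.

Let bc0 : 0 < 2 * a * q * (2 * q) * 9 `^ (q - 1) * growth.
Proof. by rewrite mulr_gt0// mulr_gt0 ?powR_gt0// mulr_gt0// mulr_gt0. Qed.

Lemma ball_radius_gt0 : 0 < ball_radius.
Proof. by rewrite lt_min ltr01 invr_gt0 mulr_gt0. Qed.

Lemma enorm_normal u : enorm (normal u) = 1.
Proof. by rewrite /enorm normal_unit sqrtr1. Qed.

Let scale3 u : ((3 * scale u) ^+ 2) `^ (q - 1) = 9 `^ (q - 1) * (scale u ^+ 2) `^ (q - 1).
Proof.
rewrite exprMn powRM ?sqr_ge0//; congr (_ `^ _ * _); ring.
Qed.

(** The second-order bound [base_lip] grows no faster than the slope, by [slope_lower]. Measured
    along the normal the graph therefore bends at a bounded rate, and one radius serves all boundary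
    points. *)
Lemma interior_ball w : gap a q w = 0 -> eball (w + ball_radius *: normal (pr w)) ball_radius `<=` U.
Proof.
move=> gw z; rewrite /eball /= => hz; set rho := ball_radius in hz *; set u := pr w in hz *.
have rho0 : 0 < rho by exact: ball_radius_gt0.
have rho1 : rho <= 1 by rewrite ge_min lexx.
set ze := z - w; set nz := dotv (normal u) ze.
have ze_sq : sq ze < 2 * rho * nz.
  by move: hz; rewrite opprD addrA -/ze tangent_ball ?normal_unit// ltW.
have ze2 : enorm ze <= 2.
  have := enorm_triangle (ze - rho *: normal u) (rho *: normal u); rewrite subrK enormZ enorm_normal gtr0_norm//.
  by move: hz; rewrite opprD addrA -/ze; lra.
have hpr : enorm (pr ze) <= enorm ze by exact: enorm_pr.
have uN : enorm u <= 3 * scale u by have := scale_ge u; have := scale_ge1 u; lra.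
have zN : enorm (pr z) <= 3 * scale u.
  have -> : pr z = u + pr ze by rewrite -prD addrC subrK.
  by have := enorm_triangle u (pr ze); have := scale_ge u; have := scale_ge1 u; lra.
have hb := breg_le a0 q1 uN zN.
rewrite -prB -/ze in hb.
have h1 := gap_normal z gw; rewrite -/u -/ze -/nz in h1.
have sqpr : sq (pr ze) <= sq ze by rewrite [X in _ <= X]dotv_prht lerDl -expr2 sqr_ge0.
have nz0 : 0 < nz.
  by have := le_lt_trans (dotvv_ge0 ze) ze_sq; rewrite pmulr_rgt0 ?mulr_gt0.
set P := (scale u ^+ 2) `^ (q - 1).
have P0 : 0 < P by apply: powR_gt0; apply: exprn_gt0; exact: lt_le_trans ltr01 (scale_ge1 u).
have PG : P <= growth * slope u.
  by apply: le_trans (slope_lower u); rewrite ler_peMr ?scale_ge1// ltW.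
have lipE : base_lip a q ((3 * scale u) ^+ 2) = 2 * a * q * (2 * q) * 9 `^ (q - 1) * P.
  by rewrite /base_lip scale3 mulrA.
set c := 2 * a * q * (2 * q) * 9 `^ (q - 1) in lipE.
have c0 : 0 < c by rewrite /c mulr_gt0 ?powR_gt0// mulr_gt0// mulr_gt0.
have hrho : rho * (2 * (c * growth)) <= 1.
  by rewrite -ler_pdivlMr ?mul1r ?mulr_gt0// ge_min lexx orbT.
rewrite lipE in hb.
have h2 : breg a q u (pr z) < slope u * nz.
  apply: le_lt_trans hb _; apply: (@le_lt_trans _ _ (c * P * sq ze)).
    by rewrite ler_pM2l// mulr_gt0.
  apply: (@lt_le_trans _ _ (c * P * (2 * rho * nz))); first by rewrite ltr_pM2l// mulr_gt0.
  rewrite mulrA ler_pM2r//.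
  apply: (@le_trans _ _ (c * (growth * slope u) * (2 * rho))).
    by rewrite ler_pM2r ?mulr_gt0// ler_pM2l.
  have -> : c * (growth * slope u) * (2 * rho) = rho * (2 * (c * growth)) * slope u by ring.
  by rewrite ler_piMl// ltW.
rewrite /= -(subr_gt0 0) subr0; move: h1 h2; linarith.
Qed.

Lemma normal_supports w z : gap a q w = 0 -> 0 < gap a q z -> 0 < dotv (normal (pr w)) (z - w).
Proof.
move=> gw gz; rewrite -(pmulr_rgt0 _ (slope_gt0 (pr w))) gap_normal//.
by apply: ltr_pwDl => //; exact: breg_ge0.
Qed.

Lemma exterior_ball w : gap a q w = 0 ->
  eball (w - ball_radius *: normal (pr w)) ball_radius `<=` ~` U.
Proof.
move=> gw z; rewrite /eball /= => hz gz; have := normal_supports gw gz.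
set u := pr w in hz *; have rho0 := ball_radius_gt0; set rho := ball_radius in rho0 hz *.
move: hz; have -> : z - (w - rho *: normal u) = (z - w) - rho *: (- normal u).
  by rewrite scalerN opprK opprB addrCA addrC.
rewrite tangent_ball ?(ltW rho0)//; last by rewrite dotvNl dotvNr opprK normal_unit.
by rewrite dotvNl; have := dotvv_ge0 (z - w); nlinarith.
Qed.

(* The interior ball at [w] forces a half-space containing the epigraph and
   touching it at [w] to be the tangent one. *)
Lemma supporting_normal (v : 'rV[R]_m.+1) (c : R) w : dotv v v = 1 -> (forall z, 0 < gap a q z -> 0 < dotv v z + c) ->
  gap a q w = 0 -> dotv v w + c = 0 -> v = normal (pr w).
Proof.
move=> vv hU gw ew; set u := pr w; have rho0 := ball_radius_gt0.
have h s : s < 1 -> 0 <= s -> s <= dotv v (normal u).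
  move=> s1 s0; have : 0 < gap a q (w + ball_radius *: normal u + - ((ball_radius * s) *: v)).
    apply: (interior_ball gw); rewrite /eball /= addrC addKr enormN enormZ /enorm vv sqrtr1 mulr1.
    by rewrite ger0_norm ?mulr_ge0 ?(ltW rho0)// gtr_pMr.
  move=> /hU; move: (normal u) => nu; rewrite !dotvDr dotvNr !dotvZr vv mulr1.
  have -> : dotv v w + ball_radius * dotv v nu - ball_radius * s + c =
     (dotv v w + c) + ball_radius * (dotv v nu - s) by ring.
  by rewrite ew add0r pmulr_rgt0// subr_gt0 => /ltW.
have h1 : 1 <= dotv v (normal u).
  apply/ler_addgt0Pr => e e0; have [e1|e1] := leP 1 e.
    have := h 0 ltr01 (lexx _); lra.
  have := h (1 - e); rewrite gtrBl e0 subr_ge0 (ltW e1) => /(_ isT isT); lra.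
by rewrite (dotv_max_eq vv (enorm_normal u) h1) scale1r.
Qed.

Let zeroB : bdry U (pack 0 0).
Proof.
rewrite epi_bdry//= /gap ht_pack pr_pack /base dotv0l powR0 ?mulr0 ?subr0//.
by rewrite gt_eqF.
Qed.

Local Notation d := (bdist U).

Lemma sub_ball_bdist x r : eball x r `<=` U -> r <= d x.
Proof.
move=> h; apply: bdist_ge; first by exists (pack 0 0).
move=> z; rewrite epi_bdry//= => gz; rewrite leNgt; apply/negP; rewrite enormBC => hz.
by have := h z hz; rewrite /= gz ltxx.
Qed.

(** By the intermediate value theorem, a segment leaving [U] inside the ball would meet the boundary
    too early. *)
Lemma ball_sub_bdist x r : 0 < gap a q x -> r <= d x -> eball x r `<=` U.
Proof.
move=> gx rd z; rewrite /eball /= => zr; rewrite ltNge; apply/negP => gz.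
have cf : continuous (fun s : R => gap a q (x + s *: (z - x))).
  move=> s.
  have c1 : x + s' *: (z - x) @[s' --> s] --> x + s *: (z - x).
    apply: cvgD; first exact: cvg_cst.
    by apply: cvgZr_tmp; exact: cvg_id.
  exact: (cvg_comp _ _ c1 (gap_continuous a0 q1 (x := x + s *: (z - x)))).
have [|s] := @IVT R (fun s => gap a q (x + s *: (z - x))) 0 1 0 ler01 (continuous_subspaceT cf).
  rewrite scale0r addr0 scale1r [x + _]addrC subrK ge_min gz orbT /= le_max (ltW gx) //.
rewrite in_itv/= => /andP[s0 s1] gs.
have Bs : bdry U (x + s *: (z - x)) by rewrite epi_bdry.
have := bdist_le x Bs; rewrite opprD addrA subrr add0r enormN enormZ ger0_norm//.
have := enorm_ge0 (z - x); nlinarith.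
Qed.

Lemma bdist_gt0 x : 0 < gap a q x -> 0 < d x.
Proof.
move=> gx; have := open_nbhs_nbhs (conj (epi_open a0 q1) gx) => /nbhs_eball[r r0 hr].
exact: lt_le_trans r0 (sub_ball_bdist hr).
Qed.

Lemma bdist_concave x y s : 0 < gap a q x -> 0 < gap a q y -> 0 <= s -> s <= 1 ->
  (1 - s) * d x + s * d y <= d (x + s *: (y - x)).
Proof.
move=> gx gy s0 s1; apply: sub_ball_bdist.
have [dx dy] := (bdist_gt0 gx, bdist_gt0 gy).
have [] := @ball_adm_convex R m.+1 U (Num.min (d x) (d y)) (Num.max (d x) (d y)) 0 x y (d x) (d y) s.
- by move=> *; exact: epi_convex.
- by rewrite lt_min dx dy.
- exact: lexx.
- by split; rewrite ?ge_min ?le_max ?lexx// addr0; exact: ball_sub_bdist.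
- by split; rewrite ?ge_min ?le_max ?lexx ?orbT// addr0; exact: ball_sub_bdist.
- exact: s0.
- exact: s1.
move=> _ _; rewrite addr0; congr (eball _ _ `<=` _); ring.
Qed.

(** The homothety of centre [b] and ratio [s] maps the ball about [x] into [U], even for [b] on the
    boundary, where [bdist_concave] does not apply. *)
Lemma bdist_cone b x s : 0 <= gap a q b -> 0 < gap a q x -> 0 < s -> s <= 1 ->
  s * d x <= d (b + s *: (x - b)).
Proof.
move=> gb gx s0 s1; apply: sub_ball_bdist => z; rewrite /eball /= => hz.
set z' := b + s^-1 *: (z - b).
have zE : z = b + s *: (z' - b).
  by rewrite /z' [b + _ - b]addrC addKr scalerA divff ?gt_eqF// scale1r addrC subrK.
have gz' : 0 < gap a q z'.
  apply: (ball_sub_bdist gx (lexx _)); rewrite /eball /=.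
  have -> : z' - x = s^-1 *: (z - (b + s *: (x - b))).
    by apply/rowP => i; rewrite /z' !mxE; field; rewrite gt_eqF.
  by rewrite enormZ gtr0_norm ?invr_gt0// mulrC ltr_pdivrMr// mulrC.
rewrite zE; apply: lt_le_trans (gap_concave a0 q1 b z' (ltW s0) s1).
by apply: ltr_wpDl; [rewrite mulr_ge0// subr_ge0|exact: mulr_gt0].
Qed.

Lemma bdist_le_supporting (v : 'rV[R]_m.+1) (c : R) z : dotv v v = 1 ->
  (forall z, 0 < gap a q z -> 0 < dotv v z + c) -> 0 < gap a q z -> d z <= dotv v z + c.
Proof.
move=> vv hU gz; rewrite leNgt; apply/negP => h.
have p0 := hU z gz.
have : 0 < gap a q (z - (dotv v z + c) *: v).
  apply: (ball_sub_bdist gz (lexx _)); rewrite /eball /= addrC addKr enormN enormZ /enorm vv sqrtr1 mulr1.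
  by rewrite gtr0_norm.
by move=> /hU; rewrite dotvBr dotvZr vv mulr1; lra.
Qed.

(** The supporting function vanishes at [x - d(x) v], which is thus outside [U], yet a limit of
    points of the ball about [x]: it is a boundary point, and [supporting_normal] applies. *)
Lemma supporting_foot (v : 'rV[R]_m.+1) (c : R) x : 0 < gap a q x -> supporting U d v c x ->
  [/\ gap a q (x - d x *: v) = 0, v = normal (pr (x - d x *: v)) &
      forall z, dotv v z + c = dotv v (z - (x - d x *: v))].
Proof.
move=> gx [vv hU e]; set w := x - d x *: v.
have d0 := bdist_gt0 gx.
have ew : dotv v w + c = 0 by rewrite /w dotvBr dotvZr vv mulr1 -e; ring.
have gw : gap a q w = 0.
  have : bdry U w; last by rewrite epi_bdry.
  split; last first.
    by have /interior_id -> := @epi_open _ m _ _ a0 q1; move=> /hU; rewrite ew ltxx.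
  move=> B /nbhs_eball[r r0 hB]; set s := Num.min (d x) r / 2.
  have m0 : 0 < Num.min (d x) r by rewrite lt_min d0.
  have m1 : Num.min (d x) r <= d x by rewrite ge_min lexx.
  have m2 : Num.min (d x) r <= r by rewrite ge_min lexx orbT.
  have s0 : 0 < s by rewrite divr_gt0.
  have ev : enorm v = 1 by rewrite /enorm vv sqrtr1.
  exists (w + s *: v); split.
    apply: (ball_sub_bdist gx (lexx _)); rewrite /eball /=.
    have -> : w + s *: v - x = (s - d x) *: v by apply/rowP => i; rewrite !mxE; ring.
    by rewrite enormZ ev mulr1 ltr0_norm /s; lra.
  by apply: hB; rewrite /eball /= addrC addKr enormZ ev mulr1 gtr0_norm// /s; lra.
split=> //; first exact: supporting_normal gw ew.
by move=> z; rewrite dotvBr; linarith.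
Qed.

Lemma nearest_boundary x : 0 < gap a q x -> exists w, gap a q w = 0 /\ enorm (x - w) = d x.
Proof.
move=> gx; set D := enorm (pack 0 0 - x).
have cK : compact ([set w | enorm (w - x) <= D] `&` [set w | gap a q w = 0]).
  apply: compact_closedI; first exact: ecompact.
  have -> : [set w | gap a q w = 0] = gap a q @^-1` [set 0] by [].
  by apply: preimage_closed => [z _|]; [exact: gap_continuous|exact: closed_eq].
have z0 : bdry U (pack 0 0) := zeroB; rewrite (@epi_bdry _ m _ _ a0 q1) /= in z0.
have [||w] := @compact_EVT_min _ R (fun w => enorm (x - w)) _ _ cK.
- by exists (pack 0 0); split => //=.
- apply: continuous_subspaceT => w; apply: (cvg_enorm (nbhs_filter w)).
  exact: (cvgB (cvg_cst x) (@cvg_id _ (nbhs w))).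
rewrite inE => -[/= wD gw] hmin; exists w; split=> //.
apply/eqP; rewrite eq_le; apply/andP; split; last by apply: bdist_le; rewrite epi_bdry.
apply: bdist_ge; first by exists (pack 0 0).
move=> z; rewrite epi_bdry//= => gz; have [zD|zD] := leP (enorm (z - x)) D.
  by apply: hmin; rewrite inE.
by rewrite enormBC (enormBC x z); apply: le_trans wD (ltW zD).
Qed.

(** A deep point is the centre of its own ball. A shallow one uses the tangent ball of radius [rho]
    at its nearest boundary point: it lies on the normal there, and the paraboloid equals
    [d (1 - d / (2 rho))]. *)
Lemma epi_ball z : 0 < gap a q z -> exists (c : 'rV[R]_m.+1) (r : R),
  [/\ ball_radius <= r, eball c r `<=` U, enorm (z - c) < r & d z / 2 <= paraboloid z c r].
Proof.
move=> gz; have d0 := bdist_gt0 gz; have rho0 := ball_radius_gt0.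
have [h|h] := leP ball_radius (d z).
  exists z, (d z); split=> //; first exact: ball_sub_bdist.
    by rewrite subrr enorm0.
  by rewrite /paraboloid subrr dotv0l mul0r subr0.
have [w [gw ew]] := nearest_boundary gz; set nu := normal (pr w).
have h1 : d z <= dotv nu (z - w).
  have := @bdist_le_supporting nu (- dotv nu w) z (normal_unit _); rewrite -dotvBr; apply=> //.
  by move=> y gy; rewrite -dotvBr; exact: normal_supports.
have zE : z - w = d z *: nu := dotv_max_eq (normal_unit _) ew h1.
have zc : z - (w + ball_radius *: nu) = (d z - ball_radius) *: nu.
  by rewrite opprD addrA zE scalerBl.
exists (w + ball_radius *: nu), ball_radius; split=> //.
- exact: interior_ball.
- by rewrite zc enormZ enorm_normal mulr1 ltr0_norm; linarith.
rewrite /paraboloid zc; have nn : dotv nu nu = 1 by exact: normal_unit.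
rewrite dotvZl dotvZr nn mulr1.
have -> : ball_radius / 2 - (d z - ball_radius) * (d z - ball_radius) / (2 * ball_radius) =
  d z * (1 - d z / ball_radius / 2) by field; rewrite gt_eqF.
rewrite ler_pM2l//.
have : d z / ball_radius <= 1 by rewrite ler_pdivrMr// mul1r ltW.
lra.
Qed.

Lemma epi_C11_set : C11_set U.
Proof.
move=> z _; set K := enorm (pr z) + 1.
have K0 : 0 <= K by rewrite addr_ge0// enorm_ge0.
(* Within distance 1 of [z] the truncation at [K] is inactive, while it makes the gradient Lipschitz
   on the whole base, as [C11_fun] demands. *)
exists 1, 1%:M, ord_max, (base_trunc a q (K ^+ 2)); split=> //.
- by rewrite trmx1 mulmx1.
- apply: (@quadratic_C11 _ _ _ (base_grad a q (K ^+ 2)) (base_lip a q (K ^+ 2)) (base_lip a q (K ^+ 2))).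
  + exact: base_lip_ge0.
  + move=> x v; have h1 := base_trunc_tangent a0 q1 x v (sqr_ge0 K).
    have h2 := base_trunc_upper a0 q1 x v K0.
    by rewrite ger0_norm; lra.
  + by move=> x v; exact: base_grad_lipschitz.
move=> x; rewrite /eball /= mulmx1 => hx; rewrite epi_bdry//=.
have hp : sq (pr x) <= K ^+ 2.
  rewrite -enorm_sqr_le//; have := enorm_triangle (pr z) (pr (x - z)); rewrite prB [_ + (_ - _)]addrC subrK.
  by have := enorm_pr (x - z); rewrite prB /K; lra.
rewrite -/(pr x) base_truncE// /gap /ht; split=> [/eqP|->]; first by rewrite subr_eq0 => /eqP.
by rewrite subrr.
Qed.

Lemma epi_C11_class : C11_class ball_radius U.
Proof.
split; first exact: epi_C11_set.
move=> z; rewrite epi_bdry//= => gz; have rho0 := ball_radius_gt0.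
exists (z + ball_radius *: normal (pr z)), (z - ball_radius *: normal (pr z)), ball_radius, ball_radius.
split; split=> //.
- by rewrite opprD addrA subrr add0r enormN enormZ enorm_normal mulr1 gtr0_norm.
- exact: interior_ball.
- by rewrite opprB addrC subrK enormZ enorm_normal mulr1 gtr0_norm.
- exact: exterior_ball.
Qed.

End EpigraphBalls.

(** * Depth along chords from a boundary point *)

Section ChordDistance.
Variables (R : realType) (m : nat) (a q : R).
Hypotheses (a0 : 0 < a) (q1 : 1 <= q).
Implicit Types (x y z w b : 'rV[R]_m.+1) (u : 'rV[R]_m) (s r : R).

Local Notation U := [set x : 'rV[R]_m.+1 | 0 < gap a q x].
Local Notation d := (bdist U).
Local Notation sq u := (dotv u u).
Local Notation normal := (normal a q).
Local Notation slope := (slope a q).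

Let qp : 0 < q. Proof. exact: lt_le_trans q1. Qed.
Let aq0 : 0 < 2 * a * q. Proof. by rewrite !mulr_gt0. Qed.

(** [base_chord] measures the convexity gain along the chord, [breg_mid] bounds it below by the
    divergence at [w], and [gap_normal] turns divergence plus gap into height over the tangent
    plane. *)
Lemma gap_chord w b s : gap a q w = 0 -> 0 <= gap a q b -> 0 <= s -> s <= 1 / 2 ->
  s * breg_const q * (slope (pr w) * dotv (normal (pr w)) (b - w)) <= gap a q (w + s *: (b - w)).
Proof.
move=> gw gb s0 s2; rewrite gap_normal//.
have h1 := base_chord a0 q1 (pr w) (pr b) s0 s2.
have h2 := ler_wpM2l s0 (breg_mid a0 q1 (pr w) (pr b)).
have h3 := ler_wpM2r gb (breg_const_le1 q1).
have h4 := ler_wpM2l s0 h3.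
have e : gap a q (w + s *: (b - w)) = (1 - s) * gap a q w + s * gap a q b +
  ((1 - s) * base a q (pr w) + s * base a q (pr b) - base a q (pr w + s *: (pr b - pr w))).
  by rewrite /gap htD htZ htB prD prZ prB; ring.
rewrite e gw mulr0 add0r -mulrA mulrDr mulrDr; rewrite mul1r in h4.
exact: lerD h4 (le_trans h2 h1).
Qed.

(** Bounds the Lipschitz constant of [gap] over [|v| <= 6 * scale u] relative to [slope u]:
    [36 = 6^2], and [6 = 2 + 4] accounts for the point and for the radius in [gap_bdist]. *)
Definition slope_ratio : R := 1 + 12 * a * q * 36 `^ (q - 1) * growth a q.

Lemma slope_ratio_ge1 : 1 <= slope_ratio.
Proof.
have g := growth_gt0 a0 q1; rewrite lerDl mulr_ge0 ?(ltW g)// mulr_ge0 ?powR_ge0//.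
by move: aq0; lra.
Qed.

Lemma gap_bdist u x : enorm (pr x) <= 2 * scale u -> 0 < gap a q x ->
  Num.min (4 * scale u) (gap a q x / (slope_ratio * slope u)) <= d x.
Proof.
move=> xN gx; have N1 := scale_ge1 u; have L1 := slope_ratio_ge1.
have S1 := slope_ge1 a q u.
have LS0 : 0 < slope_ratio * slope u by apply: mulr_gt0; [exact: lt_le_trans L1|exact: lt_le_trans S1].
apply: (sub_ball_bdist a0 q1) => z; rewrite /eball /= lt_min => /andP[z1 z2].
have zN : enorm (pr z) <= 6 * scale u.
  have := enorm_triangle (pr x) (pr (z - x)); rewrite prB [_ + (_ - _)]addrC subrK.
  have := enorm_pr (z - x); rewrite prB; lra.
have xN6 : enorm (pr x) <= 6 * scale u by lra.
have hl := gap_lipschitz a0 q1 xN6 zN.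
have hs : 1 + base_slope a q (6 * scale u) <= slope_ratio * slope u.
  rewrite /slope_ratio /base_slope exprMn powRM ?sqr_ge0// (_ : 6 ^+ 2 = 36 :> R); last by ring.
  rewrite [leRHS]mulrDl mul1r; apply: lerD => //.
  have c0 : 0 <= 12 * a * q * 36 `^ (q - 1) by rewrite mulr_ge0 ?powR_ge0//; move: aq0; linarith.
  have := ler_wpM2l c0 (slope_lower a0 q1 u); linarith.
have : gap a q x - gap a q z < gap a q x.
  apply: (le_lt_trans hl); apply: (@le_lt_trans _ _ (slope_ratio * slope u * enorm (x - z))).
    by apply: ler_wpM2r => //; exact: enorm_ge0.
  by rewrite mulrC -ltr_pdivlMr// enormBC.
by rewrite gtrBl.
Qed.

Definition chord_const : R := breg_const q / slope_ratio.

Lemma chord_const_gt0 : 0 < chord_const.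
Proof. by rewrite divr_gt0 ?breg_const_gt0// (lt_le_trans ltr01 slope_ratio_ge1). Qed.

Lemma chord_const_le1 : chord_const <= 1.
Proof.
have L := slope_ratio_ge1; rewrite ler_pdivrMr ?(lt_le_trans ltr01 L)// mul1r.
exact: le_trans (breg_const_le1 q1) L.
Qed.

Lemma bdist_chord w b s : gap a q w = 0 -> 0 <= gap a q b ->
  0 < dotv (normal (pr w)) (b - w) -> 0 < s -> s <= 1 / 2 ->
  s * enorm (pr (b - w)) <= scale (pr w) ->
  Num.min 4 (chord_const * s * dotv (normal (pr w)) (b - w)) <= d (w + s *: (b - w)).
Proof.
move=> gw gb; set u := pr w; set A := dotv _ _ => A0 s0 s2 hs.
have S1 := slope_ge1 a q u; have S0 : 0 < slope u by exact: lt_le_trans S1.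
have L0 : 0 < slope_ratio by exact: lt_le_trans slope_ratio_ge1.
have N1 := scale_ge1 u; have b0 := breg_const_gt0 q1.
have hg := gap_chord gw gb (ltW s0) s2; rewrite -/u -/A in hg.
have gx : 0 < gap a q (w + s *: (b - w)).
  by apply: lt_le_trans hg; apply: mulr_gt0; apply: mulr_gt0.
have hx : enorm (pr (w + s *: (b - w))) <= 2 * scale u.
  rewrite prD prZ; apply: le_trans (enorm_triangle _ _) _; rewrite enormZ gtr0_norm//.
  by have := scale_ge u; linarith.
apply: le_trans (gap_bdist hx gx); rewrite le_min; apply/andP; split.
  by rewrite ge_min; apply/orP; left; linarith.
rewrite ge_min; apply/orP; right; rewrite ler_pdivlMr ?mulr_gt0//.
suff -> : chord_const * s * A * (slope_ratio * slope u) = s * breg_const q * (slope u * A) by [].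
by rewrite /chord_const; field; rewrite gt_eqF.
Qed.

Definition spread_const : R := a / (2 * (1 + 2 * a * q)).

(** For a base displacement [D] of at least [2 * scale] the mean square in [breg_ge] is at least
    [scale^2], so the divergence is at least of order [scale^(2 q - 2) D^2]; division by the slope
    leaves [D^2 / scale]. *)
Lemma normal_far w b : gap a q w = 0 -> 0 <= gap a q b ->
  2 * scale (pr w) <= enorm (pr (b - w)) ->
  spread_const * enorm (pr (b - w)) ^+ 2 <= scale (pr w) * dotv (normal (pr w)) (b - w).
Proof.
move=> gw gb; set u := pr w; set D := enorm _ => hD.
have N1 := scale_ge1 u; have N0 : 0 < scale u by exact: lt_le_trans N1.
have S0 := slope_gt0 a q u; have h1 := gap_normal b gw; rewrite -/u in h1.
set A := dotv _ _ in h1 *; have h2 := breg_ge a0 q1 u (pr b).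
set S := (_ + _) / 2 in h2; set P := S `^ _ in h2.
have e2 : sq (pr b - u) = D ^+ 2 by rewrite -enormE -prB.
have hS : scale u ^+ 2 <= S.
  have : sq (pr b - u) <= 4 * S.
    have := dotvv_ge0 (pr b + u); rewrite /S !dotvE; linarith.
  rewrite e2; nlinarith.
have hP : (scale u ^+ 2) `^ (q - 1) <= P.
  by apply: ge0_ler_powR; rewrite ?subr_ge0// nnegrE ?sqr_ge0// (le_trans (sqr_ge0 _) hS).
have h3 := slope_upper a0 q1 u; rewrite e2 in h2.
set c := 1 + 2 * a * q in h3; have c0 : 0 < c by rewrite /c; move: aq0; linarith.
have P0 : 0 < P by apply: lt_le_trans hP; apply: powR_gt0; exact: exprn_gt0.
have A0 : 0 <= A.
  by rewrite -(pmulr_rge0 _ S0) h1 addr_ge0//; exact: breg_ge0.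
have h4 : slope u * A <= c * P * scale u * A.
  apply: ler_wpM2r => //; apply: le_trans h3 _; rewrite -mulrA ler_pM2l//.
  by rewrite ler_pM2r.
have h5 : a * P * D ^+ 2 / 2 <= c * P * scale u * A by apply: le_trans h4; rewrite h1; linarith.
have -> : spread_const * D ^+ 2 = a * P * D ^+ 2 / 2 / (c * P).
  by rewrite /spread_const -/c; field; rewrite !gt_eqF.
by rewrite ler_pdivrMr ?mulr_gt0//; move: h5; rewrite [c * P]mulrC; linarith.
Qed.

Definition geo_const : R := Num.min chord_const (chord_const * spread_const).

Lemma geo_const_gt0 : 0 < geo_const.
Proof.
have c0 := chord_const_gt0; rewrite lt_min c0 /=; apply: mulr_gt0 => //.
by apply: divr_gt0 => //; move: aq0; lra.
Qed.

Lemma geo_const_le1 : geo_const <= 1.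
Proof. by rewrite ge_min chord_const_le1. Qed.

(* One stops at the midpoint, at depth 4, or when the base component has moved by
   [scale (pr w)], after which the scales of the two endpoints may differ. *)
Lemma boundary_chord w b : gap a q w = 0 -> 0 <= gap a q b ->
  0 < dotv (normal (pr w)) (b - w) -> exists s : R,
  [/\ 0 < s, s <= 1 / 2,
      geo_const * s * dotv (normal (pr w)) (b - w) <= d (w + s *: (b - w)) &
      [\/ s = 1 / 2, 4 <= d (w + s *: (b - w)) | geo_const <= s * d (w + s *: (b - w))]].
Proof.
move=> gw gb A0; set A := dotv _ _ in A0 *; have c0 := chord_const_gt0.
have N1 := scale_ge1 (pr w); have N0 : 0 < scale (pr w) by exact: lt_le_trans N1.
set D := enorm (pr (b - w)).
have gc : geo_const <= chord_const by rewrite ge_min lexx.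
have gs : geo_const <= chord_const * spread_const by rewrite ge_min lexx orbT.
have D0 : 0 <= D := enorm_ge0 _.
have cA : 0 < chord_const * A by exact: mulr_gt0.
have step s : 0 < s -> s <= 1 / 2 -> s * D <= scale (pr w) -> s * (chord_const * A) <= 4 ->
    chord_const * s * A <= d (w + s *: (b - w)).
  move=> s0 s2 h1 h2; apply: le_trans (bdist_chord gw gb A0 s0 s2 h1).
  by rewrite le_min lexx andbT; move: h2; rewrite -/A; linarith.
have weak s : 0 < s -> geo_const * s * A <= chord_const * s * A.
  by move=> s0; rewrite ler_pM2r// ler_pM2r.
(* When the base component has moved by [scale], [normal_far] with [s * D = scale] gives
   [s^2 A >= spread_const]. This bounds the product [s * d] from below, not only [d], which is what
   [ratio_cases] uses to keep [s] away from 0 when the midpoint is shallow. *)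
have far s : 0 < s -> s * D = scale (pr w) -> 2 * scale (pr w) <= D ->
    chord_const * s * A <= d (w + s *: (b - w)) -> geo_const <= s * d (w + s *: (b - w)).
  move=> s0 e hD h; apply: le_trans (ler_wpM2l (ltW s0) h); apply: (le_trans gs).
  have hf := normal_far gw gb hD; rewrite -/A -/D in hf.
  have : spread_const * scale (pr w) <= s ^+ 2 * A * scale (pr w).
    have -> : s ^+ 2 * A * scale (pr w) = s ^+ 2 * (scale (pr w) * A) by ring.
    apply: le_trans (ler_wpM2l (sqr_ge0 s) hf).
    have -> : s ^+ 2 * (spread_const * D ^+ 2) = spread_const * (s * D) ^+ 2 by ring.
    rewrite e ler_wpM2l//; last by rewrite expr2 ler_peMl// ltW.
    by rewrite divr_ge0 ?(ltW a0)//; move: aq0; linarith.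
  rewrite ler_pM2r// => hk; have := ler_wpM2l (ltW c0) hk; rewrite expr2; linarith.
(* The two stopping rules, base displacement and depth, give four cases; [s] is the smallest of the
   thresholds that are active. *)
have [hD|hD] := leP D (2 * scale (pr w)); have [hA|hA] := leP (chord_const * A) 8.
- have h : chord_const * (1 / 2) * A <= d (w + (1 / 2) *: (b - w)) by apply: step; linarith.
  exists (1 / 2); split; [linarith|linarith| |exact: Or31].
  by apply: le_trans h; apply: weak; linarith.
- set s := 4 / (chord_const * A).
  have s0 : 0 < s by rewrite divr_gt0.
  have s2 : s <= 1 / 2 by rewrite ler_pdivrMr//; linarith.
  have e : s * (chord_const * A) = 4 by rewrite divfK// gt_eqF.
  have h : chord_const * s * A <= d (w + s *: (b - w)) by apply: step; nlinarith.
  by exists s; split=> //; [exact: le_trans (weak s s0) h|apply: Or32; move: e h; linarith].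
- set s := scale (pr w) / D.
  have D1 : 0 < D by linarith.
  have s0 : 0 < s by rewrite divr_gt0.
  have s2 : s <= 1 / 2 by rewrite ler_pdivrMr//; linarith.
  have e : s * D = scale (pr w) by rewrite divfK// gt_eqF.
  have h : chord_const * s * A <= d (w + s *: (b - w)) by apply: step; nlinarith.
  exists s; split=> //; first exact: le_trans (weak s s0) h.
  by apply: Or33; apply: (far s) => //; linarith.
- have D1 : 0 < D by linarith.
  set s := Num.min (scale (pr w) / D) (4 / (chord_const * A)).
  have s0 : 0 < s by rewrite lt_min !divr_gt0.
  have e1 : s * D <= scale (pr w) by rewrite -ler_pdivlMr// ge_min lexx.
  have e2 : s * (chord_const * A) <= 4 by rewrite -ler_pdivlMr// ge_min lexx orbT.
  have s2 : s <= 1 / 2 by nlinarith.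
  have h : chord_const * s * A <= d (w + s *: (b - w)) by exact: step.
  exists s; split=> //; first exact: le_trans (weak s s0) h.
  have [hm|hm] := leP (scale (pr w) / D) (4 / (chord_const * A)); last first.
    apply: Or32; apply: le_trans h; rewrite /s min_r ?(ltW hm)//.
    by rewrite le_eqVlt; apply/orP; left; apply/eqP; field; rewrite !gt_eqF.
  have e : s * D = scale (pr w) by rewrite /s min_l// divfK// gt_eqF.
  by apply: Or33; apply: (far s) => //; linarith.
Qed.

End ChordDistance.

Section Numbers.
Variables (R : realType).
Implicit Types (k s A D E : R).

Lemma le_half s : s <= 1 / 2 -> s <= 1 /\ 0 <= 1 - s.
Proof. by move=> h; split; lra. Qed.

Lemma depth_cases k s D E : 0 < k -> s <= 1 / 2 -> k <= 1 -> 0 < E -> 1 / 2 * E <= D ->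
  [\/ s = 1 / 2, 4 <= E | k <= s * E] -> s = 1 / 2 \/ k / 2 <= D.
Proof. by move=> k0 s2 k1 E0 ED [->|h|h]; [left|right; lra|right; nra]. Qed.

(** [D] is the depth of the midpoint and [E] that of the chosen chord point. When [D <= 1], the
    alternative [4 <= E] is impossible and [k <= s * E] gives [k <= 2 * s], so passing to the
    midpoint costs a bounded factor. *)
Lemma ratio_cases k s A D E : 0 < k -> k <= 1 -> 0 < s -> s <= 1 / 2 -> 0 < A ->
  k * s * A <= E -> 1 / 2 * E <= D -> [\/ s = 1 / 2, 4 <= E | k <= s * E] ->
  (D <= 1 -> k ^+ 2 / 2 <= D / (1 / 2 * A)) /\
  (1 < D -> (1 < E /\ k ^+ 2 / 2 <= E / (s * A)) \/ k ^+ 2 / 2 <= D / (1 / 2 * A)).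
Proof.
move=> k0 k1 s0 s2 A0 hE ED hs.
have sA : 0 < s * A by exact: mulr_gt0.
have hA : 0 < 1 / 2 * A by rewrite mulr_gt0.
rewrite !ler_pdivlMr//.
have weak : k ^+ 2 / 2 * (s * A) <= E.
  apply: le_trans hE; rewrite -[k * s * A]mulrA ler_pM2r// expr2.
  by have := ler_piMr (ltW k0) k1; lra.
have half : k <= 2 * s -> k ^+ 2 / 2 * (1 / 2 * A) <= D.
  move=> ks; have : k * k * A <= k * (2 * s) * A by rewrite ler_pM2r// ler_pM2l.
  by rewrite expr2; lra.
split=> hD.
  by apply: half; case: hs => [e|h|h]; [lra|lra|nra].
case: hs => [e|h|h]; first by right; apply: half; lra.
  by left; split=> //; lra.
by have [hE1|hE1] := ltP 1 E; [left|right; apply: half; nra].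
Qed.

Lemma near_point_lt D r (s := Num.min D r / 2) : 0 < D -> 0 < r -> [/\ 0 < s, s < D & s < r].
Proof.
move=> D0 r0; have m0 : 0 < Num.min D r by rewrite lt_min D0.
have m1 : Num.min D r <= D by rewrite ge_min lexx.
have m2 : Num.min D r <= r by rewrite ge_min lexx orbT.
by split; rewrite /s; lra.
Qed.

End Numbers.

(** * Membership in the class and the kernel bounds *)

Section Conclusion.
Variables (R : realType) (m : nat) (a q : R).
Hypotheses (a0 : 0 < a) (q1 : 1 <= q).
Implicit Types (x y z w b : 'rV[R]_m.+1) (s r : R).

Local Notation U := [set x : 'rV[R]_m.+1 | 0 < gap a q x].
Local Notation d := (bdist U).
Local Notation normal := (normal a q).
Local Notation geo_const := (geo_const a q).

(** [x] is the midpoint of its foot [w = x - d(x) v] and of [x + d(x) v], which lies in the closure.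
    Hence [x + s (y - x)] is the midpoint of the corresponding points on the segments from these two
    to [y], and [bdist_cone] keeps half of the depth found by [boundary_chord]. *)
Lemma supporting_chord x y (v : 'rV[R]_m.+1) (c : R) : U x -> U y -> supporting U d v c x ->
  exists s : R, [/\ 0 < s, s <= 1 / 2,
    geo_const / 2 * s * (dotv v y + c) <= d (x + s *: (y - x)) &
    s = 1 / 2 \/ geo_const / 2 <= d (x + s *: (y - x))].
Proof.
move=> Ux Uy sup; have [gw ev hA] := supporting_foot a0 q1 Ux sup.
have [vv hU e] := sup; set w := x - d x *: v in gw ev hA.
have d0 := bdist_gt0 a0 q1 Ux; have k0 := geo_const_gt0 a0 q1; have k1 := geo_const_le1 a0 q1.
have gb : 0 <= gap a q (x + d x *: v).
  have : closure U (x + d x *: v); last by rewrite (@epi_closure _ m _ _ a0 q1).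
  move=> B /nbhs_eball[r r0 hB]; have [] := near_point_lt d0 r0; set s := _ / 2 => s0 s1 s2.
  have ve : enorm v = 1 by rewrite /enorm vv sqrtr1.
  exists (x + (d x - s) *: v); split.
    apply: (ball_sub_bdist a0 q1 Ux (lexx _)); rewrite /eball /= addrC addKr enormZ ve mulr1.
    by rewrite ger0_norm ?gtrBl// subr_ge0 ltW.
  apply: hB; rewrite /eball /=.
  have -> : x + (d x - s) *: v - (x + d x *: v) = (- s) *: v by apply/rowP => i; rewrite !mxE; ring.
  by rewrite enormZ ve mulr1 normrN gtr0_norm.
have A0 : 0 < dotv (normal (pr w)) (y - w) by rewrite -ev -hA; exact: hU.
have [s [s0 s2 hd hs]] := boundary_chord a0 q1 gw (ltW Uy) A0.
rewrite -ev -hA in hd.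
have Uws : U (w + s *: (y - w)).
  have hg := gap_chord a0 q1 gw (ltW Uy) (ltW s0) s2; apply: lt_le_trans hg.
  by apply: mulr_gt0; apply: mulr_gt0 => //; [exact: breg_const_gt0|exact: slope_gt0].
set bs := x + d x *: v + s *: (y - (x + d x *: v)).
have gbs : 0 <= gap a q bs.
  apply: le_trans (gap_concave a0 q1 _ _ (ltW s0) (le_half s2).1).
  by apply: addr_ge0; apply: mulr_ge0; [exact: (le_half s2).2|exact: gb|exact: ltW|exact: ltW].
have h1 : (0 : R) < 1 / 2 by rewrite divr_gt0.
have := @bdist_cone _ _ _ _ a0 q1 bs _ (1 / 2) gbs Uws h1 (le_half (lexx _)).1.
have -> : bs + (1 / 2) *: (w + s *: (y - w) - bs) = x + s *: (y - x).
  by apply/rowP => i; rewrite /bs /w !mxE; field.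
have E0 := bdist_gt0 a0 q1 Uws => hx; exists s; split; [exact: s0|exact: s2| |].
  apply: le_trans hx; rewrite div1r [_ / 2]mulrC -!mulrA ler_pM2l ?invr_gt0// mulrA.
  exact: hd.
exact: depth_cases k0 s2 k1 E0 hx hs.
Qed.

Lemma normal_gt0 w b : gap a q w = 0 -> gap a q b = 0 -> w <> b ->
  0 < dotv (normal (pr w)) (b - w).
Proof.
move=> gw gb wb; rewrite -(pmulr_rgt0 _ (slope_gt0 a q (pr w))) gap_normal// gb add0r.
have ne : pr w != pr b.
  apply/eqP => e; apply: wb; apply/rowP => i; have [j ->|->] := unliftP ord_max i.
    by have /rowP/(_ j) := e; rewrite !mxE.
  by move: gw gb; rewrite /gap e /ht; lra.
have h : 0 < (1 / 2 : R) by linarith.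
have := base_strict_convex a0 q1 ne h ltac:(lra).
have := breg_ge0 a0 q1 (pr w) (pr w + (1 / 2) *: (pr b - pr w)).
by rewrite /breg [X in dotv _ X]addrAC subrr add0r dotvZr; linarith.
Qed.

(** With a unit normal the half-space is identified by [supporting_normal], so its distance function
    is the height over the tangent plane. *)
Lemma tangent_bdist w (H : set 'rV[R]_m.+1) : bdry U w -> tangent_half_space U w H ->
  forall z, U z -> bdist H z = dotv (normal (pr w)) (z - w).
Proof.
move=> bw [[v [c [/eqP v0 ->]]] UH]; rewrite (half_space_bdry c v0) /= => ew _ z Uz.
have ev : 0 < enorm v by rewrite enorm_gt0.
have gw : gap a q w = 0 by move: bw; rewrite (@epi_bdry _ m _ _ a0 q1).
have hn : (enorm v)^-1 *: v = normal (pr w).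
  apply: (supporting_normal a0 q1 (c := - c / enorm v)) => //.
  - by rewrite dotvZl dotvZr -enormE; field; rewrite gt_eqF.
  - move=> y /UH /= hy; rewrite dotvZl mulrC -mulrDl divr_gt0// subr_gt0.
    exact: hy.
  - by rewrite dotvZl ew mulrC -mulrDl subrr mul0r.
by rewrite bdist_half_space//; [rewrite -hn dotvZl dotvBr ew mulrC|exact: UH].
Qed.

Lemma ratio_bound w z (H : set 'rV[R]_m.+1) : bdry U w -> bdry U z -> w <> z ->
  tangent_half_space U w H ->
  (d (midpt w z) <= 1 -> geo_const ^+ 2 / 2 <= d (midpt w z) / bdist H (midpt w z)) /\
  (1 < d (midpt w z) -> exists x : 'rV[R]_m.+1, [/\ segm w z x, 1 < d x &
     geo_const ^+ 2 / 2 <= d x / bdist H x]).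
Proof.
move=> bw bz wz hH; have k0 := geo_const_gt0 a0 q1; have k1 := geo_const_le1 a0 q1.
have gw : gap a q w = 0 by move: bw; rewrite (@epi_bdry _ m _ _ a0 q1).
have gz : gap a q z = 0 by move: bz; rewrite (@epi_bdry _ m _ _ a0 q1).
have gz0 : 0 <= gap a q z by rewrite gz.
have A0 := normal_gt0 gw gz wz.
have [s [s0 s2 hd hs]] := boundary_chord a0 q1 gw gz0 A0.
have Us r : 0 < r -> r <= 1 / 2 -> U (w + r *: (z - w)).
  move=> r0 r2; have hg := gap_chord a0 q1 gw gz0 (ltW r0) r2; apply: lt_le_trans hg.
  by apply: mulr_gt0; apply: mulr_gt0 => //; [exact: breg_const_gt0|exact: slope_gt0].
have hB r : 0 < r -> r <= 1 / 2 -> bdist H (w + r *: (z - w)) = r * dotv (normal (pr w)) (z - w).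
  move=> r0 r2; rewrite (tangent_bdist bw hH); last exact: Us.
  by rewrite [w + _]addrC addrK dotvZr.
have sg r : 0 < r -> r <= 1 / 2 -> segm w z (w + r *: (z - w)).
  move=> r0 r2; exists r; first by rewrite /= (ltW r0) (le_half r2).1.
  by apply/rowP => i; rewrite !mxE; ring.
have mE : midpt w z = w + (1 / 2) *: (z - w) by apply/rowP => i; rewrite !mxE; field.
(* The midpoint is the image of the chord point under the homothety of centre [z] and ratio
   [1 / (2 (1 - s)) >= 1 / 2]. *)
have hmid : 1 / 2 * d (w + s *: (z - w)) <= d (midpt w z).
  have s1 : 0 < 1 - s by rewrite subr_gt0; apply: le_lt_trans s2 _; rewrite ltr_pdivrMr// mul1r ltr1n.
  have t0 : 0 < (2 * (1 - s))^-1 by rewrite invr_gt0 mulr_gt0.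
  have t1 : (2 * (1 - s))^-1 <= 1.
    by rewrite invf_le1 ?mulr_gt0// mulrC -ler_pdivrMr// lerBrDr addrC -lerBrDr; apply: le_trans s2 _; rewrite (_ : 1 - 1 / 2 = 1 / 2)//; field.
  have t2 : 1 / 2 <= (2 * (1 - s))^-1 by rewrite invfM div1r ler_pMr ?invr_gt0// invf_ge1// gerBl ltW.
  have := @bdist_cone _ _ _ _ a0 q1 z _ _ gz0 (Us s s0 s2) t0 t1.
  have -> : z + (2 * (1 - s))^-1 *: (w + s *: (z - w) - z) = midpt w z.
    by apply/rowP => i; rewrite /midpt !mxE; field; rewrite gt_eqF.
  apply: le_trans; rewrite ler_pM2r//; exact: bdist_gt0 (Us s s0 s2).
have h2 : (0 : R) < 1 / 2 by rewrite divr_gt0.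
have [small large] := ratio_cases k0 k1 s0 s2 A0 hd hmid hs.
rewrite mE in small large *; rewrite -(hB _ h2 (lexx _)) -?(hB _ s0 s2) in small large.
split=> // hD; have [[hE hr]|hr] := large hD; eexists; split; [exact: sg s0 s2|exact: hE| |exact: sg h2 (lexx _)|exact: hD|] => //.
Qed.

Lemma epi_RD : (0 < RD U)%E.
Proof.
have k0 := geo_const_gt0 a0 q1.
have K0 : 0 < geo_const ^+ 2 / 2 by rewrite divr_gt0// exprn_gt0.
apply: (@lt_le_trans _ _ (geo_const ^+ 2 / 2)%:E); first by rewrite lte_fin.
rewrite /RD le_min; apply/andP; split; apply: le_ereal_inf_tmp.
  move=> _ [w [z [H [[bw bz wz hH] [hd ->]]]]].
  by rewrite lee_fin; apply: (ratio_bound bw bz wz hH).1.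
move=> _ [w [z [H [[bw bz wz hH] [hd ->]]]]].
have [x [sx dx hx]] := (ratio_bound bw bz wz hH).2 hd.
by apply: le_ereal_sup_tmp; exists (d x / bdist H x)%:E; [exists x|rewrite lee_fin].
Qed.

Lemma epi_class_SR : class_SR U.
Proof.
split; [by split; [exact: epi_open|exact: epi_connected]|exact: epi_strictly_convex| |exact: epi_RD].
by exists (ball_radius a q); [exact: ball_radius_gt0|exact: epi_C11_class].
Qed.

Lemma half_space_supporting (H : set 'rV[R]_m.+1) x : half_space H -> U `<=` H -> d x = bdist H x -> U x ->
  exists (v : 'rV[R]_m.+1) (c : R), supporting U d v c x /\ forall y, U y -> bdist H y = dotv v y + c.
Proof.
move=> [v [c [/eqP v0 ->]]] UH ex Ux; have ev : 0 < enorm v by rewrite enorm_gt0.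
have e y : U y -> bdist [set x | c < dotv v x] y = dotv ((enorm v)^-1 *: v) y + - c / enorm v.
  by move=> Uy; rewrite bdist_half_space//; [rewrite dotvZl mulrBl mulNr mulrC|exact: UH].
exists ((enorm v)^-1 *: v), (- c / enorm v); split=> //; split.
- by rewrite dotvZl dotvZr -enormE; field; rewrite gt_eqF.
- move=> z /UH /= hz; rewrite dotvZl mulrC -mulrDl divr_gt0// subr_gt0.
  exact: hz.
by rewrite ex e.
Qed.

End Conclusion.

Theorem proposition5p6 (R : realType) (n : nat) (a p : R)
    (hn : (2 <= n)%N) (hp : 2 <= p) (ha : 0 < a) :
  class_SR (power_domain n a p) /\
  forall T : R, 0 < T ->
    exists c1 c2 : R, 0 < c1 /\ 0 < c2 /\
      forall pU : R -> 'rV[R]_n -> 'rV[R]_n -> R,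
        dirichlet_heat_kernel (power_domain n a p) pU ->
        forall (t : R) (x y : 'rV[R]_n) (Hx Hy : set 'rV[R]_n),
          0 < t -> t < T ->
          power_domain n a p x -> power_domain n a p y ->
          half_space Hx -> half_space Hy ->
          power_domain n a p `<=` Hx -> power_domain n a p `<=` Hy ->
          bdist (power_domain n a p) x = bdist Hx x ->
          bdist (power_domain n a p) y = bdist Hy y ->
          c1 * g_factor (power_domain n a p) Hx Hy t x y * heat_kernel t x y
            <= pU t x y /\
          pU t x y
            <= c2 * g_factor (power_domain n a p) Hx Hy t x y * heat_kernel t x y.
Proof.
case: n hn => [//|m] _; have q1 : 1 <= p / 2 by rewrite ler_pdivlMr// mul1r.
rewrite (@power_domainE _ m a (p / 2) p); last by field.
split; first exact: epi_class_SR.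
have kg := geo_const_gt0 ha q1; have kl := geo_const_le1 ha q1.
have kg2 : 0 < geo_const a (p / 2) / 2 by rewrite divr_gt0.
have kl2 : geo_const a (p / 2) / 2 <= 1 by lra.
move=> T T0; have [] := two_sided_estimate (ltn0Sn m) (@epi_open _ m _ _ ha q1) _
  (ball_radius_gt0 ha q1) (@bdist_gt0 _ m _ _ ha q1) (@epi_ball _ m _ _ ha q1) _ _ kg2 kl2
  (@supporting_chord _ m _ _ ha q1) T0.
- by move=> x y t Ux Uy t0 t1; exact: epi_convex.
- by move=> x y s Ux Uy s0 s1; exact: bdist_concave.
- by move=> v c x z [vv hU _] Uz; exact: bdist_le_supporting.
move=> K1 [K2 [K10 K20 hK]]; exists K1, K2; split=> //; split=> //.
move=> pU hpU t x y Hx Hy t0 tT Ux Uy hHx hHy UHx UHy ex ey.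
have [v1 [c1 [s1 e1]]] := half_space_supporting hHx UHx ex Ux.
have [v2 [c2 [s2 e2]]] := half_space_supporting hHy UHy ey Uy.
have [h1 h2 h3 h4] := hpU y Uy.
have := hK (fun t x => pU t x y) y Uy h1 h2 h3 h4 t x v1 c1 v2 c2 t0 tT Ux s1 s2.
by rewrite /g_factor -ex -ey (e1 y Uy) (e2 x Ux).
Qed.
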